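(* Let $V_0\in\mathscr V^{\rm irr}$ with period $p$, let $C>0$, $d_{\rm id}=2d^2(k-1)$, $0<\delta<(2(d_{\rm id}+3))^{-1}$ and $r_n=Cn^\delta$. Consider (for $n$ large enough) the local stationary output models $$\mathbf Q^{\rm out}_{V_0}(n)=\{\rho^{\rm out}_{[V(n^{-1/2}A)]}(n):\ A\in B^{\rm id}_{r_n}(V_0)\}$$ and the Gaussian mixture models $$\mathbf{GM}_{V_0}(n)=\{\rho(A):\ A\in B^{\rm id}_{r_n}(V_0)\},\qquad \rho(A)=\frac1p\sum_{m=0}^{p-1}|{\rm Coh}(U^mA)\rangle\langle{\rm Coh}(U^mA)|,$$ where $U$ is the unitary operator on $T^{\rm id}_{V_0}$ given by $UA=\gamma_{V_0}(Z_{V_0}^*\otimes\mathbf 1_{\mathcal K})AZ_{V_0}$. Then $$\lim_{n\to\infty}\Delta(\mathbf Q^{\rm out}_{V_0}(n),\mathbf{GM}_{V_0}(n))=0,$$ where $\Delta$ is the Le Cam distance.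
   Context: $\mathcal H=\mathbb C^d$, $\mathcal K=\mathbb C^k$. For an isometry $V:\mathcal H\to\mathcal H\otimes\mathcal K$, write $V|\psi\rangle=\sum_iK_i|\psi\rangle\otimes|i\rangle$; the channel is $\mathcal T_V(X)=V^*(X\otimes\mathbf 1_{\mathcal K})V$, with predual $\mathcal T_{V*}(\rho)=\sum_iK_i\rho K_i^*$; $V$ is irreducible if there is a unique state $\rho_V^{\rm ss}>0$ with $\mathcal T_{V*}(\rho_V^{\rm ss})=\rho_V^{\rm ss}$. $\mathscr V^{\rm irr}$ is the manifold of irreducible isometries. For irreducible $V$ with period $p_V$, the modulus-one eigenvalues of $\mathcal T_V$ are $\gamma_V^j$, $j=0,\dots,p_V-1$, $\gamma_V=e^{2\pi i/p_V}$, all simple, and $Z_V=\sum_{a=0}^{p_V-1}\gamma_V^aP_a$ is the unitary eigenvector with $\mathcal T_V(Z_V)=\gamma_VZ_V$, where $P_a$ are orthogonal projections summing to $\mathbf 1$ with $\mathcal T_V(P_{a\oplus1})=P_a$ (addition mod $p_V$). The stationary output state is $\rho_V^{\rm out}(n)={\rm Tr}_{\mathcal H}[V(n)\rho_V^{\rm ss}V(n)^*]$, where $V(n)|\psi\rangle=\sum_{i_1,\dots,i_n}K_{i_n}\cdots K_{i_1}|\psi\rangle\otimes|i_1\cdots i_n\rangle$; it depends only on the equivalence class $[V]$ of isometries with the same stationary outputs and is then denoted $\rho^{\rm out}_{[V]}(n)$. Tangent space convention: $T_V(\mathscr V^{\rm irr})=\{L\in L^\infty(\mathcal H,\mathcal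 H\otimes\mathcal K):L^*V-V^*L=0\}$, $L$ representing the infinitesimal change $V\mapsto V+i\delta L$. $T_V=T_V^{\rm id}\oplus T_V^{\rm nonid}$, with $T_V^{\rm id}=\{A:VV^*A=0\}$ and $T_V^{\rm nonid}=\{\theta V-(K\otimes\mathbf 1)V+VK:\theta\in\mathbb R,\ K=K^*,\ {\rm Tr}(\rho_V^{\rm ss}K)=0\}$. Fix a Riemannian metric $\nu$ on $\mathscr V^{\rm irr}$ invariant under the action $(c,W)\cdot V=\overline c(W\otimes\mathbf 1)VW^*$ of $U(1)\times PU(d)$, such that $T_V^{\rm id}\perp T_V^{\rm nonid}$ and $\nu_V(A,A)={\rm Tr}(\rho_V^{\rm ss}A^*A)$ for $A\in T_V^{\rm id}$ (such metrics exist). $V(\cdot):=\exp_{V_0}$ is its exponential map at $V_0$ (the geodesic $t\mapsto V(tA)$ has velocity $iA$ at $t=0$). $B^{\rm id}_r(V_0)$ is the ball of radius $r$ centred at $0$ in $T^{\rm id}_{V_0}$. $T^{\rm id}_{V_0}$ is a complex Hilbert space with inner product $(A,B)_{V_0}={\rm Tr}(\rho_{V_0}^{\rm ss}A^*B)$; on its symmetric Fock space, $|{\rm Coh}(A)\rangle=e^{-\frac12(A,A)_{V_0}}\bigoplus_{m\ge0}\frac1{\sqrt{m!}}A^{\otimes m}$. Le Cam distance: for families of states $\mathbf Q=\{\rho_\theta\}_{\theta\in\Theta}$ on $\mathcal H_1$ and $\mathbf R=\{\sigma_\theta\}_{\theta\in\Theta}$ on $\mathcal H_2$, $\delta(\mathbf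 Q,\mathbf R)=\inf_{\mathcal T_*}\sup_\theta\|\mathcal T_*(\rho_\theta)-\sigma_\theta\|_1$ over quantum channels (completely positive trace-preserving maps) $\mathcal T_*:L^1(\mathcal H_1)\to L^1(\mathcal H_2)$, and $\Delta(\mathbf Q,\mathbf R)=\max(\delta(\mathbf Q,\mathbf R),\delta(\mathbf R,\mathbf Q))$. *)

(* Defs.v *)
From HB Require Import structures.
From mathcomp Require Import all_boot all_order all_algebra finmap.
From mathcomp Require Import sesquilinear spectral complex mxtens.
From mathcomp Require Import all_classical all_reals all_analysis.
From mathcomp Require Import ring lra.

Set Implicit Arguments.
Unset Strict Implicit.
Unset Printing Implicit Defensive.

Import Order.TTheory GRing.Theory Num.Theory.
Import numFieldNormedType.Exports.

Local Open Scope classical_set_scope.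
Local Open Scope ring_scope.
Local Open Scope sesquilinear_scope.

Local Notation Re := complex.Re.
Local Notation Im := complex.Im.
Local Notation "x %:C" := (real_complex _ x) : ring_scope.

Record hilbert (R : realType) := Hilbert {
  hsort :> lmodType R[i];
  hdot : hsort -> hsort -> R[i];
  hdotC : forall x y, hdot x y = (hdot y x)^*;
  hdot_linear : forall x a y z,
    hdot x (a *: y + z) = a * hdot x y + hdot x z;
  hdot_gt0 : forall x, x != 0 -> 0 < hdot x x;
  hcomplete : forall u : nat -> hsort,
    (forall eps : R, 0 < eps -> exists N, forall m n, (N <= m)%N -> (N <= n)%N ->
       Re (hdot (u m - u n) (u m - u n)) < eps) ->
    exists l, forall eps : R, 0 < eps -> exists N, forall n, (N <= n)%N ->
       Re (hdot (u n - l) (u n - l)) < eps }.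

Section ComplexFacts.
Variable R : realType.
Implicit Types z w : R[i].

Lemma ReD z w : Re (z + w) = Re z + Re w. Proof. by case: z w => [? ?] []. Qed.
Lemma ImD z w : Im (z + w) = Im z + Im w. Proof. by case: z w => [? ?] []. Qed.
Lemma ReM z w : Re (z * w) = Re z * Re w - Im z * Im w.
Proof. by case: z w => [? ?] []. Qed.
Lemma ImM z w : Im (z * w) = Re z * Im w + Im z * Re w.
Proof. by case: z w => [? ?] []. Qed.
Lemma Reconj z : Re z^* = Re z. Proof. by case: z. Qed.
Lemma Imconj z : Im z^* = - Im z. Proof. by case: z. Qed.
Lemma ReB z w : Re (z - w) = Re z - Re w. Proof. by case: z w => [? ?] []. Qed.
Lemma ImB z w : Im (z - w) = Im z - Im w. Proof. by case: z w => [? ?] []. Qed.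
Lemma complexP z w : Re z = Re w -> Im z = Im w -> z = w.
Proof. by case: z w => [? ?] [? ?] /= -> ->. Qed.
Lemma Re_sum (I : Type) (r : seq I) (P : pred I) (F : I -> R[i]) :
  Re (\sum_(i <- r | P i) F i) = \sum_(i <- r | P i) Re (F i).
Proof. by apply: (big_morph _ ReD). Qed.
Lemma Im_sum (I : Type) (r : seq I) (P : pred I) (F : I -> R[i]) :
  Im (\sum_(i <- r | P i) F i) = \sum_(i <- r | P i) Im (F i).
Proof. by apply: (big_morph _ ImD). Qed.

Definition sqn z : R := Re z ^+ 2 + Im z ^+ 2.

Lemma sqn_ge0 z : 0 <= sqn z.
Proof. by rewrite addr_ge0 ?sqr_ge0. Qed.

Lemma sqn_eq0 z : sqn z = 0 -> z = 0.
Proof.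
move/eqP; rewrite paddr_eq0 ?sqr_ge0 // !sqrf_eq0 => /andP[/eqP a /eqP b].
exact: complexP.
Qed.

Lemma sqnN z : sqn (- z) = sqn z.
Proof. by case: z => a b; rewrite /sqn /= !sqrrN. Qed.

Lemma sqnD z w : sqn (z + w) <= 2 * (sqn z + sqn w).
Proof.
rewrite -subr_ge0.
suff -> : 2 * (sqn z + sqn w) - sqn (z + w) = sqn (z - w) by exact: sqn_ge0.
rewrite /sqn ReB ImB ReD ImD; ring.
Qed.

Lemma sqnM z w : sqn (z * w) = sqn z * sqn w.
Proof. rewrite /sqn ReM ImM; ring. Qed.

Lemma Re_conjM z w : Re (z^* * w) = Re z * Re w + Im z * Im w.
Proof. rewrite ReM Reconj Imconj; ring. Qed.

Lemma Im_conjM z w : Im (z^* * w) = Re z * Im w - Im z * Re w.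
Proof. rewrite ImM Reconj Imconj; ring. Qed.

Lemma conjMz z : z^* * z = (sqn z)%:C.
Proof. apply: complexP; rewrite ?Re_conjM ?Im_conjM /sqn /=; ring. Qed.

Lemma Re_conjM_le z w : `|Re (z^* * w)| <= sqn z + sqn w.
Proof.
rewrite Re_conjM; have := sqn_ge0 (z + w); have := sqn_ge0 (z - w).
have := sqn_ge0 z; have := sqn_ge0 w.
rewrite /sqn ReB ImB ReD ImD ler_norml => *; apply/andP; split; nra.
Qed.

Lemma Im_conjM_le z w : `|Im (z^* * w)| <= sqn z + sqn w.
Proof.
have -> : Im (z^* * w) = Re (z^* * (- 'i%C * w)).
  by rewrite Im_conjM Re_conjM ReM ImM /=; ring.
apply: (le_trans (Re_conjM_le _ _)); rewrite lerD2l sqnM sqnN /sqn /=.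
by rewrite expr0n expr1n add0r mul1r.
Qed.

Definition csum (u : nat -> R[i]) : R[i] :=
  (limn (series (fun m => Re (u m))) +i* limn (series (fun m => Im (u m))))%C.

Definition csummable (u : nat -> R[i]) : Prop :=
  cvgn (series (fun m => Re (u m))) /\ cvgn (series (fun m => Im (u m))).

Lemma csum_linear a u v : csummable u -> csummable v ->
  csum (fun m => a * u m + v m) = a * csum u + csum v.
Proof.
move=> [ru iu] [rv iv]; case: a => a b.
have E1 : (fun m => Re ((a +i* b)%C * u m + v m))
  = (a *: (fun m => Re (u m))) + ((- b) *: (fun m => Im (u m)))
    + (fun m => Re (v m)).
  by apply/funext => m; rewrite ReD ReM /=
    -[RHS]/(a * Re (u m) + - b * Im (u m) + Re (v m)) mulNr.
have E2 : (fun m => Im ((a +i* b)%C * u m + v m))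
  = (a *: (fun m => Im (u m))) + (b *: (fun m => Re (u m)))
    + (fun m => Im (v m)).
  by apply/funext => m; rewrite ImD ImM.
rewrite /csum E1 E2.
have L (f g h : R^nat) (x y : R) : cvgn (series f) -> cvgn (series g) ->
    cvgn (series h) -> limn (series (x *: f + y *: g + h)) =
    x * limn (series f) + y * limn (series g) + limn (series h).
  move=> cf cg ch; have cx := @is_cvg_seriesZ _ _ x cf.
  have cy := @is_cvg_seriesZ _ _ y cg.
  rewrite lim_seriesD //; last exact: is_cvg_seriesD.
  by rewrite lim_seriesD // !lim_seriesZ.
rewrite !L //.
by apply: complexP; rewrite ?ReD ?ImD ?ReM ?ImM /= ?mulNr.
Qed.

Lemma cvg_sqcauchy (x : nat -> R) :
  (forall eps : R, 0 < eps -> exists N, forall m n, (N <= m)%N -> (N <= n)%N ->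
     (x m - x n) ^+ 2 < eps) -> cvgn x.
Proof.
move=> H; apply/cauchy_cvgP; apply: cauchy_exP => e e0.
have [N HN] := H (e ^+ 2) (exprn_gt0 _ e0).
exists (x N); exists N => // n /= Nn.
have := HN _ _ (leqnn N) Nn; rewrite /ball /= => h.
move: h; rewrite -(real_normK (num_real (x N - x n))).
by rewrite ltr_pXn2r ?nnegrE ?normr_ge0 ?(ltW e0).
Qed.

End ComplexFacts.

Section FiniteDimensional.
Variables (R : realType) (I : finType).
Local Notation E := {ffun I -> R[i]^o}.

Definition ffun_dot (f g : E) : R[i] := \sum_i (f i)^* * g i.

Lemma ffun_dotE (f : E) : ffun_dot f f = (\sum_i sqn (f i))%:C.
Proof. by rewrite rmorph_sum; apply: eq_bigr => i _; exact: conjMz. Qed.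

Fact ffun_dotC (f g : E) : ffun_dot f g = (ffun_dot g f)^*.
Proof.
rewrite rmorph_sum; apply: eq_bigr => i _.
by rewrite rmorphM /= conjCK mulrC.
Qed.

Fact ffun_dot_linear f a (g h : E) :
  ffun_dot f (a *: g + h) = a * ffun_dot f g + ffun_dot f h.
Proof.
rewrite mulr_sumr -big_split; apply: eq_bigr => i _ /=.
by rewrite !ffunE mulrDr mulrCA.
Qed.

Fact ffun_dot_gt0 (f : E) : f != 0 -> 0 < ffun_dot f f.
Proof.
rewrite ffun_dotE ltcR lt0r sumr_ge0 ?andbT => [|i _]; last exact: sqn_ge0.
apply: contra => /eqP f0; apply/eqP/ffunP => i; rewrite ffunE.
apply: sqn_eq0; apply/eqP; move/eqP: f0.
by rewrite psumr_eq0 => [/allP/(_ i (mem_index_enum i))|j _]; last exact: sqn_ge0.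
Qed.

Fact ffun_complete (u : nat -> E) :
  (forall eps : R, 0 < eps -> exists N, forall m n, (N <= m)%N -> (N <= n)%N ->
     Re (ffun_dot (u m - u n) (u m - u n)) < eps) ->
  exists l, forall eps : R, 0 < eps -> exists N, forall n, (N <= n)%N ->
     Re (ffun_dot (u n - l) (u n - l)) < eps.
Proof.
move=> H.
have le1 (f : E) i : sqn (f i) <= Re (ffun_dot f f).
  rewrite ffun_dotE (bigD1 i) //= lerDl sumr_ge0 // => j _; exact: sqn_ge0.
have cre i : cvgn (fun n => Re (u n i)).
  apply: cvg_sqcauchy => e /H[N HN]; exists N => m n Nm Nn.
  apply: le_lt_trans (HN m n Nm Nn); apply: le_trans (le1 _ i).
  by rewrite !ffunE /sqn ReB lerDl sqr_ge0.
have cim i : cvgn (fun n => Im (u n i)).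
  apply: cvg_sqcauchy => e /H[N HN]; exists N => m n Nm Nn.
  apply: le_lt_trans (HN m n Nm Nn); apply: le_trans (le1 _ i).
  by rewrite !ffunE /sqn ImB lerDr sqr_ge0.
pose l : E := [ffun i => (limn (fun n => Re (u n i)) +i*
                          limn (fun n => Im (u n i)))%C].
exists l => e e0.
have : (fun n => \sum_i sqn ((u n - l) i)) @ \oo --> (\sum_(i : I) (0 : R)).
  apply: cvg_big; first exact: add_continuous.
  move=> i _.
  have -> : (0 : R) = 0 * 0 + 0 * 0 by rewrite mul0r addr0.
  have -> : (fun n => sqn ((u n - l) i)) =
     (fun n => (Re (u n i) - Re (l i)) * (Re (u n i) - Re (l i))
             + (Im (u n i) - Im (l i)) * (Im (u n i) - Im (l i))).
    by apply/funext => n; rewrite !ffunE /sqn ReB ImB !expr2.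
  have c1 : (fun n => Re (u n i) - Re (l i)) @ \oo --> (0 : R).
    by rewrite -(subrr (Re (l i))); apply: cvgB; [rewrite ffunE; exact: cre|exact: cvg_cst].
  have c2 : (fun n => Im (u n i) - Im (l i)) @ \oo --> (0 : R).
    by rewrite -(subrr (Im (l i))); apply: cvgB; [rewrite ffunE; exact: cim|exact: cvg_cst].
  by apply: cvgD; apply: cvgM.
rewrite big1 // => /cvgrPdist_lt/(_ e e0)[N _ HN]; exists N => n Nn.
have /= := HN n Nn; rewrite sub0r normrN ffun_dotE /=.
exact: le_lt_trans (ler_norm _).
Qed.

Definition ffun_hilbert : hilbert R :=
  Hilbert ffun_dotC ffun_dot_linear ffun_dot_gt0 ffun_complete.

End FiniteDimensional.

Section FockDef.
Variables (R : realType) (D : nat).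
Implicit Types f g h : seq 'I_D -> R[i]^o.

(* The component of order m of f is its restriction to words of length m: the
   coordinates f [:: i_1; ...; i_m] of a tensor in (C^D)^{(x) m}, symmetric when
   f is invariant under permutation of words. *)
Definition level_dot f g m : R[i] := \sum_(s : m.-tuple 'I_D) (f s)^* * g s.

Definition level_norm f m : R := \sum_(s : m.-tuple 'I_D) sqn (f s).

Definition fock_pred : {pred seq 'I_D -> R[i]^o} := fun f =>
  `[< (forall s t, perm_eq s t -> f s = f t) /\ cvgn (series (level_norm f)) >].

Lemma level_norm_ge0 f m : 0 <= level_norm f m.
Proof. by apply: sumr_ge0 => s _; exact: sqn_ge0. Qed.

Lemma level_normE f m : level_dot f f m = (level_norm f m)%:C.
Proof. by rewrite rmorph_sum; apply: eq_bigr => i _; exact: conjMz. Qed.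

Lemma fock_submod_closed : submod_closed fock_pred.
Proof.
split.
  apply/asboolP; split => //.
  apply: (@series_le_cvg _ _ (fun=> 0)) => [m|//|m|].
  - exact: level_norm_ge0.
  - by rewrite /level_norm big1 // => s _; rewrite /sqn /= expr0n addr0.
  - have -> : series (fun=> 0 : R) = (fun=> 0).
      by apply/funext => m; rewrite /series /= big1.
    exact: is_cvg_cst.
move=> a f g /asboolP[sf cf] /asboolP[sg cg]; apply/asboolP; split.
  by move=> s t st; rewrite /= !fctE (sf _ _ st) (sg _ _ st).
apply: (@series_le_cvg _ _
    ((2 * sqn a) *: level_norm f + 2 *: level_norm g)) => [m|m|m|].
- exact: level_norm_ge0.
- by rewrite addr_ge0 // mulr_ge0 ?level_norm_ge0 // mulr_ge0 ?sqn_ge0.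
- rewrite -[leRHS]/((2 * sqn a) * level_norm f m + 2 * level_norm g m).
  rewrite !mulr_sumr -big_split; apply: ler_sum => s _ /=.
  rewrite !fctE; apply: (le_trans (sqnD _ _)).
  by rewrite -[a *: f s]/(a * f s) sqnM mulrDr mulrA.
- by apply: is_cvg_seriesD; exact: is_cvg_seriesZ.
Qed.

HB.instance Definition _ :=
  GRing.isSubmodClosed.Build _ _ fock_pred fock_submod_closed.

Record fock := Fock { fock_fun :> seq 'I_D -> R[i]^o; _ : fock_fun \in fock_pred }.

HB.instance Definition _ := [isSub of fock for fock_fun].
HB.instance Definition _ := [Choice of fock by <:].
HB.instance Definition _ := [SubChoice_isSubLmodule of fock by <:].

Lemma fockP (f : fock) : (forall s t, perm_eq s t -> f s = f t) /\
  cvgn (series (level_norm f)).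
Proof. by case: f => f /= /asboolP. Qed.

Definition fock_dot (f g : fock) : R[i] := csum (level_dot f g).

Lemma fock_summable (f g : fock) : csummable (level_dot f g).
Proof.
have [_ cf] := fockP f; have [_ cg] := fockP g.
have cfg := is_cvg_seriesD cf cg.
have aux (u : nat -> R) :
    (forall m, `|u m| <= level_norm f m + level_norm g m) -> cvgn (series u).
  move=> h; apply: normed_cvg; apply: (series_le_cvg _ _ h cfg) => m.
    exact: normr_ge0.
  by rewrite addr_ge0 ?level_norm_ge0.
split; apply: aux => m; rewrite /level_dot ?Re_sum ?Im_sum;
  apply: (le_trans (ler_norm_sum _ _ _)); rewrite -big_split;
  apply: ler_sum => s _; [exact: Re_conjM_le | exact: Im_conjM_le].
Qed.

Lemma fock_dotE (f : fock) : fock_dot f f = (limn (series (level_norm f)))%:C.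
Proof.
apply: complexP => /=.
  by congr (limn (series _)); apply/funext => m; rewrite level_normE.
under eq_fun do rewrite level_normE /=.
have -> : series (fun=> 0 : R) = (fun=> 0).
  by apply/funext => m; rewrite /series /= big1.
exact: lim_cst.
Qed.

Fact fock_dotC (f g : fock) : fock_dot f g = (fock_dot g f)^*.
Proof.
have E m : level_dot f g m = (level_dot g f m)^*.
  rewrite rmorph_sum; apply: eq_bigr => i _.
  by rewrite rmorphM /= conjCK mulrC.
have [_ ci] := fock_summable g f.
apply: complexP; rewrite ?Reconj ?Imconj /=.
  by congr (limn (series _)); apply/funext => m; rewrite E Reconj.
rewrite -lim_seriesN //.
by congr (limn (series _)); apply/funext => m; rewrite E Imconj.
Qed.

Fact fock_dot_linear (f : fock) a (g h : fock) :
  fock_dot f (a *: g + h) = a * fock_dot f g + fock_dot f h.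
Proof.
rewrite /fock_dot -csum_linear; [|exact: fock_summable..].
congr csum; apply/funext => m.
rewrite mulr_sumr -big_split; apply: eq_bigr => s _ /=.
by rewrite !fctE mulrDr mulrCA.
Qed.

Lemma level_norm_le (f : fock) N :
  \sum_(0 <= m < N) level_norm f m <= Re (fock_dot f f).
Proof.
have [_ cf] := fockP f; rewrite fock_dotE /=.
apply: (@nondecreasing_cvgn_le _ (series (level_norm f))) => //.
by apply: nondecreasing_series => m _ _; exact: level_norm_ge0.
Qed.

Lemma sqn_fock_le (f : fock) s : sqn (f s) <= Re (fock_dot f f).
Proof.
apply: le_trans (level_norm_le f (size s).+1).
rewrite big_nat_recr //= [leRHS]addrC ler_wpDr //.
  by apply: sumr_ge0 => m _; exact: level_norm_ge0.
rewrite /level_norm (bigD1 (in_tuple s)) //= lerDl.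
by apply: sumr_ge0 => t _; exact: sqn_ge0.
Qed.

Fact fock_dot_gt0 (f : fock) : f != 0 -> 0 < fock_dot f f.
Proof.
move=> f0; have E := fock_dotE f; rewrite E ltcR lt0r.
have -> : limn (series (level_norm f)) = Re (fock_dot f f) by rewrite E.
rewrite (le_trans _ (level_norm_le f 0)) ?big_nil // andbT.
apply: contra f0 => /eqP h; apply/eqP/val_inj/funext => s /=.
apply: sqn_eq0; apply/eqP; rewrite eq_le sqn_ge0 andbT -h.
exact: sqn_fock_le.
Qed.

Fact fock_complete (u : nat -> fock) :
  (forall eps : R, 0 < eps -> exists N, forall m n, (N <= m)%N -> (N <= n)%N ->
     Re (fock_dot (u m - u n) (u m - u n)) < eps) ->
  exists l, forall eps : R, 0 < eps -> exists N, forall n, (N <= n)%N ->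
     Re (fock_dot (u n - l) (u n - l)) < eps.
Proof.
move=> H.
have cre s : cvgn (fun n => Re (u n s)).
  apply: cvg_sqcauchy => e /H[N HN]; exists N => m n Nm Nn.
  apply: le_lt_trans (HN m n Nm Nn); apply: le_trans (sqn_fock_le _ s).
  by rewrite /sqn -ReB lerDl sqr_ge0.
have cim s : cvgn (fun n => Im (u n s)).
  apply: cvg_sqcauchy => e /H[N HN]; exists N => m n Nm Nn.
  apply: le_lt_trans (HN m n Nm Nn); apply: le_trans (sqn_fock_le _ s).
  by rewrite /sqn -ImB lerDr sqr_ge0.
pose l s : R[i]^o := (limn (fun n => Re (u n s)) +i* limn (fun n => Im (u n s)))%C.
have bound (e : R) N n M : (N <= n)%N ->
    (forall k, (N <= k)%N -> Re (fock_dot (u n - u k) (u n - u k)) < e) ->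
    \sum_(0 <= m < M) level_norm (fun s => u n s - l s) m <= e.
  move=> Nn Hn.
  have cv : (fun k => \sum_(0 <= m < M) level_norm (u n - u k : fock) m) @ \oo -->
      \sum_(0 <= m < M) level_norm (fun s => u n s - l s) m.
    apply: cvg_big; first exact: add_continuous.
    move=> m _; apply: cvg_big; first exact: add_continuous.
    move=> s _; rewrite /sqn.
    have -> : (fun k => Re ((u n - u k : fock) s) ^+ 2 + Im ((u n - u k : fock) s) ^+ 2) =
     (fun k => (Re (u n s) - Re (u k s)) * (Re (u n s) - Re (u k s))
             + (Im (u n s) - Im (u k s)) * (Im (u n s) - Im (u k s))).
      by apply/funext => k; rewrite -ReB -ImB -!expr2.
    rewrite ReB ImB !expr2.
    have c1 : (fun k => Re (u n s) - Re (u k s)) @ \oo --> (Re (u n s) - Re (l s)).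
      by apply: cvgB; [exact: cvg_cst|exact: cre].
    have c2 : (fun k => Im (u n s) - Im (u k s)) @ \oo --> (Im (u n s) - Im (l s)).
      by apply: cvgB; [exact: cvg_cst|exact: cim].
    by apply: cvgD; apply: cvgM.
  rewrite -(cvg_lim _ cv) //; apply: limr_le; first by apply/cvg_ex; eexists; exact: cv.
  exists N => // k /= Nk; apply: le_trans (ltW (Hn _ Nk)).
  exact: (level_norm_le (u n - u k : fock) M).
have nd f : {homo series (level_norm f) : n m / (n <= m)%N >-> n <= m}.
  by apply: nondecreasing_series => m _ _; exact: level_norm_ge0.
have lP : l \in fock_pred.
  have [N HN] := H 1 ltr01.
  have -> : l = (u N : seq 'I_D -> R[i]^o) - (fun s => u N s - l s).
    by apply/funext => s; rewrite !fctE opprB addrC subrK.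
  apply: rpredB; first by case: (u N).
  apply/asboolP; split=> [s t st|].
    have E n : u n s = u n t by apply: (fockP (u n)).1.
    rewrite /l E; congr (_ - (_ +i* _)%C); congr (limn _);
      by apply/funext => n; rewrite E.
  apply: nondecreasing_is_cvgn; first exact: nd.
  exists 1 => _ [M _ <-]; apply: (bound _ N) => // k Nk; exact: HN.
exists (Fock lP) => e e0; have [N HN] := H (e / 2) (divr_gt0 e0 (ltr0Sn _ 1)).
exists N => n Nn; apply: (@le_lt_trans _ _ (e / 2)); last by lra.
rewrite fock_dotE /=; apply: limr_le; first by case: (fockP (u n - Fock lP)).
apply: nearW => M; apply: (bound _ N) => // k Nk; exact: HN.
Qed.

Definition fock_hilbert : hilbert R :=
  Hilbert fock_dotC fock_dot_linear fock_dot_gt0 fock_complete.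

(* |Coh(a)>: the coordinates of a^{(x) m} are the products a_{i_1} ... a_{i_m}. *)
Definition coh_fun (a : ffun_hilbert R 'I_D) : seq 'I_D -> R[i]^o := fun s =>
  (expR (- (Re (hdot a a) / 2)) / Num.sqrt (size s)`!%:R)%:C
    * \prod_(i <- s) a i.

Lemma sqn1 : sqn (1 : R[i]) = 1.
Proof. by rewrite /sqn /= expr1n expr0n addr0. Qed.

Lemma sum_tuple_prod (x : 'I_D -> R) m :
  \sum_(s : m.-tuple 'I_D) \prod_(i <- s) x i = (\sum_i x i) ^+ m.
Proof.
elim: m => [|m IH].
  rewrite (eq_bigl (pred1 [tuple])) ?big_pred1_eq ?big_nil ?expr0 // => s.
  by apply/esym/eqP; exact: tuple0.
rewrite exprS -IH mulr_suml.
under [RHS]eq_bigr do rewrite mulr_sumr.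
rewrite pair_big /= (reindex (fun p : 'I_D * m.-tuple 'I_D => [tuple of p.1 :: p.2])).
  by apply: eq_bigr => -[i s] _; rewrite big_cons.
exists (fun s => (thead s, [tuple of behead s])) => [[i s] _|s _] /=.
  by rewrite theadE; congr pair; exact: val_inj.
by rewrite -tuple_eta.
Qed.

Lemma coh_proof (a : ffun_hilbert R 'I_D) : coh_fun a \in fock_pred.
Proof.
apply/asboolP; split=> [s t st|].
  by rewrite /coh_fun (perm_size st) (perm_big _ st).
set x := \sum_i sqn (a i).
have -> : level_norm (coh_fun a)
    = (expR (- (Re (hdot a a) / 2)) ^+ 2) *: exp_coeff x.
  apply/funext => m; rewrite -[RHS]/(_ * (x ^+ m / m`!%:R)) /x -sum_tuple_prod.
  rewrite mulr_suml mulr_sumr; apply: eq_bigr => s _.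
  rewrite /coh_fun size_tuple sqnM (big_morph _ (@sqnM R) sqn1) mulrCA.
  rewrite mulrC; congr (_ * _); rewrite /sqn /= expr0n addr0 exprMn exprVn.
  by rewrite sqr_sqrtr.
apply: is_cvg_seriesZ; exact: is_cvg_series_exp_coeff.
Qed.

Definition coh a : fock_hilbert := Fock (coh_proof a).
End FockDef.

Section Operators.
Variable R : realType.

Definition hnorm (H : hilbert R) (x : H) : R := Num.sqrt (Re (hdot x x)).

Definition bounded_op (H : hilbert R) (X : H -> H) : Prop :=
  (forall a x y, X (a *: x + y) = a *: X x + X y) /\
  exists M : R, forall x, hnorm (X x) <= M * hnorm x.

Definition positive_op (H : hilbert R) (X : H -> H) : Prop :=
  bounded_op X /\ forall x, 0 <= hdot x (X x).

Definition is_adjoint (H : hilbert R) (X Y : H -> H) : Prop :=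
  forall x y, hdot (X x) y = hdot x (Y y).

(* P = |X|, the positive square root of X^* X *)
Definition is_abs (H : hilbert R) (X P : H -> H) : Prop :=
  positive_op P /\ exists Y, is_adjoint X Y /\ forall x, P (P x) = Y (X x).

Definition is_hilbert_basis (H : hilbert R) (I : choiceType) (b : I -> H) : Prop :=
  (forall i j, hdot (b i) (b j) = (i == j)%:R) /\
  (forall x, (forall i, hdot (b i) x = 0) -> x = 0).

Definition has_trace (H : hilbert R) (X : H -> H) (t : R[i]) : Prop :=
  forall (I : choiceType) (b : I -> H), is_hilbert_basis b ->
  forall eps : R, 0 < eps -> exists F0 : {fset I}, forall F : {fset I},
    (F0 `<=` F)%fset ->
    `|\sum_(i <- F) hdot (b i) (X (b i)) - t| < eps%:C.

(* ||X||_1 = Tr |X|, with value +oo when X is not of trace class *)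
Definition trace_norm (H : hilbert R) (X : H -> H) : \bar R :=
  xget +oo%E [set t%:E | t in
    [set t : R | exists P, is_abs X P /\ has_trace P t%:C]].

Definition trace_class (H : hilbert R) (X : H -> H) : Prop :=
  bounded_op X /\ (trace_norm X < +oo)%E.

(* positivity of the operator with blocks X i j on H (+) ... (+) H *)
Definition positive_block (H : hilbert R) N (X : 'I_N -> 'I_N -> H -> H) : Prop :=
  forall xi : 'I_N -> H, 0 <= \sum_i \sum_j hdot (xi i) (X i j (xi j)).

(* Predual channels L^1(H1) -> L^1(H2). They are represented by maps on all
   functions H1 -> H1, of which only the values on trace-class operators are
   constrained or used. *)
Definition channel (H1 H2 : hilbert R) (T : (H1 -> H1) -> H2 -> H2) : Prop :=
  [/\ forall X, trace_class X -> trace_class (T X),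
      forall a X Y, trace_class X -> trace_class Y ->
        T (fun x => a *: X x + Y x) = (fun x => a *: T X x + T Y x),
      forall X t, trace_class X -> has_trace X t -> has_trace (T X) t &
      forall N (X : 'I_N -> 'I_N -> H1 -> H1),
        (forall i j, trace_class (X i j)) -> positive_block X ->
        positive_block (fun i j => T (X i j))].

Definition deficiency (Theta : Type) (S : set Theta) (H1 H2 : hilbert R)
    (Q : Theta -> H1 -> H1) (G : Theta -> H2 -> H2) : \bar R :=
  ereal_inf [set ereal_sup [set trace_norm (fun x => T (Q th) x - G th x)
                           | th in S]
            | T in [set T | channel T]].

Definition le_cam (Theta : Type) (S : set Theta) (H1 H2 : hilbert R)
    (Q : Theta -> H1 -> H1) (G : Theta -> H2 -> H2) : \bar R :=
  Order.max (deficiency S Q G) (deficiency S G Q).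

End Operators.

Section Smooth.
Variable R : realType.

Fixpoint diff_class (E : normedModType R) (n : nat) (U : set E) (f : E -> R) : Prop :=
  (forall x, U x -> {for x, continuous f}) /\
  if n is n'.+1 then
    forall v, (forall x, U x -> derivable f x v) /\ diff_class n' U ('D_v f)
  else True.

Definition smooth_on (E : normedModType R) (U : set E) (f : E -> R) : Prop :=
  forall n, diff_class n U f.

Definition smooth_mx_on (E : normedModType R) (U : set E) m n
    (f : E -> 'M[R[i]]_(m, n)) : Prop :=
  forall a b, smooth_on U (fun x => Re (f x a b)) /\
              smooth_on U (fun x => Im (f x a b)).

Definition derive_mx (E : normedModType R) m n (f : E -> 'M[R[i]]_(m, n))
    (x v : E) : 'M[R[i]]_(m, n) :=
  \matrix_(a, b) ('D_v (fun y => Re (f y a b)) x +i*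
                  'D_v (fun y => Im (f y a b)) x)%C.

End Smooth.

Section QuantumMarkovChains.
Variables (R : realType) (d k : nat).
Local Notation C := R[i].
(* H (x) K has basis |a> (x) |i>, numbered by mxtens_index (a, i) *)
Local Notation isom := 'M[R[i]]_(d * k, d).
Implicit Types (V A B L : isom) (X rho K W Z : 'M[C]_d).

Definition kraus V (i : 'I_k) : 'M[C]_d :=
  \matrix_(a, b) V (mxtens_index (a, i)) b.

Definition chan V X : 'M[C]_d := V^t* *m (X *t (1%:M : 'M[C]_k)) *m V.

Definition predual V rho : 'M[C]_d :=
  \sum_i kraus V i *m rho *m (kraus V i)^t*.

Definition psd rho : Prop :=
  forall x : 'cV[C]_d, 0 <= (x^t* *m rho *m x) 0 0.

Definition posdef rho : Prop :=
  forall x : 'cV[C]_d, x != 0 -> 0 < (x^t* *m rho *m x) 0 0.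

Definition stationary_state V rho : Prop :=
  [/\ psd rho, \tr rho = 1 & predual V rho = rho].

Definition irreducible V : Prop :=
  V^t* *m V = 1%:M /\
  exists rho, [/\ stationary_state V rho, posdef rho &
    forall sigma, stationary_state V sigma -> sigma = rho].

Definition rho_ss V : 'M[C]_d := xget 0 [set rho | stationary_state V rho].

Definition root_of_unity (p : nat) : C :=
  (cos (2 * pi / p%:R) +i* sin (2 * pi / p%:R))%C.

(* The peripheral eigenvalues of T_V are exactly the p-th roots of unity. *)
Definition has_period V (p : nat) : Prop :=
  (0 < p)%N /\
  forall lambda : C, `|lambda| = 1 ->
    ((exists X, X != 0 /\ chan V X = lambda *: X) <->
     exists j : 'I_p, lambda = root_of_unity p ^+ j).

Definition cyclic_unitary V (p : nat) (P : 'I_p -> 'M[C]_d) Z : Prop :=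
  [/\ forall a, (P a)^t* = P a /\ P a *m P a = P a,
      \sum_a P a = 1%:M,
      forall a, chan V (P (ordS a)) = P a,
      Z = \sum_(a : 'I_p) root_of_unity p ^+ a *: P a &
      Z \is unitarymx /\ chan V Z = root_of_unity p *: Z].

(* word V [i_1; ...; i_n] = K_{i_n} ... K_{i_1} *)
Definition word V (s : seq 'I_k) : 'M[C]_d :=
  foldl (fun M i => kraus V i *m M) 1%:M s.

Definition out_space (n : nat) : hilbert R := ffun_hilbert R (n.-tuple 'I_k).

(* <s| Tr_H [V(n) rho_ss V(n)^*] |t> = Tr [K_s rho_ss K_t^*] *)
Definition rho_out V (n : nat) : out_space n -> out_space n := fun f =>
  [ffun s : n.-tuple 'I_k => \sum_(t : n.-tuple 'I_k)
     \tr (word V s *m rho_ss V *m (word V t)^t*) * f t].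

(* L stands for the velocity i L at V. *)
Definition tangent V L : Prop := L^t* *m V - V^t* *m L = 0.

Definition tangent_id V A : Prop := V *m V^t* *m A = 0.

Definition tangent_nonid V L : Prop :=
  exists (theta : R) (K : 'M[C]_d), [/\ K^t* = K, \tr (rho_ss V *m K) = 0 &
    L = theta%:C *: V - (K *t (1%:M : 'M[C]_k)) *m V + V *m K].

Definition inner_id V A B : C := \tr (rho_ss V *m A^t* *m B).

Definition ball_id V (r : R) : set isom :=
  [set A | tangent_id V A /\ Num.sqrt (Re (inner_id V A A)) < r].

Definition gauge (c : C) W L : isom :=
  c^* *: ((W *t (1%:M : 'M[C]_k)) *m L *m W^t*).

Section Geometry.

(* the tangent vector whose velocity is the j-th partial derivative of phi *)
Definition coord_vector N (phi : 'rV[R]_N -> isom) (x : 'rV[R]_N) (j : 'I_N) : isom :=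
  - 'i%C *: derive_mx phi x (delta_mx 0 j).

(* Local coordinates, as smooth parametrizations that are local
   diffeomorphisms into the manifold of irreducible isometries. *)
Definition parametrization N (U : set 'rV[R]_N) (phi : 'rV[R]_N -> isom) : Prop :=
  [/\ open U, smooth_mx_on U phi, forall x, U x -> irreducible (phi x),
      forall x, U x -> forall j, tangent (phi x) (coord_vector phi x j) &
      forall x, U x -> forall L, tangent (phi x) L ->
        exists! c : 'rV[R]_N, L = \sum_j (c 0 j)%:C *: coord_vector phi x j].

Variable nu : isom -> isom -> isom -> R.

Definition gram N (phi : 'rV[R]_N -> isom) (x : 'rV[R]_N) : 'M[R]_N :=
  \matrix_(i, j) nu (phi x) (coord_vector phi x i) (coord_vector phi x j).

Record riemannian_metric : Prop := RiemannianMetric {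
  metric_sym : forall V A B, irreducible V -> tangent V A -> tangent V B ->
    nu V A B = nu V B A;
  metric_linear : forall V (a : R) A B L, irreducible V ->
    tangent V A -> tangent V B -> tangent V L ->
    nu V (a%:C *: A + B) L = a * nu V A L + nu V B L;
  metric_gt0 : forall V A, irreducible V -> tangent V A -> A != 0 ->
    0 < nu V A A;
  metric_smooth : forall N (U : set 'rV[R]_N) phi, parametrization U phi ->
    forall i j, smooth_on U (fun x => gram phi x i j) }.

Record admissible_metric : Prop := AdmissibleMetric {
  admissible_riemannian : riemannian_metric;
  metric_invariant : forall V A B c W, irreducible V ->
    tangent V A -> tangent V B -> `|c| = 1 -> W \is unitarymx ->
    nu (gauge c W V) (gauge c W A) (gauge c W B) = nu V A B;
  metric_orthogonal : forall V A B, irreducible V ->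
    tangent_id V A -> tangent_nonid V B -> nu V A B = 0;
  metric_id : forall V A, irreducible V -> tangent_id V A ->
    (nu V A A)%:C = inner_id V A A }.

Definition christoffel N (phi : 'rV[R]_N -> isom) (x : 'rV[R]_N) (l i j : 'I_N) : R :=
  2^-1 * \sum_m invmx (gram phi x) l m *
    ('D_(delta_mx 0 i) (fun y => gram phi y j m) x
     + 'D_(delta_mx 0 j) (fun y => gram phi y i m) x
     - 'D_(delta_mx 0 m) (fun y => gram phi y i j) x).

(* g is smooth near t0 and solves the geodesic equation of nu in some local
   coordinates around g t0; the choice of coordinates is irrelevant. *)
Definition geodesic_at (g : R -> isom) (t0 : R) : Prop :=
  exists N (U : set 'rV[R]_N) phi (J : set R) (x : R -> 'rV[R]_N),
  [/\ parametrization U phi, open J /\ J t0,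
      forall l, smooth_on J (fun t => x t 0 l),
      forall t, J t -> U (x t) /\ g t = phi (x t) &
      forall t, J t -> forall l,
        derive1n 2 (fun s => x s 0 l) t
        + \sum_i \sum_j christoffel phi (x t) l i j
            * derive1 (fun s => x s 0 i) t * derive1 (fun s => x s 0 j) t = 0].

Definition is_exp V A V1 : Prop :=
  exists g : R -> isom,
  [/\ forall t, 0 <= t <= 1 -> geodesic_at g t,
      g 0 = V, derive_mx g 0 (1 : R) = 'i%C *: A & g 1 = V1].

(* junk value V when the geodesic issued from V does not exist up to time 1 *)
Definition exp_map V A : isom := xget V [set V1 | is_exp V A V1].

End Geometry.

Definition rotation (p : nat) Z A : isom :=
  root_of_unity p *: ((Z^t* *t (1%:M : 'M[C]_k)) *m A *m Z).

Definition basis_id V D (e : 'I_D -> isom) : Prop :=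
  [/\ forall i, tangent_id V (e i),
      forall i j, inner_id V (e i) (e j) = (i == j)%:R &
      forall A, tangent_id V A -> A = \sum_i inner_id V (e i) A *: e i].

(* the unitary identification of T_V^id with C^D given by the basis e *)
Definition coords_id V D (e : 'I_D -> isom) A : ffun_hilbert R 'I_D :=
  [ffun i => inner_id V (e i) A].

Definition rho_gm V (p : nat) Z D (e : 'I_D -> isom) A :
    fock_hilbert R D -> fock_hilbert R D := fun psi =>
  p%:R^-1 *: \sum_(m < p)
    let c := coh (coords_id V e (iter m (rotation p Z) A)) in hdot c psi *: c.

End QuantumMarkovChains.

Arguments rho_out {R d k} V n _.
Arguments rho_gm {R d k} V p Z {D} e A _.
Arguments exp_map {R d k} nu V A.
Arguments le_cam {R Theta} S {H1 H2} Q G.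

(* Main.v *)
Require Import Defs.
From HB Require Import structures.
From mathcomp Require Import all_boot all_order all_algebra finmap.
From mathcomp Require Import sesquilinear spectral complex mxtens.
From mathcomp Require Import all_classical all_reals all_analysis.
From mathcomp Require Import ring lra zify.
Set Implicit Arguments.
Unset Strict Implicit.
Unset Printing Implicit Defensive.
Import Order.TTheory GRing.Theory Num.Theory numFieldNormedType.Exports.
Local Open Scope classical_set_scope.
Local Open Scope ring_scope.
Local Open Scope sesquilinear_scope.
Local Notation Re := complex.Re.
Local Notation Im := complex.Im.
Local Notation "x %:C" := (real_complex _ x) : ring_scope.

(* Purify both models: the output state is a sum of d^2 rank one operators |x_lb><x_lb| with
  x_lb = (K_s S)_lb, S = sqrt rho_ss, and the mixture of coherent states has a similar decomposition.
  Since the n-th power of the deformed channel X |-> V_A^* (X (x) 1) V_B is governed by its p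
  peripheral eigenvalues, whose logarithms are 1/n (U^j A, B) minus norms, the Gram matrices of the two
  families agree up to O(n^(3 delta - 1/2)); a second order expansion of the geodesics suffices here.
  On a grid of polynomially many points such Gram matrices yield a contraction, hence a channel, that
  maps one family near the other, and d_id real dimensions make the grid error summable exactly when
  delta < 1/(2 (d_id + 3)). Moving off the grid costs only its mesh, which is arbitrary. *)

(** The obstacle is that terms of order n |A / sqrt n|^2 do not vanish. At that order the second
    order part of a geodesic enters the peripheral eigenvalues only through Tr (rho V^* V_A),
    because V^* A = 0. Its real part is fixed by the isometry condition; its imaginary part is a
    phase of the vectors, which rank one operators do not see and which is removed beforehand. Hence
    any expansion V + 'i A + O(|A|^2) will do, and it is shown for every geodesic with the given
    initial data, whichever endpoint [exp_map] selects; existence excludes its default value. The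
    contraction comes from Tikhonov regularization of the Gram matrix on the grid, with the Gram
    error times the number of grid vectors as parameter; the trace it loses is put on a fixed unit
    vector. Towards the mixture, a Fock decomposition with an environment index reproduces the limit
    Gram matrix exactly. Towards the output, the p coherent components go to the p gauge rotations
    of V_A, which give the same output from the initial state rho. *)

Section Hilbert.
Variable R : realType.
Local Notation C := R[i].

(** * Complex modulus with values in R *)

Definition cabs (z : C) : R := Re `|z|.

Lemma cabsE (z : C) : `|z| = (cabs z)%:C.
Proof. by []. Qed.

Lemma cabs_sqrt (z : C) : cabs z = Num.sqrt (sqn z).
Proof. by rewrite /cabs normc_def. Qed.

Lemma cabs_ge0 (z : C) : 0 <= cabs z.
Proof. by rewrite cabs_sqrt sqrtr_ge0. Qed.

Lemma cabs_sqr (z : C) : cabs z ^+ 2 = sqn z.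
Proof. by rewrite cabs_sqrt sqr_sqrtr // sqn_ge0. Qed.

Lemma cabsD (z w : C) : cabs (z + w) <= cabs z + cabs w.
Proof. by have:= ler_normD z w;rewrite !cabsE -rmorphD lecR. Qed.

Lemma cabsM (z w : C) : cabs (z * w) = cabs z * cabs w.
Proof. by have:= normrM z w;rewrite !cabsE -rmorphM=> /complexI. Qed.

Lemma cabsN (z : C) : cabs (- z) = cabs z.
Proof. by rewrite /cabs normrN. Qed.

Lemma cabsB (z w : C) : cabs (z - w) = cabs (w - z).
Proof. by rewrite /cabs distrC. Qed.

Lemma cabs0 : cabs 0 = 0.
Proof. by rewrite /cabs normr0. Qed.

Lemma cabs1 : cabs 1 = 1.
Proof. by rewrite /cabs normr1. Qed.

Lemma cabs_conj (z : C) : cabs z^* = cabs z.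
Proof. by rewrite /cabs norm_conjC. Qed.

Lemma cabs_real (x : R) : cabs x%:C = `|x|.
Proof. by rewrite cabs_sqrt /sqn expr0n addr0 sqrtr_sqr. Qed.

Lemma cabs_nat (n : nat) : cabs n%:R = n%:R.
Proof. by have:= cabs_real n%:R;rewrite rmorph_nat ger0_norm. Qed.

Lemma cabs_eq0 (z : C) : (cabs z == 0) = (z == 0).
Proof.
apply/eqP/eqP=> [z0|->];last exact:cabs0.
by apply/eqP;rewrite -normr_eq0 cabsE z0.
Qed.

Lemma cabsV (z : C) : cabs z^-1 = (cabs z)^-1.
Proof. by have:= normfV z;rewrite !cabsE -fmorphV=> /complexI. Qed.

Lemma cabsX (z : C) n : cabs (z ^+ n) = cabs z ^+ n.
Proof. by elim:n=> [|n IH];rewrite ?cabs1 // !exprS cabsM IH. Qed.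

Lemma cabs_sum (I : Type) (r : seq I) (P : pred I) (F : I -> C) :
 cabs (\sum_(i <- r | P i) F i) <= \sum_(i <- r | P i) cabs (F i).
Proof.
elim/big_ind2: _=> [|x u y v xu yv|//];first by rewrite cabs0.
exact:le_trans (cabsD _ _) (lerD xu yv).
Qed.

Lemma Re_le_cabs (z : C) : `|Re z| <= cabs z.
Proof.
by rewrite -ler_sqr ?nnegrE ?cabs_ge0 // cabs_sqr real_normK ?num_real // lerDl sqr_ge0.
Qed.

Lemma Im_le_cabs (z : C) : `|Im z| <= cabs z.
Proof.
by rewrite -ler_sqr ?nnegrE ?cabs_ge0 // cabs_sqr real_normK ?num_real // lerDr sqr_ge0.
Qed.

Lemma cabs_le (z : C) : cabs z <= `|Re z| + `|Im z|.
Proof.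
rewrite -ler_sqr ?nnegrE ?cabs_ge0 // cabs_sqr sqrrD !real_normK ?num_real //.
by rewrite /sqn addrAC lerDl mulrn_wge0 // mulr_ge0.
Qed.

Lemma conjMz_cabs (z : C) : z^* * z = (cabs z ^+ 2)%:C.
Proof. by rewrite conjMz cabs_sqr. Qed.

Lemma ge0_real (z : C) : 0 <= z -> z = (Re z)%:C.
Proof. by case:z=> a b;rewrite lecE /= => /andP[/eqP -> _]. Qed.

Lemma ge0E (z : C) : (0 <= z) = (Im z == 0) && (0 <= Re z).
Proof. by case:z=> a b;rewrite lecE. Qed.

Lemma mulC_conj (z : C) : z * z^* = (cabs z ^+ 2)%:C.
Proof. by rewrite mulrC conjMz_cabs. Qed.

Lemma conjc_realE (x : R) : (x%:C)^* = x%:C.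
Proof. by apply:complexP;rewrite /= ?oppr0. Qed.

(** * Geometry of a Hilbert space and Gram-Schmidt *)

Section OneSpace.
Variable H : hilbert R.
Implicit Types x y z v : H.

Definition hsq x : R := Re (hdot x x).

Lemma hdotDr x y z : hdot x (y + z) = hdot x y + hdot x z.
Proof. by rewrite -[y in LHS]scale1r hdot_linear mul1r. Qed.
Lemma hdot0r x : hdot x 0 = 0.
Proof. by apply:(@addrI _ (hdot x 0));rewrite -hdotDr !addr0. Qed.
Lemma hdotZr a x y : hdot x (a *: y) = a * hdot x y.
Proof. by rewrite -[a *: y]addr0 hdot_linear hdot0r addr0. Qed.
Lemma hdotNr x y : hdot x (- y) = - hdot x y.
Proof. by rewrite -scaleN1r hdotZr mulN1r. Qed.
Lemma hdotBr x y z : hdot x (y - z) = hdot x y - hdot x z.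
Proof. by rewrite hdotDr hdotNr. Qed.
Lemma hdot_sumr (I : Type) (r : seq I) (P : pred I) x (F : I -> H) :
 hdot x (\sum_(i <- r | P i) F i) = \sum_(i <- r | P i) hdot x (F i).
Proof. by apply:(big_morph _ (hdotDr x) (hdot0r x)). Qed.
Lemma hdotDl x y z : hdot (x + y) z = hdot x z + hdot y z.
Proof. by rewrite hdotC hdotDr rmorphD /= -!hdotC. Qed.
Lemma hdot0l x : hdot 0 x = 0.
Proof. by rewrite hdotC hdot0r rmorph0. Qed.
Lemma hdotZl a x y : hdot (a *: x) y = a^* * hdot x y.
Proof. by rewrite hdotC hdotZr rmorphM /= -hdotC. Qed.
Lemma hdotNl x y : hdot (- x) y = - hdot x y.
Proof. by rewrite hdotC hdotNr rmorphN /= -hdotC. Qed.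
Lemma hdotBl x y z : hdot (x - y) z = hdot x z - hdot y z.
Proof. by rewrite hdotDl hdotNl. Qed.
Lemma hdot_suml (I : Type) (r : seq I) (P : pred I) x (F : I -> H) :
 hdot (\sum_(i <- r | P i) F i) x = \sum_(i <- r | P i) hdot (F i) x.
Proof. by apply:(big_morph (fun y=> hdot y x) (fun y z=> hdotDl y z x) (hdot0l x)). Qed.

Lemma hdot_ge0 x : 0 <= hdot x x.
Proof. by have [->|/hdot_gt0/ltW//] := eqVneq x 0;rewrite hdot0r. Qed.
Lemma hdotxx x : hdot x x = (hsq x)%:C.
Proof. exact:ge0_real (hdot_ge0 x). Qed.
Lemma hsq_ge0 x : 0 <= hsq x.
Proof. by have:= hdot_ge0 x;rewrite hdotxx lecR. Qed.
Lemma hsq_eq0 x : hsq x = 0 -> x = 0.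
Proof.
move=> x0;apply/eqP;apply:contraT=> /hdot_gt0.
by rewrite hdotxx x0 ltxx.
Qed.
Lemma hdot_eq0 x : hdot x x = 0 -> x = 0.
Proof. by move=> h;apply:hsq_eq0;rewrite /hsq h. Qed.
Lemma hsqZ a x : hsq (a *: x) = cabs a ^+ 2 * hsq x.
Proof.
by apply:(@complexI R);rewrite -hdotxx hdotZl hdotZr mulrA conjMz_cabs hdotxx -rmorphM.
Qed.
Lemma hsqN x : hsq (- x) = hsq x.
Proof. by rewrite /hsq hdotNl hdotNr opprK. Qed.
Lemma hsqB x y : hsq (x - y) = hsq (y - x).
Proof. by rewrite -hsqN opprB. Qed.
Lemma hsqD x y : hsq (x + y) = hsq x + hsq y + 2 * Re (hdot x y).
Proof.
rewrite /hsq hdotDl !hdotDr [hdot y x]hdotC !ReD Reconj;ring.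
Qed.

Lemma hdot_CS x y : cabs (hdot x y) ^+ 2 <= hsq x * hsq y.
Proof.
have [->|y0] := eqVneq y 0.
 by rewrite hdot0r cabs0 expr0n mulr_ge0 ?hsq_ge0.
have yy : 0 < hsq y by have:= hdot_gt0 y0;rewrite hdotxx ltcR.
have:= hsq_ge0 (hdot y y *: x - hdot y x *: y).
rewrite hsqD hsqN !hsqZ hdotNr hdotZl hdotZr hdotxx cabs_real ger0_norm ?hsq_ge0 //.
rewrite conjc_realE [hdot x y]hdotC cabs_conj.
set c:= hdot y x.
have -> : Re (- ((hsq y)%:C * (c * c^*))) = - (hsq y * cabs c ^+ 2).
 by rewrite mulC_conj -rmorphM -rmorphN.
move=> h;rewrite -subr_ge0 -(pmulr_rge0 _ yy).
apply:le_trans h _;rewrite le_eqVlt;apply/orP;left;apply/eqP;ring.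
Qed.

Lemma hnorm_sqr x : hnorm x ^+ 2 = hsq x.
Proof. by rewrite sqr_sqrtr // hsq_ge0. Qed.
Lemma hnorm_ge0 x : 0 <= hnorm x.
Proof. exact:sqrtr_ge0. Qed.
Lemma hnorm0 : hnorm (0 : H) = 0.
Proof. by rewrite /hnorm hdot0r sqrtr0. Qed.
Lemma hdot_le x y : cabs (hdot x y) <= hnorm x * hnorm y.
Proof.
rewrite -ler_sqr ?nnegrE ?cabs_ge0 ?mulr_ge0 ?hnorm_ge0 //.
by rewrite exprMn !hnorm_sqr hdot_CS.
Qed.
Lemma hnormD x y : hnorm (x + y) <= hnorm x + hnorm y.
Proof.
rewrite -ler_sqr ?nnegrE ?addr_ge0 ?hnorm_ge0 // sqrrD !hnorm_sqr hsqD.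
have:= le_trans (ler_norm _) (le_trans (Re_le_cabs _) (hdot_le x y));lra.
Qed.
Lemma hnormZ a x : hnorm (a *: x) = cabs a * hnorm x.
Proof.
apply/eqP;rewrite -(@eqrXn2 _ 2) ?mulr_ge0 ?hnorm_ge0 ?cabs_ge0 //.
by rewrite exprMn !hnorm_sqr hsqZ.
Qed.
Lemma hnormN x : hnorm (- x) = hnorm x.
Proof. by rewrite /hnorm hdotNl hdotNr opprK. Qed.
Lemma hnormB x y : hnorm (x - y) = hnorm (y - x).
Proof. by rewrite -hnormN opprB. Qed.
Lemma hnorm_sum (I : Type) (r : seq I) (P : pred I) (F : I -> H) :
 hnorm (\sum_(i <- r | P i) F i) <= \sum_(i <- r | P i) hnorm (F i).
Proof.
elim/big_ind2: _=> [|x u y v xu yv|//];first by rewrite hnorm0.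
exact:le_trans (hnormD _ _) (lerD xu yv).
Qed.

Definition orthonormal (s : seq H) : Prop :=
 uniq s /\ {in s &, forall x y, hdot x y = (x == y)%:R}.

Definition proj (s : seq H) x : H := \sum_(g <- s) hdot g x *: g.

Lemma orthonormal_sum s g (F : H -> C) : orthonormal s -> g \in s ->
 \sum_(h <- s) F h * hdot g h = F g.
Proof.
move=> [us os] gs;rewrite (bigD1_seq g) //= os // eqxx mulr1 big_seq_cond.
rewrite big1 ?addr0 // => h /andP[hs hg];rewrite os // eq_sym (negPf hg) mulr0 //.
Qed.

Lemma hdot_proj s g x : orthonormal s -> g \in s -> hdot g (proj s x) = hdot g x.
Proof.
move=> os gs;rewrite hdot_sumr.
under eq_bigr do rewrite hdotZr.
exact:(orthonormal_sum (fun h=> hdot h x)).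
Qed.

Lemma hdot_projr s x y :
 hdot y (proj s x) = \sum_(g <- s) hdot y g * hdot g x.
Proof. by rewrite hdot_sumr;apply:eq_bigr=> g _;rewrite hdotZr mulrC. Qed.

Lemma hsq_proj s x : orthonormal s ->
 hsq (proj s x) = \sum_(g <- s) cabs (hdot g x) ^+ 2.
Proof.
move=> os;apply:(@complexI R);rewrite -hdotxx hdot_suml rmorph_sum big_seq.
rewrite [RHS]big_seq;apply:eq_bigr=> g gs.
by rewrite hdotZl hdot_proj // conjMz_cabs.
Qed.

Lemma hdot_sub_proj s x : orthonormal s -> hdot (proj s x) (x - proj s x) = 0.
Proof.
move=> os;rewrite hdot_suml big_seq big1 // => g gs.
by rewrite hdotZl hdotBr hdot_proj // subrr mulr0.
Qed.

Lemma hsq_sub_proj s x : orthonormal s ->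
 hsq (x - proj s x) = hsq x - \sum_(g <- s) cabs (hdot g x) ^+ 2.
Proof.
move=> os;rewrite -hsq_proj //;have:= hsqD (proj s x) (x - proj s x).
by rewrite hdot_sub_proj // mulr0 addr0 addrC subrK=> ->;rewrite addrAC subrr add0r.
Qed.

Lemma bessel s x : orthonormal s ->
 \sum_(g <- s) cabs (hdot g x) ^+ 2 <= hsq x.
Proof. by move=> os;rewrite -subr_ge0 -hsq_sub_proj // hsq_ge0. Qed.

Lemma proj_cat s t x : proj (s ++ t) x = proj s x + proj t x.
Proof. by rewrite /proj big_cat. Qed.

Lemma hdot_fixed_proj s x y : y = proj s y ->
 hdot x y = \sum_(g <- s) hdot x g * hdot g y.
Proof. by move=> {1}->;exact:hdot_projr. Qed.

Lemma proj_proj (r s : seq H) x : {in s, forall g, g = proj r g} ->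
 proj s x = proj r (proj s x).
Proof.
move=> sr;rewrite {1}/proj {1}/proj;under [RHS]eq_bigr do rewrite hdot_sumr scaler_suml.
rewrite exchange_big big_seq [RHS]big_seq /=;apply:eq_bigr=> g gs.
transitivity (hdot g x *: proj r g);first by rewrite -(sr _ gs).
rewrite /proj scaler_sumr;apply:eq_bigr=> h _.
by rewrite hdotZr scalerA.
Qed.

(** The predicate S keeps the new vectors in a given linear space; [polar] takes it to be the range
    of an operator, so that every new vector has a preimage. Membership in a span is expressed by
    being fixed by [proj]. *)
Lemma gram_schmidt (S : H -> Prop) (s vs : seq H) :
 (forall a x y, S x -> S y -> S (a *: x + y)) ->
 {in s, forall x, S x} -> {in vs, forall x, S x} -> orthonormal s ->
 exists t, [/\ orthonormal (s ++ t), {in t, forall x, S x} &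
  forall v, v \in s ++ vs -> v = proj (s ++ t) v].
Proof.
move=> Slin.
elim:vs s=> [|v vs IH] s Ss Svs os.
 exists [::];split;rewrite ?cats0 // => g gs.
 rewrite /proj;have [us ds] := os.
 rewrite (bigD1_seq g) //= ds // eqxx scale1r big_seq_cond big1 ?addr0 //.
 by move=> h /andP[hs hg];rewrite ds // (negPf hg) scale0r.
pose w:= v - proj s v.
have Sv : S v by apply:Svs;rewrite mem_head.
have Sz : S 0 by rewrite -(subrr v) -[- v]scaleN1r addrC;apply:(Slin).
have Sw : S w.
 rewrite /w addrC -scaleN1r;apply:(Slin)=> //.
 rewrite /proj big_seq;apply:(big_ind S)=> //.
  by move=> x y Sx Sy;rewrite -[x]scale1r;apply:(Slin).
 by move=> g gs;rewrite -[_ *: g]addr0;apply:(Slin)=> //;apply:(Ss).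
have wg g : g \in s -> hdot g w = 0.
 by move=> gs;rewrite hdotBr hdot_proj // subrr.
have Svs' : {in vs, forall x, S x} by move=> x xv;apply:Svs;rewrite inE xv orbT.
have [w0|w0] := eqVneq w 0.
 have [t [ot St pt]] := IH s Ss Svs' os;exists t;split=> // u.
 rewrite mem_cat inE orbCA=> /orP[/eqP ->|us];last by apply:pt;rewrite mem_cat.
 have -> : v = proj s v by apply/eqP;rewrite -subr_eq0;apply/eqP.
 by apply:proj_proj=> g gs;apply:pt;rewrite mem_cat gs.
pose u:= (hnorm w)^-1%:C *: w.
have nw : hnorm w != 0.
 by apply:contra w0=> /eqP h;apply/eqP/hsq_eq0;rewrite -hnorm_sqr h expr0n.
have uu : hdot u u = 1.
 rewrite hdotxx hsqZ cabs_real -hnorm_sqr -exprMn ger0_norm ?invr_ge0 ?hnorm_ge0 //.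
 by rewrite mulVf // expr1n.
have ug g : g \in s -> hdot g u = 0 by move=> gs;rewrite hdotZr wg // mulr0.
have uns : u \notin s.
 by apply/negP=> us;move:(ug _ us);rewrite uu=> /eqP;rewrite oner_eq0.
have os' : orthonormal (rcons s u).
 case:os=> us ds;split;first by rewrite rcons_uniq uns.
 move=> x y;rewrite !mem_rcons !inE=> /orP[/eqP ->|xs] /orP[/eqP ->|ys].
 - by rewrite uu eqxx.
 - rewrite hdotC ug // rmorph0;case:eqP=> // e;by rewrite -e (negPf uns) in ys.
 - rewrite ug //;case:eqP=> // e;by rewrite e (negPf uns) in xs.
 - exact:ds.
have Su : S u by rewrite -[u]addr0;apply:(Slin).
have [|t [ot St pt]] := IH (rcons s u) _ Svs' os'.
 by move=> x;rewrite mem_rcons inE=> /orP[/eqP ->//|/Ss].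
exists (u :: t);have -> : s ++ u :: t = rcons s u ++ t by rewrite cat_rcons.
split=> //.
 by move=> x;rewrite inE=> /orP[/eqP ->//|/St].
move=> x;rewrite mem_cat inE orbCA=> /orP[/eqP -> {x}|xs];last first.
 by apply:pt;rewrite mem_cat mem_rcons inE -orbA xs orbT.
have dec : v = proj (rcons s u) v.
 rewrite -cats1 proj_cat /proj big_seq1 -/(proj s v).
 have -> : hdot u v = (hnorm w)%:C.
  rewrite -[v in hdot u v](subrK (proj s v)) -/w hdotDr hdotZl hdotxx.
  have -> : hdot u (proj s v) = 0.
   rewrite hdot_sumr big_seq big1 // => g gs.
   by rewrite hdotZr [hdot u g]hdotC ug // rmorph0 mulr0.
  rewrite addr0 conjc_realE -rmorphM -hnorm_sqr expr2 mulrA mulVf // mul1r //.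
 by rewrite scalerA -rmorphM mulfV // scale1r addrC subrK.
rewrite dec;apply:proj_proj=> g gs;apply:pt;by rewrite mem_cat gs.
Qed.
End OneSpace.
End Hilbert.

(** * Hilbert bases and traces *)

Section Trace.
Variables (R : realType) (H : hilbert R).
Local Notation C := R[i].
Implicit Types x y z v : H.

(** [has_trace] quantifies over all Hilbert bases, so comparing a finite partial sum with a trace
    requires a basis through the given vectors. For the empty list this is the existence of a basis,
    by Zorn's lemma. *)
Lemma orthonormal_extend (s : seq H) : orthonormal s ->
 exists (I : choiceType) (b : I -> H) (l : seq I),
  [/\ is_hilbert_basis b, uniq l & map b l = s].
Proof.
move=> [us os].
pose ons (A : set H) := forall x y, A x -> A y -> hdot x y = (x == y)%:R.
(* Orthonormality is imposed on the union with s, so that s belongs to the basis and the empty chain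
   is covered by the hypothesis on s. *)
pose P (A : set H) := ons (A `|` [set` s]).
have [|A [PA maxA]] := @Zorn_bigcup H P.
 move=> F FP tF x y [[X FX Xx]|xs] [[Y FY Yy]|ys].
 - have [XY|YX] := tF _ _ FX FY.
   by apply:(FP _ FY);left=> //;apply:XY.
  by apply:(FP _ FX);left=> //;apply:YX.
 - by apply:(FP _ FX);[left|right].
 - by apply:(FP _ FY);[right|left].
 - exact:os.
pose B:= A `|` [set` s].
pose I:= {x : H | `[< B x >]}.
have sB x : x \in s -> B x by move=> xs;right.
exists I, val.
have /all_sigP[l ls] : all (fun x=> `[< B x >]) s.
 by apply/allP=> x xs;apply/asboolP/sB.
exists l;split;last by rewrite ls.
- split=> [i j|x xB].
  by rewrite -val_eqE;apply:PA;apply/asboolP;[case:i|case:j].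
 apply/eqP;apply:contraT=> x0.
 have nx : hnorm x != 0.
  by apply:contra x0=> /eqP h;apply/eqP/hsq_eq0;rewrite -hnorm_sqr h expr0n.
 pose u:= (hnorm x)^-1%:C *: x.
 have uu : hdot u u = 1.
  rewrite hdotxx hsqZ cabs_real -hnorm_sqr -exprMn ger0_norm ?invr_ge0 ?hnorm_ge0 //.
  by rewrite mulVf // expr1n.
 have uB g : B g -> hdot g u = 0.
  move=> Bg;have Bg' : `[< B g >] by apply/asboolP.
  by rewrite hdotZr (xB (exist _ g Bg')) mulr0.
 have nB : ~ B u by move=> /uB;rewrite uu=> /eqP;rewrite oner_eq0.
 case:(maxA (A `|` [set u])).
  split=> [y Ay|sub];first by left.
  by apply:nB;left;apply:sub;right.
 have ub y : B y -> hdot y u = (y == u)%:R /\ hdot u y = (u == y)%:R.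
  move=> By;have yu : (y == u) = false by apply/eqP=> e;apply:nB;rewrite -e.
  rewrite [u == y]eq_sym yu;split;first exact:uB.
  by rewrite hdotC (uB _ By) rmorph0.
 move=> y z [[Ay| ->]|ys] [[Az| ->]|zs].
 - by apply:PA;left.
 - by apply:(ub y _).1;left.
 - by apply:PA;[left|right].
 - by apply:(ub z _).2;left.
 - by rewrite uu eqxx.
 - by apply:(ub z _).2;right.
 - by apply:PA;[right|left].
 - by apply:(ub y _).1;right.
 - exact:os.
- by apply:(@map_uniq _ _ val);rewrite -ls.
Qed.

Lemma basis_orthonormal (I : choiceType) (b : I -> H) (F : seq I) :
 is_hilbert_basis b -> uniq F -> orthonormal (map b F).
Proof.
move=> [ob _] uF.
have ib i j : (b i == b j) = (i == j).
 apply/eqP/eqP=> [e|->//];apply/eqP;rewrite -(negbK (i == j));apply/negP=> ij.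
 by have:= ob i j;rewrite -e ob eqxx (negPf ij)=> /eqP;rewrite oner_eq0.
split;first by rewrite map_inj_uniq // => i j /eqP;rewrite ib=> /eqP.
by move=> _ _ /mapP[i _ ->] /mapP[j _ ->];rewrite ob ib.
Qed.

Lemma fset_sum_le (I : choiceType) (f : I -> R) (F G : {fset I}) :
 (forall i, 0 <= f i) -> (F `<=` G)%fset -> \sum_(i <- F) f i <= \sum_(i <- G) f i.
Proof.
move=> f0 FG;rewrite [leRHS](bigID (fun i=> i \in F)) /=.
have -> : \sum_(i <- G | i \in F) f i = \sum_(i <- F) f i.
 rewrite -big_filter;apply:perm_big;apply:uniq_perm.
 - by rewrite filter_uniq // fset_uniq.
 - exact:fset_uniq.
 - move=> i;rewrite mem_filter;apply/andP/idP=> [[]//|iF];split=> //.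
  by apply:(fsubsetP FG).
by rewrite lerDl sumr_ge0.
Qed.

(** The Bessel sums q F increase with F. Along finite sets that nearly attain their supremum the
    projections form a Cauchy sequence, and what its limit misses of x is orthogonal to the basis.
    Sequences are used because completeness is stated for them. *)
Lemma parseval_proj (I : choiceType) (b : I -> H) x : is_hilbert_basis b ->
 forall eps : R, 0 < eps -> exists F0 : {fset I}, forall F : {fset I},
 (F0 `<=` F)%fset -> hnorm (x - proj (map b F) x) < eps.
Proof.
move=> hb.
have on (F : {fset I}) : orthonormal (map b F).
 by apply:basis_orthonormal=> //;exact:fset_uniq.
pose q (F : {fset I}) := \sum_(i <- F) cabs (hdot (b i) x) ^+ 2.
have qE (F : {fset I}) : hsq (x - proj (map b F) x) = hsq x - q F.
 by rewrite hsq_sub_proj // big_map.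
have qle (F : {fset I}) : q F <= hsq x by have:= hsq_ge0 (x - proj (map b F) x);rewrite qE subr_ge0.
have qmono F G : (F `<=` G)%fset -> q F <= q G.
 by apply:fset_sum_le=> i;rewrite exprn_ge0 // cabs_ge0.
have hsup : has_sup (range q).
 by split;[exists (q fset0), fset0|exists (hsq x)=> _ [F _ <-]].
pose s:= sup (range q).
have qs F : q F <= s by apply:ub_le_sup;[case:hsup|exists F].
have ex n : exists F, s - n.+1%:R^-1 < q F.
 have [|_ [F _ <-] h] := @sup_adherent _ (range q) (n.+1%:R^-1) _ hsup.
  by [].
 by exists F.
pose F n:= projT1 (cid (ex n)).
have FP n : s - n.+1%:R^-1 < q (F n) := projT2 (cid (ex n)).
(* Unions make the chosen sets increasing, which turns squared distances of projections into
   differences of q. *)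
pose G n : {fset I} := (\bigcup_(m <- iota 0 n.+1) F m)%fset.
have GS m n : (m <= n)%N -> (G m `<=` G n)%fset.
 move=> mn;apply/bigfcupsP=> j;rewrite mem_iota add0n /= => jm _.
 by apply:bigfcup_sup=> //;rewrite mem_iota add0n (leq_trans jm).
have GP n : s - n.+1%:R^-1 < q (G n).
 apply:lt_le_trans (FP n) _;apply:qmono.
 by apply:bigfcup_sup=> //;rewrite mem_iota add0n ltnS leqnn.
pose u n:= proj (map b (G n)) x.
have uE m n : (m <= n)%N -> hsq (u n - u m) = q (G n) - q (G m).
 move=> mn.
 have fixm : u m = proj (map b (G m)) (u n).
  apply:eq_big_seq=> g gm;rewrite hdot_proj //.
  case/mapP: gm=> i im ->;apply:map_f;exact:(fsubsetP (GS _ _ mn)).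
 have -> : q (G n) = hsq (u n) by rewrite hsq_proj // big_map.
 rewrite fixm hsq_sub_proj //;congr (_ - _).
 rewrite big_map;apply:eq_big_seq=> i im;rewrite hdot_proj //.
 by apply:map_f;exact:(fsubsetP (GS _ _ mn)).
have [eps e0|l Hl] := @hcomplete _ H u.
 have [N _ HN] := near_infty_natSinv_lt (PosNum e0).
 exists N=> m n Nm Nn.
 wlog mn : m n Nm Nn / (m <= n)%N.
  move=> W;have [mn|/ltnW nm] := leqP m n;first exact:W.
  by rewrite -/(hsq _) hsqB;exact:W.
 rewrite -/(hsq _) hsqB uE //;apply:le_lt_trans (HN m Nm).
 rewrite lerBlDr;apply:le_trans (qs _) _.
 by rewrite addrC -lerBlDr ltW.
have xl : x = l.
 apply/eqP;rewrite -subr_eq0;apply/eqP;apply:(hb.2)=> i.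
 apply/eqP;rewrite -cabs_eq0 -(@eqrXn2 _ 2) ?cabs_ge0 // expr0n.
 rewrite eq_le exprn_ge0 ?cabs_ge0 // andbT;apply/ler_addgt0Pl=> e e0.
 rewrite addr0.
 have e4 : 0 < e / 4 by rewrite divr_gt0.
 have [N HN] := Hl _ e4.
 have [M _ HM] := near_infty_natSinv_lt (PosNum e4).
 pose n:= maxn N M.
 have:= HN n (leq_maxl _ _);have:= HM n (leq_maxr _ _);rewrite /= -/(hsq _)=> h1 h2.
 have -> : x - l = (x - u n) + (u n - l) by rewrite addrA subrK.
 rewrite hdotDr -(addr0 e);set A:= hdot _ _;set B:= hdot _ _.
 have hB : cabs B ^+ 2 <= e / 4.
  have:= hdot_CS (b i) (u n - l);rewrite {1}/hsq hb.1 eqxx mul1r=> h.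
  exact:le_trans h (ltW h2).
 have hA : cabs A ^+ 2 <= e / 4.
  rewrite /A;have [iG|iG] := boolP (i \in G n).
   by rewrite hdotBr hdot_proj ?map_f // subrr cabs0 expr0n ltW.
  have -> : hdot (b i) (x - u n) = hdot (b i) x.
   rewrite hdotBr [hdot _ (u n)]hdot_sumr big_map big_seq big1 ?subr0 // => j jG.
   rewrite hdotZr hb.1;case:eqP=> [e'|];last by rewrite mulr0.
   by rewrite e' jG in iG.
  (* Adding i to G n cannot raise q above s, which leaves at most 1 / (n + 1) for the squared
     coefficient at i. *)
  have : q (i |` G n)%fset <= s by [].
  rewrite {1}/q (perm_big (i :: G n)) ?big_cons /=;last first.
   apply:uniq_perm;rewrite //= ?iG ?fset_uniq // => j.
   by rewrite in_fset1U inE.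
  rewrite -/(q (G n))=> h;have:= GP n;have:= h1;set a:= n.+1%:R^-1=> *;lra.
 apply:(@le_trans _ _ (2 * (cabs A ^+ 2 + cabs B ^+ 2))).
  rewrite !cabs_sqr;exact:sqnD.
 rewrite addr0;lra.
move=> eps e0;have e2 : 0 < eps ^+ 2 by rewrite exprn_gt0.
have [N HN] := Hl _ e2;exists (G N)=> K GK.
rewrite -ltr_sqr ?nnegrE ?hnorm_ge0 ?(ltW e0) // hnorm_sqr qE.
apply:le_lt_trans (HN N (leqnn N));rewrite -/(hsq _) -xl hsqB qE lerD2l lerN2.
exact:qmono.
Qed.

Lemma has_traceP (X : H -> H) t : has_trace X t <->
 forall (I : choiceType) (b : I -> H), is_hilbert_basis b ->
 forall eps : R, 0 < eps -> exists F0 : {fset I}, forall F : {fset I},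
  (F0 `<=` F)%fset -> cabs (\sum_(i <- F) hdot (b i) (X (b i)) - t) < eps.
Proof.
by split=> h I b hb e e0;have [F0 HF] := h I b hb e e0;exists F0=> F /HF;
 rewrite cabsE ltcR.
Qed.

Lemma has_trace_linear (X Y : H -> H) a t s : has_trace X t -> has_trace Y s ->
 has_trace (fun x => a *: X x + Y x) (a * t + s).
Proof.
move=> /has_traceP hX /has_traceP hY;apply/has_traceP=> I b hb e e0.
have c0 : 0 < cabs a + 1 by rewrite ltr_wpDl ?cabs_ge0.
have [|F HF] := hX I b hb (e / 2 / (cabs a + 1));first by rewrite !divr_gt0.
have [|G HG] := hY I b hb (e / 2);first by rewrite divr_gt0.
exists (F `|` G)%fset=> K;rewrite fsubUset=> /andP[/HF h1 /HG h2].
under eq_bigr do rewrite hdot_linear.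
rewrite big_split -mulr_sumr /=.
set u:= \sum_(i <- K) _ in h1 *;set w:= \sum_(i <- K) _ in h2 *.
have -> : a * u + w - (a * t + s) = a * (u - t) + (w - s).
 by rewrite mulrBr opprD addrACA.
apply:le_lt_trans (cabsD _ _) _;rewrite cabsM [ltRHS]splitr.
apply:ltr_leD (ltW h2);apply:le_lt_trans (_ : (cabs a + 1) * cabs (u - t) < _).
 by rewrite ler_wpM2r ?cabs_ge0 // lerDl.
by rewrite mulrC -ltr_pdivlMr.
Qed.

(** Every partial sum equals <y, P_F x> with P_F the projection on the span of finitely many basis
    vectors, so [parseval_proj] applies. *)
Lemma has_trace_rank1 x y : has_trace (fun z => hdot y z *: x) (hdot y x).
Proof.
apply/has_traceP=> I b hb e e0.
have y1 : 0 < hnorm y + 1 by rewrite ltr_wpDl ?hnorm_ge0.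
have [|F0 HF] := @parseval_proj I b x hb (e / (hnorm y + 1));first by rewrite divr_gt0.
exists F0=> F /HF h.
have -> : \sum_(i <- F) hdot (b i) (hdot y (b i) *: x) = hdot y (proj (map b F) x).
 by rewrite hdot_projr big_map;apply:eq_bigr=> i _;rewrite hdotZr.
rewrite -hdotBr;apply:le_lt_trans (hdot_le _ _) _;rewrite hnormB.
apply:le_lt_trans (_ : (hnorm y + 1) * hnorm (x - proj (map b F) x) < _).
 by rewrite ler_wpM2r ?hnorm_ge0 // lerDl.
by rewrite mulrC -ltr_pdivlMr.
Qed.

Lemma has_trace0 : has_trace (fun _ : H => 0) 0.
Proof.
have:= has_trace_rank1 0 0;rewrite hdot0r;congr (has_trace _ _).
by apply/funext=> z;rewrite scaler0.
Qed.

Lemma has_traceD (X Y : H -> H) t s : has_trace X t -> has_trace Y s ->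
 has_trace (fun x => X x + Y x) (t + s).
Proof.
move=> hX hY;have:= has_trace_linear 1 hX hY;rewrite mul1r.
by congr (has_trace _ _);apply/funext=> z;rewrite scale1r.
Qed.

Lemma has_trace_sum (J : Type) (r : seq J) (P : pred J) (X : J -> H -> H) (t : J -> C) :
 (forall j, P j -> has_trace (X j) (t j)) ->
 has_trace (fun x => \sum_(j <- r | P j) X j x) (\sum_(j <- r | P j) t j).
Proof.
move=> h;elim:r=> [|j r IH].
 rewrite big_nil;have:= has_trace0;congr (has_trace _ _).
 by apply/funext=> z;rewrite big_nil.
rewrite big_cons;case:ifPn=> Pj.
 have:= has_traceD (h _ Pj) IH;congr (has_trace _ _).
 by apply/funext=> z;rewrite big_cons Pj.
move:IH;congr (has_trace _ _).
by apply/funext=> z;rewrite big_cons (negPf Pj).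
Qed.

(** In a basis through s, the partial sums that contain the given one increase to t. As the order of
    R[i] forces equal imaginary parts, the conclusion also says that t is real. *)
Lemma has_trace_ge (X : H -> H) t (s : seq H) : (forall x, 0 <= hdot x (X x)) ->
 has_trace X t -> orthonormal s -> \sum_(g <- s) hdot g (X g) <= t.
Proof.
move=> X0 /has_traceP hX /orthonormal_extend[I [b [l [hb ul <-]]]].
rewrite big_map;pose F0 : {fset I} := [fset i in l]%fset.
have -> : \sum_(i <- l) hdot (b i) (X (b i)) = \sum_(i <- F0) hdot (b i) (X (b i)).
 apply:perm_big;apply:uniq_perm;rewrite // => i.
 by rewrite in_fset.
pose f i:= Re (hdot (b i) (X (b i))).
have fE i : hdot (b i) (X (b i)) = (f i)%:C by apply:ge0_real.
have f0 i : 0 <= f i by have:= X0 (b i);rewrite fE lecR.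
have tE e : 0 < e -> exists2 F : {fset I}, (F0 `<=` F)%fset &
  cabs ((\sum_(i <- F) f i)%:C - t) < e.
 move=> e0;have [F HF] := hX I b hb e e0;exists (F0 `|` F)%fset;first exact:fsubsetUl.
 have:= HF (F0 `|` F)%fset (fsubsetUr _ _).
 by under eq_bigr do rewrite fE;rewrite -rmorph_sum.
under eq_bigr do rewrite fE;rewrite -rmorph_sum /=.
have It : Im t = 0.
 apply/eqP;rewrite -normr_eq0 eq_le normr_ge0 andbT.
 apply/ler_addgt0Pl=> e /tE[F _];rewrite addr0=> /ltW h;apply:le_trans h.
 apply:le_trans (Im_le_cabs _);by rewrite ImB sub0r normrN.
suff : \sum_(i <- F0) f i <= Re t.
 rewrite -lecR=> /le_trans;apply;case:(t) It=> a c /= ->;exact:lexx.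
apply/ler_addgt0Pl=> e /tE[F FF h].
apply:le_trans (fset_sum_le f0 FF) _;rewrite -lerBlDr.
apply:le_trans (ltW h);apply:le_trans (Re_le_cabs _);rewrite ReB /=.
exact:ler_norm.
Qed.
End Trace.

(** * Adjoints and positive matrices *)

Section Adjoint.
Variable C : numClosedFieldType.

Lemma trmxC_mul m n p (A : 'M[C]_(m, n)) (B : 'M[C]_(n, p)) :
 (A *m B)^t* = B^t* *m A^t*.
Proof. by rewrite trmx_mul map_mxM. Qed.
Lemma adjD m n (A B : 'M[C]_(m, n)) : (A + B)^t* = A^t* + B^t*.
Proof. by apply/matrixP=> i j;rewrite !mxE rmorphD. Qed.
Lemma adjB m n (A B : 'M[C]_(m, n)) : (A - B)^t* = A^t* - B^t*.
Proof. by apply/matrixP=> i j;rewrite !mxE rmorphB. Qed.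
Lemma adjZ m n a (A : 'M[C]_(m, n)) : (a *: A)^t* = a^* *: A^t*.
Proof. by apply/matrixP=> i j;rewrite !mxE rmorphM. Qed.
Lemma adj1 m : (1%:M : 'M[C]_m)^t* = 1%:M.
Proof. by rewrite trmx1 map_mx1. Qed.
End Adjoint.

Section MatrixPsd.
Variable R : realType.
Local Notation C := R[i].

Lemma mx_formE n (M : 'M[C]_n) (x : 'cV[C]_n) :
 (x^t* *m M *m x) 0 0 = \sum_i \sum_j (x i 0)^* * M i j * x j 0.
Proof.
rewrite !mxE;under eq_bigr do rewrite mxE mulr_suml.
rewrite exchange_big /=;apply:eq_bigr=> i _;apply:eq_bigr=> j _.
by rewrite !mxE.
Qed.

Lemma psd_diag n (M : 'M[C]_n) : M^t* = M -> psd M ->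
 exists (U : 'M[C]_n) (D : 'rV[C]_n), [/\ U \is unitarymx, forall i, 0 <= D 0 i &
  M = U^t* *m diag_mx D *m U].
Proof.
move=> hM pM;pose U:= spectralmx M;pose D:= spectral_diag M.
have nM : M \is normalmx by apply/normalmxP;rewrite hM.
have uU : U \is unitarymx:= spectral_unitarymx M.
have E : M = U^t* *m diag_mx D *m U.
 by rewrite -(invmx_unitary uU);apply/orthomx_spectralP.
exists U, D;split=> // i.
have:= pM (U^t* *m delta_mx i 0).
have UU : U *m U^t* = 1%:M by apply/unitarymxP.
rewrite E !trmxC_mul ?trmxCK.
have -> : (delta_mx i 0)^t* *m U *m (U^t* *m diag_mx D *m U) *m (U^t* *m delta_mx i 0)
  = (delta_mx i 0)^t* *m diag_mx D *m (delta_mx i 0) :> 'M[C]_1.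
 by rewrite !mulmxA -[_ *m U *m U^t*]mulmxA UU mulmx1 -[_ *m U *m U^t*]mulmxA UU mulmx1.
have -> : (delta_mx i 0 : 'cV[C]_n)^t* = delta_mx 0 i.
 by apply/matrixP=> a b;rewrite !mxE andbC rmorph_nat.
by rewrite -rowE -colE !mxE eqxx mulr1n.
Qed.

Lemma psd_diagE n (U : 'M[C]_n) (D : 'rV[C]_n) (x : 'cV[C]_n) :
 (x^t* *m (U^t* *m diag_mx D *m U) *m x) 0 0
 = \sum_i D 0 i * (((U *m x) i 0)^* * (U *m x) i 0).
Proof.
have -> : x^t* *m (U^t* *m diag_mx D *m U) *m x = (U *m x)^t* *m diag_mx D *m (U *m x).
 by rewrite trmxC_mul !mulmxA.
rewrite mx_formE;apply:eq_bigr=> i _;rewrite (bigD1 i) //= big1 ?addr0.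
 by rewrite !mxE eqxx mulr1n mulrCA mulrA mulrAC.
by move=> j ji;rewrite [diag_mx _ _ _]mxE eq_sym (negPf ji) mulr0n mulr0 mul0r.
Qed.

Lemma psd_sqrt n (M : 'M[C]_n) : M^t* = M -> psd M ->
 exists S : 'M[C]_n, [/\ S *m S = M, S^t* = S & psd S].
Proof.
move=> hM /(psd_diag hM)[U [D [uU D0 ->]]].
have UU : U *m U^t* = 1%:M by apply/unitarymxP.
pose E : 'rV[C]_n:= \row_i (Num.sqrt (Re (D 0 i)))%:C.
exists (U^t* *m diag_mx E *m U);split.
- rewrite !mulmxA -[_ *m U *m U^t*]mulmxA UU mulmx1;congr (_ *m U).
 rewrite -mulmxA;congr (_ *m _);rewrite mulmx_diag;congr diag_mx.
 apply/rowP=> i;rewrite !mxE -rmorphM -expr2 sqr_sqrtr.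
  by rewrite [RHS]ge0_real.
 by have:= D0 i;rewrite ge0E=> /andP[].
- rewrite !trmxC_mul trmxCK mulmxA;congr (_ *m _ *m _).
 apply/matrixP=> i j;rewrite !mxE rmorphMn /= conjc_realE [j == i]eq_sym.
 by case:eqP=> [->|].
- move=> x;rewrite psd_diagE;apply:sumr_ge0=> i _.
 by rewrite conjMz_cabs mxE -rmorphM lecR mulr_ge0 ?exprn_ge0 ?cabs_ge0.
Qed.

(** In an eigenbasis of A the trace is a sum of eigenvalues times diagonal entries of a positive
    matrix. *)
Lemma psd_trmul n (A B : 'M[C]_n) : A^t* = A -> psd A -> psd B -> 0 <= \tr (A *m B).
Proof.
move=> hA /(psd_diag hA)[U [D [uU D0 ->]]] pB.
have -> : \tr (U^t* *m diag_mx D *m U *m B) = \sum_i D 0 i * (U *m B *m U^t*) i i.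
 rewrite -mulmxA mxtrace_mulC -mulmxA mxtrace_mulC -mulmxA.
 rewrite mxtrace_mulC /mxtrace;apply:eq_bigr=> i _.
 by rewrite -mulmxA mul_diag_mx mxE mulmxA.
apply:sumr_ge0=> i _;apply:mulr_ge0=> //.
have -> : (U *m B *m U^t*) i i = ((U^t* *m delta_mx i (0 : 'I_1))^t* *m B *m (U^t* *m delta_mx i (0 : 'I_1))) 0 0.
 rewrite trmxC_mul trmxCK.
 have -> : (delta_mx i 0 : 'cV[C]_n)^t* = delta_mx 0 i.
  by apply/matrixP=> a b;rewrite !mxE andbC rmorph_nat.
 by rewrite mulmxA -colE -rowE -!row_mul !mxE.
exact:pB.
Qed.
End MatrixPsd.

(** * Finite rank operators and their trace norm *)

Section FiniteRank.
Variables (R : realType).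
Local Notation C := R[i].

Section Rank.
Variables (H1 H2 : hilbert R) (J : finType).
(** The operator sum_j |x_j><y_j|: the first family carries the bras, the second the kets. *)
Definition rankop (y : J -> H1) (x : J -> H2) (z : H1) : H2 := \sum_j hdot (y j) z *: x j.

Lemma rankop_linear y x a z w : rankop y x (a *: z + w) = a *: rankop y x z + rankop y x w.
Proof.
rewrite /rankop scaler_sumr -big_split;apply:eq_bigr=> j _ /=.
by rewrite hdot_linear scalerDl scalerA.
Qed.

Lemma hdot_rankop y x z w : hdot w (rankop y x z) = \sum_j hdot (y j) z * hdot w (x j).
Proof. by rewrite hdot_sumr;apply:eq_bigr=> j _;rewrite hdotZr. Qed.

Lemma rankop_bound y x z : hnorm (rankop y x z) <= (\sum_j hnorm (x j) * hnorm (y j)) * hnorm z.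
Proof.
apply:le_trans (hnorm_sum _ _ _) _;rewrite mulr_suml;apply:ler_sum=> j _.
by rewrite hnormZ mulrC -mulrA ler_wpM2l ?hnorm_ge0 ?hdot_le.
Qed.
End Rank.

Section OneSpace.
Variable H : hilbert R.
Implicit Types (x y z : H) (X P : H -> H).

Definition oplinear X := forall a x y, X (a *: x + y) = a *: X x + X y.

Lemma oplin0 X : oplinear X -> X 0 = 0.
Proof. by move=> l;have:= l (-1) 0 0;rewrite scaler0 addr0 scaleN1r addNr. Qed.
Lemma oplinD X x y : oplinear X -> X (x + y) = X x + X y.
Proof. by move=> l;rewrite -[x in LHS]scale1r l scale1r. Qed.
Lemma oplinZ X a x : oplinear X -> X (a *: x) = a *: X x.
Proof. by move=> l;rewrite -[a *: x]addr0 l (oplin0 l) addr0. Qed.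
Lemma oplinB X x y : oplinear X -> X (x - y) = X x - X y.
Proof. by move=> l;rewrite addrC -scaleN1r l scaleN1r addrC. Qed.
Lemma oplin_sum X (I : Type) (r : seq I) (Q : pred I) (F : I -> H) : oplinear X ->
 X (\sum_(i <- r | Q i) F i) = \sum_(i <- r | Q i) X (F i).
Proof.
by move=> l;apply:(big_morph X (fun x y=> oplinD x y l) (oplin0 l)).
Qed.

(** Polarization: the form is real, and it is expanded at x + a y for a = 1 and a = 'i. *)
Lemma positive_selfadjoint X : oplinear X -> (forall x, 0 <= hdot x (X x)) ->
 forall x y, hdot (X x) y = hdot x (X y).
Proof.
move=> l X0.
have B0 x : hdot (X x) x = hdot x (X x).
 by rewrite hdotC (ge0_real (X0 x)) conjc_realE.
pose B x y:= hdot (X x) y - hdot x (X y).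
have E (a : C) x y : a * B x y + a^* * B y x = 0.
 have:= B0 (x + a *: y);rewrite oplinD // oplinZ // !hdotDl !hdotDr !hdotZl !hdotZr.
 rewrite !B0 /B=> /eqP;rewrite -subr_eq0=> /eqP h.
 rewrite -[RHS]h;ring.
move=> x y;apply/eqP;rewrite -subr_eq0 -/(B x y).
have:= E 1 x y;have:= E 'i%C x y.
rewrite !mul1r rmorph1 mul1r conjCi=> h1 h2.
have {}h2 : B y x = - B x y by apply/eqP;rewrite -addr_eq0 addrC h2.
move:h1;rewrite h2 mulrNN -mulr2n -mulrnAl=> /eqP;rewrite mulf_eq0=> /orP[|//].
by rewrite mulrn_eq0=> /eqP/(congr1 (@Im R)) /eqP;rewrite oner_eq0.
Qed.

(** That P x |-> X x preserves inner products is all that is used of the polar decomposition. *)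
Lemma abs_isometric X P : oplinear X -> is_abs X P ->
 oplinear P /\ forall x y, hdot (P x) (P y) = hdot (X x) (X y).
Proof.
move=> lX [[[lP _] P0] [Y [aY PY]]];split=> // x y.
by rewrite (positive_selfadjoint lP P0) PY -aY.
Qed.

Definition onfam (A : eqType) (cs : seq A) (f : A -> H) :=
 uniq cs /\ {in cs &, forall c c', hdot (f c) (f c') = (c == c')%:R}.

Lemma onfam_orthonormal (A : eqType) (cs : seq A) (f : A -> H) :
 onfam cs f -> orthonormal (map f cs).
Proof.
move=> [us ds].
have inj : {in cs &, injective f}.
 move=> c c' ccs c'cs e;apply/eqP;rewrite -[_ == _]negbK;apply/negP=> /negPf cc'.
 by have:= ds c c' ccs c'cs;rewrite -e ds // eqxx cc'=> /eqP;rewrite oner_eq0.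
split;first by rewrite map_inj_in_uniq.
move=> _ _ /mapP[c ccs ->] /mapP[c' c'cs ->];rewrite ds //.
by congr (nat_of_bool _)%:R;apply/eqP/eqP=> [->|/inj ->].
Qed.

Lemma hdot_onsum (A : eqType) (cs : seq A) (f : A -> H) (a : A -> C) c : onfam cs f ->
 c \in cs -> hdot (f c) (\sum_(c <- cs) a c *: f c) = a c.
Proof.
move=> [us ds] ccs;rewrite hdot_sumr (bigD1_seq c) //= hdotZr ds // eqxx mulr1.
rewrite big_seq_cond big1 ?addr0 // => c' /andP[c'cs cc'].
by rewrite hdotZr ds // eq_sym (negPf cc') mulr0.
Qed.

Lemma hsq_onsum (A : eqType) (cs : seq A) (f : A -> H) (a : A -> C) : onfam cs f ->
 hsq (\sum_(c <- cs) a c *: f c) = \sum_(c <- cs) cabs (a c) ^+ 2.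
Proof.
move=> of_;apply:(@complexI R);rewrite -hdotxx hdot_suml rmorph_sum.
apply:eq_big_seq=> c ccs.
by rewrite hdotZl (hdot_onsum _ of_) // conjMz_cabs.
Qed.

(** A finite substitute for the polar decomposition: Gram-Schmidt is run in the range of P and
    preimages under P are chosen; as P x |-> X x is isometric, X maps the same preimages to an
    orthonormal family. *)
Lemma polar X P (bs : seq H) : oplinear X -> oplinear P ->
 (forall x y, hdot (P x) (P y) = hdot (X x) (X y)) ->
 exists cs : seq H, [/\ onfam cs P, onfam cs X,
  {in bs, forall b, P b = proj (map P cs) (P b)} &
  {in bs, forall b, X b = proj (map X cs) (X b)}].
Proof.
move=> lX lP PX.
have [|//||//|ts [ots Sts pts]] := @gram_schmidt R H (fun y=> exists c, y = P c) [::] (map P bs).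
- by move=> a x y [c ->] [c' ->];exists (a *: c + c');rewrite lP.
- by move=> x /mapP[b _ ->];exists b.
pose sect x:= xget 0 [set c | x = P c].
have sectP x : x \in ts -> P (sect x) = x.
 by move=> /Sts[c xc];rewrite /sect;case:xgetP=> [y -> <-//|/(_ c)].
pose cs:= map sect ts.
have cE : map P cs = ts by rewrite -map_comp -[RHS]map_id;apply/eq_in_map=> x /sectP.
have fP : onfam cs P.
 split;first by apply:(@map_uniq _ _ P);rewrite cE;case:ots.
 move=> _ _ /mapP[t tt ->] /mapP[u uu ->];rewrite !sectP //.
 rewrite (ots.2 t u tt uu);congr (nat_of_bool _)%:R.
 by apply/eqP/eqP=> [->//|e];rewrite -(sectP t) // e sectP.
have PXeq x y : (P x == P y) = (X x == X y).
 rewrite -subr_eq0 -oplinB // -[RHS]subr_eq0 -oplinB //.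
 by apply/eqP/eqP=> e;apply:hdot_eq0;[rewrite -PX e|rewrite PX e];rewrite hdot0r.
have fX : onfam cs X.
 by case:fP=> us ds;split=> // c c' ccs c'cs;rewrite -PX ds.
exists cs;split=> // b bb.
 by rewrite cE;apply:pts;rewrite cat0s map_f.
(* P and X have the same kernel, so the expansion of P b carries over to X b with the same
   coefficients. *)
have e : P (b - \sum_(c <- cs) hdot (P c) (P b) *: c) = 0.
 rewrite oplinB // oplin_sum //;under eq_bigr do rewrite oplinZ //.
 apply/eqP;rewrite subr_eq0;apply/eqP.
 by rewrite {1}(pts (P b)) ?map_f // -cE /proj big_map.
have : X (b - \sum_(c <- cs) hdot (P c) (P b) *: c) = 0.
 by apply/eqP;have:= PXeq (b - \sum_(c <- cs) hdot (P c) (P b) *: c) 0;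
  rewrite e oplin0 // eqxx oplin0 // => <-.
rewrite oplinB // oplin_sum //;under eq_bigr do rewrite oplinZ //.
move/eqP;rewrite subr_eq0=> /eqP Xb;rewrite /proj big_map {1}Xb.
by apply:eq_bigr=> c _;rewrite PX.
Qed.

Lemma hnorm_proj (s : seq H) x : orthonormal s -> hnorm (proj s x) <= hnorm x.
Proof.
move=> os;rewrite -ler_sqr ?nnegrE ?hnorm_ge0 // !hnorm_sqr hsq_proj //.
exact:bessel.
Qed.

Lemma abs_sum_le (J : finType) (y x : J -> H) P (s : seq H) :
 is_abs (rankop y x) P -> orthonormal s ->
 Re (\sum_(b <- s) hdot b (P b)) <= \sum_j hnorm (x j) * hnorm (y j).
Proof.
move=> aP os;have lX : oplinear (rankop y x) by move=> *;exact:rankop_linear.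
have [lP PX] := abs_isometric lX aP.
have [cs [oP oX decP decX]] := polar s lX lP PX.
(* u j is the image of x j under the partial isometry X c |-> P c, hence not longer than x j. *)
pose u j:= \sum_(c <- cs) hdot (rankop y x c) (x j) *: P c.
have -> : \sum_(b <- s) hdot b (P b) = \sum_j hdot (y j) (proj s (u j)).
 under [RHS]eq_bigr do rewrite hdot_projr.
 rewrite exchange_big;apply:eq_big_seq=> b bs /=.
 rewrite decP // hdot_projr big_map.
 under eq_bigr do rewrite PX hdot_rankop mulr_sumr.
 rewrite exchange_big /=;apply:eq_bigr=> j _;rewrite hdot_sumr mulr_sumr.
 by apply:eq_bigr=> c _;rewrite !hdotZr;ring.
rewrite Re_sum;apply:ler_sum=> j _.
apply:le_trans (ler_norm _) (le_trans (Re_le_cabs _) (le_trans (hdot_le _ _) _)).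
rewrite mulrC ler_wpM2r ?hnorm_ge0 //;apply:le_trans (hnorm_proj _ os) _.
rewrite -ler_sqr ?nnegrE ?hnorm_ge0 // !hnorm_sqr (hsq_onsum _ oP).
by have:= bessel (x j) (onfam_orthonormal oX);rewrite big_map.
Qed.

Lemma has_trace_le X t M : has_trace X t ->
 (forall s, orthonormal s -> Re (\sum_(b <- s) hdot b (X b)) <= M) -> Re t <= M.
Proof.
move=> /has_traceP hX hM.
have [|I [b [_ [hb _ _]]]] := @orthonormal_extend _ H [::];first by [].
apply/ler_addgt0Pl=> e e0;have [F HF] := hX I b hb e e0.
have:= HF F (fsubset_refl _);rewrite cabsB=> h.
have:= hM _ (basis_orthonormal hb (fset_uniq F));rewrite big_map=> h2.
have:= le_trans (ler_norm _) (Re_le_cabs (t - \sum_(i <- F) hdot (b i) (X (b i)))).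
rewrite ReB;lra.
Qed.

(** An orthonormal basis of the span of all x j and y j reduces the operator to a matrix. *)
Lemma lift_of_rankop (J : finType) (y x : J -> H) :
 exists m (f : 'I_m -> H), (forall i j, hdot (f i) (f j) = (i == j)%:R) /\
  forall z, rankop y x z = \sum_a \sum_b (hdot (f a) (rankop y x (f b)) * hdot (f b) z) *: f a.
Proof.
pose vs:= [seq x j | j : J] ++ [seq y j | j : J].
have [||//|//|s [os _ ps]] := @gram_schmidt R H (fun=> True) [::] vs;[by []|by []|].
exists (size s), (fun i=> s`_i).
case:(os)=> us ds;split.
 move=> i j;rewrite ds ?mem_nth // nth_uniq //;by case:eqP=> [/val_inj ->|];rewrite //;case:eqP=> [->|].
move=> z;have xs j : x j = proj s (x j).
 by apply:ps;rewrite cat0s mem_cat;apply/orP;left;apply:map_f;rewrite mem_enum.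
have ys j : y j = proj s (y j).
 by apply:ps;rewrite cat0s mem_cat;apply/orP;right;apply:map_f;rewrite mem_enum.
have sumE (g : H -> H) : \sum_(b < size s) g s`_b = \sum_(b <- s) g b.
 by rewrite (big_nth 0) big_mkord.
have sumEC (g : H -> C) : \sum_(b < size s) g s`_b = \sum_(b <- s) g b.
 by rewrite (big_nth 0) big_mkord.
transitivity (\sum_(a <- s) \sum_(b <- s) (hdot a (rankop y x b) * hdot b z) *: a);last first.
 by rewrite -sumE;apply:eq_bigr=> a _;rewrite -sumE.
transitivity (\sum_(a <- s) hdot a (rankop y x z) *: a).
 rewrite /rankop;under [RHS]eq_bigr do rewrite hdot_sumr scaler_suml.
 rewrite exchange_big;apply:eq_bigr=> j _ /=.
 rewrite {1}(xs j) /proj scaler_sumr;apply:eq_bigr=> a _;by rewrite hdotZr scalerA.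
apply:eq_bigr=> a _;rewrite -scaler_suml;congr (_ *: _).
transitivity (hdot a (rankop y x (proj s z))).
 congr hdot;rewrite /rankop;apply:eq_bigr=> j _;congr (_ *: _).
 rewrite {1}(ys j) hdotC hdot_projr rmorph_sum hdot_projr;apply:eq_bigr=> b _.
 by rewrite rmorphM /= -!hdotC mulrC.
have lX : oplinear (rankop y x) by move=> *;exact:rankop_linear.
rewrite /proj oplin_sum // hdot_sumr;apply:eq_bigr=> b _.
by rewrite oplinZ // hdotZr mulrC.
Qed.

(** [trace_norm] is +oo unless an absolute value with a trace exists; the square root of a matrix
    provides one. *)
Lemma rankop_abs (J : finType) (y x : J -> H) :
 exists P (t : R), is_abs (rankop y x) P /\ has_trace P t%:C.
Proof.
have [m [f [of_ fE]]] := lift_of_rankop y x.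
pose c : 'M[C]_m:= \matrix_(a, b) hdot (f a) (rankop y x (f b)).
pose lift (c : 'M[C]_m) (z : H) := \sum_a \sum_b (c a b * hdot (f b) z) *: f a.
pose xi (z : H) : 'cV[C]_m:= \col_b hdot (f b) z.
have liftE c' z : lift c' z = \sum_a ((c' *m xi z) a 0) *: f a.
 apply:eq_bigr=> a _;rewrite -scaler_suml mxE;congr (_ *: _).
 by apply:eq_bigr=> b _;rewrite mxE.
have xi_lift c' z : xi (lift c' z) = c' *m xi z.
 apply/colP=> a;rewrite mxE liftE hdot_sumr (bigD1 a) //= big1 ?addr0.
  by rewrite hdotZr of_ eqxx mulr1.
 by move=> b ba;rewrite hdotZr of_ eq_sym (negPf ba) mulr0.
have hlift c' z w : hdot w (lift c' z) = ((xi w)^t* *m c' *m xi z) 0 0.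
 rewrite liftE hdot_sumr -mulmxA [RHS]mxE;apply:eq_bigr=> a _.
 by rewrite hdotZr mulrC !mxE;congr (_ * _);rewrite -hdotC.
have lift_rank c' : lift c' = rankop (fun p : 'I_m * 'I_m=> f p.2) (fun p=> c' p.1 p.2 *: f p.1).
 apply/funext=> z;rewrite /lift pair_big /rankop;apply:eq_bigr=> -[a b] _ /=.
 by rewrite scalerA mulrC.
have XE : rankop y x = lift c.
 by apply/funext=> z;rewrite fE;apply:eq_bigr=> a _;apply:eq_bigr=> b _;rewrite mxE.
have lift_bounded c' : bounded_op (lift c').
 rewrite lift_rank;split;first by move=> *;exact:rankop_linear.
 by eexists=> z;exact:rankop_bound.
have [||S [SS hS pS]] := @psd_sqrt R m (c^t* *m c).
- by rewrite trmxC_mul trmxCK.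
- move=> v;rewrite mulmxA -mulmxA -trmxC_mul !mxE;apply:sumr_ge0=> i _.
 by rewrite !mxE conjMz_cabs lecR exprn_ge0 ?cabs_ge0.
exists (lift S), (Re (\sum_(p : 'I_m * 'I_m) hdot (f p.2) (S p.1 p.2 *: f p.1)));split.
 split.
  by split=> // z;rewrite hlift;exact:pS.
 exists (lift (c^t*));split.
  move=> u v;rewrite XE hdotC !hlift;set M:= _ *m xi u.
  have -> : (M 0 0)^* = (M^t*) 0 0 by rewrite !mxE.
  by rewrite /M !trmxC_mul trmxCK mulmxA.
 by move=> u;rewrite XE [lift S (lift _ _)]liftE xi_lift (liftE (c^t*)) xi_lift !mulmxA SS.
have tS : has_trace (lift S) (\sum_(p : 'I_m * 'I_m) hdot (f p.2) (S p.1 p.2 *: f p.1)).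
 rewrite lift_rank;apply:has_trace_sum=> p _;exact:has_trace_rank1.
rewrite -ge0_real //.
have:= has_trace_ge (s:= [::]) _ tS;rewrite big_nil;apply.
 by move=> z;rewrite hlift;exact:pS.
by [].
Qed.

(** The bound is checked for whichever value [xget] selects, and [rankop_abs] excludes the default
    +oo. It is the only upper bound on trace norms that is used. *)
Lemma trace_norm_rankop (J : finType) (y x : J -> H) :
 (trace_norm (rankop y x) <= (\sum_j hnorm (x j) * hnorm (y j))%:E)%E.
Proof.
rewrite /trace_norm;case:xgetP=> [t _ [r [P [aP tP]] <-]|/= no].
 rewrite lee_fin;apply:(has_trace_le tP)=> s os;exact:abs_sum_le.
have [P [t [aP tP]]] := rankop_abs y x.
by case:(no t%:E);exists t=> //;exists P.
Qed.

Lemma rankop_trace_class (J : finType) (y x : J -> H) : trace_class (rankop y x).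
Proof.
split;last exact:le_lt_trans (trace_norm_rankop _ _) (ltry _).
by split;[move=> *;exact:rankop_linear|eexists=> z;exact:rankop_bound].
Qed.

Lemma trace_class_abs X : trace_class X ->
 exists P (t : R), is_abs X P /\ has_trace P t%:C.
Proof.
move=> [_];rewrite /trace_norm;case:xgetP=> [y _ [t [P h] _] _|_].
 by exists P, t.
by [].
Qed.
End OneSpace.
End FiniteRank.

(** * Sums over the net of finite subsets *)

Section NetSum.
Variables (R : realType) (I : choiceType).
Local Notation C := R[i].

(** [has_trace] speaks of all bases at once; here one family is fixed, so that a limit can be shown
    to exist for it alone. *)
Definition net_sum (f : I -> C) (t : C) : Prop := forall eps : R, 0 < eps ->
 exists F0 : {fset I}, forall F : {fset I}, (F0 `<=` F)%fset ->
  cabs (\sum_(i <- F) f i - t) < eps.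

Lemma net_sum_linear f g a t s : net_sum f t -> net_sum g s ->
 net_sum (fun i => a * f i + g i) (a * t + s).
Proof.
move=> hX hY e e0.
have c0 : 0 < cabs a + 1 by rewrite ltr_wpDl ?cabs_ge0.
have [|F HF] := hX (e / 2 / (cabs a + 1));first by rewrite !divr_gt0.
have [|G HG] := hY (e / 2);first by rewrite divr_gt0.
exists (F `|` G)%fset=> K;rewrite fsubUset=> /andP[/HF h1 /HG h2].
rewrite big_split -mulr_sumr /=.
set u:= \sum_(i <- K) _ in h1 *;set w:= \sum_(i <- K) _ in h2 *.
have -> : a * u + w - (a * t + s) = a * (u - t) + (w - s) by ring.
apply:le_lt_trans (cabsD _ _) _;rewrite cabsM [ltRHS]splitr.
apply:ltr_leD (ltW h2);apply:le_lt_trans (_ : (cabs a + 1) * cabs (u - t) < _).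
 by rewrite ler_wpM2r ?cabs_ge0 // lerDl.
by rewrite mulrC -ltr_pdivlMr.
Qed.

Lemma net_sum_unique f t s : net_sum f t -> net_sum f s -> t = s.
Proof.
move=> hX hY.
apply/eqP;rewrite -subr_eq0 -cabs_eq0 eq_le cabs_ge0 andbT.
apply/ler_addgt0Pl=> e e0;rewrite addr0.
have e2 : 0 < e / 2 by rewrite divr_gt0.
have [F HF] := hX _ e2;have [G HG] := hY _ e2.
have:= HF (F `|` G)%fset (fsubsetUl _ _);have:= HG (F `|` G)%fset (fsubsetUr _ _).
set u:= \sum_(i <- _) _=> h1 h2.
have -> : t - s = (u - s) - (u - t) by ring.
apply:le_trans (cabsD _ _) _;rewrite cabsN;lra.
Qed.

Lemma net_sum_ge0 (f : I -> R) M : (forall i, 0 <= f i) ->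
 (forall F : {fset I}, \sum_(i <- F) f i <= M) -> exists t, net_sum (fun i => (f i)%:C) t.
Proof.
move=> f0 fM;pose A:= [set \sum_(i <- F) f i | F in [set: {fset I}]].
have hsup : has_sup A.
 by split;[exists 0, fset0=> //;rewrite big_seq_fset0|exists M=> _ [F _ <-]].
exists (sup A)%:C=> e e0.
have [_ [F _ <-] h] := sup_adherent e0 hsup.
exists F=> G FG;rewrite -rmorph_sum -rmorphB cabs_real distrC ger0_norm.
 by rewrite ltrBlDr addrC -ltrBlDr;apply:lt_le_trans h _;exact:fset_sum_le.
by rewrite subr_ge0;apply:ub_le_sup;[case:hsup|exists G].
Qed.

(** Applied to the indices where f is nonnegative, or nonpositive, the bound controls the positive
    and negative parts separately. *)
Lemma net_sum_cvg_real (f : I -> R) M :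
 (forall F : {fset I}, `|\sum_(i <- F) f i| <= M) -> exists t, net_sum (fun i => (f i)%:C) t.
Proof.
move=> fM.
pose p i:= Num.max (f i) 0;pose n i:= Num.max (- f i) 0.
have sub (F : {fset I}) (Q : pred I) : exists G : {fset I},
  \sum_(i <- F | Q i) f i = \sum_(i <- G) f i.
 exists [fset i in F | Q i]%fset;rewrite -big_filter;apply:perm_big.
 apply:uniq_perm;rewrite ?filter_uniq // => i.
 by rewrite mem_filter !inE andbC.
have [||tp Hp] := @net_sum_ge0 p M.
- by move=> i;rewrite le_max lexx orbT.
- move=> F;have [G E] := sub F (fun i=> 0 <= f i).
 apply:le_trans (fM G);rewrite -E;apply:le_trans (ler_norm _).
 rewrite [leLHS](bigID (fun i=> 0 <= f i)) /= addrC big1 ?add0r.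
  by apply:ler_sum=> i fi;rewrite /p max_l.
 by move=> i;rewrite -ltNge=> /ltW fi;rewrite /p max_r.
have [||tn Hn] := @net_sum_ge0 n M.
- by move=> i;rewrite le_max lexx orbT.
- move=> F;have [G E] := sub F (fun i=> f i <= 0).
 apply:le_trans (fM G);rewrite -E -normrN -sumrN;apply:le_trans (ler_norm _).
 rewrite [leLHS](bigID (fun i=> f i <= 0)) /= addrC big1 ?add0r.
  by apply:ler_sum=> i fi;rewrite /n max_l // oppr_ge0.
 by move=> i;rewrite -ltNge=> /ltW fi;rewrite /n max_r // oppr_le0.
exists (-1 * tn + tp);have:= net_sum_linear (-1) Hn Hp.
congr (net_sum _ _);apply/funext=> i;rewrite mulN1r -rmorphN -rmorphD /p /n /=.
congr (_%:C);have [fi|/ltW fi] := leP 0 (f i).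
 by rewrite max_r ?oppr_le0 // oppr0 add0r.
by rewrite max_l ?oppr_ge0 // opprK addr0.
Qed.

Lemma net_sum_cvg (f : I -> C) M :
 (forall F : {fset I}, cabs (\sum_(i <- F) f i) <= M) -> exists t, net_sum f t.
Proof.
move=> fM.
have [|tr Hr] := @net_sum_cvg_real (fun i=> Re (f i)) M.
 by move=> F;apply:le_trans (fM F);rewrite -Re_sum;exact:Re_le_cabs.
have [|ti Hi] := @net_sum_cvg_real (fun i=> Im (f i)) M.
 by move=> F;apply:le_trans (fM F);rewrite -Im_sum;exact:Im_le_cabs.
exists ('i%C * ti + tr);have:= net_sum_linear 'i%C Hi Hr;congr (net_sum _ _).
apply/funext=> i;apply:complexP;rewrite /=;ring.
Qed.
End NetSum.

(** * Completion of a contraction to a channel *)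

Section Channel.
Variable R : realType.
Local Notation C := R[i].

Lemma has_trace_net (H : hilbert R) (I : choiceType) (b : I -> H) X t :
 is_hilbert_basis b -> has_trace X t -> net_sum (fun i => hdot (b i) (X (b i))) t.
Proof. by move=> hb /has_traceP h e e0;exact:h. Qed.

Lemma positive_cross (H : hilbert R) (P : H -> H) x y : oplinear P ->
 (forall x, 0 <= hdot x (P x)) ->
 cabs (hdot x (P y)) <= (Re (hdot x (P x)) + Re (hdot y (P y))) / 2.
Proof.
move=> lP P0;set z:= hdot x (P y).
have [z0|z0] := eqVneq z 0.
 rewrite z0 cabs0 divr_ge0 // addr_ge0 //.
  by have:= P0 x;rewrite ge0E=> /andP[].
 by have:= P0 y;rewrite ge0E=> /andP[].
have cz : cabs z != 0 by rewrite cabs_eq0.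
(* u is the phase of <x, P y>; positivity of P at u x - y then bounds the modulus. *)
pose u:= z / (cabs z)%:C.
have uu : u^* * u = 1.
 rewrite conjMz_cabs /u cabsM cabsV cabs_real ger0_norm ?cabs_ge0 // mulfV //.
 by rewrite expr1n.
have uz : hdot (u *: x) (P y) = (cabs z)%:C.
 rewrite hdotZl -/z /u rmorphM fmorphV /= conjc_realE mulrAC conjMz_cabs.
 by rewrite -fmorphV -rmorphM expr2 mulfK.
have:= P0 (u *: x - y);rewrite oplinB // hdotBl !hdotBr uz.
rewrite -(positive_selfadjoint lP P0 y) (hdotC (P y)) uz conjc_realE.
rewrite oplinZ // hdotZl hdotZr mulrA uu mul1r ge0E=> /andP[_].
rewrite !ReB;lra.
Qed.

(** With X = W P for a partial isometry W, each term is <W^* b, P b>. By [positive_cross] the sum is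
    at most the mean of two sums of P, one over the vectors b and one over the vectors W^* b. *)
Lemma trace_class_sum_le (H : hilbert R) (X P : H -> H) t (s : seq H) :
 oplinear X -> is_abs X P -> has_trace P t%:C -> orthonormal s ->
 cabs (\sum_(b <- s) hdot b (X b)) <= t.
Proof.
move=> lX aP tP os;have [lP PX] := abs_isometric lX aP.
have P0 : forall x, 0 <= hdot x (P x) by case:aP=> -[].
have [cs [oP oX decP decX]] := polar s lX lP PX.
pose w b:= \sum_(c <- cs) hdot (X c) b *: P c.
have -> : \sum_(b <- s) hdot b (X b) = \sum_(b <- s) hdot (w b) (P b).
 apply:eq_big_seq=> b bs;rewrite {1}decX // hdot_projr big_map hdot_suml.
 by apply:eq_bigr=> c _;rewrite hdotZl -hdotC PX.
apply:le_trans (cabs_sum _ _ _) _.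
apply:le_trans (ler_sum _ (fun b _=> positive_cross (w b) b lP P0)) _.
rewrite -mulr_suml big_split /= ler_pdivrMr //.
have le1 : \sum_(b <- s) Re (hdot b (P b)) <= t.
 by have:= has_trace_ge P0 tP os;rewrite lecE -Re_sum=> /andP[].
suff : \sum_(b <- s) Re (hdot (w b) (P (w b))) <= t by lra.
(* Once s is enlarged to span all X c, the second sum becomes the trace of P compressed to the span
   of the P c. *)
have [//|//|//|//|s' [os' _ ps']] := @gram_schmidt R H (fun=> True) s (map X cs).
apply:(@le_trans _ _ (\sum_(b <- s ++ s') Re (hdot (w b) (P (w b))))).
 rewrite big_cat lerDl;apply:sumr_ge0=> b _.
 by have:= P0 (w b);rewrite ge0E=> /andP[].
have:= has_trace_ge P0 tP (onfam_orthonormal oP);rewrite big_map lecE=> /andP[_].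
apply:le_trans;rewrite -Re_sum le_eqVlt;apply/orP;left;apply/eqP;congr (Re _).
have E1 b : hdot (w b) (P (w b)) = \sum_(c <- cs) \sum_(c' <- cs)
  (hdot (X c) b)^* * hdot (P c) (P (hdot (X c') b *: P c')).
 rewrite {1}/w hdot_suml;apply:eq_bigr=> c _.
 by rewrite hdotZl /w oplin_sum // hdot_sumr mulr_sumr.
rewrite (eq_bigr _ (fun b _=> E1 b)).
rewrite exchange_big;apply:eq_big_seq=> c ccs /=.
rewrite exchange_big (bigD1_seq c) //=;last by case:oP.
have E c' : c' \in cs ->
  \sum_(b <- s ++ s') (hdot (X c) b)^* * hdot (P c) (P (hdot (X c') b *: P c'))
  = (c' == c)%:R * hdot (P c) (P (P c')).
 move=> c'cs;rewrite -(oX.2 c' c) //.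
 have -> : hdot (X c') (X c) = \sum_(b <- s ++ s') hdot (X c') b * hdot b (X c).
  by apply:hdot_fixed_proj;apply:ps';rewrite mem_cat map_f ?orbT.
 rewrite mulr_suml;apply:eq_bigr=> b _.
 by rewrite oplinZ // hdotZr -hdotC;ring.
rewrite E // eqxx mul1r big_seq_cond big1 ?addr0 // => c' /andP[c'cs cc'].
by rewrite E // (negPf cc') mul0r.
Qed.

Lemma trace_class_net (H : hilbert R) (I : choiceType) (b : I -> H) X :
 is_hilbert_basis b -> trace_class X ->
 exists t, net_sum (fun i => hdot (b i) (X (b i))) t.
Proof.
move=> hb tX;have [P [t [aP tP]]] := trace_class_abs tX.
apply:(@net_sum_cvg _ _ _ t)=> F.
have:= trace_class_sum_le tX.1.1 aP tP (basis_orthonormal hb (fset_uniq F)).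
by rewrite big_map.
Qed.

Lemma sum_triple (V : nmodType) (A B D : finType) (F : A * B * D -> V) :
 \sum_p F p = \sum_x \sum_y \sum_z F (x, y, z).
Proof.
rewrite (pair_bigA _ (fun x y=> \sum_z F (x, y, z))).
rewrite (pair_bigA _ (fun j z=> F (j.1, j.2, z))) /=.
by apply:eq_bigr=> -[[x y] z].
Qed.

Section Construction.
Variables (H1 H2 : hilbert R) (W Q : finType).
Variables (b : Q -> H1) (a : W -> Q -> H2) (e : H2) (I : choiceType) (h : I -> H1).
Hypothesis hh : is_hilbert_basis h.
Hypothesis ee : hdot e e = 1.
Hypothesis contr : forall x, \sum_w hsq (rankop b (a w) x) <= hsq x.

(** The trace in the fixed basis h, made total by choice; for trace class operators
    [trace_class_net] provides the limit. *)
Definition btrace (X : H1 -> H1) : C :=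
 xget 0 [set t | net_sum (fun i => hdot (h i) (X (h i))) t].

(** The trace of sum_w K_w X K_w^*, where K_w = rankop b (a w). *)
Definition kraus_trace (X : H1 -> H1) : C :=
 \sum_w \sum_q \sum_q' hdot (b q) (X (b q')) * hdot (a w q') (a w q).

(** The map X |-> sum_w K_w X K_w^* may lose trace; the loss is put on the unit vector e. *)
Definition kraus_channel (X : H1 -> H1) : H2 -> H2 := fun y =>
 \sum_w rankop b (a w) (X (rankop (a w) b y))
 + ((btrace X - kraus_trace X) * hdot e y) *: e.

Lemma btraceP X t : net_sum (fun i => hdot (h i) (X (h i))) t -> btrace X = t.
Proof.
move=> ht;rewrite /btrace;case:xgetP=> [s _ hs|/(_ t)//].
exact:net_sum_unique hs ht.
Qed.

Lemma kraus_channelE X y : oplinear X -> kraus_channel X y =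
 rankop (fun p : option (W * Q * Q) => if p is Some (w, q, q') then a w q' else e)
  (fun p => if p is Some (w, q, q') then hdot (b q) (X (b q')) *: a w q
       else (btrace X - kraus_trace X) *: e) y.
Proof.
move=> lX;rewrite /rankop /kraus_channel.
have -> (f : option (W * Q * Q) -> H2) : \sum_j f j = f None + \sum_j f (Some j).
 rewrite (bigD1 None) //=;congr (_ + _).
 rewrite (reindex_omap (@Some _) id) /=;last by case.
 by apply:eq_bigl=> j;rewrite eqxx.
rewrite addrC;congr (_ + _);first by rewrite scalerA mulrC.
rewrite sum_triple.
apply:eq_bigr=> w _;apply:eq_bigr=> q _.
rewrite oplin_sum // hdot_sumr scaler_suml;apply:eq_bigr=> q' _.
by rewrite oplinZ // hdotZr scalerA.
Qed.

(** This is Tr (Y N) <= Tr Y for N = sum_w K_w^* K_w <= 1. Replacing each b q by its projection on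
    finitely many h i makes it an inequality between matrices, and boundedness of Y lets the
    projections tend to the identity. *)
Lemma kraus_trace_le (Y : H1 -> H1) t : bounded_op Y -> (forall x, 0 <= hdot x (Y x)) ->
 net_sum (fun i => hdot (h i) (Y (h i))) t -> Re (kraus_trace Y) <= Re t.
Proof.
move=> [lY [M HM]] Y0 ht.
have {}HM x : hnorm (Y x) <= `|M| * hnorm x.
 by apply:le_trans (HM x) _;rewrite ler_wpM2r ?hnorm_ge0 // ler_norm.
pose bF (F : {fset I}) q:= proj (map h F) (b q).
have on (F : {fset I}) : orthonormal (map h F).
 by apply:basis_orthonormal=> //;exact:fset_uniq.
pose kF F:= \sum_w \sum_q \sum_q' hdot (bF F q) (Y (bF F q')) * hdot (a w q') (a w q).
have fin (F : {fset I}) : Re (kF F) <= Re (\sum_(i <- F) hdot (h i) (Y (h i))).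
 (* The empty set is treated apart because [nth] needs a default index. *)
 have [Fempty|F0] := eqVneq (size F) 0%N.
  have -> : kF F = 0.
   rewrite /kF big1 // => w _;rewrite big1 // => q _;rewrite big1 // => q' _.
   by rewrite /bF (size0nil Fempty) /proj big_nil hdot0l mul0r.
  by rewrite (size0nil Fempty) big_nil.
 have [i0 i0F] : exists i, i \in (F : seq I) by case:(F : seq I) F0=> // i l _;exists i;rewrite mem_head.
 pose n:= size F;pose f (i : 'I_n) := h (nth i0 F i).
 have sumE (V : zmodType) (g : H1 -> V) : \sum_(x <- map h F) g x = \sum_(i < n) g (f i).
  by rewrite big_map (big_nth i0) big_mkord.
 pose y : 'M[C]_n:= \matrix_(i, j) hdot (f i) (Y (f j)).
 pose K i w:= rankop b (a w) (f i).
 pose N : 'M[C]_n:= \matrix_(i, j) \sum_w hdot (K i w) (K j w).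
 have of_ i j : hdot (f i) (f j) = (i == j)%:R.
  have hinj : injective h.
   move=> u v uv;apply/eqP;have:= hh.1 u v;rewrite -uv hh.1 eqxx.
   by case:eqP=> // _ /eqP;rewrite oner_eq0.
  by rewrite /f (on F).2 ?map_f ?mem_nth // (inj_eq hinj) nth_uniq.
 have kFE : kF F = \tr (y *m N).
  rewrite /mxtrace;under [RHS]eq_bigr do rewrite mxE.
  rewrite /kF exchange_big /=.
  have E q q' : hdot (bF F q) (Y (bF F q')) =
    \sum_i \sum_j y i j * (hdot (b q) (f i) * hdot (f j) (b q')).
   rewrite /bF /proj !sumE hdot_suml;apply:eq_bigr=> i _.
   rewrite oplin_sum // hdot_sumr;apply:eq_bigr=> j _.
   by rewrite hdotZl -hdotC oplinZ // hdotZr mxE;ring.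
  have N_E i j : N j i = \sum_q \sum_w \sum_q'
    hdot (b q) (f i) * hdot (f j) (b q') * hdot (a w q') (a w q).
   rewrite mxE exchange_big;apply:eq_bigr=> w _.
   rewrite /K hdot_rankop;apply:eq_bigr=> q _.
   rewrite hdot_suml mulr_sumr;apply:eq_bigr=> q' _.
   by rewrite hdotZl -hdotC;ring.
  under [RHS]eq_bigr do under eq_bigr do rewrite N_E mulr_sumr.
  under [RHS]eq_bigr do rewrite exchange_big.
  rewrite [RHS]exchange_big /=;apply:eq_bigr=> q _.
  under [RHS]eq_bigr do under eq_bigr do rewrite mulr_sumr.
  under [RHS]eq_bigr do rewrite exchange_big.
  rewrite [RHS]exchange_big /=;apply:eq_bigr=> w _.
  under [RHS]eq_bigr do under eq_bigr do rewrite mulr_sumr.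
  under [RHS]eq_bigr do rewrite exchange_big.
  rewrite [RHS]exchange_big /=;apply:eq_bigr=> q' _.
  rewrite E mulr_suml;apply:eq_bigr=> i _.
  by rewrite mulr_suml;apply:eq_bigr=> j _;ring.
 have trE : \sum_(i <- F) hdot (h i) (Y (h i)) = \tr y.
  rewrite (big_nth i0) big_mkord;apply:eq_bigr=> i _;by rewrite mxE.
 have combE (Z : H1 -> H1) (x : 'cV[C]_n) : oplinear Z ->
   \sum_i \sum_j (x i 0)^* * hdot (f i) (Z (f j)) * x j 0
   = hdot (\sum_i x i 0 *: f i) (Z (\sum_i x i 0 *: f i)).
  move=> lZ;rewrite hdot_suml;apply:eq_bigr=> i _.
  rewrite oplin_sum // hdot_sumr;apply:eq_bigr=> j _.
  by rewrite oplinZ // hdotZl hdotZr;ring.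
 have py : psd y.
  move=> x;rewrite mx_formE;under eq_bigr do under eq_bigr do rewrite mxE.
  by rewrite combE.
 have pN : psd (1%:M - N).
  move=> x;rewrite mx_formE.
  pose v:= \sum_i x i 0 *: f i.
  have -> : \sum_i \sum_j (x i 0)^* * (1%:M - N) i j * x j 0
    = hdot v v - \sum_w hdot (rankop b (a w) v) (rankop b (a w) v).
   have -> : hdot v v = \sum_i \sum_j (x i 0)^* * 1%:M i j * x j 0.
    rewrite -(combE id) //;apply:eq_bigr=> i _;apply:eq_bigr=> j _.
    by rewrite of_ mxE.
   have -> : \sum_w hdot (rankop b (a w) v) (rankop b (a w) v)
     = \sum_i \sum_j (x i 0)^* * N i j * x j 0.
    under [RHS]eq_bigr do under eq_bigr do rewrite mxE mulr_sumr mulr_suml.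
    under [RHS]eq_bigr do rewrite exchange_big.
    rewrite [RHS]exchange_big;apply:eq_bigr=> w _ /=.
    have -> : rankop b (a w) v = \sum_i x i 0 *: K i w.
     have lr : forall c x y, rankop b (a w) (c *: x + y) = c *: rankop b (a w) x + rankop b (a w) y.
      by move=> *;exact:rankop_linear.
     rewrite /v;elim/big_rec2: _=> [|i y1 y2 _ <-];last by rewrite lr.
     by have:= lr (-1) 0 0;rewrite scaler0 addr0 scaleN1r addNr.
    rewrite hdot_suml;apply:eq_bigr=> i _;rewrite hdot_sumr.
    by apply:eq_bigr=> j _;rewrite hdotZl hdotZr;ring.
   rewrite -sumrB;apply:eq_bigr=> i _;rewrite -sumrB;apply:eq_bigr=> j _.
   by rewrite !mxE;ring.
  rewrite hdotxx;under eq_bigr do rewrite hdotxx.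
  by rewrite -rmorph_sum -rmorphB lecR subr_ge0.
 have hN : (1%:M - N)^t* = 1%:M - N.
  apply/matrixP=> i j;rewrite !mxE rmorphB rmorph_sum rmorph_nat eq_sym /=.
  by congr (_ - _);apply:eq_bigr=> w _;rewrite -hdotC.
 have:= psd_trmul hN pN py;rewrite mulmxBl mul1mx raddfB /= mxtrace_mulC ge0E=> /andP[_].
 by rewrite ReB subr_ge0 trE kFE.
pose B:= \sum_q hnorm (b q).
have hB q : hnorm (b q) <= B by rewrite /B (bigD1 q) //= lerDl sumr_ge0 // => *;exact:hnorm_ge0.
have B0 : 0 <= B by apply:sumr_ge0=> *;exact:hnorm_ge0.
pose A:= \sum_w \sum_q \sum_q' cabs (hdot (a w q') (a w q)).
have A0 : 0 <= A by do 3![apply:sumr_ge0=> ? _];exact:cabs_ge0.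
(* c absorbs the constants so that all replacements together cost at most eps / 2; the term 1 makes
   it positive. *)
pose c : R:= 2 * `|M| * B * A + 1.
have c0 : 0 < c by rewrite ltr_wpDl // !mulr_ge0.
apply/ler_addgt0Pl=> eps eps0.
have e2 : 0 < eps / 2 by rewrite divr_gt0.
have ec : 0 < eps / 2 / c by rewrite divr_gt0.
have [F1 HF1] := ht _ e2.
pose G q:= projT1 (cid (parseval_proj (b q) hh ec)).
have GP q F : (G q `<=` F)%fset -> hnorm (b q - proj (map h F) (b q)) < eps / 2 / c.
 exact:(projT2 (cid (parseval_proj (b q) hh ec))).
pose F:= (F1 `|` \bigcup_(q <- enum Q) G q)%fset.
have FG q : (G q `<=` F)%fset.
 rewrite /F;apply:fsubset_trans (fsubsetUr _ _);apply:bigfcup_sup=> //.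
 by rewrite mem_enum.
have near q q' : cabs (hdot (b q) (Y (b q')) - hdot (bF F q) (Y (bF F q'))) <=
  2 * `|M| * B * (eps / 2 / c).
 have -> : hdot (b q) (Y (b q')) - hdot (bF F q) (Y (bF F q'))
   = hdot (b q - bF F q) (Y (b q')) + hdot (bF F q) (Y (b q' - bF F q')).
  by rewrite oplinB // hdotBl hdotBr;ring.
 apply:le_trans (cabsD _ _) _.
 have h1 : cabs (hdot (b q - bF F q) (Y (b q'))) <= `|M| * B * (eps / 2 / c).
  apply:le_trans (hdot_le _ _) _;rewrite mulrC.
  apply:ler_pM;rewrite ?hnorm_ge0 ?(ltW (GP q F (FG q))) //.
  by apply:le_trans (HM _) _;rewrite ler_wpM2l.
 have h2 : cabs (hdot (bF F q) (Y (b q' - bF F q'))) <= `|M| * B * (eps / 2 / c).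
  have -> : `|M| * B * (eps / 2 / c) = B * (`|M| * (eps / 2 / c)) by ring.
  apply:le_trans (hdot_le _ _) _;apply:ler_pM;rewrite ?hnorm_ge0 //.
   by apply:le_trans (hnorm_proj _ (on F)) _.
  apply:le_trans (HM _) _;rewrite ler_wpM2l //;exact:ltW (GP q' F (FG q')).
 lra.
have d1 : cabs (kraus_trace Y - kF F) <= A * (2 * `|M| * B * (eps / 2 / c)).
 rewrite /kraus_trace /kF /A -sumrB mulr_suml;apply:le_trans (cabs_sum _ _ _) _.
 apply:ler_sum=> w _;rewrite -sumrB mulr_suml;apply:le_trans (cabs_sum _ _ _) _.
 apply:ler_sum=> q _;rewrite -sumrB mulr_suml;apply:le_trans (cabs_sum _ _ _) _.
 apply:ler_sum=> q' _;rewrite -mulrBl cabsM mulrC ler_wpM2l ?cabs_ge0 //.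
have d2 : A * (2 * `|M| * B * (eps / 2 / c)) <= eps / 2.
 have -> : A * (2 * `|M| * B * (eps / 2 / c)) = (2 * `|M| * B * A) * (eps / 2) / c by ring.
 rewrite ler_pdivrMr // mulrC ler_wpM2l ?(ltW e2) // /c lerDl //.
have:= HF1 F (fsubsetUl _ _);have:= fin F.
set S:= \sum_(i <- F) _=> h1 h2.
have:= le_trans (ler_norm _) (Re_le_cabs (kraus_trace Y - kF F)).
have:= le_trans (ler_norm _) (Re_le_cabs (S - t)).
rewrite !ReB;lra.
Qed.

Lemma kraus_channel_channel : channel kraus_channel.
Proof.
have rE (X : H1 -> H1) : oplinear X -> kraus_channel X =
 rankop (fun p : option (W * Q * Q)=> if p is Some (w, q, q') then a w q' else e)
  (fun p=> if p is Some (w, q, q') then hdot (b q) (X (b q')) *: a w q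
       else (btrace X - kraus_trace X) *: e).
 by move=> lX;apply/funext=> y;exact:kraus_channelE.
have bt X : trace_class X -> net_sum (fun i=> hdot (h i) (X (h i))) (btrace X).
 by move=> /(trace_class_net hh)[t ht];rewrite (btraceP ht).
have btl c X Y : trace_class X -> trace_class Y ->
  btrace (fun x=> c *: X x + Y x) = c * btrace X + btrace Y.
 move=> tX tY;apply:btraceP;have:= net_sum_linear c (bt _ tX) (bt _ tY).
 by congr (net_sum _ _);apply/funext=> i;rewrite hdot_linear.
have ktl c X Y : kraus_trace (fun x=> c *: X x + Y x) = c * kraus_trace X + kraus_trace Y.
 rewrite /kraus_trace mulr_sumr -big_split;apply:eq_bigr=> w _ /=.
 rewrite mulr_sumr -big_split;apply:eq_bigr=> q _ /=.
 rewrite mulr_sumr -big_split;apply:eq_bigr=> q' _ /=.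
 by rewrite hdot_linear;ring.
split.
- move=> X tX;rewrite rE;last exact:tX.1.1.
 exact:rankop_trace_class.
- move=> c X Y tX tY;apply/funext=> y;rewrite /kraus_channel btl // ktl.
 rewrite scalerDr scaler_sumr addrACA -big_split;congr (_ + _).
  by apply:eq_bigr=> w _;rewrite rankop_linear.
 by rewrite scalerA -scalerDl;congr (_ *: _);ring.
- move=> X t tX hX;rewrite rE;last exact:tX.1.1.
 have -> : t = \sum_(p : option (W * Q * Q)) (if p is Some (w, q, q')
   then hdot (a w q') (hdot (b q) (X (b q')) *: a w q)
   else hdot e ((btrace X - kraus_trace X) *: e)).
  rewrite (bigD1 None) //= hdotZr ee mulr1 (btraceP (has_trace_net hh hX)).
  rewrite (reindex_omap (@Some _) id) /=;last by case.
  under eq_bigl do rewrite eqxx.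
  rewrite sum_triple.
  rewrite -[LHS](subrK (kraus_trace X));congr (_ + _).
  by do 3![apply:eq_bigr=> ? _];rewrite hdotZr.
 apply:has_trace_sum=> -[[[w q] q']|] _;exact:has_trace_rank1.
- move=> N X tX pX xi.
 (* The completion contributes to the block form the trace of Y minus [kraus_trace] Y, for the
    positive operator Y = sum conj(c_i) c_j X_ij; [kraus_trace_le] makes it nonnegative. *)
 pose c i:= hdot e (xi i).
 pose Y (z : H1) := \sum_i \sum_j ((c i)^* * c j) *: X i j z.
 have tc0 (I1 : Type) (r : seq I1) (Z : I1 -> H1 -> H1) (k : I1 -> C) :
   (forall i, bounded_op (Z i) /\ net_sum (fun i0=> hdot (h i0) (Z i (h i0))) (btrace (Z i))) ->
   bounded_op (fun z=> \sum_(i <- r) k i *: Z i z) /\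
   net_sum (fun i0=> hdot (h i0) (\sum_(i <- r) k i *: Z i (h i0)))
    (\sum_(i <- r) k i * btrace (Z i)).
  move=> hZ;elim:r=> [|i r [[l [M HM]] IH]].
   split;first split.
   - by move=> *;rewrite !big_nil scaler0 addr0.
   - by exists 0=> x;rewrite big_nil hnorm0 mul0r.
   - move=> eps eps0;exists fset0=> F _;rewrite big_nil subr0.
    by rewrite big1 ?cabs0 // => j _;rewrite big_nil hdot0r.
  have [[li [Mi HMi]] hi] := hZ i.
  split;first split.
  - move=> c' x y;rewrite !big_cons li l !scalerDr addrACA !scalerA [k i * _]mulrC.
   by [].
  - exists (cabs (k i) * Mi + M)=> x;rewrite big_cons mulrDl -mulrA.
   apply:le_trans (hnormD _ _) (lerD _ (HM x));rewrite hnormZ.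
   by rewrite ler_wpM2l ?cabs_ge0.
  - rewrite big_cons;have:= net_sum_linear (k i) hi IH;congr (net_sum _ _).
   by apply/funext=> j;rewrite big_cons hdotDr hdotZr.
 have YE : Y = fun z=> \sum_(p : 'I_N * 'I_N) ((c p.1)^* * c p.2) *: X p.1 p.2 z.
  by apply/funext=> z;rewrite /Y pair_big.
 have [bY nY] := tc0 _ (index_enum ('I_N * 'I_N)%type) (fun p=> X p.1 p.2)
   (fun p=> (c p.1)^* * c p.2) (fun p=> conj (tX p.1 p.2).1 (bt _ (tX p.1 p.2))).
 have {}bY : bounded_op Y by rewrite YE.
 have {}nY : net_sum (fun i=> hdot (h i) (Y (h i)))
   (\sum_i \sum_j (c i)^* * c j * btrace (X i j)).
  by rewrite YE pair_big.
 have pY x : 0 <= hdot x (Y x).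
  have:= pX (fun i=> c i *: x);congr (0 <= _).
  rewrite /Y hdot_sumr;apply:eq_bigr=> i _;rewrite hdot_sumr;apply:eq_bigr=> j _.
  by rewrite hdotZl (oplinZ _ _ (tX i j).1.1) !hdotZr;ring.
 have kY : kraus_trace Y = \sum_i \sum_j (c i)^* * c j * kraus_trace (X i j).
  rewrite pair_big /= /kraus_trace.
  under [RHS]eq_bigr do rewrite mulr_sumr.
  rewrite [RHS]exchange_big;apply:eq_bigr=> w _ /=.
  under [RHS]eq_bigr do rewrite mulr_sumr.
  rewrite [RHS]exchange_big;apply:eq_bigr=> q _ /=.
  under [RHS]eq_bigr do rewrite mulr_sumr.
  rewrite [RHS]exchange_big;apply:eq_bigr=> q' _ /=.
  rewrite YE hdot_sumr mulr_suml;apply:eq_bigr=> p _;rewrite hdotZr;ring.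
 pose D i j:= btrace (X i j) - kraus_trace (X i j).
 have -> : \sum_i \sum_j hdot (xi i) (kraus_channel (X i j) (xi j)) =
   \sum_w \sum_i \sum_j hdot (rankop (a w) b (xi i)) (X i j (rankop (a w) b (xi j)))
   + \sum_i \sum_j (c i)^* * c j * D i j.
  rewrite [in RHS]exchange_big -big_split;apply:eq_bigr=> i _ /=.
  rewrite [in RHS]exchange_big -big_split;apply:eq_bigr=> j _ /=.
  rewrite /kraus_channel hdotDr hdot_sumr;congr (_ + _).
   apply:eq_bigr=> w _;rewrite hdot_rankop hdot_suml;apply:eq_bigr=> q _.
   by rewrite hdotZl -hdotC mulrC.
  by rewrite hdotZr /D /c [hdot (xi i) e]hdotC;ring.
 apply:addr_ge0;first by apply:sumr_ge0=> w _;exact:pX.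
 have -> : \sum_i \sum_j (c i)^* * c j * D i j =
   \sum_i \sum_j (c i)^* * c j * btrace (X i j) - kraus_trace Y.
  rewrite kY -sumrB;apply:eq_bigr=> i _;rewrite -sumrB;apply:eq_bigr=> j _.
  by rewrite /D mulrBr.
 set t:= \sum_i \sum_j _ in nY *.
 have:= kraus_trace_le bY pY nY.
 have Imt : Im t = 0.
  apply/eqP;rewrite -normr_eq0 eq_le normr_ge0 andbT.
  apply/ler_addgt0Pl=> eps /nY[F HF];rewrite addr0.
  have:= HF F (fsubset_refl _)=> /ltW;apply:le_trans;apply:le_trans (Im_le_cabs _).
  have ImS : Im (\sum_(i <- F) hdot (h i) (Y (h i))) = 0.
   rewrite Im_sum big1 // => i _.
   by have:= pY (h i);rewrite ge0E=> /andP[/eqP].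
  by rewrite ImB ImS sub0r normrN.
 have Imk : Im (kraus_trace Y) = 0.
  have K w : \sum_q \sum_q' hdot (b q) (Y (b q')) * hdot (a w q') (a w q) =
    (\sum_q \sum_q' hdot (b q) (Y (b q')) * hdot (a w q') (a w q))^*.
   rewrite rmorph_sum exchange_big;apply:eq_bigr=> q _ /=.
   rewrite rmorph_sum;apply:eq_bigr=> q' _.
   rewrite rmorphM /= -!hdotC;congr (_ * _).
   by rewrite (positive_selfadjoint bY.1 pY).
  have : kraus_trace Y = (kraus_trace Y)^*.
   by rewrite /kraus_trace rmorph_sum;apply:eq_bigr=> w _;exact:K.
  move/(congr1 (@Im R));rewrite Imconj;lra.
 by rewrite ge0E ImB Imt Imk subr0 eqxx ReB subr_ge0.
Qed.
End Construction.
End Channel.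

(** * Channels from nearly equal Gram matrices *)

Section Gram.
Variable R : realType.
Local Notation C := R[i].

Lemma hnorm_leP (H : hilbert R) (x : H) (c : R) : 0 <= c -> (hnorm x <= c) = (hsq x <= c ^+ 2).
Proof. by move=> c0;rewrite -hnorm_sqr ler_sqr ?nnegrE ?hnorm_ge0. Qed.

Lemma kraus_op_le (H1 H2 : hilbert R) (W Q : finType) (b : Q -> H1) (a : W -> Q -> H2) :
 (forall x, \sum_w hsq (rankop b (a w) x) <= hsq x) ->
 forall w x, hnorm (rankop b (a w) x) <= hnorm x.
Proof.
move=> contr w x;rewrite hnorm_leP ?hnorm_ge0 // hnorm_sqr.
apply:le_trans (contr x);rewrite (bigD1 w) //= lerDl.
by apply:sumr_ge0=> *;exact:hsq_ge0.
Qed.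

Lemma rankop_sum (H1 H2 : hilbert R) (J E : finType) (y x : J -> H1) (y' x' : E -> H1) z :
 rankop y x z + rankop y' x' z =
 rankop (fun s : J + E => match s with inl j => y j | inr e => y' e end)
     (fun s : J + E => match s with inl j => x j | inr e => x' e end) z.
Proof. by rewrite /rankop big_sumType. Qed.

Lemma hsqB_ge (H : hilbert R) (x y : H) eta : 0 <= eta -> hnorm y <= 1 -> hnorm (x - y) <= eta ->
 hsq y - 2 * eta <= hsq x.
Proof.
move=> e0 y1 xy;rewrite -!hnorm_sqr.
have:= hnormD x (y - x);rewrite addrC subrK hnormB=> h.
have:= hnorm_ge0 x;have:= hnorm_ge0 y;have:= hnorm_ge0 (x - y).
set a:= hnorm y in y1 h *;set b:= hnorm x in h *;set c:= hnorm (x - y) in xy h *.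
move=> c0 a0 b0;have [ea|ea] := leP eta a;nra.
Qed.

(** Here psi decomposes the source state and g the target state, while the families u and v are
    perturbations. The whole difference is written as one finite rank operator, so that
    [trace_norm_rankop] applies; r is the trace that the Kraus part loses. *)
Lemma kraus_estimate (H1 H2 : hilbert R) (W Q : finType) (b : Q -> H1) (a : W -> Q -> H2)
  (e : H2) (I : choiceType) (h : I -> H1) (J E F : finType)
  (psi : J -> H1) (u u' : E -> H1) (g : W -> J -> H2) (v v' : F -> H2)
  (eta eta' epsE epsF : R) :
 is_hilbert_basis h -> hdot e e = 1 ->
 (forall x, \sum_w hsq (rankop b (a w) x) <= hsq x) ->
 0 <= eta ->
 (forall j, hnorm (psi j) <= 1) -> (forall w j, hnorm (g w j) <= 1) ->
 (forall w j, hnorm (rankop b (a w) (psi j) - g w j) <= eta) ->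
 (forall j, `|hsq (psi j) - \sum_w hsq (g w j)| <= eta') ->
 \sum_k hnorm (u k) * hnorm (u' k) <= epsE ->
 \sum_k hnorm (v k) * hnorm (v' k) <= epsF ->
 (trace_norm (fun z => kraus_channel b a e h (fun x => rankop psi psi x + rankop u' u x)%R z
   - (\sum_j \sum_w hdot (g w j) z *: g w j + rankop v' v z))%R <=
  (2 * eta * #|W|%:R * #|J|%:R + #|J|%:R * (eta' + 2 * eta * #|W|%:R)
   + (1 + 2 * #|W|%:R) * epsE + epsF)%:E)%E.
Proof.
move=> hh ee contr eta0 psi1 g1 near norms hE hF.
have Kle:= kraus_op_le contr.
pose K w x:= rankop b (a w) x.
pose X x:= rankop psi psi x + rankop u' u x.
have lX : oplinear X by move=> c x y;rewrite /X !rankop_linear scalerDr addrACA.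
pose r:= btrace h X - kraus_trace b a X.
have XE : X = rankop (fun s : J + E=> match s with inl j=> psi j | inr e=> u' e end)
     (fun s : J + E=> match s with inl j=> psi j | inr e=> u e end).
 by apply/funext=> z;rewrite /X rankop_sum.
have bX : btrace h X = \sum_j hdot (psi j) (psi j) + \sum_k hdot (u' k) (u k).
 apply:btraceP;rewrite XE.
 have -> : \sum_j hdot (psi j) (psi j) + \sum_k hdot (u' k) (u k) =
   \sum_(s : J + E) hdot (match s with inl j=> psi j | inr e=> u' e end)
    (match s with inl j=> psi j | inr e=> u e end) by rewrite big_sumType.
 by apply:has_trace_net=> //;apply:has_trace_sum=> s _;exact:has_trace_rank1.
have kX : kraus_trace b a X = \sum_w (\sum_j hdot (K w (psi j)) (K w (psi j))
   + \sum_k hdot (K w (u' k)) (K w (u k))).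
 rewrite /kraus_trace;apply:eq_bigr=> w _.
 have E1 (x' x : H1) : \sum_q \sum_q' hdot (b q) x * hdot x' (b q') * hdot (a w q') (a w q)
   = hdot (K w x') (K w x).
  rewrite /K hdot_rankop;apply:eq_bigr=> q _;rewrite hdot_suml mulr_sumr.
  by apply:eq_bigr=> q' _;rewrite hdotZl -hdotC;ring.
 under [X in X + _]eq_bigr do rewrite -E1.
 under [X in _ + X]eq_bigr do rewrite -E1.
 rewrite [X in _ = X + _]exchange_big [X in _ = _ + X]exchange_big -big_split.
 apply:eq_bigr=> q _ /=.
 rewrite [X in _ = X + _]exchange_big [X in _ = _ + X]exchange_big -big_split.
 apply:eq_bigr=> q' _ /=.
 rewrite /X hdotDr !hdot_rankop mulrDl !mulr_suml.
 by congr (_ + _);apply:eq_bigr=> j _;ring.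
have rE : r = (\sum_j (hsq (psi j) - \sum_w hsq (K w (psi j))))%:C
  + (\sum_k hdot (u' k) (u k) - \sum_w \sum_k hdot (K w (u' k)) (K w (u k))).
 rewrite /r bX kX big_split /= sumrB rmorphB !rmorph_sum /= opprD addrACA.
 congr (_ - _ + _);first by apply:eq_bigr=> j _;rewrite hdotxx.
 rewrite exchange_big;apply:eq_bigr=> j _ /=;rewrite rmorph_sum.
 by apply:eq_bigr=> w _;rewrite hdotxx.
have KX w z : K w (X (rankop (a w) b z)) = \sum_j hdot (K w (psi j)) z *: K w (psi j)
  + \sum_k hdot (K w (u' k)) z *: K w (u k).
 have adj x : hdot x (rankop (a w) b z) = hdot (K w x) z.
  rewrite hdot_rankop hdot_suml;apply:eq_bigr=> q _.
  by rewrite hdotZl -hdotC mulrC.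
 have lK c x y : K w (c *: x + y) = c *: K w x + K w y by rewrite /K rankop_linear.
 have K0 : K w 0 = 0 by have:= lK (-1) 0 0;rewrite scaler0 addr0 scaleN1r addNr.
 have Ks (T : finType) (f : T -> C) (x : T -> H1) :
   K w (\sum_j f j *: x j) = \sum_j f j *: K w (x j).
  by elim/big_rec2: _=> [//|i y1 y2 _ <-];rewrite lK.
 have KD x y : K w (x + y) = K w x + K w y by rewrite -[x in LHS]scale1r lK scale1r.
 rewrite /X KD /rankop !Ks;congr (_ + _);apply:eq_bigr=> j _;
 by rewrite -[\sum_q _]/(rankop _ _ _) adj.
(* |K psi><K psi| - |g><g| is split as |D><K psi| + |g><D|; these are the first two summands of the
   index type S. *)
pose D w j:= K w (psi j) - g w j.
pose S:= (((W * J) + (W * J)) + ((W * E) + (option F)))%type.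
pose yy (s : S) : H2:= match s with
 | inl (inl p)=> K p.1 (psi p.2)
 | inl (inr p)=> D p.1 p.2
 | inr (inl p)=> K p.1 (u' p.2)
 | inr (inr (Some k))=> v' k
 | inr (inr None)=> e end.
pose xx (s : S) : H2:= match s with
 | inl (inl p)=> D p.1 p.2
 | inl (inr p)=> g p.1 p.2
 | inr (inl p)=> K p.1 (u p.2)
 | inr (inr (Some k))=> - v k
 | inr (inr None)=> r *: e end.
have sumopt (V : nmodType) (f : option F -> V) : \sum_j f j = f None + \sum_j f (Some j).
 rewrite (bigD1 None) //=;congr (_ + _).
 rewrite (reindex_omap (@Some _) id) /=;last by case.
 by apply:eq_bigl=> j;rewrite eqxx.
have -> : (fun z=> kraus_channel b a e h (fun x=> rankop psi psi x + rankop u' u x)%R z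
   - (\sum_j \sum_w hdot (g w j) z *: g w j + rankop v' v z)) = rankop yy xx.
 apply/funext=> z;rewrite -/X /kraus_channel -/r.
 under eq_bigr do rewrite -/(K _ _) KX.
 rewrite /rankop !big_sumType sumopt /= big_split /=.

 have -> : \sum_w \sum_j hdot (K w (psi j)) z *: K w (psi j)
   = \sum_(i : W * J) hdot (K i.1 (psi i.2)) z *: D i.1 i.2
    + \sum_(i : W * J) hdot (D i.1 i.2) z *: g i.1 i.2
    + \sum_j \sum_w hdot (g w j) z *: g w j.
  have -> : \sum_j \sum_w hdot (g w j) z *: g w j =
    \sum_(i : W * J) hdot (g i.1 i.2) z *: g i.1 i.2 by rewrite exchange_big pair_bigA.
  rewrite pair_bigA -!big_split.
  apply:eq_bigr=> -[w j] _ /=;rewrite /D hdotBl scalerBr scalerBl.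
  by rewrite addrA subrK subrK.
 have -> : \sum_w \sum_k hdot (K w (u' k)) z *: K w (u k)
   = \sum_(p : W * E) hdot (K p.1 (u' p.2)) z *: K p.1 (u p.2) by rewrite pair_bigA.
 rewrite scalerA [hdot e z * r]mulrC.
 under [X in _ = _ + (_ + (_ + X))]eq_bigr do rewrite scalerN.
 have AC (s1 s2 s3 s4 s5 s6 : H2) :
   s1 + s2 + s3 + s4 + s5 - (s3 + s6) = s1 + s2 + (s4 + (s5 - s6)).
  rewrite opprD -!addrA;congr (_ + (_ + _));rewrite addrCA;congr (_ + _).
  by rewrite addrCA;congr (_ + _);rewrite addrA subrr add0r.
 by rewrite sumrN;exact:AC.
apply:le_trans (trace_norm_rankop _ _) _;rewrite lee_fin !big_sumType sumopt /=.
have card2 (A B : finType) (f : A * B -> R) M : (forall p, f p <= M) ->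
  \sum_p f p <= #|A|%:R * #|B|%:R * M.
 move=> fM;apply:le_trans (ler_sum _ (fun p _=> fM p)) _.
 by rewrite sumr_const card_prod -natrM mulr_natl.
have b1 : \sum_(p : W * J) hnorm (D p.1 p.2) * hnorm (K p.1 (psi p.2)) <= #|W|%:R * #|J|%:R * eta.
 apply:card2=> -[w j] /=;rewrite -[leRHS]mulr1;apply:ler_pM;rewrite ?hnorm_ge0 //.
  exact:near.
 exact:le_trans (Kle _ _) (psi1 _).
have b2 : \sum_(p : W * J) hnorm (g p.1 p.2) * hnorm (D p.1 p.2) <= #|W|%:R * #|J|%:R * eta.
 apply:card2=> -[w j] /=;rewrite -[leRHS]mul1r;apply:ler_pM;rewrite ?hnorm_ge0 //.
 exact:near.
have epsE0 : 0 <= epsE.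
 by apply:le_trans hE;apply:sumr_ge0=> k _;rewrite mulr_ge0 ?hnorm_ge0.
have b3 : \sum_(p : W * E) hnorm (K p.1 (u p.2)) * hnorm (K p.1 (u' p.2)) <= #|W|%:R * epsE.
 rewrite -(pair_bigA _ (fun w k=> hnorm (K w (u k)) * hnorm (K w (u' k)))) /=.
 apply:(@le_trans _ _ (\sum_(w : W) epsE));last by rewrite sumr_const -[leLHS]mulr_natl.
 apply:ler_sum=> w _;apply:le_trans hE;apply:ler_sum=> k _.
 by apply:ler_pM;rewrite ?hnorm_ge0 // Kle.
have b4 : \sum_k hnorm (- v k) * hnorm (v' k) <= epsF.
 by under eq_bigr do rewrite hnormN.
have n1 : hnorm e = 1 by rewrite /hnorm ee sqrtr1.
have b5 : cabs r <= #|J|%:R * (eta' + 2 * eta * #|W|%:R) + (1 + #|W|%:R) * epsE.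
 rewrite rE;apply:le_trans (cabsD _ _) (lerD _ _).
  rewrite cabs_real;apply:le_trans (ler_norm_sum _ _ _) _.
  apply:(@le_trans _ _ (\sum_(j : J) (eta' + 2 * eta * #|W|%:R)));last first.
   by rewrite sumr_const -[leLHS]mulr_natl.
  apply:ler_sum=> j _.
  have c1 : 0 <= hsq (psi j) - \sum_w hsq (K w (psi j)) by rewrite subr_ge0;exact:contr.
  rewrite ger0_norm //.
  have c2 : \sum_w (hsq (g w j) - 2 * eta) <= \sum_w hsq (K w (psi j)).
   by apply:ler_sum=> w _;apply:hsqB_ge;[exact:eta0|exact:g1|exact:near].
  rewrite sumrB sumr_const -[_ *+ #|W|]mulr_natr in c2.
  have:= norms j;rewrite ler_norml=> /andP[_].
  by move:c2;set A:= \sum_w hsq (g w j);set B:= \sum_w _;lra.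
 apply:le_trans (cabsD _ _) _;rewrite cabsN mulrDl mul1r;apply:lerD.
  apply:le_trans (cabs_sum _ _ _) _;apply:le_trans hE;apply:ler_sum=> k _.
  by rewrite mulrC hdot_le.
 apply:le_trans (cabs_sum _ _ _) _.
 apply:(@le_trans _ _ (\sum_(w : W) epsE));last by rewrite sumr_const -[leLHS]mulr_natl.
 apply:ler_sum=> w _;apply:le_trans (cabs_sum _ _ _) _;apply:le_trans hE.
 apply:ler_sum=> k _;apply:le_trans (hdot_le _ _) _;rewrite mulrC.
 by apply:ler_pM;rewrite ?hnorm_ge0 // Kle.
rewrite hnormZ n1 !mulr1;move:b1 b2 b3 b4 b5.
set s1:= \sum_(p : W * J) _;set s2:= \sum_(p : W * J) _;set s3:= \sum_(p : W * E) _.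
set s4:= \sum_k _;lra.
Qed.

(** Tikhonov regularization. Let X and Y_w be the maps c |-> sum c_i x_i and c |-> sum c_i y_i w,
    and M = X^* X + eps; the operators are K_w = Y_w M^-1 X^*. The hypothesis gives sum_w Y_w^* Y_w
    <= M, hence sum_w K_w^* K_w <= X M^-1 X^* <= 1. Moreover K_w x_i - y_i w = - eps Y_w M^-1 e_i,
    and the squares sum to at most eps^2 (M^-1)_ii <= eps. *)
Lemma gram_contraction (H1 H2 : hilbert R) (W : finType) n (x : 'I_n -> H1)
  (y : 'I_n -> W -> H2) (eps : R) : 0 < eps ->
 (forall i j, cabs (\sum_w hdot (y i w) (y j w) - hdot (x i) (x j)) * n%:R <= eps) ->
 exists a : W -> 'I_n -> H2,
  (forall z, \sum_w hsq (rankop x (a w) z) <= hsq z) /\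
  forall i, \sum_w hsq (rankop x (a w) (x i) - y i w) <= eps.
Proof.
move=> eps0 near.
pose G : 'M[C]_n:= \matrix_(i, j) hdot (x i) (x j).
pose M:= G + eps%:C%:M.
pose Xc (c : 'I_n -> C) := \sum_i c i *: x i.
pose Yc (c : 'I_n -> C) w:= \sum_i c i *: y i w.
pose nc (c : 'I_n -> C) : R:= \sum_i cabs (c i) ^+ 2.
have nc0 c : 0 <= nc c by apply:sumr_ge0=> i _;rewrite exprn_ge0 ?cabs_ge0.
have comp c : \sum_w hsq (Yc c w) <= hsq (Xc c) + eps * nc c.
 have E : (\sum_w hsq (Yc c w) - hsq (Xc c))%:C = \sum_i \sum_j (c i)^* * c j *
   (\sum_w hdot (y i w) (y j w) - hdot (x i) (x j)).
  transitivity (\sum_w hdot (Yc c w) (Yc c w) - hdot (Xc c) (Xc c)).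
   rewrite rmorphB rmorph_sum hdotxx;congr (_ - _).
   by apply:eq_bigr=> w _;rewrite hdotxx.
  rewrite /Yc /Xc.
  under [RHS]eq_bigr do under eq_bigr do rewrite mulrBr.
  under [RHS]eq_bigr do rewrite sumrB.
  rewrite sumrB;congr (_ - _).
   under [RHS]eq_bigr do under eq_bigr do rewrite mulr_sumr.
   under [RHS]eq_bigr do rewrite exchange_big.
   rewrite [RHS]exchange_big;apply:eq_bigr=> w _ /=.
   rewrite hdot_suml;apply:eq_bigr=> i _;rewrite hdot_sumr;apply:eq_bigr=> j _.
   by rewrite hdotZl hdotZr;ring.
  rewrite hdot_suml;apply:eq_bigr=> i _;rewrite hdot_sumr;apply:eq_bigr=> j _.
  by rewrite hdotZl hdotZr;ring.
 rewrite -lerBlDl;apply:le_trans (ler_norm _) _;rewrite -cabs_real E.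
 apply:le_trans (cabs_sum _ _ _) _.
 have [n0|n0] := eqVneq n 0%N.
  rewrite big1 ?mulr_ge0 ?(ltW eps0) // => i;case:i=> i lti _;exfalso;move:lti;by rewrite n0.
 have n0' : (0 : R) < n%:R by rewrite ltr0n lt0n.
 apply:(@le_trans _ _ (\sum_i \sum_j (eps / n%:R) * ((cabs (c i) ^+ 2 + cabs (c j) ^+ 2) / 2))).
  apply:ler_sum=> i _;apply:le_trans (cabs_sum _ _ _) _;apply:ler_sum=> j _.
  rewrite !cabsM cabs_conj mulrC;apply:ler_pM;rewrite ?cabs_ge0 ?mulr_ge0 ?cabs_ge0 //.
   by rewrite ler_pdivlMr.
  by have:= sqr_ge0 (cabs (c i) - cabs (c j));rewrite sqrrB;lra.
 under eq_bigr do rewrite -mulr_sumr -mulr_suml big_split /= sumr_const card_ord.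
 rewrite -mulr_sumr -mulr_suml big_split /= sumr_const card_ord -/(nc c).
 under eq_bigr do rewrite -[_ *+ n]mulr_natr.
 rewrite -mulr_suml -/(nc c) -[_ *+ n]mulr_natr.
 rewrite le_eqVlt;apply/orP;left;apply/eqP;field.
 by rewrite lt0r_neq0.
have formM (c : 'I_n -> C) : \sum_i (c i)^* * (\sum_j M i j * c j) = (hsq (Xc c) + eps * nc c)%:C.
 transitivity (hdot (Xc c) (Xc c) + eps%:C * \sum_i (c i)^* * c i);last first.
  rewrite rmorphD rmorphM hdotxx /nc rmorph_sum;congr (_ + _ * _).
  by apply:eq_bigr=> i _;rewrite conjMz_cabs.
 rewrite mulr_sumr /Xc hdot_suml -big_split.
 apply:eq_bigr=> i _ /=;rewrite hdotZl hdot_sumr mulrCA -mulrDr.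
 congr (_ * _);rewrite (bigD1 i) //= [X in _ = X + _](bigD1 i) //= !mxE eqxx mulr1n mulrDl.
 rewrite -!addrA;congr (_ + _);first by rewrite hdotZr mulrC.
 rewrite addrC;congr (_ + _);apply:eq_bigr=> j ji.
 by rewrite !mxE eq_sym (negPf ji) mulr0n addr0 hdotZr mulrC.
have uM : M \in unitmx.
 rewrite unitmxE unitfE;apply/negP=> /det0P[v v0 vM].
 pose c i:= (v 0 i)^*.
 have:= formM c;rewrite (_ : \sum_i _ = 0);last first.
  under eq_bigr do rewrite mulr_sumr.
  rewrite exchange_big big1 // => j _ /=.
  under eq_bigr do rewrite mulrA.
  rewrite -mulr_suml;have:= vM;move/rowP/(_ j);rewrite !mxE.
  by under eq_bigr do rewrite -[v 0 _]conjCK;move=> ->;rewrite mul0r.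
 move/complexI/esym/eqP;rewrite paddr_eq0 ?hsq_ge0 ?mulr_ge0 ?(ltW eps0) //.
 case/andP=> _;rewrite mulf_eq0 (gt_eqF eps0) /= psumr_eq0;last first.
  by move=> i _;rewrite exprn_ge0 ?cabs_ge0.
 move/allP=> h;case/negP: v0;apply/eqP/rowP=> i;rewrite mxE.
 have:= h i (mem_index_enum _);rewrite expf_eq0 /= cabs_eq0 /c.
 by move/eqP/(congr1 Num.conj);rewrite conjCK rmorph0.
pose Rm:= invmx M.
have MR i (f : 'I_n -> C) : \sum_j M i j * (\sum_q Rm j q * f q) = f i.
 have : M *m Rm *m (\col_q f q) = \col_q f q by rewrite mulmxV // mul1mx.
 move/colP/(_ i);rewrite -mulmxA !mxE=> <-;apply:eq_bigr=> j _;rewrite !mxE.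
 by congr (_ * _);apply:eq_bigr=> q _;rewrite mxE.
exists (fun w q=> \sum_i Rm i q *: y i w).
have opE w z : rankop x (fun q=> \sum_i Rm i q *: y i w) z
  = Yc (fun i=> \sum_q Rm i q * hdot (x q) z) w.
 rewrite /rankop /Yc;under eq_bigr do rewrite scaler_sumr.
 rewrite exchange_big;apply:eq_bigr=> i _ /=;rewrite scaler_suml.
 by apply:eq_bigr=> q _;rewrite scalerA mulrC.
split=> [z|i].
 under eq_bigr do rewrite opE.
 apply:le_trans (comp (fun i=> \sum_q Rm i q * hdot (x q) z)) _;set c:= fun i=> _.
 (* M c = X^* z, so that |X c|^2 + eps |c|^2 = <X c, z>; expanding |z - X c|^2 then finishes. *)
 have hc : hdot (Xc c) z = (hsq (Xc c) + eps * nc c)%:C.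
  rewrite -formM /Xc hdot_suml;apply:eq_bigr=> i _.
  by rewrite hdotZl /c MR.
 have:= hsq_ge0 (z - Xc c);rewrite hsqD hsqN hdotNr [hdot z _]hdotC hc conjc_realE /=.
 have:= nc0 c;have:= hsq_ge0 (Xc c);nra.
pose r j:= Rm j i.
have rE : \sum_j (r j)^* * (\sum_k M j k * r k) = (r i)^*.
 have E j : \sum_k M j k * r k = (j == i)%:R.
  rewrite -(MR j (fun q=> (q == i)%:R));apply:eq_bigr=> k _;congr (_ * _).
  rewrite (bigD1 i) //= eqxx mulr1 big1 ?addr0 // => q qi.
  by rewrite (negPf qi) mulr0.
 under eq_bigr do rewrite E.
 rewrite (bigD1 i) //= eqxx mulr1 big1 ?addr0 // => j ji.
 by rewrite (negPf ji) mulr0.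
have cE w : rankop x (fun q=> \sum_i Rm i q *: y i w) (x i) - y i w = - eps%:C *: Yc r w.
 rewrite opE /Yc scaler_sumr.
 have -> : y i w = \sum_k (k == i)%:R *: y k w.
  rewrite (bigD1 i) //= eqxx scale1r big1 ?addr0 // => k ki.
  by rewrite (negPf ki) scale0r.
 rewrite -sumrB;apply:eq_bigr=> k _;rewrite scalerA -scalerBl;congr (_ *: _).
 have : Rm *m M = 1%:M by rewrite mulVmx.
 move/matrixP/(_ k i);rewrite !mxE=> <-;rewrite /M.
 under [X in _ - X]eq_bigr do rewrite !mxE mulrDr.
 rewrite big_split /= opprD addrA subrr add0r (bigD1 i) //= big1.
  by rewrite eqxx mulr1n addr0 mulNr mulrC /r.
 by move=> j ji;rewrite (negPf ji) mulr0n mulr0.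
under eq_bigr do rewrite cE hsqZ cabsN cabs_real ger0_norm ?(ltW eps0) //.
rewrite -mulr_sumr.
have h1:= comp r;have:= formM r;rewrite rE=> /(congr1 (@Re R)) /=;rewrite Reconj=> h2.
have h3 : Re (r i) <= eps^-1.
 have h4 : Re (r i) ^+ 2 <= nc r.
  apply:(@le_trans _ _ (cabs (r i) ^+ 2)).
   by rewrite cabs_sqr /sqn lerDl sqr_ge0.
  by rewrite /nc (bigD1 i) //= lerDl sumr_ge0 // => j _;rewrite exprn_ge0 ?cabs_ge0.
 have:= hsq_ge0 (Xc r)=> h5.
 have [r0|r0] := leP (Re (r i)) 0;first by apply:le_trans r0 _;rewrite invr_ge0 ltW.
 rewrite -[leRHS]mul1r ler_pdivlMr //.
 have : eps * Re (r i) ^+ 2 <= Re (r i) by nra.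
 by rewrite expr2 mulrA ger_pMl // mulrC.
apply:(@le_trans _ _ (eps ^+ 2 * eps^-1)).
 rewrite ler_wpM2l ?exprn_ge0 ?(ltW eps0) //;apply:le_trans h1 _;by rewrite -h2.
by rewrite expr2 mulfK // lt0r_neq0.
Qed.
End Gram.

(** * Complex exponential *)

Section ComplexExp.
Variable R : realType.
Local Notation C := R[i].
Implicit Types z w : C.

Definition cexp z : C := (expR (Re z))%:C * (cos (Im z) +i* sin (Im z))%C.

Lemma cexp0 : cexp 0 = 1.
Proof. by rewrite /cexp /= expR0 cos0 sin0 mul1r. Qed.

Lemma cexpD z w : cexp (z + w) = cexp z * cexp w.
Proof.
rewrite /cexp ReD ImD expRD cosD sinD rmorphM /=.
rewrite mulrACA;congr (_ * _);apply:complexP;rewrite ?Defs.ReM ?Defs.ImM /=;ring.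
Qed.

Lemma cexpMn z n : cexp (n%:R * z) = cexp z ^+ n.
Proof.
elim:n=> [|n IH];first by rewrite mul0r cexp0 expr0.
by rewrite exprS -IH -cexpD;congr cexp;rewrite mulrSr;ring.
Qed.

Lemma cexp_conj z : cexp z^* = (cexp z)^*.
Proof.
rewrite /cexp Reconj Imconj cosN sinN rmorphM /= conjc_realE;congr (_ * _).
Qed.

Lemma cabs_cexp z : cabs (cexp z) = expR (Re z).
Proof.
rewrite /cexp cabsM cabs_real ger0_norm ?expR_ge0 // cabs_sqrt /sqn /=.
by rewrite cos2Dsin2 sqrtr1 mulr1.
Qed.

(** Coefficients in t of Re (w exp (t z)): a real power series, which can be differentiated term by
    term. *)
Let kc z w (n : nat) : R := Re (w * z ^+ n) / n`!%:R.

Let kc_cvg z w (t : R) : cvgn (pseries (kc z w) t).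
Proof.
apply:normed_cvg;apply:(@series_le_cvg _ _ (cabs w *: exp_coeff (cabs z * `|t|))).
- by move=> n /=.
- by move=> n /=;rewrite mulr_ge0 ?cabs_ge0 // divr_ge0 // exprn_ge0 // mulr_ge0 // cabs_ge0.
- move=> n;rewrite /kc /= !normrM normfV normrX (ger0_norm (ler0n _ n`!)).
 rewrite -[leRHS]/(cabs w * ((cabs z * `|t|) ^+ n / n`!%:R)) exprMn.
 have -> : cabs w * (cabs z ^+ n * `|t| ^+ n / n`!%:R) = cabs w * cabs z ^+ n / n`!%:R * `|t| ^+ n by ring.
 rewrite ler_wpM2r ?exprn_ge0 // ler_wpM2r ?invr_ge0 // -cabsX -cabsM.
 exact:Re_le_cabs.
- by apply:is_cvg_seriesZ;exact:is_cvg_series_exp_coeff.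
Qed.

Let F z w (t : R) : R := limn (pseries (kc z w) t).

Let diffs_kc z w : pseries_diffs (kc z w) = kc z (w * z).
Proof.
apply/funext=> n;rewrite /pseries_diffs /kc exprS mulrA factS natrM;field.
by rewrite nat1r !pnatr_eq0 /= andbT -lt0n fact_gt0.
Qed.

Let F_derive z w (t : R) : is_derive t 1 (F z w) (F z (w * z) t).
Proof.
rewrite /F -diffs_kc;apply:(@pseries_snd_diffs _ _ (`|t| + 1)).
- exact:kc_cvg.
- rewrite diffs_kc;exact:kc_cvg.
- rewrite !diffs_kc;exact:kc_cvg.
- by rewrite [ltRHS]ger0_norm// addrC -subr_gt0 addrK.
Qed.

Let F_linear z (a : R) w w' t : F z (a%:C * w + w') t = a * F z w t + F z w' t.
Proof.
have -> : F z (a%:C * w + w') t = limn (series (a *: (fun n=> kc z w n * t ^+ n)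
  + (fun n=> kc z w' n * t ^+ n))).
 congr (limn (series _));apply/funext=> n.
 rewrite -[RHS]/(a * (kc z w n * t ^+ n) + kc z w' n * t ^+ n).
 rewrite -[LHS]/(kc z (a%:C * w + w') n * t ^+ n) /kc mulrDl ReD.
 have -> : Re (a%:C * w * z ^+ n) = a * Re (w * z ^+ n).
  by rewrite -mulrA Defs.ReM /= mul0r subr0.
 ring.
rewrite lim_seriesD;[|apply:is_cvg_seriesZ;exact:kc_cvg|exact:kc_cvg].
by rewrite lim_seriesZ //;exact:kc_cvg.
Qed.

Let F0 z w : F z w 0 = Re w.
Proof.
apply:(@cvg_lim R^o)=> //;rewrite -(cvg_shiftn 1).
apply:(cvg_trans _ (@cvg_cst _ (Re w) nat \oo _)).
apply:near_eq_cvg;near=> n;rewrite /pseries /series /=.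
rewrite addn1 big_nat_recl // expr0 mulr1 /kc expr0 mulr1 fact0 divr1 big1 ?addr0 //.
by move=> i _;rewrite expr0n mulr0.
Unshelve. all: by end_near.
Qed.

Let is_derive_scale (f : R -> R) (df : R -> R) (c t : R) :
 (forall x : R, is_derive x 1 f (df x)) -> is_derive t 1 (fun t => f (c * t)) (c * df (c * t)).
Proof.
move=> fd;have h : is_derive t 1 (fun t=> c * t) c.
 by have:= @is_deriveZ _ _ _ id c t 1 1 _;rewrite [_ *: _]mulr1;apply.
by have:= @is_derive1_comp _ f ( *%R c) t _ _ (fd (c * t)) h;rewrite mulrC.
Qed.

Let const_of_derive0 (f : R -> R) : (forall t : R, is_derive t 1 f 0) -> f 1 = f 0.
Proof.
move=> fd;have [|c _] := @MVT R f (fun=> 0) 0 1 ltr01 (fun x _=> fd x).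
 apply:continuous_subspaceT=> x;apply:differentiable_continuous.
 by apply/derivable1_diffP;case:(fd x).
by rewrite mul0r=> /eqP;rewrite subr_eq0=> /eqP.
Qed.

(** U and W solve U' = a U + b W, W' = - b U + a W. Undoing the flow by exp (- a t) and a rotation
    gives G1 and G2, whose derivatives vanish. *)
Let F_cexp z w : F z w 1 = Re (w * cexp z).
Proof.
pose a:= Re z;pose b:= Im z;pose U:= F z 1;pose W:= F z 'i%C.
have zE : z = (a +i* b)%C by rewrite /a /b;case:(z).
have FE v t : F z v t = Re v * U t + Im v * W t.
 have {1}-> : v = (Re v)%:C * 1 + ((Im v)%:C * 'i%C + 0).
  by rewrite addr0;apply:complexP;rewrite ?ReD ?ImD ?Defs.ReM ?Defs.ImM /=;ring.
 rewrite !F_linear.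
 have -> : F z 0 t = 0.
  by have:= F_linear z 1 0 0 t;rewrite mulr0 addr0 mul1r=> /eqP;rewrite -subr_eq0 opprD addNKr oppr_eq0=> /eqP.
 by rewrite addr0.
have dU (t : R) : is_derive t 1 U (a * U t + b * W t).
 by have:= F_derive z 1 t;rewrite mul1r FE.
have dW (t : R) : is_derive t 1 W (- b * U t + a * W t).
 have:= F_derive z 'i%C t;rewrite FE Defs.ReM Defs.ImM /= -/a -/b.
 have -> : (0 * a - 1 * b) * U t + (0 * b + 1 * a) * W t = - b * U t + a * W t by ring.
 by [].
have de (t : R) : is_derive t 1 (fun t=> expR (- a * t)) (- a * expR (- a * t)).
 exact:is_derive_scale.
have dc (t : R) : is_derive t 1 (fun t=> cos (b * t)) (b * - sin (b * t)).
 exact:is_derive_scale.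
have ds (t : R) : is_derive t 1 (fun t=> sin (b * t)) (b * cos (b * t)).
 exact:is_derive_scale.
pose G1:= (fun t=> expR (- a * t)) * ((fun t=> cos (b * t)) * U - (fun t=> sin (b * t)) * W).
pose G2:= (fun t=> expR (- a * t)) * ((fun t=> sin (b * t)) * U + (fun t=> cos (b * t)) * W).
have g1 : G1 1 = G1 0.
 apply:const_of_derive0=> t;rewrite /G1;apply:is_derive_eq.
 rewrite !fctE /GRing.scale /=;ring.
have g2 : G2 1 = G2 0.
 apply:const_of_derive0=> t;rewrite /G2;apply:is_derive_eq.
 rewrite !fctE /GRing.scale /=;ring.
have G1E (t : R) : G1 t = expR (- a * t) * (cos (b * t) * U t - sin (b * t) * W t) by [].
have G2E (t : R) : G2 t = expR (- a * t) * (sin (b * t) * U t + cos (b * t) * W t) by [].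
have U0 : U 0 = 1 by rewrite /U F0.
have W0 : W 0 = 0 by rewrite /W F0.
move:g1 g2;rewrite !G1E !G2E U0 W0 !mulr0 !mulr1 cos0 sin0 expR0 !mul1r subr0 addr0 expRN=> g1 g2.
have ea : expR a != 0 by rewrite gt_eqF ?expR_gt0.
have {}g1 : cos b * U 1 - sin b * W 1 = expR a.
 by rewrite -[LHS](mulVKf ea) g1 mulr1.
have {}g2 : sin b * U 1 + cos b * W 1 = 0.
 by apply/eqP;move/eqP: g2;rewrite mulf_eq0 invr_eq0 (negPf ea).
have cs:= cos2Dsin2 b.
have U1 : U 1 = expR a * cos b.
 transitivity ((cos b ^+ 2 + sin b ^+ 2) * U 1);first by rewrite cs mul1r.
 have -> : (cos b ^+ 2 + sin b ^+ 2) * U 1 = (cos b * U 1 - sin b * W 1) * cos b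
   + sin b * (sin b * U 1 + cos b * W 1) by ring.
 by rewrite g1 g2 mulr0 addr0.
have W1 : W 1 = - (expR a * sin b).
 transitivity ((cos b ^+ 2 + sin b ^+ 2) * W 1);first by rewrite cs mul1r.
 have -> : (cos b ^+ 2 + sin b ^+ 2) * W 1 = - ((cos b * U 1 - sin b * W 1) * sin b)
   + cos b * (sin b * U 1 + cos b * W 1) by ring.
 by rewrite g1 g2 mulr0 addr0.
rewrite FE U1 W1 /cexp !Defs.ReM !Defs.ImM /= -/a -/b;ring.
Qed.

Let kcE z w m : kc z w m = Re (w * (z ^+ m / m`!%:R)).
Proof.
rewrite /kc mulrA.
have -> : (m`!%:R)^-1 = ((m`!%:R)^-1 : R)%:C by rewrite fmorphV rmorph_nat.
by rewrite [RHS]Defs.ReM /= mulr0 subr0.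
Qed.

Let series_kc z w : series (fun m => Re (w * (z ^+ m / m`!%:R))) = pseries (kc z w) 1.
Proof.
rewrite /pseries;congr series;apply/funext=> m /=.
by rewrite -kcE expr1n mulr1.
Qed.

(** This series is what the levels of the Fock space contribute to the inner product of two coherent
    vectors. *)
Lemma csum_exp z : csum (fun m => z ^+ m / m`!%:R) = cexp z.
Proof.
apply:complexP.
 rewrite -[RHS]/(Re (cexp z)) -[cexp z]mul1r -F_cexp /F -series_kc /=.
 by congr (limn (series _));apply/funext=> m;rewrite mul1r.
have ImE (x : C) : Im x = Re (- 'i%C * x) by rewrite Defs.ReM /=;ring.
rewrite [RHS]ImE -F_cexp /F -series_kc /=.
by congr (limn (series _));apply/funext=> m;rewrite ImE.
Qed.

Lemma csummable_exp z : csummable (fun m => z ^+ m / m`!%:R).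
Proof.
split.
 have -> : (fun m=> Re (z ^+ m / m`!%:R)) = (fun m=> Re (1 * (z ^+ m / m`!%:R))).
  by apply/funext=> m;rewrite mul1r.
 rewrite series_kc;exact:kc_cvg.
have -> : (fun m=> Im (z ^+ m / m`!%:R)) = (fun m=> Re (- 'i%C * (z ^+ m / m`!%:R))).
 by apply/funext=> m;rewrite Defs.ReM /=;ring.
rewrite series_kc;exact:kc_cvg.
Qed.

(** The tail is dominated by a geometric series because (m + 2)! >= 2^(m + 1). *)
Lemma cexp_taylor z : cabs z <= 1 -> cabs (cexp z - 1 - z) <= cabs z ^+ 2.
Proof.
move=> z1;have z0:= cabs_ge0 z.
have part w : Re (w * (cexp z - 1 - z)) <= cabs w * cabs z ^+ 2.
 pose u m:= Re (w * (z ^+ m / m`!%:R)).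
 have su : cvgn (series u) by rewrite series_kc;exact:kc_cvg.
 have -> : Re (w * (cexp z - 1 - z)) = limn (series u) - (u 0%N + u 1%N).
  rewrite !mulrBr !ReB -F_cexp /F -series_kc -/u opprD addrA /u.
  by rewrite expr0 expr1 !divr1 mulr1.
 rewrite lerBlDr;apply:limr_le=> //;exists 2%N=> // M /= M2.
 have -> : M = (M - 2).+2 by rewrite -addn2 subnK.
 rewrite /series /= !big_nat_recl // addrA addrC lerD2r.
 have half K : \sum_(0 <= m < K) (2^-1 : R) ^+ m.+1 <= 1.
  suff -> : \sum_(0 <= m < K) (2^-1 : R) ^+ m.+1 = 1 - 2^-1 ^+ K.
   by rewrite lerBlDr lerDl exprn_ge0 // invr_ge0.
  elim:K=> [|K IH];first by rewrite big_nil expr0 subrr.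
  by rewrite big_nat_recr //= IH exprS;field.
 apply:(@le_trans _ _ (cabs w * cabs z ^+ 2 * \sum_(0 <= m < M - 2) (2^-1 : R) ^+ m.+1));last first.
  by rewrite ler_piMr ?half // mulr_ge0 ?cabs_ge0 ?exprn_ge0.
 rewrite mulr_sumr;apply:ler_sum=> m _.
 apply:le_trans (ler_norm _) (le_trans (Re_le_cabs _) _).
 rewrite [cabs (w * _)]cabsM [cabs (_ / _)]cabsM cabsX cabsV cabs_nat -mulrA ler_wpM2l ?cabs_ge0 // -addn2 exprD mulrAC.
 rewrite mulrC;apply:ler_wpM2l;first by rewrite exprn_ge0.
 apply:(@le_trans _ _ ((m + 2)`!%:R^-1)).
  by rewrite ler_piMl ?invr_ge0 // exprn_ile1.
 rewrite exprVn lef_pV2 ?posrE ?ltr0n ?fact_gt0 ?exprn_gt0 //.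
 rewrite -natrX ler_nat addn2;elim:m=> // m IH.
 by rewrite expnS factS leq_mul.
(* Tested against its own conjugate, the remainder has its squared modulus as real part. *)
have:= part (cexp z - 1 - z)^*;rewrite conjMz_cabs /= cabs_conj.
have [->|v0] := eqVneq (cabs (cexp z - 1 - z)) 0;first by rewrite exprn_ge0.
by rewrite expr2 ler_pM2l // lt_neqAle eq_sym v0 cabs_ge0.
Qed.
End ComplexExp.

(** * Inner products of coherent vectors *)

Section Coherent.
Variables (R : realType) (D : nat).
Local Notation C := R[i].
Implicit Types a b : ffun_hilbert R 'I_D.

Lemma sum_tuple_prodC (x : 'I_D -> C) m :
 \sum_(s : m.-tuple 'I_D) \prod_(i <- s) x i = (\sum_i x i) ^+ m.
Proof.
elim:m=> [|m IH].
 rewrite (eq_bigl (pred1 [tuple])) ?big_pred1_eq ?big_nil ?expr0 // => s.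
 by apply/esym/eqP;exact:tuple0.
rewrite exprS -IH mulr_suml.
under [RHS]eq_bigr do rewrite mulr_sumr.
rewrite pair_big /= (reindex (fun p : 'I_D * m.-tuple 'I_D=> [tuple of p.1 :: p.2])).
 by apply:eq_bigr=> -[i s] _;rewrite big_cons.
exists (fun s=> (thead s, [tuple of behead s]))=> [[i s] _|s _] /=.
 by rewrite theadE;congr pair;exact:val_inj.
by rewrite -tuple_eta.
Qed.

Lemma hdot_coh a b :
 hdot (coh a) (coh b) = cexp (hdot a b - ((hsq a + hsq b) / 2)%:C).
Proof.
pose ca:= expR (- (hsq a / 2));pose cb:= expR (- (hsq b / 2)).
rewrite cexpD.
have -> : cexp (- ((hsq a + hsq b) / 2)%:C) = (ca * cb)%:C.
 rewrite /cexp /= oppr0 cos0 sin0 mulr1 /ca /cb -expRD;congr (expR _)%:C;ring.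
rewrite -csum_exp mulrC -[RHS]addr0.
have -> : (0 : C) = csum (fun=> 0 : C).
 have -> : (fun=> 0 : C) = (fun m=> (-1) * ((hdot a b) ^+ m / m`!%:R) + (hdot a b) ^+ m / m`!%:R).
  by apply/funext=> m;rewrite mulN1r addNr.
 by rewrite csum_linear ?mulN1r ?addNr //;exact:csummable_exp.
rewrite -csum_linear;last first.
- have z : series (fun=> 0 : R) = (fun=> 0) by apply/funext=> m;rewrite /series /= big1.
 by split;rewrite /= z;exact:is_cvg_cst.
- exact:csummable_exp.
congr csum;apply/funext=> m;rewrite addr0 /level_dot /=.
rewrite -[ffun_dot a b]/(\sum_i (a i)^* * b i) -sum_tuple_prodC mulr_suml mulr_sumr.
apply:eq_bigr=> s _;rewrite /coh_fun size_tuple big_split /= rmorphM /= conjc_realE.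
rewrite -rmorph_prod -/ca -/cb.
have sq : (Num.sqrt (m`!%:R : R))^-1%:C * (Num.sqrt (m`!%:R : R))^-1%:C = m`!%:R^-1 :> C.
 by rewrite -rmorphM -invfM -expr2 sqr_sqrtr // fmorphV rmorph_nat.
rewrite -sq /ca /cb /hsq !rmorphM /=;ring.
Qed.
End Coherent.

(** * Calculus on the classes [diff_class] *)

Section DifferentiabilityClasses.
Variables (R : realType) (E : normedModType R).
Implicit Types (U : set E) (f g : E -> R) (n : nat).

Lemma open_near U a : open U -> U a -> \forall x \near a, U x.
Proof. by move=> oU Ua;apply:open_nbhs_nbhs. Qed.

Lemma diff_class_ext n U f g : open U -> (forall x, U x -> f x = g x) ->
 diff_class n U f -> diff_class n U g.
Proof.
move=> oU;elim:n f g=> [|n IH] f g fg.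
 move=> [cf _];split=> // x Ux.
 have e : \forall y \near x, f y = g y by apply:filterS (open_near oU Ux)=> y /fg.
 have:= cf x Ux;rewrite /prop_for /continuous_at -(fg x Ux).
 by apply:cvg_trans;apply:near_eq_cvg;apply:filterS e=> y ->.
move=> [cf h];have e x : U x -> \forall y \near x, f y = g y.
 by move=> Ux;apply:filterS (open_near oU Ux)=> y /fg.
split.
 move=> x Ux;have:= cf x Ux;rewrite /prop_for /continuous_at -(fg x Ux).
 by apply:cvg_trans;apply:near_eq_cvg;apply:filterS (e x Ux)=> y ->.
move=> v;have [dv cv] := h v;split.
 by move=> x Ux;apply:near_eq_derivable (dv x Ux);exact:e.
by apply:IH cv=> x Ux;apply:near_eq_derive;exact:e.
Qed.

Lemma diff_class_sub n (U W : set E) f : W `<=` U -> diff_class n U f -> diff_class n W f.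
Proof.
move=> WU;elim:n f=> [|n IH] f [cf h];split;try by move=> x /WU;exact:cf.
 by [].
by move=> v;have [dv cv] := h v;split;[move=> x /WU;exact:dv | exact:IH].
Qed.

Lemma diff_classW n U f : diff_class n.+1 U f -> diff_class n U f.
Proof.
elim:n f=> [|n IH] f [cf h];split=> // v.
by have [dv cv] := h v;split=> //;exact:IH.
Qed.

Lemma diff_class_cst n U (c : R) : diff_class n U (fun=> c).
Proof.
elim:n c=> [|n IH] c;split;try by move=> x _;exact:cvg_cst.
 by [].
move=> v;split=> [x _|];first exact:derivable_cst.
have -> : 'D_v (fun=> c) = (fun=> 0) :> (E -> R) by apply/funext=> x;exact:derive_cst.
exact:IH.
Qed.

Lemma diff_classD n U f g : open U -> diff_class n U f -> diff_class n U g ->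
 diff_class n U (fun x => f x + g x).
Proof.
move=> oU;elim:n f g=> [|n IH] f g [cf hf] [cg hg];split;
 try by move=> x Ux;apply:continuousD;[exact:cf | exact:cg].
 by [].
move=> v;have [df hdf] := hf v;have [dg hdg] := hg v;split=> [x Ux|].
 by apply:derivableD;[exact:df | exact:dg].
apply:(@diff_class_ext _ _ (fun x=> 'D_v f x + 'D_v g x))=> //;last exact:IH.
by move=> x Ux;rewrite -deriveD;[| exact:df | exact:dg].
Qed.

Lemma diff_classM n U f g : open U -> diff_class n U f -> diff_class n U g ->
 diff_class n U (fun x => f x * g x).
Proof.
move=> oU;elim:n f g=> [|n IH] f g hf hg.
 by case:hf hg=> cf _ [cg _];split=> // x Ux;apply:continuousM;[exact:cf | exact:cg].
have f1:= diff_classW hf;have g1:= diff_classW hg.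
case:hf hg=> cf hf [cg hg];split.
 by move=> x Ux;apply:continuousM;[exact:cf | exact:cg].
move=> v;have [df hdf] := hf v;have [dg hdg] := hg v;split=> [x Ux|].
 by apply:derivableM;[exact:df | exact:dg].
apply:(@diff_class_ext _ _ (fun x=> f x * 'D_v g x + g x * 'D_v f x))=> //.
 by move=> x Ux;rewrite -[LHS]/(f x *: 'D_v g x + g x *: 'D_v f x) -deriveM;[| exact:df | exact:dg].
by apply:diff_classD=> //;exact:IH.
Qed.

Lemma diff_classZ n U f c : open U -> diff_class n U f -> diff_class n U (fun x => c * f x).
Proof. by move=> oU;apply:diff_classM=> //;exact:diff_class_cst. Qed.

Lemma diff_classN n U f : open U -> diff_class n U f -> diff_class n U (fun x => - f x).
Proof.
move=> oU hf;apply:(@diff_class_ext _ _ (fun x=> -1 * f x))=> //;last exact:diff_classZ.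
by move=> x _;rewrite mulN1r.
Qed.

Lemma diff_classB n U f g : open U -> diff_class n U f -> diff_class n U g ->
 diff_class n U (fun x => f x - g x).
Proof. by move=> oU hf hg;apply:diff_classD=> //;exact:diff_classN. Qed.

Lemma diff_class_sum n U (I : Type) (r : seq I) (F : I -> E -> R) : open U ->
 (forall i, diff_class n U (F i)) -> diff_class n U (fun x => \sum_(i <- r) F i x).
Proof.
move=> oU h;elim:r=> [|i r IH].
 by under [X in diff_class _ _ X]funext do rewrite big_nil;exact:diff_class_cst.
under [X in diff_class _ _ X]funext do rewrite big_cons.
exact:diff_classD.
Qed.

Lemma diff_classV n U f : open U -> (forall x, U x -> f x != 0) -> diff_class n U f ->
 diff_class n U (fun x => (f x)^-1).
Proof.
move=> oU f0;elim:n=> [|n IH] hf.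
 by case:hf=> cf _;split=> // x Ux;apply:continuousV;[exact:f0 | exact:cf].
have {}IH:= IH (diff_classW hf);case:hf=> cf hf;split.
 by move=> x Ux;apply:continuousV;[exact:f0 | exact:cf].
move=> v;have [df hdf] := hf v;split=> [x Ux|].
 by apply:derivableV;[exact:f0 | exact:df].
apply:(@diff_class_ext _ _ (fun x=> - ((f x)^-1 * (f x)^-1 * 'D_v f x)))=> //.
 move=> x Ux;rewrite deriveV;[|exact:f0|exact:df].
 by rewrite -[RHS]/(- (f x) ^- 2 * 'D_v f x) mulNr expr2 invfM.
by apply:diff_classN=> //;do 2?[apply:diff_classM=> //].
Qed.

Lemma is_derive_line f (a v : E) (s df : R) : is_derive (s *: v + a) v f df ->
 is_derive s (1 : R) (fun t : R => f (t *: v + a)) df.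
Proof.
move=> [dv <-];have e : (fun h : R=> h^-1 *: (f (h *: v + (s *: v + a)) - f (s *: v + a))) =
  (fun h : R=> h^-1 *: (f ((h *: 1 + s) *: v + a) - f (s *: v + a))).
 by apply/funext=> h;rewrite scalerDl addrA -[h *: 1]/(h * 1) mulr1.
split;first exact:(eq_ind _ (fun q : R -> R=> cvg (q @ 0^')) dv _ e).
exact:(congr1 (fun q : R -> R=> lim (q @ 0^')) (esym e)).
Qed.

Lemma is_derive_translate f (w x v : E) (df : R) : is_derive (x + w) v f df ->
 is_derive x v (fun y => f (y + w)) df.
Proof.
move=> [dv <-];have e : (fun h : R=> h^-1 *: (f (h *: v + (x + w)) - f (x + w))) =
  (fun h : R=> h^-1 *: (f (h *: v + x + w) - f (x + w))).
 by apply/funext=> h;rewrite addrA.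
split;first exact:(eq_ind _ (fun q : R -> R=> cvg (q @ 0^')) dv _ e).
exact:(congr1 (fun q : R -> R=> lim (q @ 0^')) (esym e)).
Qed.

Lemma mvt_line f (a v : E) (s : R) :
 (forall t : R, `|t| <= `|s| -> derivable f (t *: v + a) v) ->
 exists2 c : R, `|c| <= `|s| & f (s *: v + a) - f a = s * 'D_v f (c *: v + a).
Proof.
move=> hd;have D t : `|t| <= `|s| -> is_derive t (1 : R) (fun t : R=> f (t *: v + a)) ('D_v f (t *: v + a)).
 by move=> ts;apply:is_derive_line;apply/derivableP/hd.
have C (x y : R) : (forall t, t \in `[x, y] -> `|t| <= `|s|) ->
  {within `[x, y], continuous (fun t : R=> f (t *: v + a))}.
 move=> h;apply:derivable_within_continuous=> t /h ts.
 by have [] := D t ts.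
have f0 : f (0 *: v + a) = f a by rewrite scale0r add0r.
have [s0|s0] := leP 0 s.
 have I t : t \in `[0, s] -> `|t| <= `|s|.
  by rewrite in_itv /= => /andP[t0 ts];rewrite !ger0_norm.
 have [c cI e] := MVT_segment s0 (fun t h=> D t (I t (subset_itv_oo_cc h))) (C _ _ I).
 by exists c;[exact:I | rewrite -f0 e subr0 mulrC].
have I t : t \in `[s, 0] -> `|t| <= `|s|.
 by rewrite in_itv /= => /andP[t0 ts];rewrite !ler0_norm ?lerN2 // ltW.
have [c cI e] := MVT_segment (ltW s0) (fun t h=> D t (I t (subset_itv_oo_cc h))) (C _ _ I).
exists c;first exact:I.
by rewrite -f0 -opprB e sub0r mulrN opprK mulrC.
Qed.
End DifferentiabilityClasses.

Lemma cts_dist (R : realType) (E : normedModType R) (f : E -> R) a eps :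
 {for a, continuous f} -> 0 < eps -> \forall x \near a, `|f x - f a| <= eps.
Proof.
by move=> cf e0;have /cvgrPdist_le/(_ eps e0) := cf;apply:filterS=> x;rewrite distrC.
Qed.

Lemma near_ball (R : realType) (E : normedModType R) (a : E) (P : E -> Prop) :
 (\forall x \near a, P x) -> exists2 rho : R, 0 < rho & forall x, `|x - a| < rho -> P x.
Proof. by move=> /nbhs_normP[rho /= r0 h];exists rho=> // x xa;apply:h;rewrite /= distrC. Qed.

Lemma near0_ball (R : realType) (E : normedModType R) (P : E -> Prop) (rho : R) :
 0 < rho -> (forall h : E, `|h| < rho -> P h) -> \forall h \near (0 : E), P h.
Proof.
move=> r0 hP;apply/nbhs_normP;exists rho=> //= h;rewrite /= sub0r normrN;exact:hP.
Qed.

Lemma cts_ball2 (R : realType) (E : normedModType R) (U : set E) (f g : E -> R) a (eps : R) :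
 open U -> U a -> {for a, continuous f} -> {for a, continuous g} -> 0 < eps ->
 exists2 rho : R, 0 < rho & forall x, `|x - a| < rho ->
  [/\ U x, `|f x - f a| <= eps & `|g x - g a| <= eps].
Proof.
move=> oU Ua cf cg e0;apply:near_ball.
near=> x;split;near: x;[exact:open_near | exact:cts_dist | exact:cts_dist].
Unshelve. all: by end_near. Qed.

Section RowVectors.
Variables (R : realType) (N : nat).
Local Notation E := 'rV[R]_N.
Local Notation ei := (fun i => delta_mx 0 i : E).

Lemma rV_norm_coord (x : E) i : `|x 0 i| <= `|x|.
Proof. by rewrite [leRHS]/Num.norm /= mx_normrE;exact:(le_bigmax _ _ (0, i)). Qed.

Lemma rV_norm_le (x : E) c : 0 <= c -> (forall i, `|x 0 i| <= c) -> `|x| <= c.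
Proof.
move=> c0 h;rewrite [leLHS]/Num.norm /= mx_normrE;apply:bigmax_le=> // -[i j] _.
by rewrite (ord1 i) h.
Qed.

Lemma derive_coord i (a v : E) : derivable (fun x : E => x 0 i) a v /\ 'D_v (fun x : E => x 0 i) a = v 0 i.
Proof.
have d : derivable (@id E) a v by exact:derivable_id.
split;first by move/derivable_mxP: d=> /(_ 0 i).
by have:= derive_mx d;rewrite derive_id=> /matrixP/(_ 0 i) ->;rewrite mxE.
Qed.

Lemma diff_class_coord n (U : set E) i : diff_class n U (fun x => x 0 i).
Proof.
case:n=> [|n];split;try by move=> x _;exact:coord_continuous.
 by [].
move=> v;split=> [x _|];first by case:(derive_coord i x v).
have -> : 'D_v (fun x : E=> x 0 i) = (fun=> v 0 i).
 by apply/funext=> x;case:(derive_coord i x v).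
exact:diff_class_cst.
Qed.

Variables (U : set E) (f : E -> R).
Hypothesis oU : open U.

(** [diff_class] speaks of directional derivatives only, while the chain rule needs a differential.
    It is obtained by moving one coordinate at a time with the mean value theorem. *)
Lemma diff_class1_differentiable a : U a -> diff_class 1 U f ->
 differentiable f a /\ forall v, 'd f a v = \sum_i v 0 i * 'D_(ei i) f a.
Proof.
move=> Ua [cf hf].
pose d (v : E) : R:= \sum_i v 0 i * 'D_(ei i) f a.
have dl : linear d.
 move=> c x y;rewrite /d scaler_sumr -big_split;apply:eq_bigr=> i _ /=.
 by rewrite !mxE mulrDl -mulrA.
pose dL : {linear E -> R} := HB.pack d (GRing.isLinear.Build _ _ _ _ _ dl).
have dB v : `|d v| <= (\sum_i `|'D_(ei i) f a|) * `|v|.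
 apply:le_trans (ler_norm_sum _ _ _) _;rewrite mulr_suml;apply:ler_sum=> i _.
 by rewrite normrM mulrC ler_wpM2l // rV_norm_coord.
have dc : continuous dL.
 apply:(@bounded_linear_continuous _ _ _ dL);apply/linear_boundedP.
 exists (\sum_i `|'D_(ei i) f a|);rewrite num_real;split=> // M hM x.
 by apply:le_trans (dB x) _;rewrite ler_wpM2r // ltW.
have key : f \o shift a = cst (f a) + dL +o_ (0 : E) id.
 apply/eqaddoP=> _/posnumP[eps].
 (* Each of the N coordinate steps may cost eps / (N + 1); the successor covers N = 0. *)
 pose e' := eps%:num / N.+1%:R;have e'0 : 0 < e' by rewrite divr_gt0.
 have [rho rho0 hrho] : exists2 rho : R, 0 < rho & forall x, `|x - a| < rho ->
   U x /\ forall i : 'I_N, `|'D_(ei i) f x - 'D_(ei i) f a| <= e'.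
  apply:near_ball;near=> x;split;first by near: x;apply:open_nbhs_nbhs.
  near: x;apply:(@filter_forall _ _ (fun i : 'I_N=> [set x | `|'D_(ei i) f x - 'D_(ei i) f a| <= e']) (nbhs a))=> i.
  exact:(cts_dist (proj1 (proj2 (hf (ei i))) a Ua) e'0).
 suff H (h : E) : `|h| < rho -> `|((f \o shift a) - (cst (f a) + dL)) h| <= eps%:num * `|h|.
  exact:(near0_ball rho0 H).
 move=> hr.
 (* A path from 0 to h along the coordinate axes. *)
 pose p m : E:= \row_i (if (i < m)%N then h 0 i else 0).
 have pE (m : 'I_N) : p m.+1 = h 0 m *: ei m + p m.
  apply/rowP=> i;rewrite !mxE eqxx /= ltnS leq_eqVlt val_eqE eq_sym.
  by case:eqVneq=> [<-|mi];rewrite ?ltnn ?mulr1 ?addr0 // mulr0 add0r.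
 have step (m : 'I_N) : `|f (p m.+1 + a) - f (p m + a) - h 0 m * 'D_(ei m) f a| <= e' * `|h|.
  have nrm (t : R) : `|t| <= `|h 0 m| -> `|t *: ei m + (p m + a) - a| < rho.
   move=> th;rewrite addrA addrK;apply:le_lt_trans hr;apply:rV_norm_le=> // i.
   rewrite !mxE eqxx /= eq_sym;case:eqVneq=> [->|mi].
    by rewrite ltnn addr0 mulr1;apply:le_trans th _;exact:rV_norm_coord.
   by rewrite mulr0 add0r;case:ifP;rewrite ?normr0 // rV_norm_coord.
  have [|c ch e] := @mvt_line R E f (p m + a) (ei m) (h 0 m).
   by move=> t /nrm/hrho[Ut _];case:(hf (ei m))=> dv _;exact:dv.
  rewrite pE -[_ + p m + a]addrA e -mulrBr normrM mulrC;apply:ler_pM=> //;last exact:rV_norm_coord.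
  by have [_] := hrho _ (nrm _ ch);apply.
 have p0 : p 0%N = 0 by apply/rowP=> i;rewrite !mxE.
 have pN : p N = h by apply/rowP=> i;rewrite !mxE ltn_ord.
 have -> : ((f \o shift a) - (cst (f a) + dL)) h =
   \sum_(m < N) (f (p m.+1 + a) - f (p m + a) - h 0 m * 'D_(ei m) f a).
  rewrite sumrB -(big_mkord xpredT (fun m=> f (p m.+1 + a) - f (p m + a))) telescope_sumr //.
  by rewrite p0 pN add0r -[LHS]/(f (h + a) - (f a + d h)) opprD addrA.
 apply:le_trans (ler_norm_sum _ _ _) _.
 apply:(@le_trans _ _ (\sum_(m < N) e' * `|h|));first by apply:ler_sum.
 rewrite sumr_const card_ord -mulr_natl mulrA ler_wpM2r // /e' mulrCA ler_piMr //.
 by rewrite ler_pdivrMr ?ltr0n // mul1r ler_nat.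
split;first by apply/diff_locallyP;rewrite (diff_unique dc key).
by move=> v;rewrite (diff_unique dc key).
Unshelve. all: by end_near. Qed.

(** Only the derivative of x in the one direction v is given, so the composition is restricted to
    the line through e, where derivable means differentiable. *)
Lemma is_derive_chain (F : normedModType R) (x : F -> E) (e v : F) (dx : 'I_N -> R) :
 diff_class 1 U f -> U (x e) -> (forall i, is_derive e v (fun y => x y 0 i) (dx i)) ->
 is_derive e v (fun y => f (x y)) (\sum_i dx i * 'D_(ei i) f (x e)).
Proof.
move=> hf Ux hx;have [df dfE] := diff_class1_differentiable Ux hf.
pose y (t : R) := x (t *: v + e).
have dy : derivable y 0 1.
 by apply/derivable_mxP=> i j;rewrite (ord1 i);have [h _] := hx j;exact:(proj1 (derivable1P (fun y=> x y 0 j) e v) h).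
have y0 : y 0 = x e by rewrite /y scale0r add0r.
have dyE j : ('D_1 y 0) 0 j = dx j.
 rewrite derive_mx // mxE.
 have : is_derive (0 *: v + e) v (fun y=> x y 0 j) (dx j) by rewrite scale0r add0r.
 by move=> /is_derive_line h;rewrite derive_val.
have dify : differentiable y 0 by exact/derivable1_diffP.
have dify' : differentiable f (y 0) by rewrite y0.
have c : differentiable (f \o y) 0 by exact:differentiable_comp.
have D : 'D_1 (f \o y) 0 = \sum_i dx i * 'D_(ei i) f (x e).
 rewrite (@deriveE _ _ _ (f \o y) (0 : R) (1 : R) c) (diff_comp dify dify') /=.
 rewrite -(@deriveE _ _ _ y (0 : R) (1 : R) dify) y0 dfE.
 by apply:eq_bigr=> i _;rewrite dyE.
have e1 : (fun h : R=> h^-1 *: (f (y (h *: 1 + 0)) - f (y 0))) =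
  (fun h : R=> h^-1 *: (f (x (h *: v + e)) - f (x e))).
 by apply/funext=> h;rewrite y0 /y addr0 -[h *: 1]/(h * 1) mulr1.
have dd : derivable (f \o y) 0 1 by exact/derivable1_diffP.
split.
 by move:dd;rewrite /derivable /= e1.
by move:D;rewrite /derive /= e1.
Qed.
End RowVectors.

Lemma rV_continuous (R : realType) (F : topologicalType) N (x : F -> 'rV[R]_N) e :
 (forall i, {for e, continuous (fun y => x y 0 i)}) -> {for e, continuous x}.
Proof.
move=> h;apply/cvgrPdist_le=> eps e0;near=> y.
apply:rV_norm_le;first exact:ltW.
move=> i;rewrite !mxE;move:i;near: y;apply:filter_forall=> i.
by have /cvgrPdist_le:= h i;apply.
Unshelve. all: by end_near. Qed.

Lemma diff_class_comp (R : realType) (F : normedModType R) N n (U : set 'rV[R]_N) (W : set F)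
  (f : 'rV[R]_N -> R) (x : F -> 'rV[R]_N) : open U -> open W ->
 (forall y, W y -> U (x y)) -> diff_class n U f ->
 (forall i, diff_class n W (fun y => x y 0 i)) -> diff_class n W (fun y => f (x y)).
Proof.
move=> oU oW xU;elim:n f=> [|n IH] f.
 move=> [cf _] hx;split=> // y Wy;apply:(@continuous_comp _ _ _ x f);last exact/cf/xU.
 by apply:rV_continuous=> i;case:(hx i)=> cx _;exact:cx.
move=> hf hx.
have f1 : diff_class 1 U f by elim:n hf {IH hx} => // n IHn /diff_classW.
have D v y : W y -> is_derive y v (fun y=> f (x y)) (\sum_i 'D_v (fun y=> x y 0 i) y * 'D_(delta_mx 0 i) f (x y)).
 move=> Wy;apply:(is_derive_chain oU f1 (xU y Wy))=> i.
 by have [_ /(_ v)[dx _]] := hx i;exact/derivableP/dx.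
case:(hf)=> cf hdf;split.
 move=> y Wy;apply:(@continuous_comp _ _ _ x f);last exact/cf/xU.
 by apply:rV_continuous=> i;case:(hx i)=> cx _;exact:cx.
move=> v;split;first by move=> y Wy;have [] := D v y Wy.
apply:(@diff_class_ext _ _ _ _ (fun y=> \sum_i 'D_v (fun y=> x y 0 i) y * 'D_(delta_mx 0 i) f (x y)))=> //.
 by move=> y Wy;have:= D v y Wy=> h;rewrite derive_val.
apply:diff_class_sum=> // i;apply:diff_classM=> //.
 by have [_ /(_ v)[]] := hx i.
have h1 : diff_class n U ('D_(delta_mx 0 i) f) by have [_] := hdf (delta_mx 0 i).
exact:(IH ('D_(delta_mx 0 i) f) h1 (fun j=> diff_classW (hx j))).
Qed.

(* both mixed derivatives are limits of the same second difference quotient *)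
Lemma schwarz (R : realType) (E : normedModType R) (U : set E) (f : E -> R) (u v a : E) :
 open U -> U a -> diff_class 2 U f -> 'D_u ('D_v f) a = 'D_v ('D_u f) a.
Proof.
move=> oU Ua [_ hf];have [du cu] := hf u;have [dv cv] := hf v.
have [_ /(_ v)[dvu [cvu _]]] := cu;have [_ /(_ u)[duv [cuv _]]] := cv.
suff H (eps : R) : 0 < eps -> `|'D_u ('D_v f) a - 'D_v ('D_u f) a| <= eps.
 by apply/eqP;rewrite -subr_eq0 -normr_le0;apply/ler_addgt0Pl=> eps /H;rewrite addr0.
move=> e0.
have [rho rho0 hrho] : exists2 rho : R, 0 < rho & forall x, `|x - a| < rho ->
  [/\ U x, `|'D_u ('D_v f) x - 'D_u ('D_v f) a| <= eps / 2 & `|'D_v ('D_u f) x - 'D_v ('D_u f) a| <= eps / 2].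
 exact:(cts_ball2 oU Ua (cuv a Ua) (cvu a Ua) (divr_gt0 e0 (ltr0n _ 2))).
pose s:= rho / (2 * (1 + `|u| + `|v|)).
have k0 : 0 < 1 + `|u| + `|v| by rewrite ltr_pwDl // ltr_wpDr.
have s0 : 0 < s by rewrite divr_gt0 // mulr_gt0.
have small (t t' : R) : `|t| <= s -> `|t'| <= s -> `|t *: u + (t' *: v + a) - a| < rho.
 move=> ts t's;rewrite addrA addrK;apply:le_lt_trans (ler_normD _ _) _;rewrite !normrZ.
 apply:(@le_lt_trans _ _ (s * `|u| + s * `|v|)).
  by apply:lerD;rewrite ler_wpM2r.
 have -> : rho = s * (2 * (1 + `|u| + `|v|)) by rewrite /s divfK // mulf_neq0 // gt_eqF.
 by rewrite -mulrDr ltr_pM2l //;have:= normr_ge0 u;have:= normr_ge0 v;lra.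
have ss : `|s| <= s by rewrite ger0_norm // ltW.
have z0 : `|0 : R| <= s by rewrite normr0 ltW.
have sE : `|s| = s by rewrite ger0_norm // ltW.
have S1 : exists2 x, `|x - a| < rho & f (s *: u + (s *: v + a)) - f (s *: u + a) - (f (s *: v + a) - f a) = s ^+ 2 * 'D_v ('D_u f) x.
 pose F y:= f (y + s *: v) - f y.
 have dF (t : R) : `|t| <= `|s| -> is_derive (t *: u + a) u F ('D_u f (t *: u + (s *: v + a)) - 'D_u f (t *: u + a)).
  rewrite sE=> ts;apply:is_deriveB.
   apply:is_derive_translate;rewrite -addrA [a + _]addrC.
   by apply/derivableP/du;have [] := hrho _ (small _ _ ts ss).
  by apply/derivableP/du;have:= small t 0 ts z0;rewrite scale0r add0r=> /hrho[].
 have [|c cs e] := @mvt_line R E F a u s;first by move=> t /dF[].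
 rewrite sE in cs;have cs' : `|c| <= `|s| by rewrite sE.
 have:= dF c cs'=> h;rewrite derive_val in e.
 have [|c' cs2 e'] := @mvt_line R E ('D_u f) (c *: u + a) v s.
  move=> t;rewrite sE=> ts;apply:dvu;rewrite addrCA;by have [] := hrho _ (small _ _ cs ts).
 rewrite sE in cs2;exists (c *: u + (c' *: v + a));first exact:small.
 have -> : s ^+ 2 * 'D_v ('D_u f) (c *: u + (c' *: v + a)) = s * (s * 'D_v ('D_u f) (c' *: v + (c *: u + a))).
  rewrite (addrCA (c' *: v) (c *: u) a);move:('D_v ('D_u f) _)=> w.
  by rewrite expr2 mulrA.
 by rewrite -e' (addrCA (s *: v)) -e /F -(addrA (s *: u)) (addrC a).
have S2 : exists2 x, `|x - a| < rho & f (s *: u + (s *: v + a)) - f (s *: u + a) - (f (s *: v + a) - f a) = s ^+ 2 * 'D_u ('D_v f) x.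
 pose F y:= f (y + s *: u) - f y.
 have dF (t : R) : `|t| <= `|s| -> is_derive (t *: v + a) v F ('D_v f (s *: u + (t *: v + a)) - 'D_v f (t *: v + a)).
  rewrite sE=> ts;apply:is_deriveB.
   apply:is_derive_translate;rewrite addrC.
   by apply/derivableP/dv;have [] := hrho _ (small _ _ ss ts).
  by apply/derivableP/dv;have:= small 0 t z0 ts;rewrite scale0r add0r=> /hrho[].
 have [|c cs e] := @mvt_line R E F a v s;first by move=> t /dF[].
 rewrite sE in cs;have cs' : `|c| <= `|s| by rewrite sE.
 have:= dF c cs'=> h;rewrite derive_val in e.
 have [|c' cs2 e'] := @mvt_line R E ('D_v f) (c *: v + a) u s.
  by move=> t;rewrite sE=> ts;apply:duv;have [] := hrho _ (small _ _ ts cs).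
 rewrite sE in cs2;exists (c' *: u + (c *: v + a));first exact:small.
 rewrite expr2 -mulrA -e' -e /F -(addrA (s *: v)) (addrC a) (addrCA (s *: v)).
 ring.
have [x xa ex] := S1;have [y ya ey] := S2.
have xy : 'D_v ('D_u f) x = 'D_u ('D_v f) y.
 have : s ^+ 2 * 'D_v ('D_u f) x = s ^+ 2 * 'D_u ('D_v f) y by rewrite -ex -ey.
 by apply:mulfI;rewrite expf_neq0 // gt_eqF.
have [_ _ h1] := hrho x xa;have [_ h2 _] := hrho y ya;rewrite xy in h1.
move:h1 h2;move:('D_u ('D_v f) y) ('D_u ('D_v f) a) ('D_v ('D_u f) a)=> w w1 w2 h1 h2.
have -> : w1 - w2 = (w - w2) - (w - w1) by ring.
by apply:le_trans (ler_normB _ _) _;rewrite [leRHS]splitr lerD.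
Qed.

(** * Entrywise norm of matrices and linear maps between them *)

Section MatrixNorm.
Variable R : realType.
Local Notation C := R[i].

Definition mxn m n (A : 'M[C]_(m, n)) : R := \sum_i \sum_j cabs (A i j).

Lemma mxn_ge0 m n (A : 'M[C]_(m, n)) : 0 <= mxn A.
Proof. by apply:sumr_ge0=> i _;apply:sumr_ge0=> j _;exact:cabs_ge0. Qed.
Lemma mxn0 m n : mxn (0 : 'M[C]_(m, n)) = 0.
Proof. by rewrite /mxn big1 // => i _;rewrite big1 // => j _;rewrite mxE cabs0. Qed.
Lemma mxnD m n (A B : 'M[C]_(m, n)) : mxn (A + B) <= mxn A + mxn B.
Proof.
rewrite /mxn -big_split;apply:ler_sum=> i _;rewrite -big_split.
by apply:ler_sum=> j _ /=;rewrite mxE cabsD.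
Qed.
Lemma mxnZ m n a (A : 'M[C]_(m, n)) : mxn (a *: A) = cabs a * mxn A.
Proof.
rewrite /mxn mulr_sumr;apply:eq_bigr=> i _;rewrite mulr_sumr.
by apply:eq_bigr=> j _;rewrite mxE cabsM.
Qed.
Lemma mxnN m n (A : 'M[C]_(m, n)) : mxn (- A) = mxn A.
Proof. by rewrite /mxn;do 2![apply:eq_bigr=> ? _];rewrite mxE cabsN. Qed.
Lemma mxnB m n (A B : 'M[C]_(m, n)) : mxn (A - B) <= mxn A + mxn B.
Proof. by rewrite -(mxnN B) mxnD. Qed.
Lemma mxn_sum m n (I : Type) (r : seq I) (P : pred I) (F : I -> 'M[C]_(m, n)) :
 mxn (\sum_(i <- r | P i) F i) <= \sum_(i <- r | P i) mxn (F i).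
Proof.
elim/big_ind2: _=> [|x u y v xu yv|//];first by rewrite mxn0.
exact:le_trans (mxnD _ _) (lerD xu yv).
Qed.
Lemma cabs_le_mxn m n (A : 'M[C]_(m, n)) i j : cabs (A i j) <= mxn A.
Proof.
rewrite /mxn (bigD1 i) //= (bigD1 j) //= -addrA lerDl addr_ge0 //.
 by apply:sumr_ge0=> ? _;exact:cabs_ge0.
by apply:sumr_ge0=> ? _;apply:sumr_ge0=> ? _;exact:cabs_ge0.
Qed.
Lemma mxn_eq0 m n (A : 'M[C]_(m, n)) : mxn A <= 0 -> A = 0.
Proof.
move=> A0;apply/matrixP=> i j;rewrite mxE;apply/eqP;rewrite -cabs_eq0.
by rewrite eq_le cabs_ge0 andbT (le_trans (cabs_le_mxn _ _ _)).
Qed.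
Lemma mxnM m n p (A : 'M[C]_(m, n)) (B : 'M[C]_(n, p)) : mxn (A *m B) <= mxn A * mxn B.
Proof.
rewrite {1 2}/mxn mulr_suml;apply:ler_sum=> i _.
apply:(@le_trans _ _ (\sum_j \sum_k cabs (A i k) * cabs (B k j))).
 apply:ler_sum=> j _;rewrite mxE;apply:le_trans (cabs_sum _ _ _) _.
 by apply:ler_sum=> k _;rewrite cabsM.
rewrite exchange_big mulr_suml;apply:ler_sum=> k _ /=.
rewrite -mulr_sumr ler_wpM2l ?cabs_ge0 // /mxn (bigD1 k) //= lerDl.
by apply:sumr_ge0=> ? _;apply:sumr_ge0=> ? _;exact:cabs_ge0.
Qed.
Lemma mxn_adj m n (A : 'M[C]_(m, n)) : mxn (A^t*) = mxn A.
Proof.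
rewrite /mxn exchange_big;do 2![apply:eq_bigr=> ? _].
by rewrite !mxE cabs_conj.
Qed.
Lemma mxn_tr n (A : 'M[C]_n) : cabs (\tr A) <= mxn A.
Proof.
apply:le_trans (cabs_sum _ _ _) _;apply:ler_sum=> i _.
by rewrite (bigD1 i) //= lerDl;apply:sumr_ge0=> ? _;exact:cabs_ge0.
Qed.
Lemma mxn_vec m n (A : 'M[C]_(m, n)) : mxn (mxvec A) = mxn A.
Proof.
rewrite {1}/mxn big_ord1 /mxn pair_bigA (reindex _ (curry_mxvec_bij m n)) /=.
by apply:eq_bigr=> -[i j] _;rewrite mxvecE.
Qed.

Definition mxlinear m n m' n' (f : 'M[C]_(m, n) -> 'M[C]_(m', n')) :=
 forall a x y, f (a *: x + y) = a *: f x + f y.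

Section Lin.
Variables (m n m' n' : nat) (f : 'M[C]_(m, n) -> 'M[C]_(m', n')).
Hypothesis lf : mxlinear f.
Lemma mxlin0 : f 0 = 0.
Proof. by have:= lf (-1) 0 0;rewrite scaler0 addr0 scaleN1r addNr. Qed.
Lemma mxlinD x y : f (x + y) = f x + f y.
Proof. by rewrite -[x in LHS]scale1r lf scale1r. Qed.
Lemma mxlinZ a x : f (a *: x) = a *: f x.
Proof. by rewrite -[a *: x]addr0 lf mxlin0 addr0. Qed.
Lemma mxlinB x y : f (x - y) = f x - f y.
Proof. by rewrite addrC -scaleN1r lf scaleN1r addrC. Qed.
Lemma mxlin_sum (I : Type) (r : seq I) (P : pred I) (F : I -> 'M[C]_(m, n)) :
 f (\sum_(i <- r | P i) F i) = \sum_(i <- r | P i) f (F i).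
Proof. by apply:(big_morph f mxlinD mxlin0). Qed.
Lemma mxlinE x : f x = \sum_i \sum_j x i j *: f (delta_mx i j).
Proof.
rewrite {1}(matrix_sum_delta x) mxlin_sum;apply:eq_bigr=> i _.
by rewrite mxlin_sum;apply:eq_bigr=> j _;rewrite mxlinZ.
Qed.
Lemma mxlin_bound (B : R) : (forall i j, mxn (f (delta_mx i j)) <= B) ->
 forall x, mxn (f x) <= B * mxn x.
Proof.
move=> hB x;rewrite mxlinE;apply:le_trans (mxn_sum _ _ _) _.
rewrite {2}/mxn mulr_sumr;apply:ler_sum=> i _;apply:le_trans (mxn_sum _ _ _) _.
rewrite mulr_sumr;apply:ler_sum=> j _;rewrite mxnZ mulrC.
by rewrite ler_wpM2r ?cabs_ge0.
Qed.
End Lin.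

(** Finite dimension, through the matrix of f on vectorized matrices. The bound B measures
    correctors and perturbations later on. *)
Lemma mxlin_inverse m n (f : 'M[C]_(m, n) -> 'M[C]_(m, n)) : mxlinear f ->
 (forall x, f x = 0 -> x = 0) ->
 exists2 B : R, 0 <= B & forall y, exists2 x, f x = y & mxn x <= B * mxn y.
Proof.
move=> lf injf.
pose F : {linear 'M[C]_(m, n) -> 'M[C]_(m, n)} :=
 HB.pack f (GRing.isLinear.Build _ _ _ _ f lf).
pose L:= lin_mx F.
have uL : L \in unitmx.
 rewrite unitmxE unitfE;apply/negP=> /det0P[v v0 vL].
 case/negP: v0;have:= injf (vec_mx v);rewrite -[v]vec_mxK mul_vec_lin in vL.
 have e : f (vec_mx v) = 0.
  by apply/eqP;rewrite -(mxvec_eq0 (f (vec_mx v)));apply/eqP.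
 by move=> /(_ e) h;rewrite -[v]vec_mxK h linear0.
exists (mxn (invmx L));first exact:mxn_ge0.
move=> y;exists (vec_mx (mxvec y *m invmx L)).
 apply:(can_inj (@mxvecK _ m n));rewrite -[f _]/(F _) -mul_vec_lin vec_mxK.
 by rewrite mulmxKV.
rewrite -mxn_vec vec_mxK mulrC -(mxn_vec y);exact:mxnM.
Qed.

(** The split characteristic polynomial turns Cayley-Hamilton into a finite chain of factors L - a.
    The decay off the unit circle is proved by induction along this chain, in place of a Jordan
    form. *)
Lemma cayley_hamilton_list n (L : 'M[C]_n) : exists s : seq C,
 foldr (fun a M => (L - a%:M) *m M) 1%:M s = 0 :> 'M[C]_n.
Proof.
case:n L=> [|n] L;first by exists [::];apply/matrixP=> -[].
have [s sE] := closed_field_poly_normal (char_poly L).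
exists s;have:= Cayley_Hamilton L;rewrite sE (monicP (char_poly_monic L)) scale1r.
rewrite rmorph_prod /=.
have -> : \prod_(i <- s) horner_mx L ('X - i%:P) = foldr (fun a M=> (L - a%:M) *m M) 1%:M s.
 elim:s {sE} => [|a s IH];first by rewrite big_nil.
 by rewrite big_cons IH /= rmorphB /= horner_mx_X horner_mx_C.
by [].
Qed.

Lemma prod_spectrum m n (T : 'M[C]_(m, n) -> 'M[C]_(m, n)) : mxlinear T ->
 exists s : seq C, forall X, foldl (fun Y a => T Y - a *: Y) X s = 0.
Proof.
move=> lT.
pose F : {linear 'M[C]_(m, n) -> 'M[C]_(m, n)} :=
 HB.pack T (GRing.isLinear.Build _ _ _ _ T lT).
have [s sE] := cayley_hamilton_list (lin_mx F).
exists s=> X;apply:(can_inj (@mxvecK _ m n));rewrite linear0.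
suff E (Y : 'M[C]_(m, n)) : mxvec (foldl (fun Y a=> T Y - a *: Y) Y s)
  = mxvec Y *m foldr (fun a M=> (lin_mx F - a%:M) *m M) 1%:M s.
 by rewrite E sE mulmx0.
elim:s {sE} Y=> [|a s IH] Y /=;first by rewrite mulmx1.
rewrite IH mulmxA;congr (_ *m _);rewrite linearB linearZ /= mulmxBr mul_mx_scalar.
by rewrite -[T Y]/(F Y) -mul_vec_lin.
Qed.
End MatrixNorm.

(** * Powers of the root of unity *)

Section RootOfUnity.
Variable R : realType.
Local Notation C := R[i].
Local Notation gam := (@Defs.root_of_unity R).

Lemma cexp_i (x : R) : cexp (x%:C * 'i%C) = (cos x +i* sin x)%C.
Proof.
rewrite /cexp Defs.ReM Defs.ImM /=.
have -> : x * 0 - 0 * 1 = 0 by ring.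
have -> : x * 1 + 0 * 0 = x by ring.
by rewrite expR0 mul1r.
Qed.

Lemma root_of_unity_cexp p : gam p = cexp ((2 * pi / p%:R)%:C * 'i%C).
Proof. by rewrite cexp_i. Qed.

Lemma cabs_root p : cabs (gam p) = 1.
Proof. by rewrite cabs_sqrt /sqn /= cos2Dsin2 sqrtr1. Qed.

Lemma root_conj p : (gam p)^* * gam p = 1.
Proof. by rewrite conjMz_cabs cabs_root expr1n. Qed.

Lemma rouX p j : gam p ^+ j = cexp ((j%:R * (2 * pi / p%:R))%:C * 'i%C).
Proof.
rewrite root_of_unity_cexp -cexpMn;congr cexp.
by rewrite mulrA [in RHS]rmorphM rmorph_nat.
Qed.

Lemma root_expr p : (0 < p)%N -> gam p ^+ p = 1.
Proof.
move=> p0;rewrite rouX cexp_i.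
have -> : p%:R * (2 * pi / p%:R) = 2 * pi :> R by field;rewrite pnatr_eq0 -lt0n.
have -> : 2 * pi = pi + pi :> R by rewrite mulr_natl mulr2n.
by rewrite cosD sinD cospi sinpi;apply:complexP=> /=;ring.
Qed.

Lemma root_primitive p j : (0 < j < p)%N -> gam p ^+ j != 1.
Proof.
move=> /andP[j0 jp];have p0 : (0 < p)%N by apply:leq_trans jp.
apply/eqP;rewrite rouX cexp_i.
(* Real parts suffice: cos x = 1 - 2 sin^2 (x / 2) with 0 < x / 2 < pi. *)
move/(congr1 (@complex.Re R))=> /=.
set x : R:= j%:R * _=> cx.
have x0 : 0 < x / 2.
 by rewrite /x !divr_gt0 ?mulr_gt0 ?invr_gt0 ?ltr0n ?pi_gt0.
have xpi : x / 2 < pi.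
 have -> : x / 2 = pi * (j%:R / p%:R) by rewrite /x;field;rewrite pnatr_eq0 -lt0n.
 by rewrite gtr_pMr ?pi_gt0 // ltr_pdivrMr ?ltr0n // mul1r ltr_nat.
have:= sin_gt0_pi;move/(_ _ (x / 2));rewrite x0 xpi=> /(_ isT) s0.
have : cos x = 1 - 2 * sin (x / 2) ^+ 2.
 have {1}-> : x = x / 2 + x / 2 by field.
 by rewrite cosD -!expr2 cos2sin2;ring.
rewrite cx=> /eqP;rewrite eq_sym subr_eq addrC -subr_eq subrr eq_sym.
by rewrite mulf_eq0 pnatr_eq0 /= sqrf_eq0 (gt_eqF s0).
Qed.

Lemma cabs_rootX p j : cabs (gam p ^+ j) = 1.
Proof. by rewrite cabsX cabs_root expr1n. Qed.

Lemma root_neq p (i j : 'I_p) : i != j -> gam p ^+ i != gam p ^+ j.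
Proof.
wlog ij : i j / (i < j)%N.
 move=> W ne;have [ij|ji|/val_inj e] := ltngtP i j;first exact:W.
  by rewrite eq_sym;apply:W=> //;rewrite eq_sym.
 by rewrite e eqxx in ne.
move=> _;apply/eqP=> e.
have g0 : gam p ^+ i != 0 by rewrite -cabs_eq0 cabs_rootX oner_eq0.
have:= @root_primitive p (j - i)%N.
rewrite subn_gt0 ij (leq_ltn_trans (leq_subr _ _) (ltn_ord j))=> /(_ isT) /eqP;apply.
by apply:(mulfI g0);rewrite -exprD subnKC ?(ltnW ij) // mulr1 e.
Qed.
End RootOfUnity.

(** * Kraus operators and the deformed channel *)

Section Kraus.
Variables (R : realType) (d k : nat).
Local Notation C := R[i].
Local Notation isom := 'M[C]_(d * k, d).
Implicit Types (V W A B : isom) (X Y : 'M[C]_d).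

Lemma sum_tens (M : nmodType) (F : 'I_(d * k) -> M) :
 \sum_s F s = \sum_a \sum_i F (mxtens_index (a, i)).
Proof.
rewrite pair_bigA (reindex (@mxtens_index d k)) /=;first by apply:eq_bigr=> -[].
exists (@mxtens_unindex d k)=> [x _|x _];first exact:mxtens_indexK.
exact:mxtens_unindexK.
Qed.

Lemma kraus_linear V W a i : kraus (a *: V + W) i = a *: kraus V i + kraus W i.
Proof. by apply/matrixP=> x y;rewrite !mxE. Qed.
Lemma krausD V W i : kraus (V + W) i = kraus V i + kraus W i.
Proof. by apply/matrixP=> x y;rewrite !mxE. Qed.
Lemma krausZ V a i : kraus (a *: V) i = a *: kraus V i.
Proof. by apply/matrixP=> x y;rewrite !mxE. Qed.
Lemma kraus_mul V X i : kraus (V *m X) i = kraus V i *m X.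
Proof. by apply/matrixP=> x y;rewrite !mxE;apply:eq_bigr=> j _;rewrite mxE. Qed.
Lemma kraus_tens V X i : kraus ((X *t (1%:M : 'M[C]_k)) *m V) i = X *m kraus V i.
Proof.
apply/matrixP=> x y;rewrite !mxE sum_tens;apply:eq_bigr=> a _.
rewrite (bigD1 i) //= tensmxE !mxE eqxx mulr1 big1 ?addr0 // => j ji.
by rewrite tensmxE mxE eq_sym (negPf ji) mulr0 mul0r.
Qed.
Lemma adj_mulE V W : V^t* *m W = \sum_i (kraus V i)^t* *m kraus W i.
Proof.
apply/matrixP=> x y;rewrite mxE summxE sum_tens exchange_big;apply:eq_bigr=> i _ /=.
by rewrite mxE;apply:eq_bigr=> a _;rewrite !mxE.
Qed.

(** The channel deformed by two isometries: its n-th iterate carries the inner products between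
    output vectors of V and of W, see [iter_chan2_word]. *)
Definition chan2 V W X : 'M[C]_d := V^t* *m (X *t (1%:M : 'M[C]_k)) *m W.

Lemma chan2E V W X : chan2 V W X = \sum_i (kraus V i)^t* *m X *m kraus W i.
Proof.
rewrite /chan2 -mulmxA adj_mulE;apply:eq_bigr=> i _.
by rewrite kraus_tens mulmxA.
Qed.

Lemma chan2_linear V W : mxlinear (chan2 V W).
Proof.
move=> a X Y;rewrite !chan2E scaler_sumr -big_split;apply:eq_bigr=> i _ /=.
by rewrite mulmxDr mulmxDl -scalemxAr -scalemxAl.
Qed.

Lemma chan2DZl V V' W a X : chan2 (a *: V + V') W X = a^* *: chan2 V W X + chan2 V' W X.
Proof.
rewrite !chan2E scaler_sumr -big_split;apply:eq_bigr=> i _ /=.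
by rewrite kraus_linear linearD linearZ /= map_mxD map_mxZ !mulmxDl -!scalemxAl.
Qed.

Lemma chan2DZr V W W' a X : chan2 V (a *: W + W') X = a *: chan2 V W X + chan2 V W' X.
Proof.
rewrite !chan2E scaler_sumr -big_split;apply:eq_bigr=> i _ /=.
by rewrite kraus_linear mulmxDr -!scalemxAr.
Qed.

Definition colsq n (u : 'cV[C]_n) : R := \sum_i cabs (u i 0) ^+ 2.
(** By scaling u against v this says that the operator norm is at most c. In this form it passes
    through [chan2] of two isometries without loss, which the entrywise norm does not. *)
Definition opbound X (c : R) := forall u v : 'cV[C]_d,
 cabs ((u^t* *m X *m v) 0 0) <= c * ((colsq u + colsq v) / 2).

Lemma colsq_ge0 n (u : 'cV[C]_n) : 0 <= colsq u.
Proof. by apply:sumr_ge0=> i _;rewrite exprn_ge0 ?cabs_ge0. Qed.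

Lemma colsqE n (u : 'cV[C]_n) : (u^t* *m u) 0 0 = (colsq u)%:C.
Proof. by rewrite mxE rmorph_sum;apply:eq_bigr=> i _;rewrite !mxE conjMz_cabs. Qed.

Lemma isometry_colsq V (u : 'cV[C]_d) : V^t* *m V = 1%:M ->
 \sum_i colsq (kraus V i *m u) = colsq u.
Proof.
move=> iV;apply:(@complexI R).
transitivity ((u^t* *m (V^t* *m V) *m u) 0 0);last by rewrite iV mulmx1 colsqE.
rewrite rmorph_sum adj_mulE mulmx_sumr mulmx_suml summxE.
by apply:eq_bigr=> i _;rewrite /= -colsqE trmxC_mul !mulmxA.
Qed.

Lemma opbound_chan2 V W X c : V^t* *m V = 1%:M -> W^t* *m W = 1%:M ->
 opbound X c -> opbound (chan2 V W X) c.
Proof.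
move=> iV iW bX u v;rewrite chan2E mulmx_sumr mulmx_suml summxE.
apply:le_trans (cabs_sum _ _ _) _.
rewrite -(isometry_colsq u iV) -(isometry_colsq v iW) -big_split /= mulr_suml mulr_sumr.
apply:ler_sum=> i _;have:= bX (kraus V i *m u) (kraus W i *m v).
by rewrite trmxC_mul !mulmxA.
Qed.

Lemma opbound_mxn X : opbound X (mxn X).
Proof.
move=> u v;rewrite mxE;apply:le_trans (cabs_sum _ _ _) _.
have E j : cabs ((u^t* *m X) 0 j * v j 0) <= \sum_i cabs (X i j) * ((colsq u + colsq v) / 2).
 rewrite cabsM mxE;apply:le_trans (ler_wpM2r (cabs_ge0 _) (cabs_sum _ _ _)) _.
 rewrite mulr_suml;apply:ler_sum=> i _;rewrite cabsM !mxE cabs_conj mulrAC mulrC.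
 rewrite ler_wpM2l ?cabs_ge0 //.
 have h n (w : 'cV[C]_n) a : cabs (w a 0) ^+ 2 <= colsq w.
  by rewrite /colsq (bigD1 a) //= lerDl sumr_ge0 // => *;rewrite exprn_ge0 ?cabs_ge0.
 have:= h _ u i;have:= h _ v j;have:= sqr_ge0 (cabs (u i 0) - cabs (v j 0)).
 rewrite sqrrB;lra.
apply:le_trans (ler_sum _ (fun j _=> E j)) _.
by rewrite exchange_big /mxn mulr_suml;apply:ler_sum=> i _;rewrite mulr_suml.
Qed.

Lemma mxn_opbound X c : opbound X c -> mxn X <= (d * d)%:R * c.
Proof.
move=> bX.
have col1 i : colsq (delta_mx i 0 : 'cV[C]_d) = 1.
 rewrite /colsq (bigD1 i) //= mxE !eqxx cabs1 expr1n big1 ?addr0 // => j ji.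
 by rewrite mxE (negPf ji) cabs0 expr0n.
have E i j : cabs (X i j) <= c.
 have:= bX (delta_mx i 0) (delta_mx j 0);rewrite !col1.
 have -> : (delta_mx i 0 : 'cV[C]_d)^t* = delta_mx 0 i.
  by apply/matrixP=> a b;rewrite !mxE andbC rmorph_nat.
 by rewrite -rowE -colE !mxE divff ?mulr1 // pnatr_eq0.
rewrite /mxn;apply:(@le_trans _ _ (\sum_(i < d) \sum_(j < d) c)).
 by do 2![apply:ler_sum=> ? _].
by rewrite !sumr_const !card_ord -mulrnA mulr_natl.
Qed.

(** Going through [opbound], the factor d * d is paid once and not at every iteration. *)
Lemma chan2_iter_bound V W X m : V^t* *m V = 1%:M -> W^t* *m W = 1%:M ->
 mxn (iter m (chan2 V W) X) <= (d * d)%:R * mxn X.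
Proof.
move=> iV iW;apply:mxn_opbound;elim:m=> [|m IH] /=;first exact:opbound_mxn.
exact:opbound_chan2.
Qed.

Lemma kraus_mxn V i : mxn (kraus V i) <= mxn V.
Proof.
rewrite {2}/mxn sum_tens;apply:ler_sum=> a _;rewrite (bigD1 i) //=.
apply:(@le_trans _ _ (\sum_j cabs (V (mxtens_index (a, i)) j))).
 by apply:ler_sum=> b _;rewrite mxE.
by rewrite lerDl;do 2![apply:sumr_ge0=> ? _];exact:cabs_ge0.
Qed.

Lemma chan2_mxn V W X : mxn (chan2 V W X) <= k%:R * (mxn V * mxn X * mxn W).
Proof.
rewrite chan2E;apply:le_trans (mxn_sum _ _ _) _.
apply:(@le_trans _ _ (\sum_(i < k) (mxn V * mxn X * mxn W)));last first.
 by rewrite sumr_const card_ord -[leLHS]mulr_natl.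
apply:ler_sum=> i _;apply:le_trans (mxnM _ _) _.
apply:ler_pM;rewrite ?mxn_ge0 ?kraus_mxn //;apply:le_trans (mxnM _ _) _.
by rewrite mxn_adj ler_wpM2r ?mxn_ge0 ?kraus_mxn.
Qed.

Lemma iter_chan2_word V W X n : iter n (chan2 V W) X =
 \sum_(s : n.-tuple 'I_k) (word V s)^t* *m X *m word W s.
Proof.
have wordE (U : isom) s (M : 'M[C]_d) : foldl (fun M i=> kraus U i *m M) M s = word U s *m M.
 rewrite /word;elim/last_ind: s=> [|s i IH];first by rewrite mul1mx.
 by rewrite !foldl_rcons IH mulmxA.
elim:n=> [|n IH].
 rewrite /= (eq_bigl (pred1 [tuple])) ?big_pred1_eq //.
  by rewrite /word /= trmx1 map_mx1 mul1mx mulmx1.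
 by move=> s;apply/esym/eqP;exact:tuple0.
rewrite iterS IH.
rewrite (reindex (fun p : 'I_k * n.-tuple 'I_k=> [tuple of p.1 :: p.2])) /=;last first.
 exists (fun s=> (thead s, [tuple of behead s]))=> [[i s] _|s _] /=.
  by rewrite theadE;congr pair;exact:val_inj.
 by rewrite -tuple_eta.
rewrite -(pair_bigA _ (fun i (s : n.-tuple 'I_k)=>
 (word V (i :: s))^t* *m X *m word W (i :: s))) /= chan2E.
apply:eq_bigr=> i _;rewrite mulmx_sumr mulmx_suml;apply:eq_bigr=> s _.
by rewrite {3 4}/word /= !wordE !mulmx1 trmxC_mul !mulmxA.
Qed.
End Kraus.

Section PositiveMatrices.
Variable R : realType.
Local Notation C := R[i].

(** Polarization, since positivity in R[i] includes that the form is real. *)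
Lemma psd_hermitian n (M : 'M[C]_n) : psd M -> M^t* = M.
Proof.
move=> pM;pose f (x y : 'cV[C]_n) : C:= (x^t* *m M *m y) 0 0.
have fl x a y z : f x (a *: y + z) = a * f x y + f x z.
 by rewrite /f mulmxDr -scalemxAr !mxE.
have fr x a y z : f (a *: y + z) x = a^* * f y x + f z x.
 by rewrite /f linearD linearZ /= map_mxD map_mxZ !mulmxDl -!scalemxAl !mxE.
have f0 x : (f x x)^* = f x x by rewrite /f (ge0_real (pM x)) conjc_realE.
pose B x y:= (f x y)^* - f y x.
have E (a : C) x y : a^* * B x y + a * B y x = 0.
 have:= f0 (a *: y + x);rewrite !(fl, fr) !rmorphD !rmorphM !rmorphD !rmorphM /= !conjCK !f0 /B.
 move:((f x y)^*) ((f y x)^*) (a^*) (f x x) (f y y) (f x y) (f y x)=> u v b k l r t.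
 move/eqP;rewrite -subr_eq0=> /eqP h;rewrite -[RHS]h;ring.
have B0 x y : B x y = 0.
 have:= E 1 x y;have:= E 'i%C x y;rewrite conjCi rmorph1 !mul1r=> h1 h2.
 have {}h2 : B y x = - B x y by apply/eqP;rewrite -addr_eq0 addrC h2.
 move:h1;rewrite h2 mulrN mulNr -opprD=> /eqP;rewrite oppr_eq0 -mulr2n -mulrnAl mulf_eq0.
 case/orP=> [|/eqP//];rewrite mulrn_eq0 /= => /eqP/(congr1 (@complex.Im R)) /= /eqP.
 by rewrite oner_eq0.
apply/matrixP=> i j;rewrite !mxE.
have fE a b : f (delta_mx a 0) (delta_mx b 0) = M a b.
 rewrite /f;have -> : (delta_mx a 0 : 'cV[C]_n)^t* = delta_mx 0 a.
  by apply/matrixP=> u v;rewrite !mxE andbC rmorph_nat.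
 by rewrite -rowE -colE !mxE.
by have:= B0 (delta_mx j 0) (delta_mx i 0);rewrite /B !fE=> /eqP;rewrite subr_eq0=> /eqP.
Qed.

Lemma hermitian_form_real n (M : 'M[C]_n) (x : 'cV[C]_n) : M^t* = M ->
 (x^t* *m M *m x) 0 0 = (Re ((x^t* *m M *m x) 0 0))%:C.
Proof.
move=> hM;set z:= (_ *m _) 0 0.
have : z^* = z.
 have -> : z^* = ((x^t* *m M *m x)^t*) 0 0 by rewrite /z [RHS]mxE [in RHS]mxE.
 by rewrite !trmxC_mul trmxCK hM mulmxA.
move/(congr1 (@complex.Im R));rewrite Imconj=> h.
by apply:complexP=> //=;lra.
Qed.

Lemma posdef_lower n (M : 'M[C]_n) : psd M -> posdef M ->
 exists2 c : R, 0 < c & forall x, c * colsq x <= Re ((x^t* *m M *m x) 0 0).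
Proof.
move=> pM dM;have hM:= psd_hermitian pM.
have [U [D [uU D0 ME]]] := psd_diag hM pM.
have UU : U *m U^t* = 1%:M by apply/unitarymxP.
have UU' : U^t* *m U = 1%:M by apply:mulmx1C.
have Dpos i : 0 < Re (D 0 i).
 have:= dM (U^t* *m delta_mx i 0);rewrite ME psd_diagE mulmxA UU mul1mx.
 rewrite (bigD1 i) //= mxE !eqxx rmorph1 mulr1 mulr1 big1 ?addr0.
  rewrite (ge0_real (D0 i)) ltcR;apply;apply/eqP=> /(congr1 (mulmx U)).
  rewrite mulmxA UU mul1mx mulmx0=> /matrixP/(_ i 0);rewrite !mxE !eqxx=> /eqP.
  by rewrite oner_eq0.
 by move=> j ji;rewrite mxE (negPf ji) rmorph0 !mulr0.
(* A positive lower bound of all eigenvalues, defined also for n = 0. *)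
pose c : R:= (1 + \sum_i (Re (D 0 i))^-1)^-1.
have s0 : 0 < 1 + \sum_i (Re (D 0 i))^-1.
 by rewrite ltr_pwDl // sumr_ge0 // => i _;rewrite invr_ge0 ltW.
exists c;first by rewrite invr_gt0.
move=> x;rewrite ME psd_diagE.
have -> : colsq x = \sum_i cabs ((U *m x) i 0) ^+ 2.
 apply:(@complexI R);rewrite -colsqE.
 have -> : x^t* *m x = (U *m x)^t* *m (U *m x).
  by rewrite trmxC_mul mulmxA -[_ *m U^t* *m U]mulmxA UU' mulmx1.
 by rewrite colsqE.
rewrite Re_sum mulr_sumr;apply:ler_sum=> i _.
rewrite conjMz_cabs (ge0_real (D0 i)) -rmorphM /= ler_wpM2r ?exprn_ge0 ?cabs_ge0 //.
rewrite /c -[leRHS]invrK lef_pV2 ?posrE ?invr_gt0 //.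
rewrite (bigD1 i) //= addrCA lerDl addr_ge0 // sumr_ge0 // => j _.
by rewrite invr_ge0 ltW.
Qed.

Lemma form_le_mxn n (M : 'M[C]_n) (x : 'cV[C]_n) :
 cabs ((x^t* *m M *m x) 0 0) <= mxn M * colsq x.
Proof.
have:= @opbound_mxn R n M x x.
by have -> : (colsq x + colsq x) / 2 = colsq x by field.
Qed.
End PositiveMatrices.

(** * Stationary states and fixed points *)

Section Stationary.
Variables (R : realType) (d k : nat).
Local Notation C := R[i].
Implicit Types (V : 'M[C]_(d * k, d)) (X Y sigma : 'M[C]_d).

Lemma predual_linear V : mxlinear (predual V).
Proof.
move=> a X Y;rewrite /predual scaler_sumr -big_split;apply:eq_bigr=> i _ /=.
by rewrite mulmxDr mulmxDl -scalemxAr -scalemxAl.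
Qed.

Lemma tr_predual V sigma X : \tr (predual V sigma *m X) = \tr (sigma *m chan V X).
Proof.
rewrite -[chan V X]/(chan2 V V X) chan2E mulmx_suml mulmx_sumr !raddf_sum.
apply:eq_bigr=> i _ /=;rewrite -!mulmxA mxtrace_mulC !mulmxA.
by rewrite -!mulmxA.
Qed.

Lemma chan1 V : V^t* *m V = 1%:M -> chan V 1%:M = 1%:M.
Proof. by move=> iV;rewrite -[chan V _]/(chan2 V V _) chan2E -[RHS]iV adj_mulE;apply:eq_bigr=> i _;rewrite mulmx1. Qed.

Lemma tr_predual1 V sigma : V^t* *m V = 1%:M -> \tr (predual V sigma) = \tr sigma.
Proof. by move=> iV;have:= tr_predual V sigma 1%:M;rewrite chan1 // !mulmx1. Qed.

Lemma predual_adj V sigma : predual V (sigma^t*) = (predual V sigma)^t*.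
Proof.
rewrite /predual linear_sum rmorph_sum /=;apply:eq_bigr=> i _.
by rewrite !trmxC_mul trmxCK mulmxA.
Qed.

Lemma irreducible_rho V : irreducible V -> [/\ V^t* *m V = 1%:M,
 stationary_state V (rho_ss V), posdef (rho_ss V) &
 forall sigma, stationary_state V sigma -> sigma = rho_ss V].
Proof.
move=> [iV [rho [sr pr ur]]].
have E : rho_ss V = rho.
 rewrite /rho_ss;case:xgetP=> [r _ /ur//|/(_ rho) h].
 by case:h.
by rewrite E.
Qed.

Section Irreducible.
Variable V : 'M[C]_(d * k, d).
Hypothesis irr : irreducible V.
Let rho := rho_ss V.
Let iV : V^t* *m V = 1%:M. Proof. by case: (irreducible_rho irr). Qed.
Let srho : stationary_state V rho. Proof. by case: (irreducible_rho irr). Qed.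
Let prho : psd rho. Proof. by case: srho. Qed.
Let trho : \tr rho = 1. Proof. by case: srho. Qed.
Let fixrho : predual V rho = rho. Proof. by case: srho. Qed.
Let drho : posdef rho. Proof. by case: (irreducible_rho irr). Qed.
Let urho : forall sigma, stationary_state V sigma -> sigma = rho.
Proof. by case:(irreducible_rho irr). Qed.

(** As rho is positive definite, rho + t sigma stays positive for small t > 0; after normalization
    it is a stationary state, hence equal to rho. *)
Lemma predual_fixed_hermitian sigma : sigma^t* = sigma -> predual V sigma = sigma ->
 sigma = \tr sigma *: rho.
Proof.
move=> hs fs;have [c c0 hc] := posdef_lower prho drho.
pose m:= mxn sigma;have m0 : 0 <= m:= mxn_ge0 sigma.
(* The bound by c keeps rho + t sigma positive, the bound by 1/2 keeps its trace positive. *)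
pose t : R:= Num.min c (2^-1) / (m + 1).
have m1 : 0 < m + 1 by rewrite ltr_wpDl.
have mn0 : 0 < Num.min c (2^-1) by rewrite lt_min c0 invr_gt0 ltr0n.
have t0 : 0 < t by rewrite divr_gt0.
have tm : t * m <= Num.min c (2^-1).
 by rewrite /t mulrAC ler_pdivrMr // ler_wpM2l ?(ltW mn0) // lerDl.
have tc : t * m <= c by apply:le_trans tm _;rewrite ge_min lexx.
have t2 : t * m <= 2^-1 by apply:le_trans tm _;rewrite ge_min lexx orbT.
have trr : \tr sigma = (Re (\tr sigma))%:C.
 have : (\tr sigma)^* = \tr sigma.
  rewrite -[in RHS]hs /mxtrace rmorph_sum;apply:eq_bigr=> i _;by rewrite !mxE.
 move/(congr1 (@complex.Im R));rewrite Imconj=> h.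
 by apply:complexP=> //=;lra.
set r:= Re (\tr sigma) in trr.
have rm : `|r| <= m by apply:le_trans (Re_le_cabs _) (mxn_tr _).
pose s : R:= 1 + t * r.
have s0 : 0 < s.
 have : `|t * r| <= 2^-1.
  by rewrite normrM gtr0_norm //;apply:le_trans t2;rewrite ler_wpM2l // ltW.
 rewrite ler_norml /s;lra.
have sC : s%:C != 0 by rewrite -cabs_eq0 cabs_real normr_eq0 gt_eqF.
pose tau:= s%:C^-1 *: (rho + t%:C *: sigma).
have stau : stationary_state V tau.
 split.
 - move=> x;rewrite /tau -scalemxAr -scalemxAl mxE mulmxDr mulmxDl -scalemxAr -scalemxAl.
  apply:mulr_ge0;first by rewrite invr_ge0 lecR ltW.
  have eE (A B : 'M[C]_1) a : (A + a *: B) 0 0 = A 0 0 + a * B 0 0 by rewrite !mxE.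
  rewrite eE (hermitian_form_real x (psd_hermitian prho)) (hermitian_form_real x hs).
  rewrite -rmorphM -rmorphD lecR.
  have h1:= hc x;have h2:= le_trans (Re_le_cabs _) (form_le_mxn sigma x).
  have h3 : t * (mxn sigma * colsq x) <= c * colsq x.
   by rewrite mulrA ler_wpM2r ?colsq_ge0.
  have h4 : - (t * Re ((x^t* *m sigma *m x) 0 0)) <= t * (mxn sigma * colsq x).
   rewrite -mulrN ler_wpM2l ?(ltW t0) //;apply:le_trans h2;rewrite -normrN;exact:ler_norm.
  by move:h1 h3 h4;set A:= Re _;set B:= Re _;lra.
 - rewrite /tau mxtraceZ mxtraceD mxtraceZ trho trr -rmorphM -[1]/(1%:C) -rmorphD mulVf //.
 - have lp := predual_linear V.
  rewrite /tau (mxlinZ lp) (mxlinD lp) (mxlinZ lp) fixrho fs //.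
have e : rho + t%:C *: sigma = s%:C *: rho.
 by rewrite -[in RHS](urho stau) /tau scalerA divff // scale1r.
have tC : t%:C != 0 by rewrite -cabs_eq0 cabs_real normr_eq0 gt_eqF.
apply:(scalerI tC);apply:(addrI rho);rewrite e /s trr scalerA -rmorphM rmorphD scalerDl.
by rewrite scale1r.
Qed.

Let ii : 'i%C * 'i%C = -1 :> C.
Proof. by apply:complexP=> /=;rewrite ?Defs.ReM ?Defs.ImM /=;ring. Qed.

Let ic : ('i%C)^* = - 'i%C :> C.
Proof. by apply:complexP=> /=;rewrite ?Reconj ?Imconj /= ?oppr0. Qed.

Lemma predual_fixed sigma : predual V sigma = sigma -> sigma = \tr sigma *: rho.
Proof.
move=> fs;have lp := predual_linear V.
have fsa : predual V (sigma^t*) = sigma^t* by rewrite predual_adj fs.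
pose h1:= sigma + sigma^t*;pose h2:= 'i%C *: (sigma - sigma^t*).
have e1 : h1 = \tr h1 *: rho.
 apply:predual_fixed_hermitian.
  by rewrite /h1 linearD /= map_mxD trmxCK addrC.
 by rewrite /h1 (mxlinD lp) fs fsa.
have e2 : h2 = \tr h2 *: rho.
 apply:predual_fixed_hermitian.
  have -> : h2^t* = ('i%C)^* *: (sigma - sigma^t*)^t* by rewrite /h2 linearZ /= map_mxZ.
  rewrite ic linearB /= map_mxB trmxCK.
  by rewrite scaleNr -scalerN opprB.
 by rewrite /h2 (mxlinZ lp) (mxlinB lp) fs fsa.
have sE : sigma = 2^-1 *: (h1 - 'i%C *: h2).
 rewrite /h2 scalerA ii scaleN1r opprK /h1 addrACA subrr addr0 -mulr2n.
 by rewrite -[sigma *+ 2]scaler_nat scalerA mulVf // scale1r.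
have {}sE : sigma = (2^-1 * (\tr h1 - 'i%C * \tr h2)) *: rho.
 by rewrite {1}sE {1}e1 {1}e2 -scalerA scalerBl scalerA.
by rewrite {2}sE mxtraceZ trho mulr1.
Qed.

(** A rank one modification of the identity minus the predual, injective at W = V. Every stationary
    state of W is sent to rho, so stationarity becomes an invertible linear equation. *)
Definition statmap (W : 'M[C]_(d * k, d)) sigma : 'M[C]_d :=
 sigma - predual W sigma + \tr sigma *: rho.

Lemma statmap_linear W : mxlinear (statmap W).
Proof.
move=> a X Y;rewrite /statmap (predual_linear W) mxtraceD mxtraceZ scalerDl -scalerA.
rewrite !scalerDr scalerN opprD.
by rewrite scalerA;apply/matrixP=> i j;rewrite !(mxE, summxE);ring.
Qed.

Lemma statmap_inj sigma : statmap V sigma = 0 -> sigma = 0.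
Proof.
move=> h;have t0 : \tr sigma = 0.
 have:= congr1 (@mxtrace _ _) h;rewrite /statmap mxtraceD mxtraceZ raddfB /= tr_predual1 //.
 by rewrite subrr add0r trho mulr1 mxtrace0.
rewrite /statmap t0 scale0r addr0 in h.
have:= predual_fixed (sigma:= sigma);rewrite t0 scale0r;apply.
by apply/eqP;rewrite eq_sym -subr_eq0 h.
Qed.

(** By duality: every sigma is an image under [statmap] V, and on images the pairing with a fixed
    point factors as Tr sigma times Tr (rho X). *)
Lemma chan_fixed X : chan V X = X -> X = \tr (rho *m X) *: 1%:M.
Proof.
move=> fX;have [B _ surj] := mxlin_inverse (statmap_linear V) statmap_inj.
have E sigma : \tr (sigma *m X) = \tr sigma * \tr (rho *m X).
 have [tau <- _] := surj sigma.
 have trE Y : chan V Y = Y -> \tr (statmap V tau *m Y) = \tr tau * \tr (rho *m Y).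
  move=> fY;rewrite /statmap mulmxDl mulmxBl -scalemxAl mxtraceD mxtraceZ raddfB /=.
  by rewrite tr_predual fY subrr add0r.
 rewrite trE //;congr (_ * _).
 by have:= trE 1%:M (chan1 iV);rewrite !mulmx1 trho mulr1.
apply/matrixP=> i j;have:= E (delta_mx j i).
have trd (Y : 'M[C]_d) : \tr (delta_mx j i *m Y) = Y i j.
 rewrite /mxtrace (bigD1 j) //= big1 ?addr0.
  rewrite mxE (bigD1 i) //= big1 ?addr0;first by rewrite mxE !eqxx mul1r.
  by move=> a ai;rewrite mxE eqxx (negPf ai) mul0r.
 move=> a aj;rewrite mxE big1 // => b _;by rewrite mxE (negPf aj) mul0r.
rewrite trd=> ->;rewrite !mxE mulrC;congr (_ * _).
by rewrite -[delta_mx j i]mulmx1 trd mxE.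
Qed.
End Irreducible.
End Stationary.

Ltac nneg := repeat first [ by [] | exact: mxn_ge0 | exact: cabs_ge0 | exact: ler0n
 | apply: mulr_ge0 | apply: addr_ge0 | apply: exprn_ge0 | apply: divr_ge0 ].

Lemma eqW (R : numDomainType) (x y : R) : x = y -> x <= y.
Proof. by move->. Qed.

Section AdjointZero.
Variable R : realType.
Local Notation C := R[i].

Lemma adj_mul_diag m n (M : 'M[C]_(m, n)) j :
 (M^t* *m M) j j = (\sum_i cabs (M i j) ^+ 2)%:C.
Proof. by rewrite mxE rmorph_sum;apply:eq_bigr=> i _;rewrite !mxE conjMz_cabs. Qed.

Lemma adj_mul_eq0 m n (M : 'M[C]_(m, n)) : M^t* *m M = 0 -> M = 0.
Proof.
move=> M0;apply/matrixP=> i j;rewrite mxE.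
have:= adj_mul_diag M j;rewrite M0 mxE=> /(congr1 (@complex.Re R)) /= /esym/eqP.
rewrite psumr_eq0=> [|a _];last by rewrite exprn_ge0 ?cabs_ge0.
by move/allP/(_ i (mem_index_enum i));rewrite /= sqrf_eq0 cabs_eq0=> /eqP.
Qed.

Lemma tens1M m n q k (A : 'M[C]_(m, n)) (B : 'M[C]_(n, q)) :
 (A *m B) *t (1%:M : 'M[C]_k) = (A *t 1%:M) *m (B *t 1%:M).
Proof. by rewrite tensmx_mul mulmx1. Qed.

Lemma tens11 m k : (1%:M : 'M[C]_m) *t (1%:M : 'M[C]_k) = 1%:M.
Proof.
apply/matrixP=> i j;rewrite -(mxtens_unindexK i) -(mxtens_unindexK j).
case:(mxtens_unindex i)=> a b;case:(mxtens_unindex j)=> x y.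
rewrite tensmxE !mxE (can_eq (@mxtens_indexK _ _)) xpair_eqE.
by case:(a == x);case:(b == y);rewrite ?mulr1 ?mulr0.
Qed.

Lemma tens1_adj m n k (A : 'M[C]_(m, n)) : (A *t (1%:M : 'M[C]_k))^t* = A^t* *t 1%:M.
Proof. by rewrite trmx_tens trmx1 map_mxT map_mx1. Qed.
End AdjointZero.

Lemma ReN (R : realType) (z : R[i]) : Re (- z) = - Re z.
Proof. by case:z. Qed.
Lemma ImN (R : realType) (z : R[i]) : Im (- z) = - Im z.
Proof. by case:z. Qed.

Section NullSequences.
Variables (R : realType).
Local Notation C := R[i].

Definition vanishing (x : nat -> R) := forall eps : R, 0 < eps -> exists N, forall n, (N <= n)%N -> x n < eps.

Lemma expr_small (a : R) eps : 0 <= a -> a < 1 -> 0 < eps -> exists m, a ^+ m < eps.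
Proof.
move=> a0 a1 e0;have : (fun n=> a ^+ n) @ \oo --> (0 : R) by apply:cvg_expr;rewrite ger0_norm.
move=> /cvgrPdist_lt/(_ eps e0)[N _ /(_ N (leqnn N))] /=.
by rewrite sub0r normrN ger0_norm ?exprn_ge0 // => h;exists N.
Qed.

(** Once e n is below (eps / 2) (1 - a), the level eps / 2 is preserved by the recursion and the
    excess over it decays geometrically. *)
Lemma vanishing_contraction (a B : R) (x e : nat -> R) : 0 <= a -> a < 1 ->
 (forall n, x n <= B) -> (forall n, x n.+1 <= a * x n + e n) -> vanishing e -> vanishing x.
Proof.
move=> a0 a1 xB xS e0 eps eps0.
have a1' : 0 < 1 - a by rewrite subr_gt0.
have [N HN] := e0 (eps / 2 * (1 - a)) (mulr_gt0 (divr_gt0 eps0 (ltr0n _ 2)) a1').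
have [m Hm] := @expr_small a (eps / 2 / (1 + `|B|)) a0 a1 (divr_gt0 (divr_gt0 eps0 (ltr0n _ 2)) (ltr_wpDr (normr_ge0 _) ltr01)).
have key j : x (N + j)%N <= a ^+ j * `|B| + eps / 2.
 elim:j=> [|j IH].
  rewrite addn0 expr0 mul1r;apply:le_trans (xB _) _;apply:le_trans (ler_norm _) _.
  by rewrite lerDl divr_ge0 // ltW.
 rewrite addnS;apply:le_trans (xS _) _.
 have h1:= HN (N + j)%N (leq_addr _ _).
 have h2:= ler_wpM2l a0 IH;rewrite exprS.
 by move:h1 h2;set u:= a ^+ j;set v:= x _;set w:= e _;move=> h1 h2;nra.
exists (N + m)%N=> n nm;have -> : n = (N + (n - N))%N by rewrite subnKC // (leq_trans _ nm) ?leq_addr.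
apply:le_lt_trans (key _) _.
have h : a ^+ (n - N) <= a ^+ m by apply:ler_wiXn2l=> //;[exact:ltW | rewrite leq_subRL // (leq_trans _ nm) ?leq_addr].
have : a ^+ (n - N) * `|B| < eps / 2.
 apply:le_lt_trans (ler_wpM2r (normr_ge0 _) h) _.
 apply:(@le_lt_trans _ _ (a ^+ m * (1 + `|B|)));last by rewrite -ltr_pdivlMr.
 by rewrite ler_wpM2l ?exprn_ge0 // lerDr.
lra.
Qed.
End NullSequences.

(** * Peripheral spectrum of the channel *)

Section Cyclic.
Variables (R : realType) (d k p : nat).
Local Notation C := R[i].
Variables (V : 'M[C]_(d * k, d)) (P : 'I_p -> 'M[C]_d) (Z : 'M[C]_d).
Hypotheses (irr : irreducible V) (per : has_period V p) (cyc : cyclic_unitary V P Z).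
Implicit Types X Y : 'M[C]_d.

Local Notation rho := (rho_ss V).
Local Notation g := (@Defs.root_of_unity R p).
Local Notation T := (chan V).

Lemma period_gt0 : (0 < p)%N. Proof. by case: per. Qed.

Lemma irr_iso : V^t* *m V = 1%:M. Proof. by case: irr. Qed.

Lemma rho_facts : [/\ psd rho, \tr rho = 1, predual V rho = rho & posdef rho].
Proof. by have [_ [? ? ?] ? _] := irreducible_rho irr. Qed.

Lemma rho_adj : rho^t* = rho.
Proof. by case:rho_facts=> /psd_hermitian. Qed.

Lemma Z_unitary : Z^t* *m Z = 1%:M /\ Z *m Z^t* = 1%:M.
Proof.
have [_ _ _ _ [/unitarymxP uZ _]] := cyc;split=> //;exact:mulmx1C.
Qed.

(** The equality case of the Schwarz inequality for T: the difference of both sides has square zero,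
    because Z is unitary and T Z = g Z. *)
Lemma Z_intertwine : (Z *t (1%:M : 'M[C]_k)) *m V = g *: (V *m Z).
Proof.
have [_ _ _ _ [_ TZ]] := cyc;have [uZ _] := Z_unitary.
apply/eqP;rewrite -subr_eq0;apply/eqP/adj_mul_eq0.
rewrite adjB adjZ !trmxC_mul tens1_adj mulmxBl !mulmxBr.
rewrite -!scalemxAl -!scalemxAr scalerA root_conj scale1r.
have e1 : V^t* *m (Z^t* *t 1%:M) *m ((Z *t 1%:M) *m V) = 1%:M.
 rewrite -mulmxA [(_ *t _) *m (_ *m V)]mulmxA -tens1M uZ tens11 mul1mx;exact:irr_iso.
have e2 : Z^t* *m V^t* *m (V *m Z) = 1%:M.
 by rewrite -mulmxA [V^t* *m _]mulmxA irr_iso mul1mx.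
have e3 : Z^t* *m V^t* *m ((Z *t 1%:M) *m V) = g *: 1%:M.
 by rewrite -mulmxA [V^t* *m _]mulmxA -[_ *m V]/(chan V Z) TZ -scalemxAr uZ.
have e4 : V^t* *m (Z^t* *t 1%:M) *m (V *m Z) = g^* *: 1%:M.
 have -> : V^t* *m (Z^t* *t 1%:M) *m (V *m Z) = (Z^t* *m V^t* *m ((Z *t 1%:M) *m V))^t*.
  by rewrite !trmxC_mul !trmxCK tens1_adj !mulmxA.
 by rewrite e3 adjZ adj1.
have gg : g * g^* = 1 by rewrite mulrC root_conj.
by rewrite e1 e2 e3 e4 !scalerA root_conj gg !scale1r !subrr.
Qed.

Definition Zp j : 'M[C]_d := iter j (mulmx Z) 1%:M.

Lemma ZpS j : Zp j.+1 = Z *m Zp j. Proof. by []. Qed.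

Lemma ZpD i j : Zp (i + j) = Zp i *m Zp j.
Proof. by elim:i=> [|i IH];rewrite ?mul1mx // addSn !ZpS IH mulmxA. Qed.

Lemma Zp1 : Zp 1 = Z. Proof. by rewrite /Zp /= mulmx1. Qed.

Lemma Zp_unitary j : (Zp j)^t* *m Zp j = 1%:M /\ Zp j *m (Zp j)^t* = 1%:M.
Proof.
suff h : (Zp j)^t* *m Zp j = 1%:M by split=> //;exact:mulmx1C.
elim:j=> [|j IH];first by rewrite /Zp /= trmx1 map_mx1 mulmx1.
by rewrite ZpS trmxC_mul -mulmxA [Z^t* *m _]mulmxA (proj1 Z_unitary) mul1mx.
Qed.

Lemma Zp_intertwine j : (Zp j *t (1%:M : 'M[C]_k)) *m V = g ^+ j *: (V *m Zp j).
Proof.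
elim:j=> [|j IH];first by rewrite /Zp /= tens11 mul1mx mulmx1 scale1r.
rewrite ZpS tens1M -mulmxA IH -scalemxAr [_ *m (V *m _)]mulmxA Z_intertwine -scalemxAl.
by rewrite scalerA -exprSr !mulmxA.
Qed.

Lemma rootX_conj j : (g ^+ j)^* * g ^+ j = 1.
Proof. by rewrite conjMz_cabs cabs_rootX expr1n. Qed.

Lemma Zp_intertwine_adj j : V^t* *m (Zp j *t (1%:M : 'M[C]_k)) = g ^+ j *: (Zp j *m V^t*).
Proof.
have [u1 u2] := Zp_unitary j.
have e : (Zp j)^t* *t (1%:M : 'M[C]_k) *m V = (g ^+ j)^* *: (V *m (Zp j)^t*).
 have:= congr1 (fun M=> (g ^+ j)^* *: (((Zp j)^t* *t (1%:M : 'M[C]_k)) *m M *m (Zp j)^t*)) (Zp_intertwine j).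
 rewrite /= !mulmxA -tens1M u1 tens11 mul1mx -scalemxAr -scalemxAl scalerA rootX_conj scale1r.
 by move=> ->;rewrite -!mulmxA u2 mulmx1.
have:= congr1 (fun M=> M^t*) e;rewrite /= adjZ conjCK !trmxC_mul tens1_adj.
by rewrite !trmxCK.
Qed.

Lemma chan_Zp_mul j X : T (Zp j *m X) = g ^+ j *: (Zp j *m T X).
Proof. by rewrite /chan tens1M mulmxA Zp_intertwine_adj -!scalemxAl !mulmxA. Qed.

Lemma chan_Zp_adj_mul j X : (Zp j)^t* *m T X = g ^+ j *: T ((Zp j)^t* *m X).
Proof.
have [u1 u2] := Zp_unitary j.
have -> : T X = T (Zp j *m ((Zp j)^t* *m X)) by rewrite mulmxA u2 mul1mx.
by rewrite chan_Zp_mul -scalemxAr mulmxA u1 mul1mx.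
Qed.

Lemma chan_Zp j : T (Zp j) = g ^+ j *: Zp j.
Proof. by rewrite -[in LHS](mulmx1 (Zp j)) chan_Zp_mul chan1 ?mulmx1 //;exact:irr_iso. Qed.

(** The left eigenfunctional of T for g^j, dual to the powers of Z: it reads off the coefficient of
    [Zp] j in the peripheral part of X. *)
Definition fZ j X : C := \tr (rho *m (Zp j)^t* *m X).

Lemma fZ_linear j a X Y : fZ j (a *: X + Y) = a * fZ j X + fZ j Y.
Proof. by rewrite /fZ mulmxDr -scalemxAr mxtraceD mxtraceZ. Qed.

Lemma fZD j X Y : fZ j (X + Y) = fZ j X + fZ j Y.
Proof. by rewrite /fZ mulmxDr mxtraceD. Qed.
Lemma fZZ j a X : fZ j (a *: X) = a * fZ j X.
Proof. by rewrite /fZ -scalemxAr mxtraceZ. Qed.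
Lemma fZN j X : fZ j (- X) = - fZ j X.
Proof. by rewrite -scaleN1r fZZ mulN1r. Qed.
Lemma fZB j X Y : fZ j (X - Y) = fZ j X - fZ j Y.
Proof. by rewrite fZD fZN. Qed.
Lemma fZ_sum j (I : Type) (r : seq I) (Q : pred I) (F : I -> 'M[C]_d) :
 fZ j (\sum_(i <- r | Q i) F i) = \sum_(i <- r | Q i) fZ j (F i).
Proof. by apply:(big_morph _ (@fZD j));rewrite /fZ mulmx0 mxtrace0. Qed.

Lemma fZ_chan j X : fZ j (T X) = g ^+ j * fZ j X.
Proof.
rewrite /fZ -!mulmxA chan_Zp_adj_mul -scalemxAr mxtraceZ -tr_predual.
by case:rho_facts=> _ _ -> _.
Qed.

(** Multiplication by the adjoint of Z^j turns eigenvectors for g^j into fixed points, which are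
    scalar. *)
Lemma chan_eigen j X : T X = g ^+ j *: X -> X = fZ j X *: Zp j.
Proof.
move=> TX;have [u1 u2] := Zp_unitary j.
have e : T ((Zp j)^t* *m X) = (Zp j)^t* *m X.
 have:= chan_Zp_adj_mul j X;rewrite TX -scalemxAr=> /(congr1 (fun M=> (g ^+ j)^* *: M)).
 by rewrite /= !scalerA rootX_conj !scale1r.
have:= chan_fixed irr e;rewrite mulmxA -/(fZ j X)=> h.
by rewrite -[X in LHS]mul1mx -u2 -mulmxA h -scalemxAr mulmx1.
Qed.

Lemma fZ_Zp (i j : 'I_p) : fZ i (Zp j) = (i == j)%:R.
Proof.
have [->|ij] := eqVneq i j.
 rewrite /fZ -mulmxA (proj1 (Zp_unitary j)) mulmx1;by case:rho_facts.
have:= fZ_chan i (Zp j);rewrite chan_Zp fZZ=> /eqP.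
rewrite -subr_eq0 -mulrBl mulf_eq0 subr_eq0=> /orP[|/eqP//].
by rewrite eq_sym (negPf (root_neq R ij)).
Qed.

Lemma tr_rho_Zp j : (0 < j < p)%N -> \tr (rho *m Zp j) = 0.
Proof.
move=> /andP[j0 jp];have p0:= period_gt0.
have:= @fZ_Zp (Ordinal p0) (Ordinal jp);rewrite /fZ /= trmx1 map_mx1 mulmx1.
by move=> ->;rewrite -val_eqE /= eq_sym (gtn_eqF j0).
Qed.

(** Compressing sum_c P c = 1 by P b leaves a vanishing sum of positive matrices, so each of them is
    zero. *)
Lemma P_orth a b : a != b -> P a *m P b = 0.
Proof.
move=> ab;have [pP sP _ _ _] := cyc;have [pb1 pb2] := pP b.
have h : \sum_(c | c != b) (P c *m P b)^t* *m (P c *m P b) = 0.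
 have -> : \sum_(c | c != b) (P c *m P b)^t* *m (P c *m P b) = \sum_(c | c != b) P b *m P c *m P b.
  apply:eq_bigr=> c _;have [pc1 pc2] := pP c.
  by rewrite trmxC_mul pb1 pc1 -!mulmxA [P c *m (P c *m _)]mulmxA pc2.
 have : \sum_c P b *m P c *m P b = P b by rewrite -mulmx_suml -mulmx_sumr sP mulmx1 pb2.
 rewrite (bigD1 b) //= pb2 pb2=> /(congr1 (fun M=> M - P b)).
 by rewrite addrAC subrr add0r.
have M0 c i0 : 0 <= ((P c *m P b)^t* *m (P c *m P b)) i0 i0.
 by rewrite adj_mul_diag lecR sumr_ge0 // => ? _;rewrite exprn_ge0 ?cabs_ge0.
apply/matrixP=> u v;rewrite [RHS]mxE.
have : ((P a *m P b)^t* *m (P a *m P b)) v v = 0.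
 have:= congr1 (fun M : 'M[C]_d=> M v v) h;rewrite /= summxE mxE=> /eqP.
 rewrite psumr_eq0=> [|c _];last exact:M0.
 by move/allP/(_ a (mem_index_enum a));rewrite ab=> /eqP.
rewrite adj_mul_diag=> /(congr1 (@complex.Re R)) /= /eqP.
rewrite psumr_eq0=> [|c _];last by rewrite exprn_ge0 ?cabs_ge0.
by move/allP/(_ u (mem_index_enum u));rewrite /= sqrf_eq0 cabs_eq0=> /eqP.
Qed.

Lemma Zp_sum j : Zp j = \sum_(a < p) (g ^+ a) ^+ j *: P a.
Proof.
have [pP sP _ dZ _] := cyc;elim:j=> [|j IH].
 by rewrite /Zp /= -sP;apply:eq_bigr=> a _;rewrite expr0 scale1r.
rewrite ZpS IH dZ mulmx_suml;apply:eq_bigr=> a _.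
rewrite mulmx_sumr (bigD1 a) //= big1 ?addr0=> [|b ba].
 by rewrite -scalemxAl -scalemxAr scalerA (proj2 (pP a)) exprS.
by rewrite -scalemxAl -scalemxAr P_orth 1?eq_sym // !scaler0.
Qed.

Lemma Zp_period : Zp p = 1%:M.
Proof.
have [_ sP _ _ _] := cyc;rewrite Zp_sum -sP;apply:eq_bigr=> a _.
by rewrite exprAC root_expr ?period_gt0 // expr1n scale1r.
Qed.

(** By the intertwining relation the conjugate of rho by Z is again fixed by the predual, and its
    trace is 1. *)
Lemma rho_Z : rho *m Z = Z *m rho.
Proof.
have [_ tr1 fr _] := rho_facts;have [u1 u2] := Z_unitary.
have kZ i : kraus V i *m Z = g^* *: (Z *m kraus V i).
 have:= congr1 (fun M=> g^* *: kraus M i) Z_intertwine.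
 by rewrite /= kraus_tens krausZ scalerA root_conj scale1r kraus_mul.
have f : predual V (Z *m rho *m Z^t*) = Z *m rho *m Z^t*.
 rewrite -[in RHS]fr /predual mulmx_sumr mulmx_suml;apply:eq_bigr=> i _.
 have -> : kraus V i *m (Z *m rho *m Z^t*) *m (kraus V i)^t* = (kraus V i *m Z) *m rho *m (kraus V i *m Z)^t*.
  by rewrite trmxC_mul !mulmxA.
 rewrite kZ adjZ conjCK -!scalemxAl -scalemxAr scalerA root_conj scale1r.
 by rewrite trmxC_mul !mulmxA.
have:= predual_fixed irr f;rewrite mxtrace_mulC mulmxA u1 mul1mx tr1 scale1r.
by move=> h;rewrite -{1}h -!mulmxA u1 mulmx1.
Qed.

Lemma rho_Zp j : rho *m Zp j = Zp j *m rho.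
Proof.
elim:j=> [|j IH];first by rewrite mulmx1 mul1mx.
by rewrite ZpS mulmxA rho_Z -mulmxA IH mulmxA.
Qed.

Lemma chan_linear : mxlinear T.
Proof. exact:(@chan2_linear R d k V V). Qed.

(** The rank one term makes g^j - T injective; it vanishes on the kernel of [fZ] j, where g^j - T
    has to be inverted. *)
Definition shift j X := g ^+ j *: X - T X + fZ j X *: Zp j.

Lemma shift_linear j : mxlinear (shift j).
Proof.
move=> a X Y;rewrite /shift (mxlinD chan_linear) (mxlinZ chan_linear) fZ_linear scalerDl -scalerA.
move:(T X) (T Y) (fZ j X) (fZ j Y) (Zp j) (g ^+ j)=> TX TY x y z c.
by apply/matrixP=> u v;rewrite !mxE;ring.
Qed.

Lemma fZ_shift (j : 'I_p) X : fZ j (shift j X) = fZ j X.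
Proof. by rewrite /shift fZD fZB !fZZ fZ_chan subrr add0r fZ_Zp eqxx mulr1. Qed.

Lemma shift_inj (j : 'I_p) X : shift j X = 0 -> X = 0.
Proof.
move=> h;have f0 : fZ j X = 0 by rewrite -fZ_shift h /fZ mulmx0 mxtrace0.
move:h;rewrite /shift f0 scale0r addr0=> /eqP;rewrite subr_eq0 eq_sym=> /eqP/chan_eigen ->.
by rewrite f0 scale0r.
Qed.

Lemma corrector (j : 'I_p) : exists2 B : R, 0 <= B & forall Y, fZ j Y = 0 ->
 exists X, g ^+ j *: X - T X = Y /\ mxn X <= B * mxn Y.
Proof.
have [B B0 hB] := mxlin_inverse (@shift_linear j) (@shift_inj j).
exists B=> // Y fY;have [X XY XB] := hB Y;exists X;split=> //.
by rewrite -[RHS]XY /shift -fZ_shift XY fY scale0r addr0.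
Qed.

Lemma iter_chan_bound m X : mxn (iter m T X) <= (d * d)%:R * mxn X.
Proof. exact:(@chan2_iter_bound R d k V V X m irr_iso irr_iso). Qed.

Lemma fZ_iter j m X : fZ j (iter m T X) = (g ^+ j) ^+ m * fZ j X.
Proof. by elim:m=> [|m IH] /=;rewrite ?mul1r // fZ_chan IH exprS mulrA. Qed.

(** Otherwise iterating T on X would exceed the uniform bound of [iter_chan_bound]. *)
Lemma eigen_bound (a : C) X : T X = a *: X -> X != 0 -> cabs a <= 1.
Proof.
move=> TX X0;rewrite leNgt;apply/negP=> a1.
have iT m : iter m T X = a ^+ m *: X.
 elim:m=> [|m IH] /=;first by rewrite scale1r.
 by rewrite IH (mxlinZ chan_linear) TX scalerA -exprSr.
have m0 : 0 < mxn X.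
 by rewrite lt_def mxn_ge0 andbT;apply:contra X0=> /eqP h;apply/eqP/mxn_eq0;rewrite h.
have d1 : 0 < ((d * d)%:R + 1 : R)^-1 by rewrite invr_gt0 ltr_wpDl.
have ai : 0 <= (cabs a)^-1 by rewrite invr_ge0 cabs_ge0.
have a0 : 0 < cabs a by apply:lt_trans a1.
have [|m hm] := expr_small ai _ d1;first by rewrite invf_lt1.
have:= iter_chan_bound m X;rewrite iT mxnZ cabsX ler_pM2r // leNgt=> /negP;apply.
apply:(@lt_trans _ _ ((d * d)%:R + 1));first by rewrite ltrDl.
by move:hm;rewrite exprVn ltf_pV2 ?posrE ?exprn_gt0 ?ltr_wpDl.
Qed.

Definition inker X := forall j : 'I_p, fZ j X = 0.

Lemma inker_chan X : inker X -> inker (T X).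
Proof. by move=> h j;rewrite fZ_chan h mulr0. Qed.

(* the part of T off the unit circle is killed by a product of factors T - a:
  the factors with |a| < 1 are contractions, the others are injective on the
  common kernel of the peripheral functionals *)
Lemma inker_vanishing X : inker X -> vanishing (fun n => mxn (iter n T X)).
Proof.
have [s hs] := prod_spectrum chan_linear.
have {hs} := hs X;elim:s X=> [|a s IH] X /= hX kX.
 move=> eps e0;exists 0%N=> n _;rewrite hX;elim:n=> [|n IHn] /=;first by rewrite mxn0.
 by move:IHn;rewrite -iterS iterSr (mxlin0 chan_linear).
have kY : inker (T X - a *: X).
 by move=> j;rewrite fZB fZZ (inker_chan kX) kX mulr0 subrr.
have {}IH:= IH _ hX kY.
have iE n : iter n T (T X - a *: X) = iter n.+1 T X - a *: iter n T X.
 elim:n=> [|n IHn] //=;by rewrite IHn (mxlinB chan_linear) (mxlinZ chan_linear).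
have inj (f : 'M[C]_d -> 'M[C]_d) : mxlinear f -> (forall Y, f Y = 0 -> Y = 0) ->
  (forall n, mxn (f (iter n T X)) = mxn (iter n T (T X - a *: X))) ->
  vanishing (fun n=> mxn (iter n T X)).
 move=> lf injf fE;have [B B0 hB] := mxlin_inverse lf injf.
 move=> eps e0;have B1 : 0 < B + 1 by rewrite ltr_wpDl.
 have [N HN] := IH (eps / (B + 1)) (divr_gt0 e0 B1).
 exists N=> n Nn;have [Y fY YB] := hB (f (iter n T X)).
 have -> : iter n T X = Y by apply/eqP;rewrite eq_sym -subr_eq0;apply/eqP/injf;rewrite (mxlinB lf) fY subrr.
 apply:le_lt_trans YB _;rewrite fE.
 have h:= HN n Nn;rewrite ltr_pdivlMr // in h.
 by have:= mxn_ge0 (iter n T (T X - a *: X));nra.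
have [a1|a1] := ltP (cabs a) 1.
 apply:(vanishing_contraction (cabs_ge0 a) a1 (B:= (d * d)%:R * mxn X) _ _ IH)=> n.
  exact:iter_chan_bound.
 by rewrite iE -mxnZ addrC;apply:le_trans (mxnD _ _);rewrite subrK.
have [[j aj]|na] := pselect (exists j : 'I_p, a = g ^+ j).
 apply:(inj (shift j));[exact:shift_linear | exact:shift_inj|].
 move=> n;rewrite iE /shift fZ_iter kX mulr0 scale0r addr0 aj -mxnN opprB.
 by rewrite iterS.
apply:(inj (fun Y=> T Y - a *: Y)).
- move=> b U W;rewrite chan_linear;move:(T U) (T W)=> TU TW.
 by apply/matrixP=> u v;rewrite !mxE;ring.
- move=> Y /eqP;rewrite subr_eq0=> /eqP TY;apply/eqP;apply:contraT=> Y0.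
 have a2 : `|a| = 1.
  have:= eigen_bound TY Y0=> a2.
  have : cabs a = 1 by apply/eqP;rewrite eq_le a2 a1.
  by rewrite cabsE=> ->.
 case:na;have [_ h] := per;by apply/(h a a2);exists Y.
- by move=> n;rewrite iE.
Qed.

Definition kerproj X := X - \sum_(j < p) fZ j X *: Zp j.

Lemma inker_kerproj X : inker (kerproj X).
Proof.
move=> j;rewrite /kerproj fZB fZ_sum (bigD1 j) //= fZZ fZ_Zp eqxx mulr1 big1 ?addr0 ?subrr //.
by move=> i ij;rewrite fZZ fZ_Zp eq_sym (negPf ij) mulr0.
Qed.

Lemma kerproj_id X : inker X -> kerproj X = X.
Proof. by move=> kX;rewrite /kerproj big1 ?subr0 // => j _;rewrite kX scale0r. Qed.

Lemma kerproj_linear : mxlinear kerproj.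
Proof.
move=> a X Y;rewrite /kerproj.
rewrite (eq_bigr (fun j : 'I_p=> a *: (fZ j X *: Zp j) + fZ j Y *: Zp j));last first.
 by move=> j _;rewrite fZ_linear scalerDl scalerA.
rewrite big_split -scaler_sumr scalerBr opprD addrACA //.
Qed.

(** By linearity, decay on the finitely many projected matrix units yields one N for the whole
    kernel. *)
Lemma spectral_gap : exists2 N, (0 < N)%N & forall X, inker X -> mxn (iter N T X) <= 2^-1 * mxn X.
Proof.
have h (ab : 'I_d * 'I_d) : exists N, forall n, (N <= n)%N ->
  mxn (iter n T (kerproj (delta_mx ab.1 ab.2))) < 2^-1.
 by apply:(inker_vanishing (inker_kerproj _));rewrite invr_gt0.
have [N hN] := choice h.
exists (\sum_ab N ab).+1=> // X kX.
have lT n : mxlinear (iter n T).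
 elim:n=> [|n IH] a Y W //=;by rewrite IH chan_linear.
have l : mxlinear (fun X=> iter (\sum_ab N ab).+1 T (kerproj X)).
 by move=> a Y W;rewrite kerproj_linear lT.
rewrite -{1}(kerproj_id kX);apply:(mxlin_bound l)=> i j.
apply/ltW/(hN (i, j));by apply:leqW;rewrite (bigD1 (i, j)) //= leq_addr.
Qed.

Lemma corrector_unif : exists2 B : R, 0 <= B & forall (j : 'I_p) Y, fZ j Y = 0 ->
 exists X, g ^+ j *: X - T X = Y /\ mxn X <= B * mxn Y.
Proof.
have h (j : 'I_p) : exists B : R, 0 <= B /\ forall Y, fZ j Y = 0 ->
  exists X, g ^+ j *: X - T X = Y /\ mxn X <= B * mxn Y.
 by have [B ? ?] := corrector j;exists B.
have [B hB] := choice h.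
exists (\sum_j B j);first by apply:sumr_ge0=> j _;case:(hB j).
move=> j Y fY;have [X [XY XB]] := proj2 (hB j) Y fY;exists X;split=> //.
apply:le_trans XB _;rewrite ler_wpM2r ?mxn_ge0 // (bigD1 j) //= lerDl.
by apply:sumr_ge0=> i _;case:(hB i).
Qed.

(** * Rotated tangent vectors and their inner product *)

Lemma rotE j A : iter j (rotation p Z) A = g ^+ j *: (((Zp j)^t* *t (1%:M : 'M[C]_k)) *m A *m Zp j).
Proof.
elim:j=> [|j IH];first by rewrite /Zp /= adj1 tens11 mul1mx mulmx1 scale1r.
rewrite iterS IH /rotation -addn1 ZpD Zp1 trmxC_mul tens1M exprD expr1.
by rewrite -!scalemxAr -!scalemxAl scalerA mulrC !mulmxA.
Qed.

Lemma tangent_id0 A : tangent_id V A -> V^t* *m A = 0.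
Proof.
rewrite /tangent_id=> /(congr1 (mulmx (V^t*))).
by rewrite mulmx0 !mulmxA irr_iso mul1mx.
Qed.

Lemma tangent_id_rot j A : tangent_id V A -> tangent_id V (iter j (rotation p Z) A).
Proof.
move=> tA;rewrite /tangent_id rotE -scalemxAr -!mulmxA [V^t* *m _]mulmxA.
have -> : V^t* *m ((Zp j)^t* *t (1%:M : 'M[C]_k)) = (g ^+ j)^* *: ((Zp j)^t* *m V^t*).
 have:= congr1 (fun M=> M^t*) (Zp_intertwine j).
 by rewrite /= adjZ !trmxC_mul tens1_adj.
rewrite -scalemxAl -mulmxA [V^t* *m (A *m _)]mulmxA tangent_id0 // mul0mx mulmx0.
by rewrite scaler0 mulmx0 scaler0.
Qed.

Definition brot j A B : C := inner_id V (iter j (rotation p Z) A) B.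

(** The inner products of the Gaussian model appear as the peripheral components of the deformed
    channel at second order. *)
Lemma brotE j A B : brot j A B = (g ^+ j)^* * fZ j (chan2 A B (Zp j)).
Proof.
rewrite /brot /inner_id rotE adjZ -scalemxAr -scalemxAl mxtraceZ;congr (_ * _).
by rewrite /fZ /chan2 !trmxC_mul tens1_adj trmxCK !mulmxA.
Qed.

Lemma brot0 A B : brot 0 A B = inner_id V A B. Proof. by []. Qed.

Lemma innerDl A A' B : inner_id V (A + A') B = inner_id V A B + inner_id V A' B.
Proof. by rewrite /inner_id adjD mulmxDr mulmxDl mxtraceD. Qed.
Lemma innerDr A B B' : inner_id V A (B + B') = inner_id V A B + inner_id V A B'.
Proof. by rewrite /inner_id mulmxDr mxtraceD. Qed.
Lemma innerZl a A B : inner_id V (a *: A) B = a^* * inner_id V A B.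
Proof. by rewrite /inner_id adjZ -scalemxAr -scalemxAl mxtraceZ. Qed.
Lemma innerZr a A B : inner_id V A (a *: B) = a * inner_id V A B.
Proof. by rewrite /inner_id -scalemxAr mxtraceZ. Qed.
Lemma innerNl A B : inner_id V (- A) B = - inner_id V A B.
Proof. by rewrite -scaleN1r innerZl rmorphN1 mulN1r. Qed.
Lemma innerNr A B : inner_id V A (- B) = - inner_id V A B.
Proof. by rewrite -scaleN1r innerZr mulN1r. Qed.

Lemma inner_rot j A B :
 inner_id V (iter j (rotation p Z) A) (iter j (rotation p Z) B) = inner_id V A B.
Proof.
have [u1 u2] := Zp_unitary j.
rewrite !rotE innerZl innerZr mulrA rootX_conj mul1r /inner_id.
rewrite !trmxC_mul tens1_adj trmxCK !mulmxA mxtrace_mulC.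
rewrite -2!mulmxA [(_ *t _) *m _]mulmxA -tens1M u2 tens11 mul1mx !mulmxA.
by rewrite -rho_Zp -[_ *m Zp j *m _]mulmxA u2 mulmx1.
Qed.

Lemma tr_adj n (M : 'M[C]_n) : \tr (M^t*) = (\tr M)^*.
Proof. by rewrite /mxtrace rmorph_sum;apply:eq_bigr=> i _;rewrite !mxE. Qed.

Lemma innerC A B : inner_id V A B = (inner_id V B A)^*.
Proof. by rewrite /inner_id -tr_adj !trmxC_mul trmxCK rho_adj mulmxA [RHS]mxtrace_mulC mulmxA. Qed.

Lemma inner_rows A : inner_id V A A =
 \sum_s ((((row s A)^t*)^t* *m rho *m (row s A)^t*) 0 0).
Proof.
rewrite /inner_id -mulmxA mxtrace_mulC /mxtrace.
have -> : A^t* *m A *m rho = A^t* *m (A *m rho) by rewrite mulmxA.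
rewrite -/(mxtrace _) mxtrace_mulC /mxtrace;apply:eq_bigr=> s _.
rewrite trmxCK -row_mul !mxE;apply:eq_bigr=> a _;by rewrite !mxE.
Qed.

Lemma inner_ge0 A : 0 <= inner_id V A A.
Proof. by rewrite inner_rows sumr_ge0 // => s _;case:rho_facts=> ps _ _ _;apply:ps. Qed.

Lemma inner_Re_le A B : Re (inner_id V A B) <= (Re (inner_id V A A) + Re (inner_id V B B)) / 2.
Proof.
have:= inner_ge0 (A - B);rewrite ge0E=> /andP[_].
rewrite innerDl !innerDr !innerNl !innerNr (innerC B A).
move:(inner_id V A A) (inner_id V A B) (inner_id V B B)=> [a1 a2] [b1 b2] [c1 c2] /=;lra.
Qed.

(** Only this much of a geodesic endpoint is used below: an isometry equal to V + 'i A up to second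
    order in the common scale e. *)
Definition near (kap e : R) (A VA : 'M[C]_(d * k, d)) : Prop :=
 [/\ VA^t* *m VA = 1%:M, tangent_id V A, mxn A <= e &
   mxn (VA - V - 'i%C *: A) <= kap * e ^+ 2].

(** The component of VA along 'i V. Under [near] it is of second order but not determined by A, and
    it enters the eigenvalues as a phase. *)
Definition phase (VA : 'M[C]_(d * k, d)) : R := Im (\tr (rho *m V^t* *m VA)).

(** The logarithm of the perturbed eigenvalue divided by g^j, up to order e^3. *)
Definition zeta (j : nat) A B VA VB : C :=
 brot j A B - (((Re (inner_id V A A) + Re (inner_id V B B)) / 2)%:C)
 + ((phase VB - phase VA)%:C * 'i%C).

Lemma chan2Dl (A A' B : 'M[C]_(d * k, d)) X : chan2 (A + A') B X = chan2 A B X + chan2 A' B X.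
Proof. by rewrite -[A]scale1r chan2DZl rmorph1 !scale1r. Qed.
Lemma chan2Dr (A B B' : 'M[C]_(d * k, d)) X : chan2 A (B + B') X = chan2 A B X + chan2 A B' X.
Proof. by rewrite -[B]scale1r chan2DZr !scale1r. Qed.
Lemma chan2Zl a (A B : 'M[C]_(d * k, d)) X : chan2 (a *: A) B X = a^* *: chan2 A B X.
Proof.
by rewrite /chan2 adjZ -!scalemxAl.
Qed.
Lemma chan2Zr a (A B : 'M[C]_(d * k, d)) X : chan2 A (a *: B) X = a *: chan2 A B X.
Proof. by rewrite /chan2 -scalemxAr. Qed.

Definition zbound : R := \sum_(j < p) mxn (Zp j).
Lemma zbound_ge0 : 0 <= zbound. Proof. by apply: sumr_ge0 => j _; exact: mxn_ge0. Qed.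
Lemma Zp_bound (j : 'I_p) : mxn (Zp j) <= zbound.
Proof. by rewrite /zbound (bigD1 j) //= lerDl;apply:sumr_ge0=> ? _;exact:mxn_ge0. Qed.

Definition fbound : R := mxn rho * zbound.
Lemma fbound_ge0 : 0 <= fbound. Proof. by rewrite mulr_ge0 ?mxn_ge0 ?zbound_ge0. Qed.
Lemma fZ_bound (j : 'I_p) X : cabs (fZ j X) <= fbound * mxn X.
Proof.
apply:le_trans (mxn_tr _) _;apply:le_trans (mxnM _ _) _;rewrite ler_wpM2r ?mxn_ge0 //.
apply:le_trans (mxnM _ _) _;rewrite ler_wpM2l ?mxn_ge0 // mxn_adj;exact:Zp_bound.
Qed.

Definition bbound : R := fbound * (k%:R * zbound).
Lemma bbound_ge0 : 0 <= bbound.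
Proof. by rewrite mulr_ge0 ?fbound_ge0 // mulr_ge0 ?zbound_ge0. Qed.

Lemma brot_bound (j : 'I_p) A B : cabs (brot j A B) <= bbound * (mxn A * mxn B).
Proof.
rewrite brotE cabsM cabs_conj cabs_rootX mul1r;apply:le_trans (fZ_bound _ _) _.
rewrite /bbound -(mulrA fbound) ler_wpM2l ?fbound_ge0 //.
apply:le_trans (chan2_mxn _ _ _) _;rewrite -[leRHS]mulrA.
rewrite ler_wpM2l // -mulrA mulrCA ler_wpM2r ?mulr_ge0 ?mxn_ge0 //;exact:Zp_bound.
Qed.

Lemma brotDl j A A' B : brot j (A + A') B = brot j A B + brot j A' B.
Proof. by rewrite !brotE chan2Dl fZD mulrDr. Qed.
Lemma brotDr j A B B' : brot j A (B + B') = brot j A B + brot j A B'.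
Proof. by rewrite !brotE chan2Dr fZD mulrDr. Qed.

Lemma brot_Re_le j A B : Re (brot j A B) <= (Re (inner_id V A A) + Re (inner_id V B B)) / 2.
Proof. by rewrite -(inner_rot j A A);exact:inner_Re_le. Qed.

Lemma mxn_i (A : 'M[C]_(d * k, d)) : mxn ('i%C *: A) = mxn A.
Proof. by rewrite mxnZ cabs_sqrt /sqn /= expr0n expr1n add0r sqrtr1 mul1r. Qed.

Lemma cabs_sub (z w : C) : cabs (z - w) <= cabs z + cabs w.
Proof. by rewrite -(cabsN w) cabsD. Qed.

(** For |z| > 1 the bound |exp z| <= 1 on the left half plane suffices, so that z may be large. *)
Lemma cexp_taylor_left (z : C) : Re z <= 0 -> cabs (cexp z - 1 - z) <= 3 * cabs z ^+ 2.
Proof.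
move=> z0;have [z1|z1] := leP (cabs z) 1.
 apply:le_trans (cexp_taylor z1) _;have:= exprn_ge0 2 (cabs_ge0 z);lra.
apply:le_trans (cabs_sub _ _) _;apply:le_trans (lerD (cabs_sub _ _) (lexx _)) _.
rewrite cabs_cexp cabs1.
have : expR (Re z) <= 1 by rewrite -expR0 ler_expR.
by nra.
Qed.

Lemma half_dist (x y z w t : R) : `|z - x| <= t -> `|w - y| <= t ->
 `|(z + w) / 2 - (x + y) / 2| <= t.
Proof. by rewrite !ler_norml=> /andP[? ?] /andP[? ?];apply/andP;split;lra. Qed.

(** * Perturbed eigenvalues of the deformed channel *)

Section Pair.
Variables (kap e : R) (A B VA VB : 'M[C]_(d * k, d)).
Hypotheses (kap0 : 0 <= kap) (e0 : 0 <= e) (e1 : e <= 1).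
Hypotheses (nA : near kap e A VA) (nB : near kap e B VB).
Let dA := VA - V.
Let dB := VB - V.
Let v := mxn V.
Let S := chan2 VA VB.
Let K1 := 1 + kap.
Let v0 : 0 <= v. Proof. exact: mxn_ge0. Qed.
Let K10 : 0 <= K1. Proof. by rewrite addr_ge0. Qed.

(** As V^* A' = 0, the part of VA' - V along the range of V is of second order, although VA' - V is
    of first order. *)
Lemma near_diff A' VA' : near kap e A' VA' -> [/\ mxn (VA' - V) <= K1 * e,
 V^t* *m (VA' - V) = V^t* *m (VA' - V - 'i%C *: A') & mxn (V^t* *m (VA' - V)) <= v * kap * e ^+ 2].
Proof.
move=> [iA tA Ae RA].
have h : V^t* *m (VA' - V) = V^t* *m (VA' - V - 'i%C *: A').
 by rewrite [RHS]mulmxBr -[V^t* *m ('i%C *: A')]scalemxAr (tangent_id0 tA) scaler0 subr0.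
split=> //.
 rewrite -[VA' - V](subrK ('i%C *: A'));apply:le_trans (mxnD _ _) _;rewrite mxn_i.
 have : kap * e ^+ 2 <= kap * e by rewrite ler_wpM2l // expr2 ler_piMr.
 by rewrite /K1 mulrDl mul1r;lra.
rewrite h;apply:le_trans (mxnM _ _) _;rewrite mxn_adj -mulrA ler_wpM2l //.
Qed.

Let hA : mxn dA <= K1 * e. Proof. by case: (near_diff nA). Qed.
Let hB : mxn dB <= K1 * e. Proof. by case: (near_diff nB). Qed.
Let VAE : VA = V + dA. Proof. by rewrite /dA addrC subrK. Qed.
Let VBE : VB = V + dB. Proof. by rewrite /dB addrC subrK. Qed.
Let hVB : mxn VB <= v + K1.
Proof.
rewrite VBE;apply:le_trans (mxnD _ _) _;rewrite lerD2l;apply:le_trans hB _.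
by rewrite ler_piMr.
Qed.

Definition sdiff_const : R := k%:R * (K1 * (v + K1) + v * K1).
Lemma sdiff_const_ge0 : 0 <= sdiff_const.
Proof. by rewrite mulr_ge0 // addr_ge0 ?mulr_ge0 // addr_ge0. Qed.

Lemma sdiff X : mxn (S X - T X) <= sdiff_const * e * mxn X.
Proof.
have -> : S X - T X = chan2 dA VB X + chan2 V dB X.
 have -> : chan2 dA VB X = S X - chan2 V VB X.
  by rewrite /S {1}VAE chan2Dl addrAC subrr add0r.
 have -> : chan2 V VB X = T X + chan2 V dB X by rewrite {1}VBE chan2Dr.
 by rewrite opprD addrA subrK.
apply:le_trans (mxnD _ _) _;apply:le_trans (lerD (chan2_mxn _ _ _) (chan2_mxn _ _ _)) _.
rewrite /sdiff_const -mulrDr -!mulrA ler_wpM2l // !mulrDl.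
have X0:= mxn_ge0 X;rewrite lerD //.
 have:= ler_pM (mxn_ge0 _) (mulr_ge0 X0 (mxn_ge0 VB)) hA (ler_wpM2l X0 hVB).
 by rewrite /K1;lra.
have:= ler_wpM2l (mulr_ge0 v0 X0) hB;rewrite -/v.
by rewrite /K1;lra.
Qed.

(** Everything that S changes on Z^j. The intertwining relations turn the two linear terms into
    multiples of V^* dB and of the adjoint of V^* dA, so nothing of first order remains. *)
Definition sec j : 'M[C]_d := chan2 dA dB (Zp j) + g ^+ j *: (Zp j *m (V^t* *m dB))
 + g ^+ j *: ((V^t* *m dA)^t* *m Zp j).

Lemma S_Zp j : S (Zp j) = g ^+ j *: Zp j + sec j.
Proof.
have e1' : chan2 V dB (Zp j) = g ^+ j *: (Zp j *m (V^t* *m dB)).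
 by rewrite /chan2 Zp_intertwine_adj -scalemxAl mulmxA.
have e2' : chan2 dA V (Zp j) = g ^+ j *: ((V^t* *m dA)^t* *m Zp j).
 by rewrite /chan2 -mulmxA Zp_intertwine -scalemxAr trmxC_mul trmxCK mulmxA.
rewrite /sec -e1' -e2' -chan_Zp -[T _]/(chan2 V V (Zp j)) /S;move:(dA) (dB) VAE VBE.
move=> a b -> ->;rewrite chan2Dl !chan2Dr -!addrA;congr (_ + _).
by rewrite [LHS]addrA [LHS]addrC.
Qed.

(** The peripheral component of [sec] j relative to g^j: [zeta] with VA - V and VB - V in place of A
    and B. *)
Definition cc j : C := brot j dA dB
 - (((Re (inner_id V dA dA) + Re (inner_id V dB dB)) / 2)%:C)
 + ((phase VB - phase VA)%:C * 'i%C).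

(** For D = W - V, the isometry condition V^* D + D^* V = - D^* D fixes the real part; the imaginary
    part is [phase]. *)
Lemma tr_diff W : W^t* *m W = 1%:M -> \tr (rho *m (V^t* *m (W - V))) =
 (- (Re (inner_id V (W - V) (W - V)) / 2))%:C + (phase W)%:C * 'i%C.
Proof.
move=> iW;have [D WE] : exists D, W = V + D by exists (W - V);rewrite addrC subrK.
have -> : W - V = D by rewrite WE addrC addKr.
set t:= \tr _.
have h : V^t* *m D + (V^t* *m D)^t* = - (D^t* *m D).
 apply/eqP;rewrite -subr_eq0 opprK;apply/eqP.
 have:= iW;rewrite WE adjD mulmxDl !mulmxDr irr_iso trmxC_mul trmxCK=> /eqP.
 rewrite -subr_eq0=> /eqP h;rewrite -[RHS]h.
 by rewrite -!addrA [RHS]addrC !addrA subrK.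
have h2 : t + t^* = - inner_id V D D.
 have -> : t^* = \tr (rho *m (V^t* *m D)^t*).
  by rewrite /t -tr_adj [(rho *m _)^t*]trmxC_mul rho_adj mxtrace_mulC.
 by rewrite /t -mxtraceD -mulmxDr h mulmxN raddfN /= mulmxA.
have ph : phase W = Im t.
 rewrite /phase /t WE mulmxDr -mulmxA irr_iso mulmx1 mxtraceD ImD mulmxA.
 by case:rho_facts=> _ -> _ _ /=;rewrite add0r.
apply:complexP.
 have:= congr1 (@complex.Re R) h2;rewrite ReD Reconj ReN ReD Defs.ReM /=;lra.
by rewrite ImD Defs.ImM /= ph;ring.
Qed.

Lemma fZ_sec (j : 'I_p) : fZ j (sec j) = g ^+ j * cc j.
Proof.
have [u1 u2] := Zp_unitary j;have [iA _ _ _] := nA;have [iB _ _ _] := nB.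
rewrite /sec !fZD !fZZ.
have -> : fZ j (chan2 dA dB (Zp j)) = g ^+ j * brot j dA dB.
 by rewrite brotE mulrA [_ * _^*]mulrC rootX_conj mul1r.
have -> : fZ j (Zp j *m (V^t* *m dB)) = \tr (rho *m (V^t* *m dB)).
 by rewrite /fZ mulmxA -[rho *m _ *m _]mulmxA u1 mulmx1.
have -> : fZ j ((V^t* *m dA)^t* *m Zp j) = (\tr (rho *m (V^t* *m dA)))^*.
 have -> : (\tr (rho *m (V^t* *m dA)))^* = \tr (rho *m (V^t* *m dA)^t*).
  by rewrite -tr_adj [(rho *m _)^t*]trmxC_mul rho_adj mxtrace_mulC.
 by rewrite /fZ mulmxA mxtrace_mulC !mulmxA -rho_Zp -[_ *m Zp j *m _]mulmxA u2 mulmx1.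
rewrite !tr_diff // -!mulrDr;congr (_ * _);rewrite /cc -/dA -/dB.
apply:complexP;rewrite !(ReD, ImD, Reconj, Imconj, ReN, ImN, Defs.ReM, Defs.ImM) /=;lra.
Qed.

Definition sec_const : R := k%:R * (K1 * K1 * zbound) + 2 * (zbound * (v * kap)).
Lemma sec_const_ge0 : 0 <= sec_const.
Proof. by rewrite addr_ge0 // !mulr_ge0 ?zbound_ge0. Qed.

Lemma sec_bound (j : 'I_p) : mxn (sec j) <= sec_const * e ^+ 2.
Proof.
have [_ _ bA] := near_diff nA;have [_ _ bB] := near_diff nB.
have z1:= Zp_bound j;have z0:= zbound_ge0;have zj:= mxn_ge0 (Zp j).
apply:le_trans (mxnD _ _) _;apply:le_trans (lerD (mxnD _ _) (lexx _)) _.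
rewrite !mxnZ cabs_rootX !mul1r /sec_const mulrDl.
have t1 : mxn (chan2 dA dB (Zp j)) <= k%:R * (K1 * K1 * zbound) * e ^+ 2.
 apply:le_trans (chan2_mxn _ _ _) _;rewrite -!mulrA ler_wpM2l //.
 apply:(@le_trans _ _ ((K1 * e) * (zbound * (K1 * e))));last by rewrite expr2;lra.
 by rewrite ler_pM ?mulr_ge0 ?mxn_ge0 // ler_pM ?mxn_ge0.
have t2 : mxn (Zp j *m (V^t* *m dB)) <= zbound * (v * kap * e ^+ 2).
 by apply:le_trans (mxnM _ _) _;rewrite ler_pM ?mxn_ge0.
have t3 : mxn ((V^t* *m dA)^t* *m Zp j) <= zbound * (v * kap * e ^+ 2).
 by apply:le_trans (mxnM _ _) _;rewrite mxn_adj mulrC ler_pM ?mxn_ge0.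
by lra.
Qed.

Definition cc_const : R := fbound * sec_const.

Lemma cc_bound (j : 'I_p) : cabs (cc j) <= cc_const * e ^+ 2.
Proof.
have -> : cabs (cc j) = cabs (fZ j (sec j)) by rewrite fZ_sec cabsM cabs_rootX mul1r.
apply:le_trans (fZ_bound _ _) _;rewrite /cc_const -mulrA ler_wpM2l ?fbound_ge0 //.
exact:sec_bound.
Qed.

Lemma i_conj_i : ('i%C)^* * 'i%C = 1 :> C.
Proof. by apply:complexP;rewrite ?Defs.ReM ?Defs.ImM ?Reconj ?Imconj /=;ring. Qed.

Lemma brot_diff (j : 'I_p) (X Y VX VY : 'M[C]_(d * k, d)) : near kap e X VX -> near kap e Y VY ->
 cabs (brot j (VX - V) (VY - V) - brot j X Y) <= bbound * (kap * (K1 + 1)) * e ^+ 3.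
Proof.
move=> nX nY;have [_ _ Xe RX] := nX;have [_ _ Ye RY] := nY.
have [dY _ _] := near_diff nY.
set RX' := VX - V - _ in RX;set RY' := VY - V - _ in RY.
have eX : VX - V = 'i%C *: X + RX' by rewrite /RX' addrCA subrr addr0.
have eY : VY - V = 'i%C *: Y + RY' by rewrite /RY' addrCA subrr addr0.
move:dY eX eY;move:(VX - V) (VY - V)=> DX DY dY eX eY.
have -> : brot j DX DY - brot j X Y = brot j RX' DY + brot j ('i%C *: X) RY'.
 rewrite {1}eX brotDl {1}eY brotDr.
 have -> : brot j ('i%C *: X) ('i%C *: Y) = brot j X Y.
  by rewrite !brotE chan2Zl chan2Zr scalerA i_conj_i scale1r.
 ring.
apply:le_trans (cabsD _ _) _;apply:le_trans (lerD (brot_bound _ _ _) (brot_bound _ _ _)) _.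
rewrite -mulrDr -(mulrA bbound) ler_wpM2l ?bbound_ge0 // mxn_i.
have h1 : mxn RX' * mxn DY <= (kap * e ^+ 2) * (K1 * e) by rewrite ler_pM ?mxn_ge0.
have h2 : mxn X * mxn RY' <= e * (kap * e ^+ 2) by rewrite ler_pM ?mxn_ge0.
by apply:le_trans (lerD h1 h2) _;apply/eqW;ring.
Qed.

Definition zeta_const : R := 2 * (bbound * (kap * (K1 + 1))).

Lemma cc_zeta (j : 'I_p) : cabs (cc j - zeta j A B VA VB) <= zeta_const * e ^+ 3.
Proof.
have h1:= brot_diff j nA nB.
have h2:= brot_diff (Ordinal period_gt0) nA nA;have h3:= brot_diff (Ordinal period_gt0) nB nB.
have -> : cc j - zeta j A B VA VB = (brot j dA dB - brot j A B) -
  (((Re (inner_id V dA dA) + Re (inner_id V dB dB)) / 2 - (Re (inner_id V A A) + Re (inner_id V B B)) / 2)%:C).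
 by rewrite /cc /zeta rmorphB /=;ring.
apply:le_trans (cabs_sub _ _) _;rewrite cabs_real.
have h4:= le_trans (Re_le_cabs _) h2;have h5:= le_trans (Re_le_cabs _) h3.
rewrite ReB brot0 brot0 -/dA in h4;rewrite ReB brot0 brot0 -/dB in h5.
rewrite -/dA -/dB in h1.
have h6 : `|(Re (inner_id V dA dA) + Re (inner_id V dB dB)) / 2 - (Re (inner_id V A A) + Re (inner_id V B B)) / 2| <= bbound * (kap * (K1 + 1)) * e ^+ 3.
 exact:half_dist.
by apply:le_trans (lerD h1 h6) _;apply/eqW;rewrite /zeta_const;ring.
Qed.

Lemma zeta_Re (j : 'I_p) : Re (zeta j A B VA VB) <= 0.
Proof. have:= brot_Re_le j A B;rewrite /zeta.
move:((Re _ + Re _) / 2) (brot j A B) (phase VB - phase VA)=> z [x1 x2] y /=;lra. Qed.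

Variables (Bc : R).
Hypotheses (Bc0 : 0 <= Bc) (hBc : forall (j : 'I_p) Y, fZ j Y = 0 ->
 exists X, g ^+ j *: X - T X = Y /\ mxn X <= Bc * mxn Y).

Let iA : VA^t* *m VA = 1%:M. Proof. by case: nA. Qed.
Let iB : VB^t* *m VB = 1%:M. Proof. by case: nB. Qed.
Let M : R := (d * d)%:R.
Let lS : mxlinear S. Proof. exact: chan2_linear. Qed.
Let bS m X : mxn (iter m S X) <= M * mxn X. Proof. exact: chan2_iter_bound. Qed.
Let lSm m : mxlinear (iter m S).
Proof. by elim:m=> [|m IH] a X Y //=;rewrite IH lS. Qed.
Let eM n : (0 < n)%N -> e ^+ n <= e.
Proof. by case:n=> // n _;rewrite exprS ler_piMr // exprn_ile1. Qed.

Lemma cc_const_ge0 : 0 <= cc_const.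
Proof. by rewrite mulr_ge0 ?fbound_ge0 ?sec_const_ge0. Qed.
Lemma zeta_const_ge0 : 0 <= zeta_const.
Proof. by have b0:= bbound_ge0;rewrite /zeta_const;nneg. Qed.

Definition exp_const : R := zeta_const + 3 * (cc_const + zeta_const) ^+ 2.
Lemma exp_const_ge0 : 0 <= exp_const.
Proof. by rewrite addr_ge0 ?zeta_const_ge0 // mulr_ge0 // sqr_ge0. Qed.

(** The eigenvalue is replaced by an exponential because its n-th power is then explicit. *)
Lemma exp_zeta (j : 'I_p) : cabs (1 + cc j - cexp (zeta j A B VA VB)) <= exp_const * e ^+ 3.
Proof.
set z:= zeta _ _ _ _ _;have z0 : Re z <= 0 by apply:zeta_Re.
have h1:= cc_zeta j;rewrite -/z in h1;have h2:= cc_bound j.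
have h3:= cexp_taylor_left z0.
have zc : cabs z <= (cc_const + zeta_const) * e ^+ 2.
 have -> : z = cc j - (cc j - z) by ring.
 apply:le_trans (cabs_sub _ _) _;rewrite mulrDl;apply:lerD=> //.
 apply:le_trans h1 _;rewrite ler_wpM2l ?zeta_const_ge0 // exprS ler_piMl ?exprn_ge0 //.
have h4 : cabs z ^+ 2 <= (cc_const + zeta_const) ^+ 2 * e ^+ 3.
 apply:(@le_trans _ _ (((cc_const + zeta_const) * e ^+ 2) ^+ 2)).
  by rewrite lerXn2r ?nnegrE ?cabs_ge0 // mulr_ge0 ?exprn_ge0 // addr_ge0 ?cc_const_ge0 ?zeta_const_ge0.
 rewrite exprMn ler_wpM2l ?sqr_ge0 // -exprM (exprS _ 3) ler_piMl ?exprn_ge0 //.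
have -> : 1 + cc j - cexp z = (cc j - z) - (cexp z - 1 - z) by ring.
apply:le_trans (cabs_sub _ _) _;rewrite /exp_const mulrDl;apply:lerD=> //.
by apply:le_trans h3 _;rewrite -mulrA ler_wpM2l.
Qed.

Definition corr_const : R := Bc * (sec_const + cc_const * zbound).
Lemma corr_const_ge0 : 0 <= corr_const.
Proof. by rewrite mulr_ge0 // addr_ge0 ?sec_const_ge0 // mulr_ge0 ?cc_const_ge0 ?zbound_ge0. Qed.

Definition eig_const : R := sdiff_const * corr_const + cc_const * corr_const
 + exp_const * (zbound + corr_const).
Lemma eig_const_ge0 : 0 <= eig_const.
Proof.
by have x0:= exp_const_ge0;have z0:= zbound_ge0;rewrite /eig_const;nneg.
Qed.

(** First order perturbation theory: w solves (g^j - T) w = Y, where Y is the part of [sec] j that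
    the eigenvalue does not account for; [fZ] j Y = 0 makes this solvable, and the remaining error
    is of third order. *)
Lemma approx_eigen (j : 'I_p) : exists w, mxn w <= corr_const * e ^+ 2 /\
 mxn (S (Zp j + w) - (g ^+ j * cexp (zeta j A B VA VB)) *: (Zp j + w)) <= eig_const * e ^+ 3.
Proof.
set ze:= cexp _;have z0:= zbound_ge0.
pose Y:= sec j - (g ^+ j * cc j) *: Zp j.
have fY : fZ j Y = 0 by rewrite /Y fZB fZZ fZ_sec fZ_Zp eqxx mulr1 subrr.
have [w [wY wB]] := hBc fY.
have Yb : mxn Y <= (sec_const + cc_const * zbound) * e ^+ 2.
 apply:le_trans (mxnB _ _) _;rewrite mulrDl;apply:lerD;first exact:sec_bound.
 rewrite mxnZ cabsM cabs_rootX mul1r mulrAC;apply:ler_pM=> //;[exact:cabs_ge0|exact:mxn_ge0|exact:cc_bound|exact:Zp_bound].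
have wb : mxn w <= corr_const * e ^+ 2.
 by apply:le_trans wB _;rewrite /corr_const -mulrA ler_wpM2l.
exists w;split=> //.
have -> : S (Zp j + w) - (g ^+ j * ze) *: (Zp j + w) =
  (S w - T w) - (g ^+ j * cc j) *: w + (g ^+ j * (1 + cc j - ze)) *: (Zp j + w).
 rewrite (mxlinD lS) S_Zp.
 have -> : sec j = g ^+ j *: w - T w + (g ^+ j * cc j) *: Zp j by rewrite wY /Y subrK.
 apply/matrixP=> x y;move:(S w) (T w)=> s t;rewrite !mxE;ring.
have w0:= mxn_ge0 w.
have t1 : mxn (S w - T w) <= sdiff_const * corr_const * e ^+ 3.
 apply:le_trans (sdiff _) _;rewrite -!(mulrA sdiff_const).
 apply:ler_wpM2l;first exact:sdiff_const_ge0.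
 by rewrite exprS mulrCA;apply:ler_wpM2l.
have t2 : mxn ((g ^+ j * cc j) *: w) <= cc_const * corr_const * e ^+ 3.
 rewrite mxnZ cabsM cabs_rootX mul1r.
 apply:(@le_trans _ _ ((cc_const * e ^+ 2) * (corr_const * e ^+ 2))).
  by apply:ler_pM=> //;[exact:cabs_ge0 | exact:cc_bound].
 rewrite mulrACA;apply:ler_wpM2l.
  by apply:mulr_ge0;[exact:cc_const_ge0 | exact:corr_const_ge0].
 by rewrite -exprD [leLHS](exprS e 3) ler_piMl ?exprn_ge0.
have t3 : mxn ((g ^+ j * (1 + cc j - ze)) *: (Zp j + w)) <= exp_const * (zbound + corr_const) * e ^+ 3.
 rewrite mxnZ cabsM cabs_rootX mul1r mulrAC;apply:ler_pM;rewrite ?cabs_ge0 ?mxn_ge0 //.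
  exact:exp_zeta.
 apply:le_trans (mxnD _ _) _;apply:lerD;first exact:Zp_bound.
 by apply:le_trans wb _;rewrite ler_piMr ?corr_const_ge0 // exprn_ile1.
apply:le_trans (mxnD _ _) _;apply:le_trans (lerD (mxnB _ _) (lexx _)) _.
rewrite /eig_const [leRHS]mulrDl (mulrDl (sdiff_const * corr_const)).
exact:lerD (lerD t1 t2) t3.
Qed.

(** Power boundedness of S lets the errors of the n steps add up instead of multiplying. *)
Lemma iter_eigen E a eta n : cabs a <= 1 -> mxn (S E - a *: E) <= eta ->
 mxn (iter n S E - a ^+ n *: E) <= n%:R * (M * eta).
Proof.
move=> a1 h;elim:n=> [|n IH].
 by rewrite expr0 scale1r subrr mxn0 mul0r.
have -> : iter n.+1 S E - a ^+ n.+1 *: E = iter n S (S E - a *: E) + a *: (iter n S E - a ^+ n *: E).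
 by rewrite iterSr (mxlinB (lSm n)) (mxlinZ (lSm n)) scalerBr addrA subrK scalerA exprS.
apply:le_trans (mxnD _ _) _;rewrite mxnZ -[n.+1]add1n natrD mulrDl mul1r;apply:lerD.
 by apply:le_trans (bS _ _) _;rewrite ler_wpM2l.
by apply:le_trans IH;rewrite ler_piMl ?mxn_ge0.
Qed.

(** The corrector w enters only at the two ends of the iteration, so its size e^2 is not multiplied
    by n. *)
Lemma iter_Zp (j : 'I_p) n :
 mxn (iter n S (Zp j) - (g ^+ j * cexp (zeta j A B VA VB)) ^+ n *: Zp j) <=
 n%:R * (M * (eig_const * e ^+ 3)) + (M + 1) * (corr_const * e ^+ 2).
Proof.
have [w [wb hw]] := approx_eigen j;set a:= _ * cexp _ in hw *.
have a1 : cabs a <= 1.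
 by rewrite cabsM cabs_rootX mul1r cabs_cexp -expR0 ler_expR zeta_Re.
have h:= iter_eigen n a1 hw.
have -> : iter n S (Zp j) - a ^+ n *: Zp j = (iter n S (Zp j + w) - a ^+ n *: (Zp j + w)) - (iter n S w - a ^+ n *: w).
 rewrite (mxlinD (lSm n)) scalerDr;apply/matrixP=> x y;move:(iter n S _) (iter n S w)=> s t.
 rewrite !mxE;ring.
apply:le_trans (mxnB _ _) _;apply:lerD=> //;apply:le_trans (mxnB _ _) _.
rewrite mulrDl mul1r;apply:lerD;first by apply:le_trans (bS _ _) _;rewrite ler_wpM2l.
by apply:le_trans wb;rewrite mxnZ ler_piMl ?mxn_ge0 // cabsX exprn_ile1 ?cabs_ge0.
Qed.

Lemma iter_diff m q X :
 mxn (iter m S (iter q T X) - iter (m + q) T X) <= m%:R * (M * (sdiff_const * e * (M * mxn X))).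
Proof.
elim:m q=> [|m IH] q;first by rewrite subrr mxn0 mul0r.
have -> : iter m.+1 S (iter q T X) - iter (m.+1 + q) T X =
  iter m S (S (iter q T X) - T (iter q T X)) + (iter m S (iter q.+1 T X) - iter (m + q.+1) T X).
 by rewrite iterSr (mxlinB (lSm m)) addrA subrK addnS.
apply:le_trans (mxnD _ _) _;rewrite -[m.+1]add1n natrD mulrDl mul1r;apply:lerD;last exact:IH.
apply:le_trans (bS _ _) _;rewrite ler_wpM2l //;apply:le_trans (sdiff _) _.
apply:ler_wpM2l;last exact:iter_chan_bound.
by apply:mulr_ge0=> //;exact:sdiff_const_ge0.
Qed.

Variable N : nat.
Hypotheses (N0 : (0 < N)%N) (gap : forall X, inker X -> mxn (iter N T X) <= 2^-1 * mxn X).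
Let L : R := N%:R * (M * (sdiff_const * M)).

Let L0 : 0 <= L. Proof. by have s0 := sdiff_const_ge0; rewrite /L; nneg. Qed.

(** Every N steps halve the norm up to an error M L e; the level 2 M L e is the fixed point of this
    recursion. *)
Lemma iter_inker m X : inker X ->
 mxn (iter (m * N) S X) <= (M / 2 ^+ m + 2 * M * L * e) * mxn X.
Proof.
have M0 : 0 <= M by [].
elim:m X=> [|m IH] X kX.
 rewrite mul0n expr0 divr1 /= mulrDl;apply:le_trans (bS 0 X) _.
 by rewrite lerDl;nneg.
have kT q : inker (iter q T X) by elim:q=> //= q;exact:inker_chan.
rewrite mulSn addnC iterD;have x0:= mxn_ge0 X.
have -> : iter N S X = iter N T X + (iter N S X - iter N T X) by rewrite addrC subrK.
rewrite (mxlinD (lSm _));apply:le_trans (mxnD _ _) _.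
have h1:= IH _ (kT N);have h2:= gap kX.
have h3 : mxn (iter N S X - iter N T X) <= L * e * mxn X.
 have:= iter_diff N 0 X;rewrite addn0 /= => h;apply:le_trans h _.
 by rewrite /L;apply/eqW;ring.
have h4:= le_trans (bS (m * N) (iter N S X - iter N T X)) (ler_wpM2l M0 h3).
have c0 : 0 <= M / 2 ^+ m + 2 * M * L * e.
 by nneg.
have h5:= le_trans h1 (ler_wpM2l c0 h2).
apply:le_trans (lerD h5 h4) _;rewrite exprSr invfM;apply/eqW;field.
by rewrite expf_neq0.
Qed.

(** The geometric decay in n %/ N is weakened to N / n, which is enough for the rate that is
    needed. *)
Lemma iter_inker_bound n X : (0 < n)%N -> inker X ->
 mxn (iter n S X) <= (M * M * N%:R / n%:R + 2 * M * M * L * e) * mxn X.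
Proof.
move=> n0 kX;rewrite {1}(divn_eq n N) addnC iterD;apply:le_trans (bS _ _) _.
have M0 : 0 <= M by [].
apply:le_trans (ler_wpM2l M0 (iter_inker (n %/ N) kX)) _;rewrite mulrA ler_wpM2r ?mxn_ge0 //.
have -> : M * (M / 2 ^+ (n %/ N) + 2 * M * L * e) = M * (M / 2 ^+ (n %/ N)) + 2 * M * M * L * e by ring.
rewrite lerD2r -2![leRHS]mulrA;do 2![apply:ler_wpM2l=> //].
rewrite -[leRHS]invrK lef_pV2 ?posrE ?exprn_gt0 ?invr_gt0 ?mulr_gt0 ?invr_gt0 ?ltr0n //.
rewrite invfM invrK ler_pdivrMl ?ltr0n //.
have h : (n <= N * 2 ^ (n %/ N))%N.
 have:= ltn_expl (n %/ N) (isT : (1 < 2)%N)=> h.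
 have:= ltn_ceil n N0;rewrite mulnC=> h2;apply:ltnW (leq_trans h2 _).
 by rewrite leq_pmul2l.
by rewrite -natrX -natrM ler_nat.
Qed.

Lemma iter_chan2_pair n X : (0 < n)%N ->
 mxn (iter n S X - \sum_(j < p) ((g ^+ j * cexp (zeta j A B VA VB)) ^+ n * fZ j X) *: Zp j) <=
 ((1 + p%:R * (fbound * zbound)) * (M * M * N%:R / n%:R + 2 * M * M * L * e)
  + p%:R * (fbound * (n%:R * (M * (eig_const * e ^+ 3)) + (M + 1) * (corr_const * e ^+ 2)))) * mxn X.
Proof.
move=> n0;have M0 : 0 <= M by [].
set a:= fun j : 'I_p=> g ^+ j * cexp (zeta j A B VA VB).
have XE : X = kerproj X + \sum_(j < p) fZ j X *: Zp j by rewrite /kerproj subrK.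
have -> : iter n S X - \sum_(j < p) (a j ^+ n * fZ j X) *: Zp j =
  iter n S (kerproj X) + \sum_(j < p) fZ j X *: (iter n S (Zp j) - a j ^+ n *: Zp j).
 rewrite {1}XE (mxlinD (lSm n)) (mxlin_sum (lSm n)) -addrA -sumrB;congr (_ + _).
 by apply:eq_bigr=> j _;rewrite (mxlinZ (lSm n)) scalerBr scalerA mulrC.
have kX : mxn (kerproj X) <= (1 + p%:R * (fbound * zbound)) * mxn X.
 apply:le_trans (mxnB _ _) _;rewrite mulrDl mul1r lerD2l;apply:le_trans (mxn_sum _ _ _) _.
 apply:(@le_trans _ _ (\sum_(j < p) (fbound * mxn X * zbound))).
  apply:ler_sum=> j _;rewrite mxnZ;apply:ler_pM;rewrite ?cabs_ge0 ?mxn_ge0 //.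
   exact:fZ_bound.
  exact:Zp_bound.
 by rewrite sumr_const card_ord -[leLHS]mulr_natl;apply/eqW;ring.
rewrite mulrDl;apply:le_trans (mxnD _ _) _;apply:lerD.
 apply:le_trans (iter_inker_bound n0 (inker_kerproj X)) _.
 rewrite mulrC [leRHS]mulrAC;apply:ler_wpM2r=> //;nneg.
apply:le_trans (mxn_sum _ _ _) _;set Q:= _ + (M + 1) * _.
apply:(@le_trans _ _ (\sum_(j < p) (fbound * mxn X * Q))).
 apply:ler_sum=> j _;rewrite mxnZ;apply:ler_pM;rewrite ?cabs_ge0 ?mxn_ge0 //.
  exact:fZ_bound.
 exact:iter_Zp.
by rewrite sumr_const card_ord -[leLHS]mulr_natl;apply/eqW;ring.
Qed.
End Pair.

(* e stands for |A| / sqrt n: first-order terms vanish on the peripheral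
  eigenvectors, so that n steps accumulate an error n e^3 only *)
Theorem iter_chan2_asymptotics kap : 0 <= kap -> exists2 K : R, 0 <= K &
 forall e A B VA VB n X, 0 <= e -> e <= 1 -> (0 < n)%N -> near kap e A VA -> near kap e B VB ->
 mxn (iter n (chan2 VA VB) X -
    \sum_(j < p) ((g ^+ j * cexp (zeta j A B VA VB)) ^+ n * fZ j X) *: Zp j) <=
 K * (n%:R^-1 + e + n%:R * e ^+ 3) * mxn X.
Proof.
move=> kap0;have [Bc Bc0 hBc] := corrector_unif;have [N N0 gap] := spectral_gap.
pose M : R:= (d * d)%:R.
pose a1:= (1 + p%:R * (fbound * zbound)) * (M * M * N%:R).
pose a2:= (1 + p%:R * (fbound * zbound)) * (2 * M * M * (N%:R * (M * (sdiff_const kap * M)))) + p%:R * (fbound * ((M + 1) * corr_const kap Bc)).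
pose a3:= p%:R * (fbound * (M * eig_const kap Bc)).
have M0 : 0 <= M by [].
have z0:= zbound_ge0;have f0:= fbound_ge0.
have s0:= sdiff_const_ge0 kap0;have c0:= corr_const_ge0 kap0 Bc0;have g0:= eig_const_ge0 kap0 Bc0.
have a10 : 0 <= a1 by rewrite /a1;nneg.
have a20 : 0 <= a2 by rewrite /a2;nneg.
have a30 : 0 <= a3 by rewrite /a3;nneg.
exists (a1 + a2 + a3);first by apply:addr_ge0=> //;apply:addr_ge0.
move=> e A B VA VB n X e0 e1 n0 nA nB.
apply:le_trans (iter_chan2_pair kap0 e0 e1 nA nB Bc0 hBc N0 gap X n0) _.
rewrite ler_wpM2r ?mxn_ge0 //.
have e2 : e ^+ 2 <= e by rewrite expr2 ler_piMr.
have n1 : 0 <= n%:R^-1 :> R by rewrite invr_ge0.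
have e3 : 0 <= n%:R * e ^+ 3 by rewrite mulr_ge0 ?exprn_ge0.
apply:(@le_trans _ _ (a1 * n%:R^-1 + a2 * e + a3 * (n%:R * e ^+ 3))).
 have h : p%:R * (fbound * ((M + 1) * (corr_const kap Bc * e ^+ 2))) <= p%:R * (fbound * ((M + 1) * (corr_const kap Bc * e))).
  by do 4?[rewrite ler_wpM2l //];rewrite ?addr_ge0.
 rewrite /a1 /a2 /a3 -/M;lra.
have h1:= mulr_ge0 a10 e0;have h2:= mulr_ge0 a10 e3;have h3:= mulr_ge0 a20 n1.
have h4:= mulr_ge0 a20 e3;have h5:= mulr_ge0 a30 e0;have h6:= mulr_ge0 a30 n1.
by move:h1 h2 h3 h4 h5 h6;set ee:= n%:R * e ^+ 3;set nn:= n%:R^-1;lra.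
Qed.
End Cyclic.

Local Notation derive_mx := Defs.derive_mx.

(** * Smooth complex and matrix valued functions *)

Section ComplexClasses.
Variables (R : realType) (E : normedModType R).
Local Notation C := R[i].
Implicit Types (U : set E) (n : nat).

Definition cx_class n U (f : E -> C) :=
 diff_class n U (fun x => Re (f x)) /\ diff_class n U (fun x => Im (f x)).

Lemma cx_class_ext n U f g : open U -> (forall x, U x -> f x = g x) ->
 cx_class n U f -> cx_class n U g.
Proof.
move=> oU fg [h1 h2];split;[apply:diff_class_ext h1 | apply:diff_class_ext h2] => // x Ux;
 by rewrite fg.
Qed.

Lemma cx_class_cst n U (c : C) : cx_class n U (fun=> c).
Proof. by split;exact:diff_class_cst. Qed.

Lemma cx_classD n U f g : open U -> cx_class n U f -> cx_class n U g ->
 cx_class n U (fun x => f x + g x).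
Proof.
move=> oU [f1 f2] [g1 g2];split.
 by under [X in diff_class _ _ X]funext do rewrite ReD;exact:diff_classD.
by under [X in diff_class _ _ X]funext do rewrite ImD;exact:diff_classD.
Qed.

Lemma cx_classM n U f g : open U -> cx_class n U f -> cx_class n U g ->
 cx_class n U (fun x => f x * g x).
Proof.
move=> oU [f1 f2] [g1 g2];split.
 under [X in diff_class _ _ X]funext do rewrite Defs.ReM.
 by apply:diff_classB=> //;exact:diff_classM.
under [X in diff_class _ _ X]funext do rewrite Defs.ImM.
by apply:diff_classD=> //;exact:diff_classM.
Qed.

Lemma cx_class_conj n U f : open U -> cx_class n U f -> cx_class n U (fun x => (f x)^*).
Proof.
move=> oU [f1 f2];split.
 by under [X in diff_class _ _ X]funext do rewrite Reconj.
by under [X in diff_class _ _ X]funext do rewrite Imconj;exact:diff_classN.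
Qed.

Lemma cx_class_real n U (f : E -> R) : diff_class n U f -> cx_class n U (fun x => (f x)%:C).
Proof. by move=> hf;split=> //;exact:diff_class_cst. Qed.

Lemma sqn_neq0 (z : C) : z != 0 -> sqn z != 0.
Proof. by move=> z0;apply:contra_neq z0;exact:sqn_eq0. Qed.

Lemma cx_classV n U f : open U -> (forall x, U x -> f x != 0) -> cx_class n U f ->
 cx_class n U (fun x => (f x)^-1).
Proof.
move=> oU f0 hf;apply:(@cx_class_ext _ _ (fun x=> (f x)^* * ((sqn (f x))^-1)%:C))=> //.
 move=> x Ux;have s0 : (sqn (f x))%:C != 0.
  by apply:contra_neq (sqn_neq0 (f0 x Ux))=> /complexI.
 apply:(mulIf (f0 x Ux));rewrite mulVf ?f0 // mulrAC conjMz fmorphV mulfV //.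
apply:cx_classM=> //;first exact:cx_class_conj.
apply:cx_class_real;apply:diff_classV=> //;first by move=> x /f0/sqn_neq0.
case:hf=> h1 h2;rewrite /sqn;under [X in diff_class _ _ X]funext do rewrite !expr2.
by apply:diff_classD=> //;exact:diff_classM.
Qed.

Lemma cx_class_sum n U (I : Type) (r : seq I) (F : I -> E -> C) : open U ->
 (forall i, cx_class n U (F i)) -> cx_class n U (fun x => \sum_(i <- r) F i x).
Proof.
move=> oU h;elim:r=> [|i r IH].
 by under [X in cx_class _ _ X]funext do rewrite big_nil;exact:cx_class_cst.
by under [X in cx_class _ _ X]funext do rewrite big_cons;exact:cx_classD.
Qed.

Lemma cx_class_prod n U (I : Type) (r : seq I) (F : I -> E -> C) : open U ->
 (forall i, cx_class n U (F i)) -> cx_class n U (fun x => \prod_(i <- r) F i x).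
Proof.
move=> oU h;elim:r=> [|i r IH].
 by under [X in cx_class _ _ X]funext do rewrite big_nil;exact:cx_class_cst.
by under [X in cx_class _ _ X]funext do rewrite big_cons;exact:cx_classM.
Qed.

Definition mx_class k U m n (f : E -> 'M[C]_(m, n)) :=
 forall a b, cx_class k U (fun x => f x a b).

Lemma smooth_mxP U m n (f : E -> 'M[C]_(m, n)) : smooth_mx_on U f <-> forall k, mx_class k U f.
Proof.
split=> [h k a b|h a b];first by have [h1 h2] := h a b;split.
by split=> k;have [] := h k a b.
Qed.

Lemma mx_class_ext k U m n (f g : E -> 'M[C]_(m, n)) : open U -> (forall x, U x -> f x = g x) ->
 mx_class k U f -> mx_class k U g.
Proof. by move=> oU fg h a b;apply:cx_class_ext (h a b)=> // x /fg ->. Qed.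

Lemma mx_class_cst k U m n (A : 'M[C]_(m, n)) : mx_class k U (fun=> A).
Proof. by move=> a b;exact:cx_class_cst. Qed.

Lemma mx_classD k U m n (f g : E -> 'M[C]_(m, n)) : open U -> mx_class k U f -> mx_class k U g ->
 mx_class k U (fun x => f x + g x).
Proof.
by move=> oU hf hg a b;under [X in cx_class _ _ X]funext do rewrite mxE;exact:cx_classD.
Qed.

Lemma mx_classM k U m n q (f : E -> 'M[C]_(m, n)) (g : E -> 'M[C]_(n, q)) : open U ->
 mx_class k U f -> mx_class k U g -> mx_class k U (fun x => f x *m g x).
Proof.
move=> oU hf hg a b;under [X in cx_class _ _ X]funext do rewrite mxE.
by apply:cx_class_sum=> // j;exact:cx_classM.
Qed.

Lemma mx_classZ k U m n (c : E -> C) (f : E -> 'M[C]_(m, n)) : open U ->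
 cx_class k U c -> mx_class k U f -> mx_class k U (fun x => c x *: f x).
Proof.
by move=> oU hc hf a b;under [X in cx_class _ _ X]funext do rewrite mxE;exact:cx_classM.
Qed.

Lemma mx_classZc k U m n (c : C) (f : E -> 'M[C]_(m, n)) : open U ->
 mx_class k U f -> mx_class k U (fun x => c *: f x).
Proof. by move=> oU;apply:mx_classZ=> //;exact:cx_class_cst. Qed.

Lemma mx_classB k U m n (f g : E -> 'M[C]_(m, n)) : open U -> mx_class k U f -> mx_class k U g ->
 mx_class k U (fun x => f x - g x).
Proof.
move=> oU hf hg;apply:(@mx_class_ext _ _ _ _ (fun x=> f x + (-1) *: g x))=> //.
 by move=> x _;rewrite scaleN1r.
by apply:mx_classD=> //;exact:mx_classZc.
Qed.

Lemma mx_class_adj k U m n (f : E -> 'M[C]_(m, n)) : open U -> mx_class k U f ->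
 mx_class k U (fun x => (f x)^t*).
Proof.
move=> oU hf a b;under [X in cx_class _ _ X]funext do rewrite !mxE;exact:cx_class_conj.
Qed.

Lemma cx_class_det k U n (f : E -> 'M[C]_n) : open U -> mx_class k U f ->
 cx_class k U (fun x => \det (f x)).
Proof.
move=> oU hf;apply:cx_class_sum=> // s;apply:cx_classM=> //;first exact:cx_class_cst.
by apply:cx_class_prod=> // i;exact:hf.
Qed.

(** Cramer's formula reduces the inverse to sums, products and one scalar inverse. *)
Lemma mx_class_inv k U n (f : E -> 'M[C]_n) : open U -> (forall x, U x -> f x \in unitmx) ->
 mx_class k U f -> mx_class k U (fun x => invmx (f x)).
Proof.
move=> oU uf hf.
apply:(@mx_class_ext _ _ _ _ (fun x=> (\det (f x))^-1 *: \adj (f x)))=> //.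
 by move=> x Ux;rewrite /invmx uf.
apply:mx_classZ=> //.
 by apply:cx_classV=> //;exact:cx_class_det.
move=> a b;under [X in cx_class _ _ X]funext do rewrite !mxE /cofactor.
apply:cx_classM=> //;first exact:cx_class_cst.
apply:cx_class_det=> // i j;under [X in cx_class _ _ X]funext do rewrite !mxE.
exact:hf.
Qed.

Definition mx_derivable m n (f : E -> 'M[C]_(m, n)) (x v : E) :=
 forall a b, derivable (fun y => Re (f y a b)) x v /\ derivable (fun y => Im (f y a b)) x v.

Lemma mx_class_derivable U m n (f : E -> 'M[C]_(m, n)) x v : mx_class 1 U f -> U x ->
 mx_derivable f x v.
Proof.
by move=> h Ux a b;have [[_ h1] [_ h2]] := h a b;split;[case:(h1 v) | case:(h2 v)] => d _;exact:d.
Qed.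

Lemma mx_derivableP m n (f : E -> 'M[C]_(m, n)) x v a b : mx_derivable f x v ->
 is_derive x v (fun y => Re (f y a b)) (Re (derive_mx f x v a b)) /\
 is_derive x v (fun y => Im (f y a b)) (Im (derive_mx f x v a b)).
Proof. by move=> h;have [h1 h2] := h a b;rewrite mxE /=;split;exact:derivableP. Qed.

Lemma derive_mxP m n (f : E -> 'M[C]_(m, n)) x v (D : 'M[C]_(m, n)) :
 (forall a b, is_derive x v (fun y => Re (f y a b)) (Re (D a b)) /\
  is_derive x v (fun y => Im (f y a b)) (Im (D a b))) ->
 mx_derivable f x v /\ derive_mx f x v = D.
Proof.
move=> h;split=> [a b|];first by have [[? _] [? _]] := h a b.
apply/matrixP=> a b;rewrite mxE;have [h1 h2] := h a b.
by apply:complexP=> /=;apply:derive_val.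
Qed.

Lemma derive_mx_cst m n (A : 'M[C]_(m, n)) x v :
 mx_derivable (fun=> A) x v /\ derive_mx (fun=> A) x v = 0.
Proof. by apply:derive_mxP=> a b;rewrite mxE;split;exact:is_derive_cst. Qed.

Lemma derive_mxD m n (f g : E -> 'M[C]_(m, n)) x v : mx_derivable f x v -> mx_derivable g x v ->
 mx_derivable (fun y => f y + g y) x v /\
 derive_mx (fun y => f y + g y) x v = derive_mx f x v + derive_mx g x v.
Proof.
move=> hf hg;apply:derive_mxP=> a b.
have -> : (derive_mx f x v + derive_mx g x v) a b = derive_mx f x v a b + derive_mx g x v a b.
 by rewrite [LHS]mxE.
have [f1 f2] := mx_derivableP a b hf;have [g1 g2] := mx_derivableP a b hg.
split.
 by under [X in is_derive _ _ X]funext do rewrite mxE ReD;rewrite ReD;exact:is_deriveD.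
by under [X in is_derive _ _ X]funext do rewrite mxE ImD;rewrite ImD;exact:is_deriveD.
Qed.

Lemma is_derive_sum_fun n (h : 'I_n -> E -> R) x v (dh : 'I_n -> R) :
 (forall i, is_derive x v (h i) (dh i)) ->
 is_derive x v (fun y => \sum_i h i y) (\sum_i dh i).
Proof.
move=> H;have:= is_derive_sum H.
by have -> : \sum_i h i = (fun y=> \sum_i h i y) by apply/funext=> y;rewrite fct_sumE.
Qed.

Lemma derive_mxM m n q (f : E -> 'M[C]_(m, n)) (g : E -> 'M[C]_(n, q)) x v :
 mx_derivable f x v -> mx_derivable g x v ->
 mx_derivable (fun y => f y *m g y) x v /\
 derive_mx (fun y => f y *m g y) x v = derive_mx f x v *m g x + f x *m derive_mx g x v.
Proof.
move=> hf hg;apply:derive_mxP=> a b.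
have -> : (derive_mx f x v *m g x + f x *m derive_mx g x v) a b =
  \sum_j (derive_mx f x v a j * g x j b + f x a j * derive_mx g x v j b).
 by rewrite [LHS]mxE [X in X + _]mxE [X in _ + X]mxE -big_split.
have F (I : Type) (r : seq I) (F : I -> C) : (Re (\sum_(i <- r) F i) = \sum_(i <- r) Re (F i)) * (Im (\sum_(i <- r) F i) = \sum_(i <- r) Im (F i)).
 by rewrite Re_sum Im_sum.
rewrite Re_sum Im_sum;split.
 under [X in is_derive _ _ X]funext do rewrite mxE Re_sum.
 apply:is_derive_sum_fun=> j;under [X in is_derive _ _ X]funext do rewrite Defs.ReM.
 have [f1 f2] := mx_derivableP a j hf;have [g1 g2] := mx_derivableP j b hg.
 apply:is_derive_eq;rewrite ReD !Defs.ReM /GRing.scale /=;ring.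
under [X in is_derive _ _ X]funext do rewrite mxE Im_sum.
apply:is_derive_sum_fun=> j;under [X in is_derive _ _ X]funext do rewrite Defs.ImM.
have [f1 f2] := mx_derivableP a j hf;have [g1 g2] := mx_derivableP j b hg.
apply:is_derive_eq;rewrite ImD !Defs.ImM /GRing.scale /=;ring.
Qed.

Lemma derive_mx_adj m n (f : E -> 'M[C]_(m, n)) x v : mx_derivable f x v ->
 mx_derivable (fun y => (f y)^t*) x v /\ derive_mx (fun y => (f y)^t*) x v = (derive_mx f x v)^t*.
Proof.
move=> hf;apply:derive_mxP=> a b;have [f1 f2] := mx_derivableP b a hf.
have -> : ((derive_mx f x v)^t*) a b = (derive_mx f x v b a)^* by rewrite [LHS]mxE [in LHS]mxE.
split.
 by under [X in is_derive _ _ X]funext do rewrite !mxE Reconj;rewrite Reconj.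
by under [X in is_derive _ _ X]funext do rewrite !mxE Imconj;rewrite Imconj;exact:is_deriveN.
Qed.

Lemma derive_mx_near m n (f g : E -> 'M[C]_(m, n)) x v : (\forall y \near x, f y = g y) ->
 mx_derivable f x v -> mx_derivable g x v /\ derive_mx g x v = derive_mx f x v.
Proof.
move=> fg hf;apply:derive_mxP=> a b;have [f1 f2] := mx_derivableP a b hf.
by split;[apply:near_eq_is_derive f1 | apply:near_eq_is_derive f2];apply:filterS fg=> y ->.
Qed.
End ComplexClasses.

Section Chains.
Variables (R : realType) (N : nat).
Local Notation C := R[i].

Lemma cx_class_comp (F : normedModType R) n (U : set 'rV[R]_N) (W : set F)
  (f : 'rV[R]_N -> C) (x : F -> 'rV[R]_N) : open U -> open W ->
 (forall y, W y -> U (x y)) -> cx_class n U f ->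
 (forall i, diff_class n W (fun y => x y 0 i)) -> cx_class n W (fun y => f (x y)).
Proof.
move=> oU oW xU [h1 h2] hx;split.
 exact:(@diff_class_comp _ _ _ _ _ _ (fun z=> Re (f z)) x oU oW xU h1 hx).
exact:(@diff_class_comp _ _ _ _ _ _ (fun z=> Im (f z)) x oU oW xU h2 hx).
Qed.

Lemma derive_mx_chain (F : normedModType R) m n (U : set 'rV[R]_N) (f : 'rV[R]_N -> 'M[C]_(m, n))
  (x : F -> 'rV[R]_N) (e v : F) (dx : 'I_N -> R) : open U -> mx_class 1 U f -> U (x e) ->
 (forall i, is_derive e v (fun y => x y 0 i) (dx i)) ->
 mx_derivable (fun y => f (x y)) e v /\
 derive_mx (fun y => f (x y)) e v = \sum_i (dx i)%:C *: derive_mx f (x e) (delta_mx 0 i).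
Proof.
move=> oU hf Ux hx;apply:derive_mxP=> a b;have [h1 h2] := hf a b.
have c1:= is_derive_chain oU h1 Ux hx;have c2:= is_derive_chain oU h2 Ux hx.
rewrite summxE Re_sum Im_sum;split.
 by apply:is_derive_eq c1 _;apply:eq_bigr=> i _;rewrite !mxE Defs.ReM /= mul0r subr0.
by apply:is_derive_eq c2 _;apply:eq_bigr=> i _;rewrite !mxE Defs.ImM /= mul0r addr0.
Qed.

Variables (m n : nat) (B : 'I_N -> 'M[C]_(m, n)).
Definition rlin (x : 'rV[R]_N) : 'M[C]_(m, n) := \sum_j (x 0 j)%:C *: B j.

Lemma rlin0 : rlin 0 = 0.
Proof. by rewrite /rlin big1 // => j _;rewrite mxE scale0r. Qed.

Lemma mx_class_rlin k (U : set 'rV[R]_N) : open U -> mx_class k U rlin.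
Proof.
move=> oU a b;under [X in cx_class _ _ X]funext do rewrite summxE.
apply:cx_class_sum=> // j;under [X in cx_class _ _ X]funext do rewrite mxE.
by apply:cx_classM=> //;[apply:cx_class_real;exact:diff_class_coord | exact:cx_class_cst].
Qed.

Lemma derive_rlin x v : derive_mx rlin x v = rlin v.
Proof.
suff [] : mx_derivable rlin x v /\ derive_mx rlin x v = rlin v by [].
apply:derive_mxP=> a b;rewrite summxE Re_sum Im_sum.
have h j:= derivableP (derive_coord j x v).1.
split.
 under [X in is_derive _ _ X]funext do rewrite summxE Re_sum.
 apply:is_derive_sum_fun=> j.
 under [X in is_derive _ _ X]funext do rewrite mxE Defs.ReM /= mul0r subr0.
 rewrite mxE Defs.ReM /= mul0r subr0 -(derive_coord j x v).2.
 by apply:is_derive_eq;rewrite scaler0 add0r mulrC.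
under [X in is_derive _ _ X]funext do rewrite summxE Im_sum.
apply:is_derive_sum_fun=> j.
under [X in is_derive _ _ X]funext do rewrite mxE Defs.ImM /= mul0r addr0.
rewrite mxE Defs.ImM /= mul0r addr0 -(derive_coord j x v).2.
by apply:is_derive_eq;rewrite scaler0 add0r mulrC.
Qed.
End Chains.

Ltac mxfield := apply/matrixP => ? ?; rewrite !mxE; field; rewrite ?pnatr_eq0 //.

(** * Stability of irreducibility *)

Section Openness.
Variables (R : realType) (d k : nat).
Local Notation C := R[i].
Variable V : 'M[C]_(d * k, d).
Hypothesis irr : irreducible V.
Local Notation rho := (rho_ss V).
Implicit Types (W : 'M[C]_(d * k, d)) (sigma : 'M[C]_d).

Lemma predual_diff W sigma : mxn (W - V) <= 1 ->
 mxn (predual W sigma - predual V sigma) <=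
 k%:R * (2 * mxn V + 1) * mxn (W - V) * mxn sigma.
Proof.
move=> h1;set D:= W - V in h1 *.
have kE i : kraus W i = kraus V i + kraus D i.
 by rewrite -krausD /D addrC subrK.
rewrite /predual -sumrB;apply:le_trans (mxn_sum _ _ _) _.
apply:(@le_trans _ _ (\sum_(i < k) ((2 * mxn V + 1) * mxn D * mxn sigma)));last first.
 by rewrite sumr_const card_ord -[leLHS]mulr_natl !mulrA.
apply:ler_sum=> i _.
have -> : kraus W i *m sigma *m (kraus W i)^t* - kraus V i *m sigma *m (kraus V i)^t* =
  kraus D i *m sigma *m (kraus W i)^t* + kraus V i *m sigma *m (kraus D i)^t*.
 have cE (a b c e x : 'M[C]_d) : (a + b) *m x *m (c + e) - a *m x *m c = b *m x *m (c + e) + a *m x *m e.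
  by rewrite !mulmxDl mulmxDr addrC -!addrA addKr addrC.
 by rewrite !kE adjD cE.
have v0:= mxn_ge0 V;have d0:= mxn_ge0 D;have s0:= mxn_ge0 sigma.
have hD:= kraus_mxn D i;have hV:= kraus_mxn V i.
have hW : mxn (kraus W i) <= mxn V + mxn D by rewrite kE;apply:le_trans (mxnD _ _) (lerD _ _).
apply:le_trans (mxnD _ _) _.
have t1 : mxn (kraus D i *m sigma *m (kraus W i)^t*) <= mxn D * mxn sigma * (mxn V + mxn D).
 apply:le_trans (mxnM _ _) _;rewrite mxn_adj;apply:ler_pM;rewrite ?mxn_ge0 //.
 by apply:le_trans (mxnM _ _) _;apply:ler_pM;rewrite ?mxn_ge0.
have t2 : mxn (kraus V i *m sigma *m (kraus D i)^t*) <= mxn V * mxn sigma * mxn D.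
 apply:le_trans (mxnM _ _) _;rewrite mxn_adj;apply:ler_pM;rewrite ?mxn_ge0 //.
 by apply:le_trans (mxnM _ _) _;apply:ler_pM;rewrite ?mxn_ge0.
apply:le_trans (lerD t1 t2) _;have p0:= mulr_ge0 d0 s0.
have h : mxn D * mxn sigma * mxn D <= mxn D * mxn sigma by rewrite ler_piMr.
by move:h;set x:= mxn D;set y:= mxn sigma;set z:= mxn V;lra.
Qed.

(** For W near V the map [statmap] V W is a small perturbation of the invertible [statmap] V V. The
    unique sigma that it sends to rho has trace one and is fixed by the predual of W; uniqueness
    makes it hermitian, and closeness to rho makes it positive definite. *)
Lemma stationary_near : exists r K : R, [/\ 0 < r, 0 <= K & forall W, W^t* *m W = 1%:M ->
 mxn (W - V) < r -> irreducible W /\ mxn (rho_ss W - rho) <= K * mxn (W - V)].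
Proof.
have [iV [prho trho frho] drho _] := irreducible_rho irr.
have hrho:= psd_hermitian prho.
have [c c0 hc] := posdef_lower prho drho.
have [B B0 hB] := mxlin_inverse (statmap_linear V V) (statmap_inj irr).
pose K1:= k%:R * (2 * mxn V + 1).
have v0:= mxn_ge0 V;have m0:= mxn_ge0 rho.
have K10 : 0 <= K1 by rewrite /K1;nneg.
have inv sigma : mxn sigma <= B * mxn (statmap V V sigma).
 have [tau h1 h2] := hB (statmap V V sigma).
 suff e : sigma = tau by rewrite {1}e.
 apply/eqP;rewrite eq_sym -subr_eq0;apply/eqP/(statmap_inj irr).
 by rewrite (mxlinB (statmap_linear V V)) h1 subrr.
pose a:= 2 * (B * K1) + 1.
have a0 : 0 < a by rewrite /a ltr_wpDl //;nneg.
(* a^-1 keeps B K1 x below 1/2, the bound 1 serves [predual_diff], and the last term keeps sigma -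
   rho below the lower bound c of rho. *)
pose r:= Num.min a^-1 (Num.min 1 (c / (a * (mxn rho + 1)))).
have r0 : 0 < r.
 by rewrite !lt_min invr_gt0 a0 ltr01 divr_gt0 // mulr_gt0 // ltr_wpDl.
exists r, (a * mxn rho);split=> //;first by rewrite mulr_ge0 // ltW.
move=> W iW hW;set x:= mxn (W - V) in hW *;have x0 : 0 <= x:= mxn_ge0 _.
have x1 : x <= 1 by apply:le_trans (ltW hW) _;rewrite !ge_min lexx orbT.
have xa : x * a <= 1.
 by rewrite -ler_pdivlMr // mul1r;apply:le_trans (ltW hW) _;rewrite ge_min lexx.
have xc : x * (a * (mxn rho + 1)) < c.
 have q0 : 0 < a * (mxn rho + 1) by rewrite mulr_gt0 // ltr_wpDl.
 by rewrite -ltr_pdivlMr //;apply:lt_le_trans hW _;rewrite !ge_min lexx !orbT.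
have dS sigma : mxn (statmap V W sigma - statmap V V sigma) <= K1 * x * mxn sigma.
 have -> : statmap V W sigma - statmap V V sigma = - (predual W sigma - predual V sigma).
  by rewrite /statmap [in LHS]opprD addrACA subrr addr0 [in LHS]opprB addrC subrKA opprB.
 by rewrite mxnN;exact:predual_diff.
have bx : B * (K1 * x) <= 2^-1.
 have -> : B * (K1 * x) = 2^-1 * (x * (2 * (B * K1))) by field.
 rewrite ler_piMr ?invr_ge0 //;apply:le_trans xa;rewrite ler_wpM2l // /a lerDl //.
have half sigma tau : statmap V W sigma = tau -> mxn sigma <= 2 * (B * mxn tau).
 move=> h;have h1:= inv sigma;have h2:= dS sigma;rewrite h in h2.
 have h3 : mxn (statmap V V sigma) <= mxn tau + K1 * x * mxn sigma.
  have -> : statmap V V sigma = tau - (tau - statmap V V sigma) by rewrite subKr.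
  by apply:le_trans (mxnB _ _) _;rewrite lerD2l.
 have h4:= ler_wpM2l B0 h3;have h5:= ler_wpM2r (mxn_ge0 sigma) bx.
 by move:h1 h4 h5;set s:= mxn sigma;set t:= mxn tau;set q:= mxn (statmap _ _ _);lra.
have injW sigma : statmap V W sigma = 0 -> sigma = 0.
 by move=> /half;rewrite mxn0 !mulr0;exact:mxn_eq0.
have lW:= statmap_linear V W.
have [Bw _ hBw] := mxlin_inverse lW injW.
have [sigma hs _] := hBw rho.
have uniq tau : statmap V W tau = rho -> tau = sigma.
 by move=> h;apply/eqP;rewrite -subr_eq0;apply/eqP/injW;rewrite (mxlinB lW) h hs subrr.
have trs : \tr sigma = 1.
 have:= congr1 (@mxtrace _ _) hs;rewrite /statmap mxtraceD mxtraceZ raddfB /= tr_predual1 //.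
 by rewrite subrr add0r trho mulr1.
have fs : predual W sigma = sigma.
 move:hs;rewrite /statmap trs scale1r=> /eqP;rewrite -subr_eq0 addrK subr_eq0.
 by move=> /eqP.
have hsig : sigma^t* = sigma.
 apply:uniq;rewrite /statmap predual_adj fs subrr add0r tr_adj trs rmorph1 scale1r //.
have near_s : mxn (sigma - rho) <= a * mxn rho * x.
 have e1 : statmap V W (sigma - rho) = - (statmap V W rho - statmap V V rho).
  by rewrite (mxlinB lW) hs {3}/statmap frho subrr add0r trho scale1r opprB.
 have h1:= half _ _ e1;rewrite mxnN in h1.
 have h2:= ler_wpM2l B0 (dS rho).
 apply:le_trans h1 _;apply:(@le_trans _ _ (2 * (B * (K1 * x * mxn rho)))).
  by rewrite ler_wpM2l.
 have -> : 2 * (B * (K1 * x * mxn rho)) = (2 * (B * K1)) * (mxn rho * x) by ring.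
 by rewrite -(mulrA a) ler_wpM2r ?mulr_ge0 // /a lerDl.
have near_c : mxn (sigma - rho) < c.
 apply:le_lt_trans near_s _;apply:le_lt_trans xc;rewrite mulrC ler_wpM2l //.
 by rewrite ler_wpM2l ?(ltW a0) // lerDl.
have low (y : 'cV[C]_d) : (c - mxn (sigma - rho)) * colsq y <= Re ((y^t* *m sigma *m y) 0 0).
 have -> : y^t* *m sigma *m y = y^t* *m rho *m y + y^t* *m (sigma - rho) *m y.
  by rewrite mulmxBr mulmxBl addrC subrK.
 have eE (A A' : 'M[C]_1) : (A + A') 0 0 = A 0 0 + A' 0 0 by rewrite mxE.
 rewrite eE ReD mulrBl.
 have h1:= hc y;have h2:= le_trans (Re_le_cabs _) (form_le_mxn (sigma - rho) y).
 move:h2;rewrite ler_norml=> /andP[h2 _].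
 by move:h1 h2;set p:= Re _;set q:= Re _;lra.
have st : stationary_state W sigma.
 split=> // y;rewrite (hermitian_form_real y hsig) lecR;apply:le_trans (low y).
 by rewrite mulr_ge0 ?colsq_ge0 // subr_ge0 ltW.
have ds : posdef sigma.
 move=> y y0;rewrite (hermitian_form_real y hsig) ltcR;apply:lt_le_trans (low y).
 rewrite mulr_gt0 ?subr_gt0 // lt_def colsq_ge0 andbT;apply:contra y0=> /eqP h.
 apply/eqP/matrixP=> i j;rewrite (ord1 j) mxE;apply/eqP;rewrite -cabs_eq0 -sqrf_eq0.
 by move/eqP: h;rewrite psumr_eq0=> [/allP/(_ i (mem_index_enum i))//|? _];rewrite exprn_ge0 ?cabs_ge0.
have us tau : stationary_state W tau -> tau = sigma.
 by move=> [_ t1 t2];apply:uniq;rewrite /statmap t2 subrr add0r t1 scale1r.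
have irrW : irreducible W by split=> //;exists sigma;split.
split=> //;have [_ _ _ u] := irreducible_rho irrW.
by rewrite -(u sigma st).
Qed.
End Openness.

Section SmallInverse.
Variable R : realType.
Local Notation C := R[i].

(** The inverse Y satisfies Y = 1 - X Y, and half of its norm is absorbed on the left. *)
Lemma unitmx_near n (X : 'M[C]_n) : mxn X <= 2^-1 ->
 1%:M + X \in unitmx /\ mxn (invmx (1%:M + X)) <= 2 * mxn (1%:M : 'M[C]_n).
Proof.
move=> hX;have u : 1%:M + X \in unitmx.
 rewrite -row_free_unit -kermx_eq0;apply/eqP;set K:= kermx _.
 have : K *m (1%:M + X) = 0 by exact:mulmx_ker.
 rewrite mulmxDr mulmx1=> /eqP;rewrite addr_eq0=> /eqP h.
 apply:mxn_eq0;have:= mxnM K X;rewrite -[mxn (K *m X)]mxnN -h.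
 have:= ler_wpM2l (mxn_ge0 K) hX;have:= mxn_ge0 K;lra.
split=> //;set Y:= invmx _.
have e : Y = 1%:M - X *m Y.
 have : (1%:M + X) *m Y = 1%:M by rewrite mulmxV.
 by rewrite mulmxDl mul1mx=> <-;rewrite addrK.
have : mxn Y <= mxn (1%:M : 'M[C]_n) + mxn X * mxn Y.
 by rewrite {1}e;apply:le_trans (mxnB _ _) _;rewrite lerD2l mxnM.
have:= ler_wpM2r (mxn_ge0 Y) hX;lra.
Qed.
End SmallInverse.

(** * Cayley coordinates on isometries *)

Section Cayley.
Variables (C : numClosedFieldType) (m d : nat).
Local Notation isom := 'M[C]_(m, d).
Variable V0 : isom.
Hypothesis iV0 : V0^t* *m V0 = 1%:M.
Implicit Types (W X Y : isom).

Definition vert X : 'M[C]_d := V0^t* *m X.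
Definition horiz X : isom := X - V0 *m vert X.
Definition skew (S : 'M[C]_d) := S^t* = - S.
(** With v = [vert] X and b = [horiz] X, the parametrization is (2 V0 + b) E^-1 - V0 with E = 1 - v
    / 2 + b^* b / 4. For b = 0 it is V0 times the Cayley transform (1 + v / 2) (1 - v / 2)^-1. Being
    rational, it has explicit derivatives and an explicit inverse. *)
Definition cden X : 'M[C]_d :=
 1%:M + ((- 2^-1) *: vert X + (4^-1) *: ((horiz X)^t* *m horiz X)).
Definition cayley X : isom := (2 *: V0 + horiz X) *m invmx (cden X) - V0.

Lemma vert_horiz X : vert (horiz X) = 0.
Proof. by rewrite /vert /horiz mulmxBr mulmxA iV0 mul1mx subrr. Qed.

Lemma horiz_V0 X : (horiz X)^t* *m V0 = 0.
Proof. by rewrite -[_ *m V0]trmxCK trmxC_mul trmxCK -/(vert _) vert_horiz trmx0 map_mx0. Qed.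

Lemma cden_adj X : skew (vert X) ->
 cden X + (cden X)^t* = 2 *: 1%:M + 2^-1 *: ((horiz X)^t* *m horiz X).
Proof.
move=> sk;rewrite /cden;move:(vert X) sk (horiz X)=> v sk h.
rewrite !adjD !adjZ adj1 sk trmxC_mul trmxCK.
have r1 : (- (2^-1 : C))^* = - 2^-1 by rewrite rmorphN fmorphV rmorph_nat.
have r2 : (4^-1 : C)^* = 4^-1 by rewrite fmorphV rmorph_nat.
rewrite r1 r2.
by move:(1%:M : 'M[C]_d) (h^t* *m h)=> o q;mxfield.
Qed.

(** With B = 2 V0 + b, the condition on E says that B^* B is twice the sum of E and its adjoint; the
    terms of B F and V0 then cancel. *)
Lemma cayley_isometry_aux (b : isom) (E F : 'M[C]_d) : V0^t* *m b = 0 -> E *m F = 1%:M ->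
 E + E^t* = 2 *: 1%:M + 2^-1 *: (b^t* *m b) ->
 ((2 *: V0 + b) *m F - V0)^t* *m ((2 *: V0 + b) *m F - V0) = 1%:M.
Proof.
move=> Vb EF EE.
have bV : b^t* *m V0 = 0 by rewrite -[_ *m V0]trmxCK trmxC_mul trmxCK Vb trmx0 map_mx0.
have FE : F^t* *m E^t* = 1%:M by rewrite -trmxC_mul EF adj1.
have r : (2 : C)^* = 2 by rewrite rmorph_nat.
have BB : (2 *: V0 + b)^t* *m (2 *: V0 + b) = 2 *: (E + E^t*).
 rewrite EE adjD adjZ r mulmxDl !mulmxDr -!scalemxAl -!scalemxAr iV0 bV Vb.
 move:(b^t* *m b)=> q;mxfield.
have BV : (2 *: V0 + b)^t* *m V0 = 2 *: 1%:M.
 by rewrite adjD adjZ r mulmxDl -scalemxAl iV0 bV addr0.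
have VB : V0^t* *m (2 *: V0 + b) = 2 *: 1%:M by rewrite mulmxDr -scalemxAr iV0 Vb addr0.
move:(2 *: V0 + b) BB BV VB=> B BB BV VB.
rewrite adjB trmxC_mul mulmxBl !mulmxBr.
have -> : F^t* *m B^t* *m (B *m F) = 2 *: (F^t* + F).
 have -> : F^t* *m B^t* *m (B *m F) = F^t* *m (B^t* *m B) *m F by rewrite !mulmxA.
 by rewrite BB -scalemxAr -scalemxAl mulmxDr mulmxDl -mulmxA EF mulmx1 FE mul1mx.
have -> : F^t* *m B^t* *m V0 = 2 *: F^t* by rewrite -mulmxA BV -scalemxAr mulmx1.
have -> : V0^t* *m (B *m F) = 2 *: F by rewrite mulmxA VB -scalemxAl mul1mx.
rewrite iV0;move:(F^t*)=> G;mxfield.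
Qed.

Lemma cayley_isometry X : skew (vert X) -> cden X \in unitmx ->
 (cayley X)^t* *m cayley X = 1%:M.
Proof.
move=> sk uE;apply:cayley_isometry_aux (cden_adj sk);last exact:mulmxV.
exact:vert_horiz.
Qed.

(* inverse of the Cayley parametrization, from (W + V0) E = 2 V0 + b with V0^* (W + V0) E = 2 *)
Definition cinv W : isom :=
 let N := invmx (1%:M + vert W) in
 let b := 2 *: (horiz W *m N) in
 V0 *m (2 *: (1%:M + 4^-1 *: (b^t* *m b) - 2 *: N)) + b.

Lemma cayley_inv W : W^t* *m W = 1%:M -> 1%:M + vert W \in unitmx ->
 [/\ cayley (cinv W) = W, skew (vert (cinv W)) & cden (cinv W) \in unitmx].
Proof.
move=> iW uP;set P:= 1%:M + vert W in uP;pose N:= invmx P.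
pose b:= 2 *: (horiz W *m N);pose s:= 2 *: (1%:M + 4^-1 *: (b^t* *m b) - 2 *: N).
have PN : P *m N = 1%:M by exact:mulmxV.
have NP : N *m P = 1%:M by exact:mulVmx.
have NaPa : N^t* *m P^t* = 1%:M by rewrite -trmxC_mul PN adj1.
have Vb : V0^t* *m b = 0 by rewrite /b -scalemxAr mulmxA -/(vert _) vert_horiz mul0mx scaler0.
have vE : vert (cinv W) = s by rewrite /cinv /vert mulmxDr mulmxA iV0 mul1mx -/b Vb addr0.
have hE : horiz (cinv W) = b by rewrite /horiz vE /cinv -/b -/s addrAC subrr add0r.
have dE : cden (cinv W) = 2 *: N.
 rewrite /cden vE hE /s;move:(b^t* *m b)=> q;mxfield.
have r2 : (2 : C)^* = 2 by rewrite rmorph_nat.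
have two : (2 : C) != 0 by rewrite pnatr_eq0.
have uN : N \in unitmx by rewrite unitmx_inv.
have u2N : 2 *: N \in unitmx by rewrite unitmxZ // unitfE.
have bb : b^t* *m b = 4 *: (N^t* *m ((P + P^t*) - P^t* *m P) *m N).
 have hh : (horiz W)^t* *m horiz W = P + P^t* - P^t* *m P.
  have -> : (horiz W)^t* *m horiz W = 1%:M - (vert W)^t* *m vert W.
   have -> : (horiz W)^t* *m horiz W = (horiz W)^t* *m W.
    by rewrite {2}/horiz mulmxBr mulmxA horiz_V0 mul0mx subr0.
   by rewrite /horiz adjB mulmxBl iW trmxC_mul -mulmxA.
  rewrite /P;move:(vert W)=> x;rewrite adjD adj1 mulmxDl !mulmxDr !mul1mx !mulmx1.
  move:(x^t* *m x) (x^t*)=> z y;mxfield.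
 rewrite /b adjZ r2 -scalemxAl -scalemxAr scalerA -natrM trmxC_mul.
 have -> : N^t* *m (horiz W)^t* *m (horiz W *m N) = N^t* *m ((horiz W)^t* *m horiz W) *m N by rewrite !mulmxA.
 by rewrite hh.
have bb2 : b^t* *m b = 4 *: (N^t* + N - 1%:M).
 rewrite bb;congr (_ *: _);rewrite mulmxBr mulmxBl mulmxDr mulmxDl.
 rewrite -[N^t* *m P *m N]mulmxA PN mulmx1 NaPa mul1mx.
 by rewrite [N^t* *m (P^t* *m P)]mulmxA NaPa mul1mx PN.
split;last by rewrite dE.
- rewrite /cayley dE hE.
 have -> : invmx (2 *: N) = 2^-1 *: P by rewrite invmxZ // /N invmxK.
 rewrite -scalemxAr mulmxDl -scalemxAl /b -scalemxAl -mulmxA NP mulmx1 -scalerDr scalerA mulVf // scale1r.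
 rewrite /P /horiz mulmxDr mulmx1;move:(V0 *m _)=> q;mxfield.
- have r4 : (4^-1 : C)^* = 4^-1 by rewrite fmorphV rmorph_nat.
 have q : (b^t* *m b)^t* = b^t* *m b by rewrite trmxC_mul trmxCK.
 rewrite /skew vE /s;move:(b^t* *m b) bb2 q=> w bb2 q.
 rewrite adjZ r2 adjB adjD adj1 !adjZ r2 r4 q bb2.
 by move:(N^t*) (N) (1%:M : 'M[C]_d)=> G N' o;mxfield.
Qed.

(** The derivatives of [cden] and [cayley] at X in direction Y, the latter by differentiating
    (cayley X + V0) cden X = 2 V0 + horiz X. *)
Definition dden X Y : 'M[C]_d :=
 (- 2^-1) *: vert Y + 4^-1 *: ((horiz Y)^t* *m horiz X + (horiz X)^t* *m horiz Y).
Definition dcayley X Y : isom :=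
 (horiz Y - (cayley X + V0) *m dden X Y) *m invmx (cden X).

Lemma vert_horizK X : X = V0 *m vert X + horiz X.
Proof. by rewrite /horiz addrC subrK. Qed.

Lemma cayley_plus X : cden X \in unitmx ->
 (cayley X + V0) *m cden X = 2 *: V0 + horiz X.
Proof. by move=> u;rewrite /cayley subrK -mulmxA mulVmx // mulmx1. Qed.

(** V0^* annihilates the horizontal side of the equation, and V0^* W is invertible by [cayley_plus];
    so [dden] X Y vanishes first. *)
Lemma dcayley_inj X Y : cden X \in unitmx -> dcayley X Y = 0 -> Y = 0.
Proof.
move=> u h;set W:= cayley X + V0.
have h1 : horiz Y = W *m dden X Y.
 have:= congr1 (fun M=> M *m cden X) h;rewrite /= /dcayley -mulmxA mulVmx // mulmx1 mul0mx.
 by move/eqP;rewrite subr_eq0=> /eqP.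
have h2 : V0^t* *m W *m cden X = 2%:M.
 by rewrite -mulmxA cayley_plus // mulmxDr -scalemxAr iV0 -/(vert (horiz X)) vert_horiz addr0 scalemx1.
have d0 : dden X Y = 0.
 have : V0^t* *m W *m dden X Y = 0 by rewrite -mulmxA -h1 -/(vert (horiz Y)) vert_horiz.
 move=> /(congr1 (mulmx (cden X)));rewrite mulmx0 mulmxA.
 have -> : cden X *m (V0^t* *m W) = 2%:M.
  have:= mulmx1C (A:= 2^-1 *: (V0^t* *m W)) (B:= cden X).
  rewrite -scalemxAl h2 -scalemx1 scalerA mulVf ?pnatr_eq0 // scale1r=> /(_ erefl).
  rewrite -scalemxAr=> /(congr1 (fun M=> 2 *: M));rewrite /= scalerA mulfV ?pnatr_eq0 // scale1r.
  by rewrite scalemx1.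
 by rewrite mul_scalar_mx=> /eqP;rewrite scaler_eq0 pnatr_eq0 /= => /eqP.
have hY : horiz Y = 0 by rewrite h1 d0 mulmx0.
have vY : vert Y = 0.
 move:d0;rewrite /dden hY mulmx0 trmx0 map_mx0 mul0mx addr0 scaler0 addr0=> /eqP.
 by rewrite scaler_eq0 oppr_eq0 invr_eq0 pnatr_eq0 /= => /eqP.
by rewrite (vert_horizK Y) vY hY mulmx0 addr0.
Qed.

(* differentiate (W + V0)^* (W + V0) computed in two ways *)
Lemma dcayley_surj_aux (b W Y : isom) (E : 'M[C]_d) : V0^t* *m b = 0 ->
 (W + V0) *m E = 2 *: V0 + b -> W^t* *m W = 1%:M -> skew (W^t* *m Y) ->
 let G := (- 2^-1) *: (E *m (V0^t* *m Y) *m E) in let b' := Y *m E + (W + V0) *m G in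
 V0^t* *m b' = 0 /\ b'^t* *m b + b^t* *m b' = 2 *: (G + G^t*).
Proof.
move=> Vb WE iW sY G b'.
have r2 : (2 : C)^* = 2 by rewrite rmorph_nat.
pose P:= 1%:M + V0^t* *m W.
have VP : V0^t* *m (W + V0) = P by rewrite mulmxDr iV0 addrC.
have PE : P *m E = 2 *: 1%:M by rewrite -VP -mulmxA WE mulmxDr -scalemxAr iV0 Vb addr0.
have EP : E *m P = 2 *: 1%:M.
 have:= mulmx1C (A:= 2^-1 *: P) (B:= E).
 rewrite -scalemxAl PE scalerA mulVf // scale1r=> /(_ erefl).
 by rewrite -scalemxAr=> <-;rewrite scalerA mulfV // scale1r.
have PaEa : E^t* *m P^t* = 2 *: 1%:M by rewrite -trmxC_mul PE adjZ adj1 r2.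
have Vb' : V0^t* *m b' = 0.
 rewrite /b' /G mulmxDr [V0^t* *m (_ *m (_ *: _))]mulmxA VP -scalemxAr !mulmxA PE.
 by rewrite -!scalemxAl mul1mx scalerA mulNr mulVf // scaleN1r subrr.
split=> //.
have hb : b = (W + V0) *m E - 2 *: V0 by rewrite WE addrAC subrr add0r.
have b'V : b'^t* *m V0 = 0 by rewrite -[_ *m V0]trmxCK trmxC_mul trmxCK Vb' trmx0 map_mx0.
have e1 : b'^t* *m b = b'^t* *m ((W + V0) *m E) by rewrite hb mulmxBr -scalemxAr b'V scaler0 subr0.
have e2 : b^t* *m b' = ((W + V0) *m E)^t* *m b'.
 by rewrite hb adjB mulmxBl adjZ r2 -scalemxAl Vb' scaler0 subr0.
have WV : W^t* *m V0 = (V0^t* *m W)^t* by rewrite trmxC_mul trmxCK.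
have WW : (W + V0)^t* *m (W + V0) = P + P^t*.
 rewrite adjD mulmxDl !mulmxDr iW iV0 WV /P adjD adj1.
 move:(V0^t* *m W)=> x;move:(x^t*)=> y;mxfield.
have YW : Y^t* *m (W + V0) + (W + V0)^t* *m Y = V0^t* *m Y + (V0^t* *m Y)^t*.
 rewrite mulmxDr adjD mulmxDl.
 have -> : Y^t* *m V0 = (V0^t* *m Y)^t* by rewrite trmxC_mul trmxCK.
 have -> : Y^t* *m W = - (W^t* *m Y) by rewrite -sY trmxC_mul trmxCK.
 move:(W^t* *m Y) (V0^t* *m Y)=> x y;move:(y^t*)=> z;mxfield.
have b'a : b'^t* = E^t* *m Y^t* + G^t* *m (W + V0)^t*.
 by rewrite /b' [LHS]adjD;congr (_ + _);exact:trmxC_mul.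
have t1 : b'^t* *m ((W + V0) *m E) = E^t* *m (Y^t* *m (W + V0)) *m E + G^t* *m ((W + V0)^t* *m (W + V0)) *m E.
 by rewrite b'a mulmxDl !mulmxA.
have t2 : ((W + V0) *m E)^t* *m b' = E^t* *m ((W + V0)^t* *m Y) *m E + E^t* *m ((W + V0)^t* *m (W + V0)) *m G.
 by rewrite /b' mulmxDr (trmxC_mul (W + V0) E) !mulmxA.
rewrite e1 e2 t1 t2 WW addrACA -mulmxDl -mulmxDr YW.
have g1 : E^t* *m (P + P^t*) *m G = E^t* *m P *m G + 2 *: G.
 by rewrite mulmxDr mulmxDl PaEa -scalemxAl mul1mx.
have g2 : G^t* *m (P + P^t*) *m E = 2 *: G^t* + G^t* *m P^t* *m E.
 by rewrite mulmxDr mulmxDl -[G^t* *m P *m E]mulmxA PE -scalemxAr mulmx1.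
have g3 : E^t* *m P *m G = - (E^t* *m (V0^t* *m Y) *m E).
 rewrite /G -scalemxAr !mulmxA -[E^t* *m P *m E]mulmxA PE -scalemxAr mulmx1 -!scalemxAl scalerA.
 by rewrite mulNr mulVf // scaleN1r.
have g4 : G^t* *m P^t* *m E = - (E^t* *m (V0^t* *m Y)^t* *m E).
 have -> : G^t* = (- 2^-1) *: (E^t* *m (V0^t* *m Y)^t* *m E^t*).
  rewrite /G adjZ [(_ *m E)^t*]trmxC_mul [(E *m _)^t*]trmxC_mul mulmxA;congr (_ *: _).
  by rewrite rmorphN fmorphV rmorph_nat.
 rewrite -!scalemxAl -[_ *m E^t* *m P^t*]mulmxA PaEa -scalemxAr mulmx1 -scalemxAl scalerA.
 by rewrite mulNr mulVf // scaleN1r.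
rewrite g1 g2 g3 g4 mulmxDr mulmxDl.
move:(E^t* *m (V0^t* *m Y) *m E) (E^t* *m (V0^t* *m Y)^t* *m E) (G^t*)=> x y z.
move:(G)=> G';mxfield.
Qed.

Lemma dcayley_surj X Y : skew (vert X) -> cden X \in unitmx -> skew ((cayley X)^t* *m Y) ->
 exists2 X', skew (vert X') & dcayley X X' = Y.
Proof.
move=> sX u sY.
have [] := dcayley_surj_aux (vert_horiz X) (cayley_plus u) (cayley_isometry sX u) sY.
rewrite /dcayley /dden;move:(horiz X) (cayley X) (cden X) u=> b W E u.
set G:= _ *: (E *m _ *m E);set b' := Y *m E + _=> Vb' key.
have b'E : b' - (W + V0) *m G = Y *m E by rewrite /b' addrK.
clearbody b' G.
(* The vertical part is chosen so that [dden] of the new vector equals G. *)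
pose s' := 2 *: (4^-1 *: (b'^t* *m b + b^t* *m b') - G).
have r2 : (2 : C)^* = 2 by rewrite rmorph_nat.
have vE : vert (V0 *m s' + b') = s' by rewrite /vert mulmxDr Vb' addr0 mulmxA iV0 mul1mx.
have hE : horiz (V0 *m s' + b') = b' by rewrite /horiz vE addrAC subrr add0r.
exists (V0 *m s' + b').
 rewrite /skew vE /s' key adjZ r2 adjB !adjZ r2 adjD trmxCK.
 have -> : (4^-1 : C)^* = 4^-1 by rewrite fmorphV rmorph_nat.
 move:(G^t*) (G)=> z G';mxfield.
rewrite vE hE.
have -> : - 2^-1 *: s' + 4^-1 *: (b'^t* *m b + b^t* *m b') = G.
 rewrite /s';move:(b'^t* *m b + _) (G)=> q G';mxfield.
by rewrite b'E -mulmxA mulmxV // mulmx1.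
Qed.
End Cayley.

Lemma invmx_double (F : numFieldType) n (M : 'M[F]_n) : M \in unitmx ->
 invmx (2 *: M) = 2^-1 *: invmx M.
Proof.
move=> uM;have u2 : (2 : F) != 0 by rewrite pnatr_eq0.
have h : 2^-1 *: invmx M *m (2 *: M) = 1%:M.
 by rewrite -scalemxAl -scalemxAr scalerA mulVf // scale1r mulVmx.
have [_ uM2] := mulmx1_unit h.
by rewrite -[LHS]mul1mx -h -mulmxA mulmxV // mulmx1.
Qed.

Lemma derive_mx_dir (R : realType) N m n (U : set 'rV[R]_N) (f : 'rV[R]_N -> 'M[R[i]]_(m, n)) x v :
 open U -> mx_class 1 U f -> U x ->
 derive_mx f x v = \sum_i (v 0 i)%:C *: derive_mx f x (delta_mx 0 i).
Proof.
move=> oU hf Ux;apply/matrixP=> a b;have [h1 h2] := hf a b.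
have [d1 e1] := diff_class1_differentiable oU Ux h1.
have [d2 e2] := diff_class1_differentiable oU Ux h2.
rewrite [LHS]mxE (deriveE v d1) (deriveE v d2) e1 e2 summxE.
apply:complexP;rewrite ?Re_sum ?Im_sum /=;apply:eq_bigr=> i _.
 by rewrite !mxE Defs.ReM /= mul0r subr0.
by rewrite !mxE Defs.ImM /= mul0r addr0.
Qed.

Section DeriveLinear.
Variables (R : realType) (E : normedModType R).
Local Notation C := R[i].

Lemma derive_mxMl m n q (A : 'M[C]_(m, n)) (f : E -> 'M[C]_(n, q)) x v : mx_derivable f x v ->
 mx_derivable (fun y => A *m f y) x v /\ derive_mx (fun y => A *m f y) x v = A *m derive_mx f x v.
Proof.
move=> hf;have [dA eA] := derive_mx_cst A x v.
by have [d1 e1] := derive_mxM dA hf;split=> //;rewrite e1 eA mul0mx add0r.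
Qed.

Lemma derive_mxZ m n (c : C) (f : E -> 'M[C]_(m, n)) x v : mx_derivable f x v ->
 mx_derivable (fun y => c *: f y) x v /\ derive_mx (fun y => c *: f y) x v = c *: derive_mx f x v.
Proof.
move=> /(derive_mxMl c%:M);rewrite mul_scalar_mx.
by under [X in mx_derivable X]funext do rewrite mul_scalar_mx;
  under [X in derive_mx X]funext do rewrite mul_scalar_mx.
Qed.
End DeriveLinear.

(** * A chart at V0 with real coordinates *)

Section Chart.
Variables (R : realType) (d k D : nat).
Local Notation C := R[i].
Local Notation isom := 'M[C]_(d * k, d).
Variables (V0 : isom) (e : 'I_D -> isom).
Hypotheses (irr : irreducible V0) (be : basis_id V0 e).
Local Notation J := (('I_d * 'I_d) + ('I_D + 'I_D))%type.
Local Notation N := #|{: J}|.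
Implicit Types (x v : 'rV[R]_N) (X Y W : isom).

Let iV0 : V0^t* *m V0 = 1%:M. Proof. by case: irr. Qed.

(* Every complex number is uniquely 2^-1 ((1 + i) a + (1 - i) b) with a, b real;
  with a = x_ab and b = x_ba this parametrizes hermitian matrices by real ones. *)
Definition herm_of x : 'M[C]_d := \matrix_(a, b)
 (2^-1 * ((1 + 'i%C) * (x 0 (enum_rank (inl (a, b))))%:C
     + (1 - 'i%C) * (x 0 (enum_rank (inl (b, a))))%:C)).

(** These are velocities, so the factor 'i of the tangent convention is already included and the
    vertical part is skew. *)
Definition tan_of x : isom := 'i%C *: (V0 *m herm_of x)
 + \sum_l ((x 0 (enum_rank (inr (inl l))))%:C + 'i%C * (x 0 (enum_rank (inr (inr l))))%:C) *: e l.

(** An entry of the hermitian part is (s + t) / 2 + 'i (s - t) / 2, with s and t the coordinates at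
    (a, b) and (b, a); the sum of its real and imaginary parts is s. *)
Definition tan_coord (X : isom) : 'rV[R]_N := \row_i
 match enum_val i with
 | inl (a, b) => let z := (- 'i%C *: vert V0 X) a b in Re z + Im z
 | inr (inl l) => Re (inner_id V0 (e l) X)
 | inr (inr l) => Im (inner_id V0 (e l) X)
 end.

Lemma tan_of_linear (a : R) x v : tan_of (a *: x + v) = a%:C *: tan_of x + tan_of v.
Proof.
rewrite /tan_of;have -> : herm_of (a *: x + v) = a%:C *: herm_of x + herm_of v.
 apply/matrixP=> i j;rewrite !mxE !rmorphD !rmorphM /=.
 move:(x 0 _)%:C (x 0 _)%:C (v 0 _)%:C (v 0 _)%:C (a%:C)=> z1 z2 z3 z4 z5.
 by move:(2^-1 : C) (1 + 'i%C : C) (1 - 'i%C : C)=> z6 z7 z8;ring.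
have h1 (A A' : 'M[C]_d) : 'i%C *: (V0 *m (a%:C *: A + A')) = a%:C *: ('i%C *: (V0 *m A)) + 'i%C *: (V0 *m A').
 by rewrite mulmxDr -scalemxAr scalerDr !scalerA (mulrC _ a%:C).
pose g (x : 'rV[R]_N) := \sum_l ((x 0 (enum_rank (inr (inl l))))%:C
 + 'i%C * (x 0 (enum_rank (inr (inr l))))%:C) *: e l.
have h2 : g (a *: x + v) = a%:C *: g x + g v.
 rewrite /g scaler_sumr -big_split;apply:eq_bigr=> l _ /=;rewrite scalerA -scalerDl !mxE !rmorphD !rmorphM /=.
 by congr (_ *: _);move:(_%:C) (_%:C) (_%:C) (_%:C) (_%:C)=> *;ring.
by rewrite h1 -!/(g _) h2 (scalerDr a%:C) addrACA.
Qed.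

Lemma tan_ofE x : tan_of x = rlin (fun i => tan_of (delta_mx 0 i)) x.
Proof.
rewrite {1}(row_sum_delta x) /rlin.
have z0 : tan_of 0 = 0.
 have:= tan_of_linear (-1) 0 0;rewrite scaler0 addr0 rmorphN rmorph1 scaleN1r.
 by rewrite addNr.
by elim/big_rec2: _=> // i y1 y2 _ <-;exact:tan_of_linear.
Qed.

Lemma tan_of_skew x : skew (vert V0 (tan_of x)).
Proof.
rewrite /vert /tan_of mulmxDr -scalemxAr mulmxA iV0 mul1mx mulmx_sumr big1 ?addr0;last first.
 by case:be=> te _ _ l _;rewrite -scalemxAr (tangent_id0 irr (te l)) scaler0.
rewrite /skew adjZ;have -> : (herm_of x)^t* = herm_of x.
 apply/matrixP=> a b;rewrite !mxE rmorphM fmorphV rmorph_nat rmorphD !rmorphM rmorphD rmorphB rmorph1 /=.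
 have cr (t : R) : (t%:C)^* = t%:C by apply:complexP=> //=;rewrite oppr0.
 by rewrite !cr conjCi opprK addrC.
by rewrite -scaleNr;congr (_ *: _);exact:conjCi.
Qed.

Lemma herm_of_eq0 x : herm_of x = 0 -> forall a b, x 0 (enum_rank (inl (a, b))) = 0.
Proof.
move=> h a b;move/matrixP: (h)=> /(_ a b);rewrite !mxE=> /eqP.
rewrite mulf_eq0 invr_eq0 pnatr_eq0 /= => /eqP.
move:(x 0 _) (x 0 _)=> u w h1;have:= congr1 (@complex.Re R) h1;have:= congr1 (@complex.Im R) h1.
rewrite ImD ReD !Defs.ReM !Defs.ImM ImB ReB ImD ReD /=;lra.
Qed.

Lemma tan_of_vert x : vert V0 (tan_of x) = 'i%C *: herm_of x.
Proof.
rewrite /vert /tan_of mulmxDr -scalemxAr mulmxA iV0 mul1mx mulmx_sumr big1 ?addr0 //.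
by case:be=> te _ _ l _;rewrite -scalemxAr (tangent_id0 irr (te l)) scaler0.
Qed.

Lemma inner_V0 l (X : 'M[C]_d) : inner_id V0 (e l) (V0 *m X) = 0.
Proof.
case:be=> te _ _;rewrite /inner_id -mulmxA [(e l)^t* *m _]mulmxA.
have -> : (e l)^t* *m V0 = 0.
 by rewrite -[_ *m V0]trmxCK trmxC_mul trmxCK (tangent_id0 irr (te l)) trmx0 map_mx0.
by rewrite mul0mx mulmx0 mxtrace0.
Qed.

Lemma inner_tan_of l x : inner_id V0 (e l) (tan_of x) =
 (x 0 (enum_rank (inr (inl l))))%:C + 'i%C * (x 0 (enum_rank (inr (inr l))))%:C.
Proof.
rewrite /tan_of innerDr innerZr inner_V0 mulr0 add0r.
have -> (I : Type) (r : seq I) (F : I -> isom) : inner_id V0 (e l) (\sum_(i <- r) F i) =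
  \sum_(i <- r) inner_id V0 (e l) (F i).
 apply:(big_morph (fun X=> inner_id V0 (e l) X))=> [x' y|];first exact:innerDr.
 by rewrite /inner_id mulmx0 mxtrace0.
case:be=> _ on _;rewrite (bigD1 l) //= innerZr on eqxx mulr1 big1 ?addr0 // => j jl.
by rewrite innerZr on eq_sym (negPf jl) mulr0.
Qed.

Lemma tan_of_inj x : tan_of x = 0 -> x = 0.
Proof.
move=> h;have h1 : forall a b, x 0 (enum_rank (inl (a, b))) = 0.
 apply:herm_of_eq0;apply/eqP;have:= tan_of_vert x.
 rewrite h /vert mulmx0=> /esym/eqP;rewrite scaler_eq0=> /orP[/eqP/(congr1 (@complex.Im R))/= /eqP|//].
 by rewrite oner_eq0.
have h2 l : (x 0 (enum_rank (inr (inl l)))) = 0 /\ (x 0 (enum_rank (inr (inr l)))) = 0.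
 have:= inner_tan_of l x;rewrite h /inner_id mulmx0 mxtrace0=> h0.
 by have:= congr1 (@complex.Re R) h0;have:= congr1 (@complex.Im R) h0;rewrite ImD ReD Defs.ImM Defs.ReM /=;split;lra.
apply/rowP=> i;rewrite mxE -(enum_valK i);case:(enum_val i)=> [[a b]|[l|l]].
- exact:h1.
- by have [] := h2 l.
- by have [] := h2 l.
Qed.

Lemma tan_coordK X : skew (vert V0 X) -> tan_of (tan_coord X) = X.
Proof.
move=> sX;have iE : 'i%C * - 'i%C = 1 :> C by apply:complexP;rewrite ?Defs.ReM ?Defs.ImM /=;ring.
rewrite [RHS](vert_horizK V0);congr (_ + _).
 rewrite scalemxAr;congr (_ *m _).
 have hK : (- 'i%C *: vert V0 X)^t* = - 'i%C *: vert V0 X.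
  have ci : (- 'i%C)^* = 'i%C :> C by apply:complexP;rewrite /= ?oppr0 ?opprK.
  by rewrite adjZ sX ci scalerN scaleNr.
 have -> : herm_of (tan_coord X) = - 'i%C *: vert V0 X;last by rewrite scalerA iE scale1r.
 set K:= - 'i%C *: vert V0 X in hK *.
 have tE a b : tan_coord X 0 (enum_rank (inl (a, b))) = Re (K a b) + Im (K a b).
  by rewrite mxE enum_rankK.
 apply/matrixP=> a b;rewrite [LHS]mxE !tE.
 move/matrixP: hK=> /(_ b a);rewrite [LHS]mxE [in LHS]mxE=> <-.
 rewrite Reconj Imconj;case:(K a b)=> u w /=.
 have h2 : (2^-1 : C) = (2^-1)%:C by rewrite fmorphV rmorph_nat.
 by rewrite h2;apply:complexP;rewrite !(Defs.ReM, Defs.ImM, ReD, ImD, ReB, ImB) /=;field.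
case:be=> te _ hb;rewrite [RHS](hb (horiz V0 X));last first.
 by rewrite /tangent_id -mulmxA -/(vert V0 (horiz V0 X)) vert_horiz ?mulmx0.
apply:eq_bigr=> l _;congr (_ *: _);rewrite !mxE !enum_rankK.
have -> : inner_id V0 (e l) (horiz V0 X) = inner_id V0 (e l) X.
 by rewrite /horiz innerDr innerNr inner_V0 subr0.
by apply:complexP;rewrite ?ReD ?ImD ?Defs.ReM ?Defs.ImM /=;ring.
Qed.

Lemma tan_of_bound : exists2 K : R, 0 <= K & forall x, mxn (tan_of x) <= K * `|x|.
Proof.
exists (\sum_i mxn (tan_of (delta_mx 0 i)));first by apply:sumr_ge0=> i _;exact:mxn_ge0.
move=> x;rewrite tan_ofE;apply:le_trans (mxn_sum _ _ _) _;rewrite mulr_suml;apply:ler_sum=> i _.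
by rewrite mxnZ cabs_real mulrC ler_wpM2l ?mxn_ge0 // rV_norm_coord.
Qed.

Lemma tan_coord_bound : exists2 K : R, 0 <= K & forall X, `|tan_coord X| <= K * mxn X.
Proof.
pose K1:= mxn (V0^t*);pose K2:= \sum_l mxn (rho_ss V0 *m (e l)^t*).
have k2 : 0 <= K2 by apply:sumr_ge0=> l _;exact:mxn_ge0.
have hi l X : cabs (inner_id V0 (e l) X) <= K2 * mxn X.
 apply:le_trans (mxn_tr _) _;apply:le_trans (mxnM _ _) _;rewrite ler_wpM2r ?mxn_ge0 //.
 by rewrite /K2 (bigD1 l) //= lerDl;apply:sumr_ge0=> ? _;exact:mxn_ge0.
exists (2 * K1 + K2);first by nneg.
move=> X;have x0:= mxn_ge0 X.
apply:rV_norm_le=> [|i];first by nneg.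
rewrite mxE mulrDl;case:(enum_val i)=> [[a b]|[l|l]].
- have h : cabs ((- 'i%C *: vert V0 X) a b) <= K1 * mxn X.
  by apply:le_trans (cabs_le_mxn _ _ _) _;rewrite mxnZ cabsN cabs_sqrt /sqn /= expr0n expr1n add0r sqrtr1 mul1r mxnM.
 have:= Re_le_cabs ((- 'i%C *: vert V0 X) a b);have:= Im_le_cabs ((- 'i%C *: vert V0 X) a b).
 have t:= ler_normD (Re ((- 'i%C *: vert V0 X) a b)) (Im ((- 'i%C *: vert V0 X) a b)).
 rewrite /= -(mulrA 2)=> h1 h2;have p:= mulr_ge0 k2 x0;move:(K2 * mxn X) p (K1 * mxn X) h=> y p z h;lra.
- apply:le_trans (Re_le_cabs _) _;apply:le_trans (hi l X) _;rewrite lerDr;nneg.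
- apply:le_trans (Im_le_cabs _) _;apply:le_trans (hi l X) _;rewrite lerDr;nneg.
Qed.

Let c1 := mxn (V0^t*).
Let c2 := 1 + mxn V0 * c1.
Let o := 2 * mxn (1%:M : 'M[C]_d).

Let c1_ge0 : 0 <= c1. Proof. exact: mxn_ge0. Qed.
Let c2_ge0 : 0 <= c2. Proof. by rewrite /c2; nneg. Qed.
Let o_ge0 : 0 <= o. Proof. by rewrite /o; nneg. Qed.

Lemma vert_le X : mxn (vert V0 X) <= c1 * mxn X. Proof. exact: mxnM. Qed.
Lemma horiz_le X : mxn (horiz V0 X) <= c2 * mxn X.
Proof.
apply:le_trans (mxnB _ _) _;rewrite /c2 mulrDl mul1r lerD2l -mulrA.
by apply:le_trans (mxnM _ _) _;rewrite ler_wpM2l ?mxn_ge0 ?vert_le.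
Qed.

Lemma mxn_real m n (a : R) (A : 'M[C]_(m, n)) : mxn (a%:C *: A) = `|a| * mxn A.
Proof. by rewrite mxnZ cabs_real. Qed.

Lemma cayley_near : exists r K : R, [/\ 0 < r, 0 <= K & forall X, mxn X <= r ->
 cden V0 X \in unitmx /\ mxn (cayley V0 X - V0 - X) <= K * mxn X ^+ 2].
Proof.
pose c3:= c1 + c2 ^+ 2.
have c30 : 0 <= c3 by rewrite /c3;nneg.
pose K:= mxn V0 * c2 ^+ 2 + c2 * c3 + (2 * mxn V0 + c2) * (c3 ^+ 2 * o).
have v0:= mxn_ge0 V0.
have K0 : 0 <= K by rewrite /K;nneg.
exists (2 * c3 + 1)^-1, K;split=> //;first by rewrite invr_gt0 ltr_wpDl //;nneg.
move=> X;set x:= mxn X=> hx;have x0 : 0 <= x:= mxn_ge0 X.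
have hx' : x * (2 * c3 + 1) <= 1 by rewrite -ler_pdivlMr ?mul1r // ltr_wpDl //;nneg.
have x1 : x <= 1 by apply:le_trans hx';rewrite ler_peMr // lerDr;nneg.
set v:= vert V0 X;set b:= horiz V0 X;pose q:= b^t* *m b.
pose Y:= - 2^-1 *: v + 4^-1 *: q.
have hv : mxn v <= c1 * x:= vert_le X;have hb : mxn b <= c2 * x:= horiz_le X.
have hq : mxn q <= c2 ^+ 2 * x ^+ 2.
 apply:le_trans (mxnM _ _) _;rewrite mxn_adj -exprMn expr2;apply:ler_pM;rewrite ?mxn_ge0 //.
have xx : x ^+ 2 <= x by rewrite expr2 ler_piMr.
have two : (2^-1 : C) = (2^-1)%:C by rewrite fmorphV rmorph_nat.
have four : (4^-1 : C) = (4^-1)%:C by rewrite fmorphV rmorph_nat.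
have hY : mxn Y <= c3 * x.
 apply:le_trans (mxnD _ _) _;rewrite scaleNr mxnN two four !mxn_real !ger0_norm ?invr_ge0 //.
 have h1 : c2 ^+ 2 * x ^+ 2 <= c2 ^+ 2 * x by rewrite ler_wpM2l ?exprn_ge0.
 have:= mxn_ge0 v;have:= mxn_ge0 q.
 by rewrite /c3 mulrDl;move:h1 hq hv;move:(c2 ^+ 2 * x) (c2 ^+ 2 * _) (c1 * x)=> *;lra.
have h2 : mxn Y <= 2^-1.
 apply:le_trans hY _;rewrite mulrC;move:hx';rewrite mulrDr mulr1 mulrCA.
 move:(x * c3)=> t;lra.
have [uE hF] := unitmx_near h2.
have dE : cden V0 X = 1%:M + Y by [].
split;first by rewrite dE.
rewrite /cayley dE;set F:= invmx (1%:M + Y) in hF *.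
(* Two terms of the Neumann series make the first order part equal to V0 v + b = X, which
   cancels. *)
have FE : F = 1%:M - Y + Y *m Y *m F.
 have h : F + Y *m F = 1%:M by rewrite -[X in X + _]mul1mx -mulmxDl mulmxV.
 have h' : F = 1%:M - Y *m F by rewrite -h addrK.
 by rewrite {1}h' {1}h' mulmxBr mulmx1 opprB -mulmxA addrA addrAC.
have -> : (2 *: V0 + b) *m F - V0 - V0 - X = - 2^-1 *: (V0 *m q) - b *m Y + (2 *: V0 + b) *m (Y *m Y *m F).
 rewrite {1}FE mulmxDr [X in X + _ - _ - _ - _](_ : _ = 2 *: V0 + b + V0 *m v - 2^-1 *: (V0 *m q) - b *m Y);last first.
  rewrite mulmxBr mulmx1 mulmxDl opprD addrA;congr (_ + _).
  rewrite -scalemxAl /Y mulmxDr -!scalemxAr;move:(V0 *m v) (V0 *m q)=> s1 s2;mxfield.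
 have XE : X = V0 *m v + b:= vert_horizK V0 X.
 rewrite [X in _ - _ - _ - X]XE;move:(V0 *m v) ((2 *: V0 + b) *m _) (V0 *m q) (b *m Y)=> s1 s2 s3 s4;mxfield.
apply:le_trans (mxnD _ _) _;rewrite /K mulrDl;apply:lerD.
 apply:le_trans (mxnB _ _) _;rewrite mulrDl;apply:lerD.
  rewrite scaleNr mxnN two mxn_real ger0_norm ?invr_ge0 //.
  apply:(@le_trans _ _ (mxn (V0 *m q)));first by rewrite ler_piMl ?mxn_ge0 // invf_le1 // ler1n.
  by apply:le_trans (mxnM _ _) _;rewrite -mulrA ler_wpM2l.
 apply:le_trans (mxnM _ _) _;have -> : c2 * c3 * x ^+ 2 = (c2 * x) * (c3 * x) by ring.
 by apply:ler_pM;rewrite ?mxn_ge0.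
apply:le_trans (mxnM _ _) _;rewrite -mulrA;apply:ler_pM;rewrite ?mxn_ge0 //.
 apply:le_trans (mxnD _ _) _;rewrite -[2]/(2%:R) -(rmorph_nat (real_complex R) 2) mxn_real ger0_norm // lerD2l.
 by apply:le_trans hb _;rewrite ler_piMr.
have -> : c3 ^+ 2 * o * x ^+ 2 = (c3 * x) * (c3 * x) * o by ring.
apply:le_trans (mxnM _ _) _;apply:ler_pM;rewrite ?mxn_ge0 //.
by apply:le_trans (mxnM _ _) _;apply:ler_pM;rewrite ?mxn_ge0.
Qed.

Lemma cinv_bound (b : isom) (F X : 'M[C]_d) (a a' o' x : R) : 0 <= a -> 0 <= o' -> 0 <= x <= 1 ->
 mxn b <= a * x -> mxn X <= a' * x -> mxn F <= o' -> F + X *m F = 1%:M ->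
 mxn (V0 *m (2 *: (1%:M + 4^-1 *: (b^t* *m b) - 2 *: (2^-1 *: F))) + b) <=
 (mxn V0 * (2 * (a ^+ 2 + a' * o')) + a) * x.
Proof.
move=> a0 o0 /andP[x0 x1] hb hX hF h.
have n2 : (2 : C) != 0 by rewrite pnatr_eq0.
have -> : 1%:M + 4^-1 *: (b^t* *m b) - 2 *: (2^-1 *: F) = 4^-1 *: (b^t* *m b) + X *m F.
 by rewrite scalerA (mulfV n2) scale1r -h addrAC (addrC F) addrK addrC.
apply:(le_trans (mxnD _ _));rewrite mulrDl;apply:lerD;last exact:hb.
apply:(le_trans (mxnM _ _));rewrite -mulrA;apply:ler_wpM2l;first exact:mxn_ge0.
rewrite mxnZ (cabs_nat R 2) -mulrA;apply:ler_wpM2l;first exact:ler0n.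
apply:(le_trans (mxnD _ _));rewrite mulrDl;apply:lerD.
 rewrite mxnZ cabsV (cabs_nat R 4);apply:(@le_trans _ _ (mxn (b^t* *m b))).
  by apply:ler_piMl;[exact:mxn_ge0 | rewrite invf_le1 ?ltr0n // ler1n].
 apply:(le_trans (mxnM _ _));rewrite mxn_adj;apply:(@le_trans _ _ ((a * x) * (a * x))).
  by apply:ler_pM;rewrite ?mxn_ge0.
 have -> : a * x * (a * x) = a ^+ 2 * (x * x) by ring.
 by apply:ler_wpM2l;[exact:sqr_ge0 | exact:ler_piMr].
apply:(le_trans (mxnM _ _));rewrite mulrAC;apply:ler_pM;rewrite ?mxn_ge0 //.
Qed.

Lemma cinv_near : exists r K : R, [/\ 0 < r, 0 <= K & forall W, mxn (W - V0) <= r ->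
 1%:M + vert V0 W \in unitmx /\ mxn (cinv V0 W) <= K * mxn (W - V0)].
Proof.
have v0:= mxn_ge0 V0.
exists (c1 + 1)^-1, (mxn V0 * (2 * ((c2 * o) ^+ 2 + 2^-1 * c1 * o)) + c2 * o).
split;[by rewrite invr_gt0 ltr_wpDl | by nneg;rewrite invr_ge0 |].
move=> W hx;have x0:= mxn_ge0 (W - V0).
have hx' : mxn (W - V0) * (c1 + 1) <= 1 by rewrite -ler_pdivlMr ?mul1r // ltr_wpDl.
have x1 : mxn (W - V0) <= 1 by apply:le_trans hx';rewrite ler_peMr // lerDr.
have hX : mxn ((2^-1 : C) *: vert V0 (W - V0)) <= 2^-1 * c1 * mxn (W - V0).
 by rewrite mxnZ cabsV (cabs_nat R 2) -(mulrA 2^-1);apply:ler_wpM2l;[rewrite invr_ge0 | exact:vert_le].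
have [|uM hM] := @unitmx_near _ _ ((2^-1 : C) *: vert V0 (W - V0)).
 apply:(le_trans hX);rewrite -mulrA ler_piMr ?invr_ge0 // mulrC;apply:le_trans hx'.
 by apply:ler_wpM2l=> //;rewrite lerDl.
have ME : 1%:M + vert V0 W = 2 *: (1%:M + 2^-1 *: vert V0 (W - V0)).
 rewrite /vert mulmxBr iV0;move:(V0^t* *m W)=> t;mxfield.
have NE : invmx (1%:M + vert V0 W) = 2^-1 *: invmx (1%:M + 2^-1 *: vert V0 (W - V0)).
 by rewrite ME;exact:invmx_double.
have hE : horiz V0 W = horiz V0 (W - V0).
 rewrite /horiz /vert !mulmxBr iV0 mulmx1;move:(V0 *m (_ *m _))=> t.
 by rewrite opprB addrA subrK.
have n2 : (2 : C) != 0 by rewrite pnatr_eq0.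
have u2 : (2 : C) \is a GRing.unit by rewrite unitfE.
split;first by rewrite ME unitmxZ.
have FE:= mulmxV uM;rewrite mulmxDl mul1mx in FE.
rewrite /cinv NE hE.
suff key (F X : 'M[C]_d) (b : isom) (x : R) : 0 <= x <= 1 -> mxn F <= o -> F + X *m F = 1%:M ->
  mxn X <= 2^-1 * c1 * x -> mxn b <= c2 * x ->
  mxn (V0 *m (2 *: (1%:M + 4^-1 *: ((2 *: (b *m (2^-1 *: F)))^t* *m (2 *: (b *m (2^-1 *: F))))
   - 2 *: (2^-1 *: F))) + 2 *: (b *m (2^-1 *: F))) <=
  (mxn V0 * (2 * ((c2 * o) ^+ 2 + 2^-1 * c1 * o)) + c2 * o) * x.
 by apply:key hM FE hX (horiz_le _);rewrite x0.
move=> x01 hF h hX' hb;have -> : 2 *: (b *m (2^-1 *: F)) = b *m F.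
 by rewrite -scalemxAr scalerA (mulfV n2) scale1r.
have hbF : mxn (b *m F) <= c2 * o * x.
 by apply:(le_trans (mxnM _ _));rewrite (mulrAC c2);apply:ler_pM;rewrite ?mxn_ge0.
by apply:cinv_bound hbF hX' hF h;[exact:mulr_ge0 | exact:o_ge0 |].
Qed.

Definition chart x : isom := cayley V0 (tan_of x).
Definition chart_inv W : 'rV[R]_N := tan_coord (cinv V0 W).

Lemma mx_class_tan_of n U : open U -> mx_class n U tan_of.
Proof.
move=> oU;apply:(@mx_class_ext _ _ _ _ _ _ (rlin (fun i=> tan_of (delta_mx 0 i))))=> //.
 by move=> x _;rewrite -tan_ofE.
exact:mx_class_rlin.
Qed.

Lemma mx_class_vert (E : normedModType R) n (U : set E) f : open U -> mx_class n U f ->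
 mx_class n U (fun y => vert V0 (f y)).
Proof. by move=> oU hf;apply:mx_classM=> //;exact:mx_class_cst. Qed.

Lemma mx_class_horiz (E : normedModType R) n (U : set E) f : open U -> mx_class n U f ->
 mx_class n U (fun y => horiz V0 (f y)).
Proof.
move=> oU hf;apply:mx_classB=> //;apply:mx_classM=> //;first exact:mx_class_cst.
exact:mx_class_vert.
Qed.

Lemma mx_class_cden (E : normedModType R) n (U : set E) f : open U -> mx_class n U f ->
 mx_class n U (fun y => cden V0 (f y)).
Proof.
move=> oU hf;apply:mx_classD=> //;first exact:mx_class_cst.
apply:mx_classD=> //;apply:mx_classZc=> //;first exact:mx_class_vert.
by apply:mx_classM=> //;[apply:mx_class_adj=> //;exact:mx_class_horiz | exact:mx_class_horiz].
Qed.

Lemma mx_class_chart n U : open U -> (forall x, U x -> cden V0 (tan_of x) \in unitmx) ->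
 mx_class n U chart.
Proof.
move=> oU uU;apply:mx_classB=> //;last exact:mx_class_cst.
apply:mx_classM=> //;last by apply:mx_class_inv=> //;apply:mx_class_cden=> //;exact:mx_class_tan_of.
apply:mx_classD=> //;first exact:mx_class_cst.
by apply:mx_class_horiz=> //;exact:mx_class_tan_of.
Qed.

Lemma diff_class_chart_inv (E : normedModType R) n (U : set E) (f : E -> isom) i : open U ->
 (forall y, U y -> 1%:M + vert V0 (f y) \in unitmx) -> mx_class n U f ->
 diff_class n U (fun y => chart_inv (f y) 0 i).
Proof.
move=> oU uU hf.
have hN : mx_class n U (fun y=> invmx (1%:M + vert V0 (f y))).
 apply:mx_class_inv=> //;apply:mx_classD=> //;[exact:mx_class_cst | exact:mx_class_vert].
have hb : mx_class n U (fun y=> 2 *: (horiz V0 (f y) *m invmx (1%:M + vert V0 (f y)))).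
 by apply:mx_classZc=> //;apply:mx_classM=> //;exact:mx_class_horiz.
have hc : mx_class n U (fun y=> cinv V0 (f y)).
 rewrite /cinv;apply:mx_classD=> //;apply:mx_classM=> //;first exact:mx_class_cst.
 apply:mx_classZc=> //;apply:mx_classB=> //;last exact:mx_classZc.
 apply:mx_classD=> //;first exact:mx_class_cst.
 by apply:mx_classZc=> //;apply:mx_classM=> //;exact:mx_class_adj.
rewrite /chart_inv;under [X in diff_class _ _ X]funext do rewrite mxE.
have hi l : cx_class n U (fun y=> inner_id V0 (e l) (cinv V0 (f y))).
 apply:cx_class_sum=> // j;suff h : mx_class n U (fun y=> rho_ss V0 *m (e l)^t* *m cinv V0 (f y)) by exact:h.
 by apply:mx_classM=> //;exact:mx_class_cst.
case:(enum_val i)=> [[a b]|[l|l]].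
- have [h1 h2] : cx_class n U (fun y=> (- 'i%C *: vert V0 (cinv V0 (f y))) a b).
  suff h : mx_class n U (fun y=> - 'i%C *: vert V0 (cinv V0 (f y))) by exact:h.
  by apply:mx_classZc=> //;exact:mx_class_vert.
 exact:diff_classD.
- by case:(hi l).
- by case:(hi l).
Qed.

Lemma derive_tan_of x v : mx_derivable tan_of x v /\ derive_mx tan_of x v = tan_of v.
Proof.
split;first exact:(mx_class_derivable v (mx_class_tan_of 1 (@openT _)) I).
by rewrite [in LHS](funext tan_ofE) derive_rlin -tan_ofE.
Qed.

Lemma derive_chart U x v : open U -> (forall y, U y -> cden V0 (tan_of y) \in unitmx) -> U x ->
 derive_mx chart x v = dcayley V0 (tan_of x) (tan_of v).
Proof.
move=> oU uU Ux.
have dp : mx_derivable chart x v:= mx_class_derivable v (mx_class_chart 1 oU uU) Ux.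
have [dt et] := derive_tan_of x v.
have [dv ev] : mx_derivable (fun y=> vert V0 (tan_of y)) x v /\
  derive_mx (fun y=> vert V0 (tan_of y)) x v = vert V0 (tan_of v).
 by have [? ee] := derive_mxMl (V0^t*) dt;split=> //;rewrite ee et.
pose H : 'M[C]_(d * k) := 1%:M - V0 *m V0^t*.
have hH X : horiz V0 X = H *m X by rewrite /horiz /H /vert mulmxBl mul1mx mulmxA.
have [dh eh] : mx_derivable (fun y=> horiz V0 (tan_of y)) x v /\
  derive_mx (fun y=> horiz V0 (tan_of y)) x v = horiz V0 (tan_of v).
 under [X in mx_derivable X]funext do rewrite hH.
 under [X in derive_mx X]funext do rewrite hH.
 by have [? ee] := derive_mxMl H dt;split=> //;rewrite ee et hH.
have [dha eha] := derive_mx_adj dh.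
have [dq eq] := derive_mxM dha dh.
have [d2 e2] := derive_mxZ (4^-1) dq.
have [d1 e1] := derive_mxZ (- 2^-1) dv.
have [d3 e3] := derive_mxD d1 d2.
have [dc ec] := derive_mx_cst (1%:M : 'M[C]_d) x v.
have [dE eE] := derive_mxD dc d3.
have {}eE : derive_mx (fun y=> cden V0 (tan_of y)) x v = dden V0 (tan_of x) (tan_of v).
 apply:etrans eE _;rewrite ec add0r;apply:etrans e3 _;rewrite /dden -ev.
 by apply:(congr2 +%R e1);apply:etrans e2 _;rewrite eq eha eh.
have [dV eV] := derive_mx_cst V0 x v.
have [dS eS] := derive_mxD dp dV.
have [dL eL] := derive_mxM dS dE.
have [dV2 eV2] := derive_mx_cst (2 *: V0) x v.
have [dR eR] := derive_mxD dV2 dh.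
have nE : \forall y \near x, 2 *: V0 + horiz V0 (tan_of y) = (chart y + V0) *m cden V0 (tan_of y).
 by apply:filterS (open_near oU Ux)=> y Uy;rewrite cayley_plus //;exact:uU.
have [_ key] := derive_mx_near nE dR.
move:key;rewrite eL eR eV2 add0r eh eS eV addr0 eE=> key.
rewrite /dcayley -/(chart x) -key addrK -mulmxA mulmxV ?mulmx1 //;exact:uU.
Qed.

Lemma tangent_skew (V L : isom) : tangent V L -> skew (V^t* *m ('i%C *: L)).
Proof.
rewrite /tangent /skew=> /eqP;rewrite subr_eq0=> /eqP h.
rewrite -scalemxAr adjZ trmxC_mul trmxCK h conjCi scaleNr //.
Qed.

Lemma skew_tangent (V L : isom) : skew (V^t* *m L) -> tangent V (- 'i%C *: L).
Proof.
rewrite /tangent /skew trmxC_mul trmxCK=> h.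
have ci : (- 'i%C)^* = 'i%C :> C by apply:complexP;rewrite /= ?oppr0 ?opprK.
by rewrite adjZ ci -scalemxAl h -scalemxAr scalerN scaleNr subrr.
Qed.

Lemma derive_isometry_skew (E : normedModType R) (U : set E) (f : E -> isom) y u : open U -> U y ->
 mx_class 1 U f -> (forall z, U z -> (f z)^t* *m f z = 1%:M) -> skew ((f y)^t* *m derive_mx f y u).
Proof.
move=> oU Uy hf iso;have df:= mx_class_derivable u hf Uy.
have [da ea] := derive_mx_adj df;have [dm em] := derive_mxM da df.
have n1 : \forall z \near y, (1%:M : 'M[C]_d) = (f z)^t* *m f z.
 by apply:filterS (open_near oU Uy)=> z Uz;rewrite iso.
have [d1 e1] := derive_mx_cst (1%:M : 'M[C]_d) y u.
have [_ key] := derive_mx_near n1 d1;move:key;rewrite em e1 ea=> /eqP.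
rewrite addrC addr_eq0 /skew trmxC_mul trmxCK=> /eqP ->;by rewrite opprK.
Qed.

Lemma scale_ii X : - 'i%C *: ('i%C *: X) = X.
Proof. by rewrite scalerA (_ : - 'i%C * 'i%C = 1) ?scale1r //;apply:complexP;rewrite ?Defs.ReM ?Defs.ImM /=;ring. Qed.
Lemma scale_ii' X : 'i%C *: (- 'i%C *: X) = X.
Proof. by rewrite scalerA (_ : 'i%C * - 'i%C = 1) ?scale1r //;apply:complexP;rewrite ?Defs.ReM ?Defs.ImM /=;ring. Qed.

Lemma chart_facts : exists r0 rho0 K : R, [/\ 0 < r0, 0 < rho0, 0 <= K,
 [/\ parametrization (ball 0 r0) chart,
  forall x v, `|x| < r0 -> derive_mx chart x v = dcayley V0 (tan_of x) (tan_of v),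
  derive_mx chart 0 = tan_of &
  forall x, `|x| < r0 -> mxn (chart x - V0 - tan_of x) <= K * `|x| ^+ 2 /\
    mxn (chart x - V0) <= K * `|x| ] &
 [/\ forall W, W^t* *m W = 1%:M -> mxn (W - V0) < rho0 -> `|chart_inv W| < r0 /\ chart (chart_inv W) = W,
   chart_inv V0 = 0,
   forall (E : normedModType R) n (U : set E) (f : E -> isom) i, open U ->
    (forall y, U y -> mxn (f y - V0) < rho0) -> mx_class n U f ->
    diff_class n U (fun y => chart_inv (f y) 0 i) &
   forall A, tangent V0 A -> exists v, tan_of v = 'i%C *: A /\ `|v| <= K * mxn A]].
Proof.
have [Kt Kt0 hKt] := tan_of_bound;have [Kc Kc0 hKc] := tan_coord_bound.
have [r1 [K1 [r10 K10 h1]]] := cayley_near.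
have [r2 [K2 [r20 K20 h2]]] := cinv_near.
have [r3 [K3 [r30 _ h3]]] := stationary_near irr.
pose K:= Kt + K1 * Kt ^+ 2 + Kc.
have K0 : 0 <= K by rewrite /K;nneg.
pose K' := K + 1.
have K'0 : 0 < K' by rewrite ltr_wpDl.
(* The three bounds serve to absorb second order terms, to apply [cayley_near], and to apply
   [stationary_near]. *)
pose r0:= Num.min 1 (Num.min (r1 / K') (r3 / K')).
have r00 : 0 < r0 by rewrite /r0 !lt_min ltr01 !divr_gt0.
have small x : `|x| < r0 -> [/\ `|x| <= 1, mxn (tan_of x) <= r1 & K * `|x| < r3].
 move=> hx;split.
 - by apply/ltW/(lt_le_trans hx);rewrite /r0 ge_min lexx.
 - apply:le_trans (hKt x) _;apply:(@le_trans _ _ (`|x| * K')).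
   by rewrite mulrC ler_wpM2l // /K' /K -!addrA lerDl;nneg.
  by rewrite -ler_pdivlMr //;apply/ltW/(lt_le_trans hx);rewrite /r0 !ge_min lexx orbT.
 - apply:(@le_lt_trans _ _ (`|x| * K'));first by rewrite mulrC ler_wpM2l // /K' lerDl.
  by rewrite -ltr_pdivlMr //;apply:(lt_le_trans hx);rewrite /r0 !ge_min lexx !orbT.
have chn x : `|x| < r0 -> mxn (chart x - V0 - tan_of x) <= K * `|x| ^+ 2 /\ mxn (chart x - V0) <= K * `|x|.
 move=> /small[x1 tx _];have [_ hc] := h1 _ tx;have t:= hKt x;have t0:= mxn_ge0 (tan_of x).
 have q : mxn (chart x - V0 - tan_of x) <= (K1 * Kt ^+ 2) * `|x| ^+ 2.
  apply:le_trans hc _;rewrite -mulrA ler_wpM2l // -exprMn ler_sqr ?nnegrE //;nneg.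
 have n0:= normr_ge0 x;split.
  apply:le_trans q _;rewrite ler_wpM2r ?sqr_ge0 // /K -addrA addrCA lerDl;nneg.
 rewrite -[chart x - V0](subrK (tan_of x));apply:le_trans (mxnD _ _) _.
 have s : `|x| ^+ 2 <= `|x| by rewrite expr2 ler_piMr.
 have g0 : 0 <= K1 * Kt ^+ 2 by nneg.
 have:= ler_wpM2l g0 s;have:= mulr_ge0 Kc0 n0.
 by rewrite /K !mulrDl;move:q t;move:(K1 * _ * _) (Kt * _) (Kc * _) (K1 * _ * _)=> *;lra.
have BE x : ball 0 r0 x <-> `|x| < r0 by rewrite -ball_normE /= sub0r normrN.
have oB : open (ball (0 : 'rV[R]_N) r0) by exact:ball_open.
have uB x : ball 0 r0 x -> cden V0 (tan_of x) \in unitmx by move=> /BE/small[_ /h1[]].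
have isoB x : ball 0 r0 x -> (chart x)^t* *m chart x = 1%:M.
 by move=> Bx;apply:cayley_isometry=> //;[exact:tan_of_skew | exact:uB].
have dch x v : `|x| < r0 -> derive_mx chart x v = dcayley V0 (tan_of x) (tan_of v).
 by move=> /BE Bx;exact:(derive_chart v oB uB Bx).
have t0 : tan_of 0 = 0 by rewrite tan_ofE rlin0.
exists r0, (Num.min r2 (r0 / (Kc * K2 + 1))), K;split=> //.
- by rewrite lt_min r20 divr_gt0 // ltr_wpDl //;nneg.
- split=> //.
 + split=> //.
  * by apply/smooth_mxP=> n;exact:mx_class_chart.
  * move=> x Bx;have [h _] := h3 (chart x) (isoB x Bx) (le_lt_trans (chn x (proj1 (BE x) Bx)).2 (let: And3 _ _ h:= small x (proj1 (BE x) Bx) in h)).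
   exact:h.
  * move=> x Bx j;apply:skew_tangent.
   exact:(derive_isometry_skew _ oB Bx (mx_class_chart 1 oB uB) isoB).
  * move=> x Bx L tL;have nx:= proj1 (BE x) Bx.
   have cE (c : 'rV[R]_N) : \sum_j (c 0 j)%:C *: coord_vector chart x j = - 'i%C *: dcayley V0 (tan_of x) (tan_of c).
    rewrite -dch // (derive_mx_dir c oB (mx_class_chart 1 oB uB) Bx) scaler_sumr.
    by apply:eq_bigr=> j _;rewrite scalerA mulrC -scalerA.
   have sY : skew ((cayley V0 (tan_of x))^t* *m ('i%C *: L)) by exact:tangent_skew.
   have [X' sX' hX'] := dcayley_surj iV0 (tan_of_skew x) (uB x Bx) sY.
   exists (tan_coord X');split;first by rewrite cE tan_coordK // hX' scale_ii.
   move=> c hc;have ec:= cE c;rewrite -hc in ec.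
   have e2 : dcayley V0 (tan_of x) (tan_of (-1 *: c + tan_coord X')) = 0.
    rewrite -dch // (derive_mx_dir _ oB (mx_class_chart 1 oB uB) Bx).
    have E j : ((-1 *: c + tan_coord X') 0 j)%:C = - (c 0 j)%:C + (tan_coord X' 0 j)%:C :> C.
     by rewrite !mxE mulN1r rmorphD rmorphN.
    rewrite (eq_bigr _ (fun j _=> congr1 (fun t=> t *: _) (E j))).
    rewrite (eq_bigr _ (fun j _=> scalerDl _ _ _)) big_split /=.
    rewrite (eq_bigr _ (fun j _=> scaleNr _ _)) sumrN.
    rewrite -!(derive_mx_dir _ oB (mx_class_chart 1 oB uB) Bx) !dch // tan_coordK // hX'.
    by rewrite -[dcayley V0 (tan_of x) (tan_of c)]scale_ii' -ec addNr.
   have:= tan_of_inj (dcayley_inj iV0 (uB x Bx) e2).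
   by rewrite scaleN1r=> /eqP;rewrite addrC subr_eq0=> /eqP.
 + apply/funext=> v;rewrite dch ?normr0 // t0.
  have hz : horiz V0 0 = 0 by rewrite /horiz /vert !mulmx0 subrr.
  have vz : vert V0 0 = 0 by rewrite /vert mulmx0.
  have cz : cden V0 0 = 1%:M by rewrite /cden hz vz mulmx0 !scaler0 !addr0.
  have i1 : invmx (1%:M : 'M[C]_d) = 1%:M by exact:invmx1.
  rewrite /dcayley /dden /cayley hz cz i1 mulmx1 mulmx0 trmx0 map_mx0 mul0mx !addr0 scaler0 addr0.
  rewrite mulmx1 subrK -scalemxAr -scalemxAl scalerA [RHS](vert_horizK V0).
  by rewrite mulNr mulVf ?pnatr_eq0 // scaleN1r opprK addrC.
- have cV W : mxn (W - V0) < Num.min r2 (r0 / (Kc * K2 + 1)) ->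
   1%:M + vert V0 W \in unitmx /\ `|chart_inv W| < r0.
  rewrite lt_min=> /andP[/ltW a1 a2];have [u hu] := h2 W a1;split=> //.
  apply:le_lt_trans (hKc _) _;apply:(@le_lt_trans _ _ (mxn (W - V0) * (Kc * K2 + 1))).
   apply:le_trans (ler_wpM2l Kc0 hu) _;rewrite mulrA [leRHS]mulrC ler_wpM2r ?mxn_ge0 //.
   by rewrite lerDl.
  by rewrite -ltr_pdivlMr // ltr_wpDl //;nneg.
 split.
 + move=> W iW hW;have [u hu] := cV W hW;split=> //.
  have [c1' c2' c3'] := cayley_inv iV0 iW u.
  by rewrite /chart /chart_inv tan_coordK.
 + have c0 : cinv V0 V0 = 0.
   apply:mxn_eq0;have h : mxn (V0 - V0) <= r2 by rewrite subrr mxn0 ltW.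
   by have [_ h'] := h2 V0 h;apply:le_trans h' _;rewrite subrr mxn0 mulr0.
  have:= hKc (cinv V0 V0);rewrite c0 mxn0 mulr0 normr_le0=> /eqP h.
  by rewrite /chart_inv c0 h.
 + move=> E n U f i oU hU hf;apply:diff_class_chart_inv=> // y Uy.
  by have [] := cV _ (hU y Uy).
 + move=> A tA;exists (tan_coord ('i%C *: A));split.
   by rewrite tan_coordK //;exact:tangent_skew.
  apply:le_trans (hKc _) _;rewrite mxn_i ler_wpM2r ?mxn_ge0 // /K lerDr;nneg.
Qed.
End Chart.

(** * Ordinary differential equations *)

Section Ode.
Variable R : realType.

Lemma mean_value_bound (g dg : R -> R) (t c : R) : 0 <= t ->
 (forall s, 0 <= s <= t -> is_derive s (1 : R) g (dg s)) ->
 (forall s, 0 <= s <= t -> `|dg s| <= c) -> `|g t - g 0| <= c * t.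
Proof.
move=> t0 hg hc.
have [||s] := @MVT_segment R g dg 0 t t0.
- by move=> s;rewrite in_itv /= => /andP[/ltW a /ltW b];apply:hg;rewrite a.
- apply:derivable_within_continuous=> s;rewrite in_itv /= => hs.
 by have [] := hg s hs.
by rewrite in_itv /= subr0=> hs ->;rewrite normrM (ger0_norm t0) ler_wpM2r // hc.
Qed.

Lemma mean_value_lip (g dg : R -> R) (b c : R) :
 (forall u, `|u| <= b -> is_derive u (1 : R) g (dg u)) ->
 (forall u, `|u| <= b -> `|dg u| <= c) ->
 forall s t, `|s| <= b -> `|t| <= b -> `|g s - g t| <= c * `|s - t|.
Proof.
move=> hg hc s t;wlog st : s t / t <= s.
 move=> H hs ht;case:(leP t s)=> [|/ltW] st;first exact:H.
 by rewrite distrC (distrC s);exact:H.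
rewrite ler_norml=> /andP[s1 s2];rewrite ler_norml=> /andP[t1 t2].
have bd u : t <= u <= s -> `|u| <= b.
 by move=> /andP[? ?];rewrite ler_norml;apply/andP;split;lra.
have [||u] := @MVT_segment R g dg t s st.
- by move=> u;rewrite in_itv /= => /andP[/ltW a /ltW a'];apply/hg/bd/andP.
- by apply:derivable_within_continuous=> u;rewrite in_itv /= => /bd hu;have [] := hg u hu.
by rewrite in_itv /= => /bd hu e;rewrite e normrM ler_wpM2r // hc.
Qed.

Lemma antiderivative (f : R -> R) (b : R) : continuous f ->
 exists2 G : R -> R, G 0 = 0 & forall t, `|t| < b -> is_derive t (1 : R) G (f t).
Proof.
move=> cf;case:(ltP 0 b)=> b0;last first.
 by exists (fun=> 0)=> // t tb;have:= lt_le_trans tb b0;rewrite ltNge normr_ge0.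
pose mu:= @lebesgue_measure R.
pose F x:= (\int[mu]_(t in [set` `[- b, x]]) (f t))%R.
exists (fun t=> F t - F 0);first by rewrite subrr.
move=> t;rewrite ltr_norml=> /andP[t1 t2].
have int : mu.-integrable `[- b, b] (EFin \o f).
 apply:continuous_compact_integrable;first exact:segment_compact.
 exact:continuous_subspaceT.
have [dF eF] := @continuous_FTC1_closed R f (- b) t b t2 int t1 (cf t).
have h : is_derive t (1 : R) F (f t).
 by apply:(@DeriveDef _ _ _ t 1 F (f t) dF);rewrite -derive1E;exact:eF.
clearbody F.
have:= is_deriveB h (is_derive_cst (F 0) t 1).
by rewrite subr0.
Qed.

(* the limit is the supremum of the increasing sequence u n - 2 c / 2^n *)
Lemma geometric_limit (u : nat -> R) (c : R) : (forall n, `|u n.+1 - u n| <= c * 2^-1 ^+ n) ->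
 exists l, forall n, `|u n - l| <= 2 * c * 2^-1 ^+ n.
Proof.
move=> h;pose q n : R:= 2^-1 ^+ n.
have c0 : 0 <= c by have:= le_trans (normr_ge0 _) (h 0%N);rewrite expr0 mulr1.
have qS n : q n.+1 = q n / 2 by rewrite /q exprS mulrC.
have q0 n : 0 <= q n by rewrite exprn_ge0 ?invr_ge0.
pose a n:= u n - 2 * c * q n;pose b n:= u n + 2 * c * q n.
have hn n : a n <= a n.+1 /\ b n.+1 <= b n.
 by have:= h n;rewrite -/(q n) /a /b qS ler_norml=> /andP[];move:(q n)=> t;split;lra.
have aM m n : a m <= a (m + n)%N.
 by elim:n=> [|n IH];rewrite ?addn0 // addnS;apply:le_trans IH (hn _).1.
have bM m n : b (m + n)%N <= b m.
 by elim:n=> [|n IH];rewrite ?addn0 // addnS;apply:le_trans (hn _).2 IH.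
have ab n : a n <= b n.
 by rewrite /a /b;have:= mulr_ge0 c0 (q0 n);move:(q n)=> t;rewrite -mulrA;lra.
have amb m n : a m <= b n.
 apply:le_trans (aM m n) _;apply:le_trans (ab _) _;rewrite addnC;exact:bM.
exists (sup (range a))=> n.
have s1 : a n <= sup (range a).
 by apply:ub_le_sup;[exists (b 0%N)=> _ [m _ <-] | exists n].
have s2 : sup (range a) <= b n by apply:ge_sup;[exists (a 0%N);exists 0%N | move=> _ [m _ <-]].
by move:s1 s2;rewrite /a /b -/(q n) ler_norml;move:(q n)=> t;lra.
Qed.
End Ode.

Section Picard.
Variables (R : realType) (M : nat).
Local Notation E := 'rV[R]_M.
Variables (F : E -> E) (x0 : E) (r : R).
Hypotheses (r0 : 0 < r)
 (lipF : forall x y, `|x - x0| <= r -> `|y - x0| <= r -> `|F x - F y| <= 4^-1 * `|x - y|)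
 (bndF : forall x, `|x - x0| <= r -> `|F x| <= r / 4).

(** Freezing time outside [-2, 2] makes the iterates global curves that can be compared by one
    uniform bound. *)
Definition clamp (t : R) : R := Num.max (- 2) (Num.min 2 t).

Lemma clamp_bound t : `|clamp t| <= 2.
Proof.
rewrite /clamp /Num.max /Num.min ler_norml;case:(ltP 2 t)=> ?;case:ltP=> ?;apply/andP;split;lra.
Qed.
Lemma clamp_id t : `|t| <= 2 -> clamp t = t.
Proof.
rewrite /clamp /Num.max /Num.min ler_norml=> /andP[? ?];case:(ltP 2 t)=> ?;case:ltP=> ?;lra.
Qed.
Lemma clamp_lip s t : `|clamp s - clamp t| <= `|s - t|.
Proof.
have a1:= ler_norm (s - t);have a2:= lerNnormlW (lexx `|s - t|).
rewrite /clamp /Num.max /Num.min ler_norml.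
by case:(ltP 2 s)=> ?;case:ltP=> ?;case:(ltP 2 t)=> ?;case:ltP=> ?;apply/andP;split;lra.
Qed.

Definition tame (X : R -> E) :=
 (forall t, `|X t - x0| <= r) /\ forall s t, `|X s - X t| <= r * `|s - t|.

Lemma lipschitz_continuous (h : R -> R) c : (forall s t, `|h s - h t| <= c * `|s - t|) -> continuous h.
Proof.
move=> hh t;apply/cvgrPdist_le=> eps e0.
apply/nbhs_normP;exists (eps / (`|c| + 1));rewrite /= ?divr_gt0 // => s /ltW.
rewrite ler_pdivlMr // mulrC=> h1;apply:le_trans (hh t s) _;apply:le_trans h1.
by rewrite ler_wpM2r // (le_trans (ler_norm c)) // lerDl.
Qed.

Lemma tame_F X : tame X -> forall i, continuous (fun t => F (X (clamp t)) 0 i).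
Proof.
move=> [hX lX] i;apply:(@lipschitz_continuous _ (4^-1 * r))=> s t.
apply:(@le_trans _ _ `|F (X (clamp s)) - F (X (clamp t))|).
 by have:= rV_norm_coord (F (X (clamp s)) - F (X (clamp t))) i;rewrite !mxE.
apply:le_trans (lipF (hX _) (hX _)) _;rewrite -mulrA ler_wpM2l ?invr_ge0 //.
by apply:le_trans (lX _ _) _;rewrite ler_wpM2l ?(ltW r0) // clamp_lip.
Qed.

(** A relation, because antiderivatives are only known to exist. They are differentiable for |t| <
    3, hence also at the ends of the clamped interval. *)
Definition picard_step (X Y : R -> E) := exists G : 'I_M -> R -> R,
 [/\ forall i, G i 0 = 0, forall i t, `|t| < 3 -> is_derive t (1 : R) (G i) (F (X (clamp t)) 0 i) &
  forall t, Y t = x0 + \row_i G i (clamp t)].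

Lemma picard_stepP X : tame X -> exists Y, picard_step X Y.
Proof.
move=> hX;have /choice[G hG] : forall i, exists G : R -> R, G 0 = 0 /\
  forall t, `|t| < 3 -> is_derive t (1 : R) G (F (X (clamp t)) 0 i).
 by move=> i;have [G G0 dG] := antiderivative 3 (tame_F hX (i:= i));exists G.
exists (fun t=> x0 + \row_i G i (clamp t));exists G;split=> // i;first by have [] := hG i.
by have [_] := hG i.
Qed.

Let lt23 (t : R) : `|t| <= 2 -> `|t| < 3.
Proof. by move=> h;apply:le_lt_trans h _;rewrite ltr_nat. Qed.

Lemma picard_step_tame X Y : tame X -> picard_step X Y -> tame Y.
Proof.
move=> [hX lX] [G [G0 dG YE]].
have r4 : 0 <= r / 4 by rewrite divr_ge0 // ltW.
have bd i s : `|F (X (clamp s)) 0 i| <= r / 4.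
 by apply:le_trans (rV_norm_coord _ _) (bndF (hX _)).
split=> [t|s t].
 rewrite YE addrC addKr;apply:rV_norm_le=> [|i];first exact:ltW.
 have dd u : `|u| <= 2 -> is_derive u (1 : R) (G i) (F (X (clamp u)) 0 i) by move=> /lt23;exact:dG.
 have b0 : `|(0 : R)| <= 2 by rewrite normr0.
 have:= mean_value_lip dd (fun u _=> bd i u) (clamp_bound t) b0.
 rewrite mxE G0 !subr0=> h;apply:le_trans h _.
 by have:= ler_wpM2l r4 (clamp_bound t);have:= r0;lra.
rewrite !YE opprD addrACA subrr add0r;apply:rV_norm_le=> [|i].
 by rewrite mulr_ge0 ?(ltW r0).
rewrite !mxE.
have dd u : `|u| <= 2 -> is_derive u (1 : R) (G i) (F (X (clamp u)) 0 i) by move=> /lt23;exact:dG.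
apply:le_trans (mean_value_lip dd (fun u _=> bd i u) (clamp_bound s) (clamp_bound t)) _.
by apply:ler_pM=> //;[rewrite ler_pdivrMr // ler_peMr ?(ltW r0) // ler1n | exact:clamp_lip].
Qed.

(** The Lipschitz constant 1/4 over times up to 2 gives the contraction factor 1/2. *)
Lemma picard_step_contract X Y X' Y' c : tame X -> tame X' -> picard_step X Y -> picard_step X' Y' ->
 (forall t, `|X t - X' t| <= c) -> forall t, `|Y t - Y' t| <= 2^-1 * c.
Proof.
move=> [hX _] [hX' _] [G [G0 dG YE]] [G' [G0' dG' YE']] hc t.
have c0 : 0 <= c:= le_trans (normr_ge0 _) (hc 0).
rewrite YE YE' opprD addrACA subrr add0r;apply:rV_norm_le=> [|i];first by rewrite mulr_ge0 ?invr_ge0.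
rewrite !mxE.
have dd u : `|u| <= 2 ->
  is_derive u (1 : R) (fun v=> G i v - G' i v) (F (X (clamp u)) 0 i - F (X' (clamp u)) 0 i).
 by move=> /lt23 hu;apply:is_deriveB;[exact:dG | exact:dG'].
have bd u : `|u| <= 2 -> `|F (X (clamp u)) 0 i - F (X' (clamp u)) 0 i| <= 4^-1 * c.
 move=> _;apply:(@le_trans _ _ `|F (X (clamp u)) - F (X' (clamp u))|).
  by have:= rV_norm_coord (F (X (clamp u)) - F (X' (clamp u))) i;rewrite !mxE.
 by apply:le_trans (lipF (hX _) (hX' _)) _;rewrite ler_wpM2l ?invr_ge0.
have b0 : `|(0 : R)| <= 2 by rewrite normr0.
have:= mean_value_lip dd bd (clamp_bound t) b0.
rewrite G0 G0' !subr0=> h;apply:le_trans h _.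
have c40 : 0 <= 4^-1 * c by rewrite mulr_ge0 ?invr_ge0.
by have:= ler_wpM2l c40 (clamp_bound t);lra.
Qed.

Theorem picard : exists X : R -> E, [/\ X 0 = x0, forall t, `|X t - x0| <= r &
 forall t, `|t| < 2 -> forall i, is_derive t (1 : R) (fun s => X s 0 i) (F (X t) 0 i)].
Proof.
have tame0 : tame (fun=> x0).
 by split=> [t|s t];rewrite subrr normr0 ?mulr_ge0 // ltW.
have /choice[step hstep] : forall X, exists Y, tame X -> picard_step X Y.
 move=> X;have [tX|nX] := pselect (tame X);last by exists X.
 by have [Y hY] := picard_stepP tX;exists Y.
pose u n:= iter n step (fun=> x0).
have tu n : tame (u n).
 by elim:n=> [//|n IH] /=;apply:picard_step_tame (IH) _;exact:hstep.
have su n : picard_step (u n) (u n.+1) by apply:hstep.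
have du n t : `|u n.+1 t - u n t| <= r * 2^-1 ^+ n.
 elim:n t=> [|n IH] t;first by rewrite expr0 mulr1;have [h _] := tu 1%N;exact:h.
 by rewrite exprS mulrCA;apply:(picard_step_contract (tu _) (tu _) (su _) (su _)).
have /choice[L hL] : forall ti : R * 'I_M, exists l, forall n, `|u n ti.1 0 ti.2 - l| <= 2 * r * 2^-1 ^+ n.
 move=> [t i];apply:geometric_limit=> n.
 by have:= rV_norm_coord (u n.+1 t - u n t) i;rewrite !mxE=> h;apply:le_trans h (du n t).
pose X t : E:= \row_i L (t, i).
have q0 n : 0 <= 2^-1 ^+ n :> R by rewrite exprn_ge0 ?invr_ge0.
have r00:= ltW r0.
have hX n t : `|u n t - X t| <= 2 * r * 2^-1 ^+ n.
 by apply:rV_norm_le=> [|i];[rewrite !mulr_ge0 | rewrite !mxE;exact:(hL (t, i))].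
have small (x c : R) : (forall n, x <= c + 4 * r * 2^-1 ^+ n) -> x <= c.
 move=> h;apply/ler_addgt0Pr=> eps e0.
 have : 4 * r * 2^-1 ^+ n @[n --> \oo] --> 4 * r * (0 : R).
  by apply:cvgMr;apply:cvg_expr;rewrite ger0_norm ?invr_ge0 // invf_lt1 // ltr1n.
 rewrite mulr0=> /cvgrPdist_le/(_ eps e0)[n _ /(_ n (leqnn n))];rewrite /= sub0r normrN=> hn.
 by apply:le_trans (h n) _;rewrite lerD2l;apply:le_trans (ler_norm _) hn.
have tX : tame X.
 split=> [t|s t];apply:small=> n;have [h1 h2] := tu n.
  have -> : X t - x0 = (u n t - x0) - (u n t - X t) by apply/rowP=> i;rewrite !mxE;ring.
  apply:le_trans (ler_normB _ _) _;have:= h1 t;have:= hX n t;have:= mulr_ge0 r00 (q0 n);lra.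
 have -> : X s - X t = (u n s - u n t) - (u n s - X s) + (u n t - X t).
  by apply/rowP=> i;rewrite !mxE;ring.
 apply:le_trans (ler_normD _ _) _;have:= ler_normB (u n s - u n t) (u n s - X s).
 by have:= h2 s t;have:= hX n t;have:= hX n s;lra.
have [Y sY] := picard_stepP tX.
have XY t : X t = Y t.
 apply/eqP;rewrite -subr_eq0 -normr_le0;apply:small=> n;rewrite add0r.
 have h1:= hX n.+1 t.
 have h2:= picard_step_contract (tu n) tX (su n) sY (hX n) t.
 have -> : X t - Y t = (u n.+1 t - Y t) - (u n.+1 t - X t).
  by apply/rowP=> i;rewrite !mxE;ring.
 apply:le_trans (ler_normB _ _) _;move:h1 h2;rewrite exprS.
 have:= mulr_ge0 r00 (q0 n);move:(2^-1 ^+ n)=> q *;lra.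
have [G [G0 dG YE]] := sY.
exists X;split.
- rewrite XY YE clamp_id ?normr0 //;apply/rowP=> i;rewrite !mxE G0 addr0 //.
- by case:tX.
- move=> t t2 i;have h:= dG i t (lt23 (ltW t2)).
 rewrite clamp_id ?ltW // in h.
 have nE : \forall s \near t, x0 0 i + G i s = X s 0 i.
  have : \forall s \near t, `|s| < 2.
   by apply/nbhs_normP;exists (2 - `|t|);rewrite /= ?subr_gt0 // => s /= hs;
     have:= ler_normB t (t - s);rewrite subKr;lra.
  by apply:filterS=> s /ltW s2;rewrite XY YE clamp_id // !mxE.
 apply:near_eq_is_derive nE _.
 by have:= is_deriveD (is_derive_cst (x0 0 i) t 1) h;rewrite add0r.
Qed.
End Picard.

Lemma diff_class_cts (R : realType) (E : normedModType R) n (U : set E) (f : E -> R) x :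
 diff_class n U f -> U x -> {for x, continuous f}.
Proof. by case:n=> [|n] [h _];exact:h. Qed.

(** * Local Lipschitz bounds and regularity of solutions *)

Section SmoothFamilies.
Variables (R : realType) (N : nat).
Local Notation E := 'rV[R]_N.

Lemma smooth_lip (I : finType) (U : set E) (f : I -> E -> R) a : open U -> U a ->
 (forall i, diff_class 1 U (f i)) ->
 exists r L : R, [/\ 0 < r, 0 <= L, forall x, `|x - a| <= r -> U x &
  forall i x y, `|x - a| <= r -> `|y - a| <= r -> `|f i x - f i y| <= L * `|x - y|].
Proof.
move=> oU Ua hf.
have hd i j : diff_class 0 U ('D_(delta_mx 0 j) (f i)).
 by have [_ h] := hf i;have [] := h (delta_mx 0 j).
pose L0:= \sum_i \sum_j (`|'D_(delta_mx 0 j) (f i) a| + 1).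
have [rho rho0 hrho] : exists2 rho : R, 0 < rho & forall x, `|x - a| < rho -> U x /\
  forall ij : I * 'I_N, `|'D_(delta_mx 0 ij.2) (f ij.1) x - 'D_(delta_mx 0 ij.2) (f ij.1) a| <= 1.
 apply:near_ball;near=> x;split;first by near: x;apply:open_nbhs_nbhs.
 near: x;apply:(@filter_forall _ _ (fun ij : I * 'I_N=>
  [set x | `|'D_(delta_mx 0 ij.2) (f ij.1) x - 'D_(delta_mx 0 ij.2) (f ij.1) a| <= 1]) (nbhs a))=> ij.
 exact:(cts_dist (proj1 (hd ij.1 ij.2) a Ua) ltr01).
have L00 : 0 <= L0 by apply:sumr_ge0=> i _;apply:sumr_ge0=> j _;rewrite addr_ge0.
have r40 : 0 < rho / 4 by rewrite divr_gt0.
(* With x and y within rho / 4 of a, the points y + t (x - y) for |t| <= 1 stay within 3 rho / 4. *)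
exists (rho / 4), L0;split=> //.
 by move=> x hx;have [] := hrho x;first by apply:le_lt_trans hx _;lra.
move=> i x y hx hy.
have Lb z : `|z - a| < rho -> `|'D_(x - y) (f i) z| <= L0 * `|x - y|.
 move=> /hrho[Uz hz];have [df dE] := diff_class1_differentiable oU Uz (hf i).
 rewrite deriveE // dE;apply:le_trans (ler_norm_sum _ _ _) _.
 rewrite /L0 (bigD1 i) //= mulrDl -[leLHS]addr0;apply:lerD;last first.
  by rewrite mulr_ge0 //;apply:sumr_ge0=> ? _;apply:sumr_ge0=> ? _;rewrite addr_ge0.
 rewrite mulr_suml;apply:ler_sum=> j _;rewrite normrM mulrC;apply:ler_pM=> //;last exact:rV_norm_coord.
 rewrite -['D__ _ z](subrK ('D_(delta_mx 0 j) (f i) a)) addrC.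
 by apply:le_trans (ler_normD _ _) _;rewrite lerD2l;exact:(hz (i, j)).
have [|c hc] := @mvt_line R E (f i) y (x - y) 1.
 move=> t ht;have : `|t *: (x - y) + y - a| < rho.
  rewrite -addrA;apply:le_lt_trans (ler_normD _ _) _;rewrite normrZ.
  have d1:= ler_normB (x - a) (y - a);rewrite opprB addrA subrK in d1.
  have:= ler_wpM2r (normr_ge0 (x - y)) ht;rewrite normr1 mul1r.
  by have:= rho0;lra.
 by move=> /hrho[Uz _];have [_ h] := hf i;have [h' _] := h (x - y);exact:h'.
rewrite scale1r subrK mul1r=> ->;apply:Lb.
rewrite -addrA;apply:le_lt_trans (ler_normD _ _) _;rewrite normrZ.
have d1:= ler_normB (x - a) (y - a);rewrite opprB addrA subrK in d1.
have:= ler_wpM2r (normr_ge0 (x - y)) hc;rewrite normr1 mul1r.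
by have:= rho0;lra.
Unshelve. all: by end_near. Qed.

Lemma diff_class_invmx (F : normedModType R) n (U : set F) m (M : F -> 'M[R]_m) : open U ->
 (forall x, U x -> M x \in unitmx) -> (forall i j, diff_class n U (fun x => M x i j)) ->
 forall i j, diff_class n U (fun x => invmx (M x) i j).
Proof.
move=> oU uU hM i j.
have h : mx_class n U (fun x=> map_mx (real_complex R) (M x)).
 by move=> a b;under [X in cx_class _ _ X]funext do rewrite mxE;exact:cx_class_real.
have u x : U x -> map_mx (real_complex R) (M x) \in unitmx by move=> Ux;rewrite map_unitmx uU.
have [h1 _] := mx_class_inv oU u h i j.
by apply:diff_class_ext h1=> // x _;rewrite -map_invmx mxE.
Qed.

Lemma is_derive_scale_dir (f : R -> R) (t v df : R) : is_derive t (1 : R) f df -> is_derive t v f (v * df).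
Proof.
move=> [d1 <-];have df' : differentiable f t by apply/derivable1_diffP.
split;first exact:diff_derivable.
by rewrite !deriveE // -[v in LHS]mulr1 -[v * 1]/(v *: 1) linearZ.
Qed.

(** Bootstrap: by X' = F X the derivative is as regular as X itself. *)
Lemma ode_class (U : set E) (J : set R) (F : E -> E) (X : R -> E) : open U -> open J ->
 (forall n i, diff_class n U (fun x => F x 0 i)) -> (forall t, J t -> U (X t)) ->
 (forall t, J t -> forall i, is_derive t (1 : R) (fun s => X s 0 i) (F (X t) 0 i)) ->
 forall n i, diff_class n J (fun t => X t 0 i).
Proof.
move=> oU oJ hF XU dX;elim=> [|n IH] i.
 split=> // t Jt;have [d _] := dX t Jt i.
 by apply:differentiable_continuous;apply/derivable1_diffP.
split=> [t Jt|v];first exact:diff_class_cts (IH i) Jt.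
have dv t : J t -> is_derive t v (fun s=> X s 0 i) (v * F (X t) 0 i).
 by move=> Jt;apply:is_derive_scale_dir;exact:dX.
split=> [t Jt|];first by have [] := dv t Jt.
apply:(@diff_class_ext _ _ _ _ (fun t=> v * F (X t) 0 i))=> //.
 by move=> t Jt;have [_ ->] := dv t Jt.
by apply:diff_classZ=> //;exact:(@diff_class_comp _ _ _ _ _ _ (fun x=> F x 0 i) X oU oJ XU (hF n i) IH).
Qed.
End SmoothFamilies.

Lemma exchange_big4 (T : nmodType) (I1 I2 I3 I4 : finType) (F : I1 -> I2 -> I3 -> I4 -> T) :
 \sum_a \sum_b \sum_i \sum_j F a b i j = \sum_i \sum_j \sum_a \sum_b F a b i j.
Proof.
rewrite pair_bigA [RHS]pair_bigA /=;under eq_bigr=> p _ do rewrite pair_bigA /=.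
by under [RHS]eq_bigr=> p _ do rewrite pair_bigA /=;rewrite exchange_big.
Qed.

(** * Geodesic equation in momentum form *)

Section Metric.
Variables (R : realType) (d k : nat).
Local Notation C := R[i].
Local Notation isom := 'M[C]_(d * k, d).
Variable nu : isom -> isom -> isom -> R.
Hypothesis rm : riemannian_metric nu.
Implicit Types (V A B L : isom).

Lemma tangent_linear V (a : R) A B : tangent V A -> tangent V B -> tangent V (a%:C *: A + B).
Proof.
rewrite /tangent=> /eqP;rewrite subr_eq0=> /eqP hA /eqP;rewrite subr_eq0=> /eqP hB.
have cr : (a%:C)^* = a%:C by apply:complexP=> //=;rewrite oppr0.
by rewrite adjD adjZ cr mulmxDl mulmxDr -scalemxAl -scalemxAr hA hB subrr.
Qed.

Lemma tangent_0 V : tangent V 0.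
Proof. by rewrite /tangent trmx0 map_mx0 mul0mx mulmx0 subrr. Qed.

Lemma tangent_sum V n (c : 'I_n -> R) (A : 'I_n -> isom) : (forall i, tangent V (A i)) ->
 tangent V (\sum_i (c i)%:C *: A i).
Proof.
by move=> hA;elim/big_rec: _=> [|i B _ hB];[exact:tangent_0 | exact:tangent_linear].
Qed.

Lemma nu_suml V n (c : 'I_n -> R) (A : 'I_n -> isom) B : irreducible V ->
 (forall i, tangent V (A i)) -> tangent V B ->
 nu V (\sum_i (c i)%:C *: A i) B = \sum_i c i * nu V (A i) B.
Proof.
move=> irr hA hB;have n0 : nu V 0 B = 0.
 have:= metric_linear rm (-1) irr (tangent_0 V) (tangent_0 V) hB.
 by rewrite scaler0 addr0 mulN1r addNr.
suff [_ ->] : tangent V (\sum_i (c i)%:C *: A i) /\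
 nu V (\sum_i (c i)%:C *: A i) B = \sum_i c i * nu V (A i) B by [].
elim/big_rec2: _=> [|i x y _ [h <-]];first by split;[exact:tangent_0 |].
by split;[exact:tangent_linear | rewrite (metric_linear rm)].
Qed.

Lemma nu_sum2 V m n (c : 'I_m -> R) (b : 'I_n -> R) (A : 'I_m -> isom) (B : 'I_n -> isom) : irreducible V ->
 (forall i, tangent V (A i)) -> (forall i, tangent V (B i)) ->
 nu V (\sum_i (c i)%:C *: A i) (\sum_j (b j)%:C *: B j) = \sum_i \sum_j c i * b j * nu V (A i) (B j).
Proof.
move=> irr hA hB;rewrite nu_suml //;last exact:tangent_sum.
apply:eq_bigr=> i _;rewrite (Defs.metric_sym rm) //;last exact:tangent_sum.
rewrite nu_suml // mulr_sumr;apply:eq_bigr=> j _.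
by rewrite mulrA (Defs.metric_sym rm).
Qed.

Variables (N : nat) (U : set 'rV[R]_N) (phi : 'rV[R]_N -> isom).
Hypothesis par : parametrization U phi.
Local Notation co := (coord_vector phi).

Lemma gram_sym x i j : U x -> gram nu phi x i j = gram nu phi x j i.
Proof.
by case:par=> _ _ irr tan _ Ux;rewrite [LHS]mxE [RHS]mxE;apply:(Defs.metric_sym rm);[exact:irr | exact:tan | exact:tan].
Qed.

(** A kernel vector would be a tangent vector of length zero, hence zero by positivity and by
    uniqueness of coordinates. *)
Lemma gram_unit x : U x -> gram nu phi x \in unitmx.
Proof.
case:par=> oU sm irr tan co_uniq Ux.
rewrite -row_free_unit -kermx_eq0;apply/eqP/row_matrixP=> i.
set c:= row i _;have cG : c *m gram nu phi x = 0.
 by rewrite /c -row_mul mulmx_ker row0.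
pose A:= \sum_j (c 0 j)%:C *: co x j.
have tA : tangent (phi x) A by apply:tangent_sum=> j;exact:tan.
have nA : nu (phi x) A A = 0.
 rewrite /A nu_sum2 //;[|exact:irr|by move=> ?;exact:tan|by move=> ?;exact:tan].
 rewrite exchange_big /= big1 // => j _.
 have /rowP/(_ j) := cG;rewrite !mxE=> h;transitivity (c 0 j * \sum_i0 c 0 i0 * gram nu phi x i0 j).
  by rewrite mulr_sumr;apply:eq_bigr=> l _;rewrite !mxE;ring.
 by rewrite h mulr0.
have A0 : A = 0.
 by apply/eqP;apply:contraT=> A0;have:= metric_gt0 rm (irr x Ux) tA A0;rewrite nA ltxx.
have [c' [_ u]] := co_uniq x Ux 0 (tangent_0 _).
rewrite -(u c (esym A0)) row0;apply:u.
by rewrite big1 // => j _;rewrite mxE scale0r.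
Qed.

Lemma gram_class n i j : diff_class n U (fun x => gram nu phi x i j).
Proof. exact:(metric_smooth rm par i j n). Qed.

Lemma gram_inv_class n i j : diff_class n U (fun x => invmx (gram nu phi x) i j).
Proof.
by apply:diff_class_invmx=> [|x Ux|];[case:par | exact:gram_unit | exact:gram_class].
Qed.

Lemma gram_derive_class n v i j : diff_class n U ('D_v (fun x => gram nu phi x i j)).
Proof. by have [_ h] := gram_class n.+1 i j;have [] := h v. Qed.

Lemma christoffel_class n l i j : diff_class n U (fun x => christoffel nu phi x l i j).
Proof.
have oU : open U by case:par.
apply:diff_classZ=> //;apply:diff_class_sum=> // m;apply:diff_classM=> //;first exact:gram_inv_class.
apply:diff_classB=> //;last exact:gram_derive_class.
by apply:diff_classD=> //;exact:gram_derive_class.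
Qed.

(* the geodesic equation in momentum form: d/dt (G x') = 1/2 dG(x', x') *)
Lemma geodesic_momentum (J : set R) (x : R -> 'rV[R]_N) t : open J -> J t -> (forall s, J s -> U (x s)) ->
 (forall l, smooth_on J (fun s => x s 0 l)) ->
 (forall l, derive1n 2 (fun s => x s 0 l) t + \sum_i \sum_j christoffel nu phi (x t) l i j
   * derive1 (fun s => x s 0 i) t * derive1 (fun s => x s 0 j) t = 0) ->
 forall n, is_derive t (1 : R) (fun s => \sum_j gram nu phi (x s) n j * derive1 (fun s => x s 0 j) s)
  (2^-1 * \sum_i \sum_j 'D_(delta_mx 0 n) (fun y => gram nu phi y i j) (x t)
   * derive1 (fun s => x s 0 i) t * derive1 (fun s => x s 0 j) t).
Proof.
move=> oJ Jt xU sx geo n;have oU : open U by case:par.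
pose x1 l:= derive1 (fun s=> x s 0 l) t;pose x2 l:= derive1n 2 (fun s=> x s 0 l) t.
have d1 l : is_derive t (1 : R) (fun s=> x s 0 l) (x1 l).
 by have [_ h] := sx l 1%N;have [h' _] := h 1;split;[exact:h' | rewrite /x1 derive1E].
have d2 l : is_derive t (1 : R) (fun s=> derive1 (fun s=> x s 0 l) s) (x2 l).
 have [_ h] := sx l 2%N;have [_ [_ h2]] := h 1;have [h3 _] := h2 1.
 have e : (fun s=> derive1 (fun s=> x s 0 l) s) = 'D_1 (fun s=> x s 0 l).
  by apply/funext=> s;rewrite derive1E.
 by rewrite e;split;[exact:h3 | rewrite -derive1E -e].
pose DG m i j:= 'D_(delta_mx 0 m) (fun y=> gram nu phi y i j) (x t).
have dG i j : is_derive t (1 : R) (fun s=> gram nu phi (x s) i j) (\sum_m x1 m * DG m i j).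
 exact:(is_derive_chain oU (gram_class 1 i j) (xU t Jt) d1).
have key:= is_derive_sum_fun (fun j=> is_deriveM (dG n j) (d2 j)).
have e : \sum_j (gram nu phi (x t) n j *: x2 j + derive1 (fun s=> x s 0 j) t *: (\sum_m x1 m * DG m n j)) =
  2^-1 * \sum_i \sum_j DG n i j * x1 i * x1 j.
 have Ut:= xU t Jt;have uG:= gram_unit Ut.
 have sDG m i j : DG m i j = DG m j i.
  apply:near_eq_derive;apply:filterS (open_near oU Ut)=> y Uy;exact:gram_sym.
 pose S m i j:= DG i j m + DG j i m - DG m i j.
 pose T m:= \sum_i \sum_j S m i j * x1 i * x1 j.
 have x2E l : x2 l = - (2^-1 * \sum_m invmx (gram nu phi (x t)) l m * T m).
  apply/eqP;rewrite -addr_eq0;apply/eqP;rewrite -[RHS](geo l);congr (_ + _).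
  transitivity (\sum_i \sum_j \sum_m (2^-1 * (invmx (gram nu phi (x t)) l m * (S m i j * x1 i * x1 j)))).
   under [RHS]eq_bigr=> i _ do rewrite exchange_big /=.
   rewrite [RHS]exchange_big /= mulr_sumr;apply:eq_bigr=> m _;rewrite /T !mulr_sumr.
   by apply:eq_bigr=> i _;rewrite !mulr_sumr;apply:eq_bigr=> j _.
  apply:eq_bigr=> i _;apply:eq_bigr=> j _.
  rewrite /christoffel mulr_sumr !mulr_suml;apply:eq_bigr=> m _.
  by rewrite /S /DG /x1;ring.
 have Gx2 : \sum_j gram nu phi (x t) n j * x2 j = - (2^-1 * T n).
  transitivity (- (2^-1 * \sum_m (gram nu phi (x t) *m invmx (gram nu phi (x t))) n m * T m)).
   rewrite (eq_bigr _ (fun j _=> congr1 (fun z=> _ * z) (x2E j))).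
   rewrite mulr_sumr -sumrN.
   transitivity (\sum_j \sum_m - (2^-1 * (gram nu phi (x t) n j * invmx (gram nu phi (x t)) j m * T m))).
    apply:eq_bigr=> j _;rewrite sumrN mulrN;congr (- _);rewrite mulrCA -mulr_sumr;congr (_ * _).
    by rewrite mulr_sumr;apply:eq_bigr=> m _;rewrite mulrA.
   rewrite exchange_big /=;apply:eq_bigr=> m _;rewrite sumrN -mulr_sumr;congr (- (_ * _)).
   by rewrite [in RHS]mxE mulr_suml.
  rewrite mulmxV // (bigD1 n) //= big1 ?addr0;last by move=> m mn;rewrite mxE eq_sym (negPf mn) mul0r.
  by rewrite mxE eqxx mul1r.
 pose Q:= \sum_j x1 j * \sum_m x1 m * DG m n j;pose P:= \sum_i \sum_j DG n i j * x1 i * x1 j.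
 have TE : T n = Q + Q - P.
  transitivity (\sum_i \sum_j (DG i j n * x1 i * x1 j + DG j i n * x1 i * x1 j - DG n i j * x1 i * x1 j)).
   by apply:eq_bigr=> i _;apply:eq_bigr=> j _;rewrite /S;ring.
  under eq_bigr=> i _ do rewrite sumrB big_split /=.
  rewrite sumrB big_split /=;congr (_ + _ - _).
   rewrite exchange_big /=;apply:eq_bigr=> j _;rewrite mulr_sumr;apply:eq_bigr=> i _.
   by rewrite (sDG i);ring.
  by apply:eq_bigr=> i _;rewrite mulr_sumr;apply:eq_bigr=> j _;rewrite (sDG j);ring.
 rewrite big_split /=;rewrite -[X in X + _]/(\sum_j gram nu phi (x t) n j * x2 j) Gx2 TE.
 rewrite -[X in _ + X]/Q -/P;lra.
exact:is_derive_eq key e.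
Qed.

(** Momenta are pulled back by the Jacobian of theta, so in this form the equation changes
    coordinates without a transformation rule for Christoffel symbols. Both sides are expressed in
    the new coordinates, and [cancel] removes the Jacobian. *)
Lemma momentum_change (J : set R) (x : R -> 'rV[R]_N) t N' (U' : set 'rV[R]_N') (phi' : 'rV[R]_N' -> isom)
  (theta : 'rV[R]_N -> 'rV[R]_N') :
 parametrization U' phi' -> open J -> J t -> (forall s, J s -> U (x s)) ->
 (forall l, smooth_on J (fun s => x s 0 l)) ->
 (forall n i, diff_class n U (fun z => theta z 0 i)) ->
 (forall z, U z -> U' (theta z) /\ phi z = phi' (theta z)) ->
 (forall n, is_derive t (1 : R) (fun s => \sum_j gram nu phi (x s) n j * derive1 (fun s => x s 0 j) s)
  (2^-1 * \sum_i \sum_j 'D_(delta_mx 0 n) (fun y => gram nu phi y i j) (x t)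
   * derive1 (fun s => x s 0 i) t * derive1 (fun s => x s 0 j) t)) ->
 let y s := theta (x s) in
 (forall a, is_derive t (1 : R) (fun s => y s 0 a) (derive1 (fun s => y s 0 a) t)) /\
 forall a, is_derive t (1 : R) (fun s => \sum_b gram nu phi' (y s) a b * derive1 (fun s => y s 0 b) s)
  (2^-1 * \sum_b \sum_c 'D_(delta_mx 0 a) (fun z => gram nu phi' z b c) (y t)
   * derive1 (fun s => y s 0 b) t * derive1 (fun s => y s 0 c) t).
Proof.
move=> par' oJ Jt xU sx sth hth geo y.
have oU : open U by case:par.
have oU' : open U' by case:par'.
have gram_sym' a b : gram nu phi' (theta (x t)) a b = gram nu phi' (theta (x t)) b a.
 have [Uz _] := hth _ (xU t Jt);case:(par')=> _ _ irr tan _.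
 by rewrite [LHS]mxE [RHS]mxE;apply:(Defs.metric_sym rm);[exact:irr | exact:tan | exact:tan].
have Ut:= xU t Jt;have Ut' : U' (y t) by have [] := hth _ Ut.
pose Jm z m a:= 'D_(delta_mx 0 m) (fun z=> theta z 0 a) z.
pose x1 s l:= derive1 (fun s=> x s 0 l) s.
pose y1 s a:= derive1 (fun s=> y s 0 a) s.
have d1 s l : J s -> is_derive s (1 : R) (fun s=> x s 0 l) (x1 s l).
 by move=> Js;have [_ h] := sx l 1%N;have [h' _] := h 1;split;[exact:h' | rewrite /x1 derive1E].
have dy s a : J s -> is_derive s (1 : R) (fun s=> y s 0 a) (\sum_i x1 s i * Jm (x s) i a).
 move=> Js;apply:(is_derive_chain oU (sth 1%N a) (xU s Js))=> i;exact:d1.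
have y1E s a : J s -> y1 s a = \sum_i x1 s i * Jm (x s) i a.
 by move=> Js;rewrite /y1 derive1E;have [_ ->] := dy s a Js.
split;first by move=> a;rewrite -/(y1 t a) y1E //;exact:dy.
have d2 l : exists x2, is_derive t (1 : R) (fun s=> x1 s l) x2.
 have [_ h] := sx l 2%N;have [_ [_ h2]] := h 1;have [h3 _] := h2 1.
 have e : (fun s=> x1 s l) = 'D_1 (fun s=> x s 0 l) by apply/funext=> s;rewrite /x1 derive1E.
 by exists ('D_1 ('D_1 (fun s=> x s 0 l)) t);rewrite e;split;[exact:h3 |].
have /choice[x2 {}d2] := d2.
have cJ n m a : diff_class n U (fun z=> Jm z m a).
 by have [_ h] := sth n.+1 a;have [] := h (delta_mx 0 m).
pose DJ i m a:= 'D_(delta_mx 0 i) (fun z=> Jm z m a) (x t).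
have dJ m a : is_derive t (1 : R) (fun s=> Jm (x s) m a) (\sum_i x1 t i * DJ i m a).
 by apply:(is_derive_chain oU (cJ 1%N m a) Ut)=> i;exact:d1.
(* Second derivatives of theta occur on both sides of the momentum equation and cancel thanks to
   this symmetry. *)
have symJ i m a : DJ i m a = DJ m i a:= schwarz _ _ oU Ut (sth 2%N a).
have coE z n : U z -> co z n = \sum_a (Jm z n a)%:C *: coord_vector phi' (theta z) a.
 move=> Uz;rewrite /coord_vector.
 have sm : mx_class 1 U' phi' by case:par'=> _ /smooth_mxP h _ _ _;exact:h.
 have dth a : is_derive z (delta_mx 0 n) (fun z=> theta z 0 a) (Jm z n a).
  by have [_ h] := sth 1%N a;have [h' _] := h (delta_mx 0 n);split;[exact:h' |].
 have [de ee] := derive_mx_chain oU' sm (proj1 (hth z Uz)) dth.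
 have nE : \forall w \near z, phi' (theta w) = phi w.
  by apply:filterS (open_near oU Uz)=> w Uw;have [] := hth w Uw.
 have [_ e2] := derive_mx_near nE de.
 by rewrite e2 ee scaler_sumr;apply:eq_bigr=> a _;rewrite !scalerA mulrC.
pose H z a b:= gram nu phi' z a b.
have GE z i j : U z -> gram nu phi z i j = \sum_a \sum_b Jm z i a * Jm z j b * H (theta z) a b.
 move=> Uz;have [Uz' pz] := hth z Uz;case:(par')=> _ _ irr' tan' _.
 rewrite mxE !coE // pz nu_sum2 //;[|exact:irr'|by move=> ?;exact:tan'|by move=> ?;exact:tan'].
 by apply:eq_bigr=> a _;apply:eq_bigr=> b _;rewrite /H [in RHS]mxE.
(* Both families of coordinate vectors are bases of the same tangent space, so the vectors of the
   new chart are combinations of rows of the Jacobian. *)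
have cancel (w : 'I_N' -> R) : (forall n, \sum_a Jm (x t) n a * w a = 0) -> forall b, w b = 0.
 move=> h b;have [_ _ _ tan uniq] := par;have [_ _ _ tan' uniq'] := par'.
 have pE : phi (x t) = phi' (y t) by have [] := hth _ Ut.
 have tb : tangent (phi (x t)) (coord_vector phi' (y t) b) by rewrite pE;exact:tan'.
 have [c [hc _]] := uniq _ Ut _ tb.
 have tb' : tangent (phi' (y t)) (coord_vector phi' (y t) b) by exact:tan'.
 have [c' [_ uc']] := uniq' _ Ut' _ tb'.
 have e1 : c' = delta_mx 0 b.
  apply:uc';rewrite (bigD1 b) //= mxE !eqxx scale1r big1 ?addr0 // => a ab.
  by rewrite mxE (negPf ab) andbF scale0r.
 have e2 : c' = \row_a \sum_n c 0 n * Jm (x t) n a.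
  apply:uc';rewrite [LHS]hc;under eq_bigr=> n _ do rewrite coE // scaler_sumr.
  rewrite exchange_big /=;apply:eq_bigr=> a _;rewrite mxE rmorph_sum scaler_suml.
  by apply:eq_bigr=> n _;rewrite rmorphM scalerA.
 have : \sum_a c' 0 a * w a = 0.
  rewrite e2;under eq_bigr=> a _ do rewrite mxE mulr_suml.
  rewrite exchange_big /= big1 // => n _;under eq_bigr=> a _ do rewrite -mulrA.
  by rewrite -mulr_sumr h mulr0.
 rewrite e1 (bigD1 b) //= mxE !eqxx mul1r big1 ?addr0 // => a ab.
 by rewrite mxE (negPf ab) andbF mul0r.
pose DH c a b:= 'D_(delta_mx 0 c) (fun z=> gram nu phi' z a b) (y t).
have dH a b : is_derive t (1 : R) (fun s=> H (y s) a b) (\sum_c y1 t c * DH c a b).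
 have cH : diff_class 1 U' (fun z=> H z a b) by exact:(metric_smooth rm par' a b 1%N).
 by apply:(is_derive_chain oU' cH Ut')=> c;rewrite y1E //;exact:dy.
pose A n a:= \sum_i x1 t i * DJ i n a.
have dy1 a : exists y2, is_derive t (1 : R) (fun s=> y1 s a) y2.
 have h:= is_derive_sum_fun (fun i=> is_deriveM (d2 i) (dJ i a)).
 eexists;apply:near_eq_is_derive h.
 by apply:filterS (open_near oJ Jt)=> s Js;rewrite y1E.
have /choice[y2 {}dy1] := dy1.
pose q s a:= \sum_b H (y s) a b * y1 s b.
have [dq hdq] : exists dq : 'I_N' -> R, forall a, is_derive t (1 : R) (fun s=> q s a) (dq a).
 eexists=> a;exact:(is_derive_sum_fun (fun b=> is_deriveM (dH a b) (dy1 b))).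
have pE s n : J s -> \sum_j gram nu phi (x s) n j * x1 s j = \sum_a Jm (x s) n a * q s a.
 move=> Js;have Us:= xU s Js;rewrite /q;under eq_bigr=> j _ do rewrite GE // mulr_suml.
 rewrite exchange_big /=;apply:eq_bigr=> a _;rewrite mulr_sumr.
 under eq_bigr=> j _ do rewrite mulr_suml.
 rewrite exchange_big /=;apply:eq_bigr=> b _;rewrite y1E // !mulr_sumr.
 by apply:eq_bigr=> j _;rewrite -/(y s);ring.
have main n : 2^-1 * (\sum_i \sum_j 'D_(delta_mx 0 n) (fun y=> gram nu phi y i j) (x t) * x1 t i * x1 t j) =
  \sum_a (Jm (x t) n a * dq a + q t a * A n a).
 have h1:= is_derive_sum_fun (fun a=> is_deriveM (dJ n a) (hdq a)).
 have nE : \forall s \near t, \sum_j gram nu phi (x s) n j * x1 s j = \sum_a Jm (x s) n a * q s a.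
  by apply:filterS (open_near oJ Jt)=> s Js;exact:pE.
 have [_ <-] := near_eq_is_derive nE (geo n).
 by have [_ ->] := h1.
(* The velocity is frozen at time t while the base point z moves, so that differentiating the energy
   in z yields the right side of the momentum equation. *)
pose eta z a:= \sum_i x1 t i * Jm z i a.
have LE z : U z -> \sum_i \sum_j gram nu phi z i j * x1 t i * x1 t j =
  \sum_a \sum_b H (theta z) a b * (eta z a * eta z b).
 move=> Uz;transitivity (\sum_i \sum_j \sum_a \sum_b
  (H (theta z) a b * (x1 t i * Jm z i a) * (x1 t j * Jm z j b))).
  apply:eq_bigr=> i _;apply:eq_bigr=> j _;rewrite GE // !mulr_suml;apply:eq_bigr=> a _.
  by rewrite !mulr_suml;apply:eq_bigr=> b _;ring.
 rewrite exchange_big4;apply:eq_bigr=> a _;apply:eq_bigr=> b _.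
 rewrite /eta mulrA [RHS]mulr_sumr.
 under eq_bigr=> i _ do rewrite -mulr_sumr.
 by rewrite -mulr_suml -!mulr_sumr.
have DL n : \sum_i \sum_j 'D_(delta_mx 0 n) (fun y=> gram nu phi y i j) (x t) * x1 t i * x1 t j =
  \sum_c Jm (x t) n c * (\sum_a \sum_b DH c a b * y1 t a * y1 t b) + (\sum_a q t a * A n a) *+ 2.
 have dHn a b : is_derive (x t) (delta_mx 0 n) (fun z=> H (theta z) a b) (\sum_c Jm (x t) n c * DH c a b).
  have cH : diff_class 1 U' (fun z=> H z a b) by exact:(metric_smooth rm par' a b 1%N).
  apply:(@is_derive_chain _ _ _ _ oU' _ theta (x t) (delta_mx 0 n) (Jm (x t) n) cH (proj1 (hth _ Ut)))=> c.
  by have [_ h] := sth 1%N c;have [h' _] := h (delta_mx 0 n);split;[exact:h' |].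
 have deta a : is_derive (x t) (delta_mx 0 n) (fun z=> eta z a) (A n a).
  have dJi i : is_derive (x t) (delta_mx 0 n) (fun z=> Jm z i a) (DJ n i a).
   by have [_ h] := cJ 1%N i a;have [h' _] := h (delta_mx 0 n);split;[exact:h' |].
  have h:= is_derive_sum_fun (fun i=> is_deriveZ (x1 t i) (dJi i)).
  by apply:is_derive_eq h _;apply:eq_bigr=> i _;rewrite symJ.
 have eta1 a : eta (x t) a = y1 t a by rewrite y1E.
 have h1:= is_derive_sum_fun (fun a=> is_derive_sum_fun (fun b=> is_deriveM (dHn a b) (is_deriveM (deta a) (deta b)))).
 have dGn i j : is_derive (x t) (delta_mx 0 n) (fun z=> gram nu phi z i j) ('D_(delta_mx 0 n) (fun y=> gram nu phi y i j) (x t)).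
  by have [_ h] := gram_class 1 i j;have [h' _] := h (delta_mx 0 n);split;[exact:h' |].
 have h2:= is_derive_sum_fun (fun i=> is_derive_sum_fun (fun j=> is_deriveZ (x1 t i * x1 t j) (dGn i j))).
 have nE : \forall z \near x t, \sum_i \sum_j (x1 t i * x1 t j) *: gram nu phi z i j =
   \sum_a \sum_b H (theta z) a b * (eta z a * eta z b).
  apply:filterS (open_near oU Ut)=> z Uz;rewrite -LE //;apply:eq_bigr=> i _;apply:eq_bigr=> j _.
  by rewrite -[_ *: _]/(_ * _);ring.
 have [_ e1] := near_eq_is_derive nE h2;have [_ e2] := h1.
 transitivity (\sum_i \sum_j (x1 t i * x1 t j) *: 'D_(delta_mx 0 n) (fun y=> gram nu phi y i j) (x t)).
  by apply:eq_bigr=> i _;apply:eq_bigr=> j _;rewrite -mulrA mulrC.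
 rewrite -[LHS]e1;apply:etrans e2 _.
 have sH a b : H (y t) a b = H (y t) b a by exact:gram_sym'.
 transitivity (\sum_a \sum_b \sum_c Jm (x t) n c * (DH c a b * y1 t a * y1 t b)
   + (\sum_a \sum_b H (y t) b a * y1 t a * A n b + \sum_a \sum_b H (y t) a b * y1 t b * A n a)).
  rewrite -!big_split /=;apply:eq_bigr=> a _;rewrite -!big_split /=;apply:eq_bigr=> b _.
  rewrite !eta1 -[H (theta (x t)) a b]/(H (y t) a b) [LHS]addrC.
  rewrite -[X in X + _](_ : \sum_c Jm (x t) n c * (DH c a b * y1 t a * y1 t b) = _);last first.
   rewrite -[RHS]/(eta (x t) a * eta (x t) b * \sum_c Jm (x t) n c * DH c a b) !eta1 mulr_sumr.
   by apply:eq_bigr=> c _;ring.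
  congr (_ + _);rewrite -(sH a b) -[_ *: _]/(_ * _) -[y1 t a *: _]/(_ * _) -[y1 t b *: _]/(_ * _).
  by move:(H (y t) a b) (y1 t a) (A n b) (y1 t b) (A n a)=> *;rewrite mulrDr !mulrA.
 congr (_ + _).
  under [RHS]eq_bigr=> c _ do rewrite mulr_sumr.
  rewrite [RHS]exchange_big /=;apply:eq_bigr=> a _.
  under [RHS]eq_bigr=> c _ do rewrite mulr_sumr.
  by rewrite [RHS]exchange_big.
 rewrite mulr2n;congr (_ + _).
  by rewrite exchange_big /=;apply:eq_bigr=> b _;rewrite /q mulr_suml.
 by apply:eq_bigr=> a _;rewrite /q mulr_suml.
move=> a;apply:(is_derive_eq (hdq a));apply/eqP;rewrite -subr_eq0;apply/eqP.
apply:(cancel (fun a=> dq a - 2^-1 * \sum_b \sum_c DH a b c * y1 t b * y1 t c))=> n.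
have h : forall u v w : R, 2^-1 * (u + v *+ 2) = w + v -> w = 2^-1 * u by move=> u v w;rewrite (mulr2n v);lra.
have:= main n;rewrite DL [in RHS]big_split=> /h e;under eq_bigr=> c _ do rewrite mulrBr.
rewrite sumrB [X in X - _]e mulr_sumr;apply/eqP;rewrite subr_eq0;apply/eqP;apply:eq_bigr=> c _.
by rewrite mulrCA.
Qed.
End Metric.

(** * Existence of short geodesics *)

Section GeodesicExistence.
Variables (R : realType) (d k N : nat).
Local Notation C := R[i].
Local Notation isom := 'M[C]_(d * k, d).
Variable nu : isom -> isom -> isom -> R.
Hypothesis rm : riemannian_metric nu.
Variables (r0 : R) (phi : 'rV[R]_N -> isom).
Hypotheses (r00 : 0 < r0) (par : parametrization (ball 0 r0) phi).
Local Notation E2 := 'rV[R]_(N + N).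

Lemma ball0E (x : 'rV[R]_N) (r : R) : ball 0 r x <-> `|x| < r.
Proof. by rewrite -ball_normE /= sub0r normrN. Qed.

Definition geodesic_field (x : E2) : E2 :=
 row_mx (rsubmx x) (\row_l - \sum_i \sum_j christoffel nu phi (lsubmx x) l i j
  * rsubmx x 0 i * rsubmx x 0 j).

Lemma open_lsub : open [set x : E2 | ball 0 r0 (lsubmx x)].
Proof.
have cl : continuous (fun x : E2=> lsubmx x).
 move=> x;apply:rV_continuous=> j.
 rewrite (_ : (fun y : E2=> lsubmx y 0 j) = (fun y : E2=> y 0 (lshift N j))).
  exact:coord_continuous.
 by apply/funext=> y;rewrite mxE.
exact:(@open_comp _ _ (fun x : E2=> lsubmx x) (ball 0 r0) (fun x _=> cl x) (ball_open _ _)).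
Qed.

Lemma geodesic_field_class n i :
 diff_class n [set x : E2 | ball 0 r0 (lsubmx x)] (fun x => geodesic_field x 0 i).
Proof.
have oU:= open_lsub.
have cr j : diff_class n [set x : E2 | ball 0 r0 (lsubmx x)] (fun x=> rsubmx x 0 j).
 rewrite (_ : (fun x : E2=> rsubmx x 0 j) = (fun x=> x 0 (rshift N j))).
  exact:diff_class_coord.
 by apply/funext=> x;rewrite mxE.
rewrite /geodesic_field;case:(split_ordP i)=> j ->.
 by rewrite (_ : (fun x : E2=> _) = (fun x=> rsubmx x 0 j)) //;apply/funext=> x;rewrite row_mxEl.
rewrite (_ : (fun x : E2=> _) = (fun x=> - \sum_i \sum_l christoffel nu phi (lsubmx x) j i l
  * rsubmx x 0 i * rsubmx x 0 l));last by apply/funext=> x;rewrite row_mxEr mxE.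
apply:diff_classN=> //;apply:diff_class_sum=> // a;apply:diff_class_sum=> // b.
apply:diff_classM=> //;apply:diff_classM=> //.
apply:(@diff_class_comp _ _ _ _ (ball 0 r0) _ (fun y=> christoffel nu phi y j a b) (fun x : E2=> lsubmx x) (ball_open _ _) oU)=> //.
 exact:christoffel_class.
move=> l;rewrite (_ : (fun x : E2=> lsubmx x 0 l) = (fun x=> x 0 (lshift N l))).
 exact:diff_class_coord.
by apply/funext=> x;rewrite mxE.
Qed.

(** [picard] needs a small Lipschitz constant, so the field is scaled by eps and the initial
    velocity by eps^-1. The position then satisfies x' = eps w and w' carries the other factor eps,
    hence x solves the unscaled equation with initial velocity v. *)
Lemma geodesic_exists : exists2 rho : R, 0 < rho & forall v : 'rV[R]_N, `|v| <= rho ->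
 exists g : R -> isom, [/\ forall t, 0 <= t <= 1 -> geodesic_at nu g t, g 0 = phi 0 &
  derive_mx g 0 1 = \sum_i (v 0 i)%:C *: derive_mx phi 0 (delta_mx 0 i)].
Proof.
set U:= [set x : E2 | ball 0 r0 (lsubmx x)].
have oU : open U:= open_lsub.
have U0 : U 0 by rewrite /U /= linear0;apply:ballxx.
have [r [L [r_0 L0 rU hL]]] := smooth_lip oU U0 (fun i=> geodesic_field_class 1 i).
have F0 : geodesic_field 0 = 0.
 apply/rowP=> i;rewrite /geodesic_field;case:(split_ordP i)=> j ->;rewrite ?row_mxEl ?row_mxEr !mxE //.
 by rewrite big1 ?oppr0 // => a _;rewrite big1 // => b _;rewrite !mxE !mulr0.
(* The scaled Lipschitz constant is at most 1/8. As the field vanishes at 0, its size is at most r /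
   8 on the ball of radius r, as [picard] requires for the radius r / 2. *)
pose eps : R:= (8 * L + 1)^-1.
have e1 : 0 < 8 * L + 1 by rewrite ltr_wpDl // mulr_ge0.
have e0 : 0 < eps by rewrite invr_gt0.
have eL : eps * L <= 8^-1.
 rewrite /eps mulrC ler_pdivrMr // mulrDr mulrA mulVf ?pnatr_eq0 // mul1r lerDl;lra.
pose F x : E2:= eps *: geodesic_field x.
have lipF (x y : E2) : `|x| <= r -> `|y| <= r -> `|F x - F y| <= 8^-1 * `|x - y|.
 move=> hx hy;apply:rV_norm_le=> [|i];first by rewrite mulr_ge0 // invr_ge0.
 have e z : F z 0 i = eps * geodesic_field z 0 i by rewrite [LHS]mxE.
 have -> : (F x - F y) 0 i = F x 0 i - F y 0 i by rewrite [LHS]mxE [X in _ + X]mxE.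
 rewrite !e -mulrBr normrM (gtr0_norm e0).
 apply:(@le_trans _ _ (eps * (L * `|x - y|))).
  by rewrite ler_wpM2l ?(ltW e0) //;apply:hL;rewrite subr0.
 by rewrite mulrA ler_wpM2r.
exists (eps * (r / 2))=> [|v hv];first by rewrite mulr_gt0 // divr_gt0.
pose x0 : E2:= row_mx 0 (eps^-1 *: v).
have nv : `|eps^-1 *: v| <= r / 2.
 by rewrite normrZ gtr0_norm ?invr_gt0 // -ler_pdivlMl ?invr_gt0 // invrK.
have r2 : 0 < r / 2 by rewrite divr_gt0.
have nx0 : `|x0| <= r / 2.
 apply:rV_norm_le=> [|i];first exact:ltW.
 rewrite /x0;case:(split_ordP i)=> j ->;rewrite ?row_mxEl ?row_mxEr ?mxE ?normr0 ?(ltW r2) //.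
 by have:= rV_norm_coord (eps^-1 *: v) j;rewrite mxE=> h;apply:le_trans h nv.
have inr (x : E2) : `|x - x0| <= r / 2 -> `|x| <= r.
 move=> h;rewrite -[x](subrK x0);apply:le_trans (ler_normD _ _) _;lra.
have lip4 (x y : E2) : `|x - x0| <= r / 2 -> `|y - x0| <= r / 2 -> `|F x - F y| <= 4^-1 * `|x - y|.
 move=> /inr hx /inr hy;apply:le_trans (lipF x y hx hy) _;rewrite ler_wpM2r // lef_pV2 ?posrE //;lra.
have bF (x : E2) : `|x - x0| <= r / 2 -> `|F x| <= (r / 2) / 4.
 move=> /inr hx;have z : `|(0 : E2)| <= r by rewrite normr0 ltW.
 have:= lipF x 0 hx z;rewrite /F F0 scaler0 !subr0=> h;apply:le_trans h _.
 by have i8 : 0 <= 8^-1 :> R;[rewrite invr_ge0 | have:= ler_wpM2l i8 hx;lra].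
have [X [X0 hX dX]] := picard r2 lip4 bF.
have XU t : U (X t) by apply:rU;rewrite subr0;apply:inr.
pose y t : 'rV[R]_N:= lsubmx (X t);pose w t : 'rV[R]_N:= rsubmx (X t).
pose J : set R:= ball 0 2.
have JE t : J t <-> `|t| < 2 by rewrite /J -ball_normE /= sub0r normrN.
have oJ : open J by exact:ball_open.
have dy t : J t -> forall l, is_derive t (1 : R) (fun s=> y s 0 l) (eps * w t 0 l).
 move=> /JE Jt l;have:= dX t Jt (lshift N l);rewrite mxE /geodesic_field row_mxEl.
 by rewrite (_ : (fun s=> X s 0 (lshift N l)) = (fun s=> y s 0 l)) //;apply/funext=> s;rewrite mxE.
have dw t : J t -> forall l, is_derive t (1 : R) (fun s=> w s 0 l)
  (- (eps * \sum_i \sum_j christoffel nu phi (y t) l i j * w t 0 i * w t 0 j)).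
 move=> /JE Jt l;have:= dX t Jt (rshift N l);rewrite mxE /geodesic_field row_mxEr mxE mulrN.
 by rewrite (_ : (fun s=> X s 0 (rshift N l)) = (fun s=> w s 0 l)) //;apply/funext=> s;rewrite mxE.
have cF n i : diff_class n U (fun x=> F x 0 i).
 rewrite /F;under [X in diff_class _ _ X]funext do rewrite mxE.
 by apply:diff_classZ=> //;exact:geodesic_field_class.
have cX:= @ode_class _ _ U J F X oU oJ cF (fun t _=> XU t) (fun t Jt=> dX t (proj1 (JE t) Jt)).
exists (fun t=> phi (y t));split.
- move=> t /andP[t0 t1];exists N, (ball 0 r0), phi, J, y;split=> //.
 + by split=> //;apply/JE;rewrite ger0_norm //;apply:le_lt_trans t1 _;rewrite ltr1n.
 + move=> l n;rewrite (_ : (fun s=> y s 0 l) = (fun s=> X s 0 (lshift N l)));first exact:cX.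
  by apply/funext=> s;rewrite mxE.
 + by move=> s Js;split=> //;exact:(XU s).
 + move=> s Js l.
  have y1 u l' : J u -> derive1 (fun s=> y s 0 l') u = eps * w u 0 l'.
   by move=> Ju;rewrite derive1E;have [_ ->] := dy u Ju l'.
  have -> : derive1n 2 (fun s=> y s 0 l) s =
    eps * - (eps * \sum_i \sum_j christoffel nu phi (y s) l i j * w s 0 i * w s 0 j).
   have nE : \forall u \near s, eps * w u 0 l = derive1 (fun s=> y s 0 l) u.
    by apply:filterS (open_near oJ Js)=> u Ju;rewrite y1.
   have [_ e] := near_eq_is_derive nE (is_deriveZ eps (dw s Js l)).
   by rewrite -[LHS]/(derive1 (derive1 (fun s=> y s 0 l)) s) derive1E -[LHS]/('D_1 (fun u=> derive1 (fun s=> y s 0 l) u) s) e.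
  rewrite mulrN;apply/eqP;rewrite addrC subr_eq0;apply/eqP;rewrite !mulr_sumr.
  apply:eq_bigr=> i _;rewrite !mulr_sumr;apply:eq_bigr=> j _;rewrite !y1 //;ring.
- by rewrite /y X0 row_mxKl.
- have J0 : J 0 by apply/JE;rewrite normr0.
 have sm : mx_class 1 (ball 0 r0) phi by case:par=> _ /smooth_mxP h _ _ _;exact:h.
 have [_ ->] := @derive_mx_chain R N _ _ _ (ball 0 r0) phi y 0 1 (fun i=> eps * w 0 0 i) (ball_open _ _) sm (XU 0) (dy 0 J0).
 rewrite /y X0 row_mxKl;apply:eq_bigr=> i _.
 by rewrite /w X0 row_mxKr mxE mulrA mulfV ?mul1r // gt_eqF.
Qed.
End GeodesicExistence.

(** * Continuity in the entrywise norm and induction on the unit interval *)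

Section Continuity.
Variables (R : realType) (E : normedModType R) (m n : nat).
Local Notation C := R[i].

Lemma mx_class_near (U : set E) (f : E -> 'M[C]_(m, n)) x (eps : R) : mx_class 0 U f -> U x -> 0 < eps ->
 \forall y \near x, mxn (f y - f x) <= eps.
Proof.
move=> hf Ux e0;pose e' := eps / (2 * (m * n)%:R + 1).
have e'0 : 0 < e' by rewrite divr_gt0.
have : \forall y \near x, forall ij : 'I_m * 'I_n,
  `|Re (f y ij.1 ij.2) - Re (f x ij.1 ij.2)| <= e' /\ `|Im (f y ij.1 ij.2) - Im (f x ij.1 ij.2)| <= e'.
 apply:(@filter_forall _ _ (fun ij : 'I_m * 'I_n=> [set y | `|Re (f y ij.1 ij.2) - Re (f x ij.1 ij.2)| <= e' /\
   `|Im (f y ij.1 ij.2) - Im (f x ij.1 ij.2)| <= e']) (nbhs x))=> -[i j] /=.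
 have [[c1 _] [c2 _]] := hf i j.
 by apply:filterI;[exact:(cts_dist (c1 x Ux) e'0) | exact:(cts_dist (c2 x Ux) e'0)].
apply:filterS=> y hy;rewrite /mxn;apply:(@le_trans _ _ (\sum_(i < m) \sum_(j < n) (2 * e'))).
 apply:ler_sum=> i _;apply:ler_sum=> j _;apply:le_trans (cabs_le _) _.
 by rewrite !mxE ReB ImB;have [h1 h2] := hy (i, j);lra.
rewrite !sumr_const !card_ord -mulrnA -[leLHS]mulr_natl mulrA -/e' /e' mulrA ler_pdivrMr //.
rewrite mulrC ler_wpM2l ?(ltW e0) // mulnC mulrC lerDl //.
Qed.

Lemma open_mxn (U : set E) (f : E -> 'M[C]_(m, n)) A (r : R) : open U -> mx_class 0 U f ->
 open [set x | U x /\ mxn (f x - A) < r].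
Proof.
move=> oU hf;rewrite openE=> x [Ux hx];rewrite /interior.
have e0 : 0 < (r - mxn (f x - A)) / 2 by rewrite divr_gt0 // subr_gt0.
apply:filterS2 (open_near oU Ux) (mx_class_near hf Ux e0)=> y Uy hy;split=> //.
rewrite -[f y - A](subrK (f x - A));apply:le_lt_trans (mxnD _ _) _.
by move:hy;rewrite opprB addrA subrK=> hy;lra.
Qed.

Lemma mxn_continuous (U : set E) (f : E -> 'M[C]_(m, n)) A x : mx_class 0 U f -> U x ->
 {for x, continuous (fun y => mxn (f y - A))}.
Proof.
move=> hf Ux;apply/cvgrPdist_le=> eps e0;apply:filterS (mx_class_near hf Ux e0)=> y hy.
apply:le_trans hy;rewrite ler_norml;apply/andP;split.
 by have:= mxnD (f y - f x) (f x - A);rewrite addrA subrK;lra.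
by have:= mxnD (f x - f y) (f y - A);rewrite addrA subrK -[mxn (f x - f y)]mxnN opprB;lra.
Qed.
End Continuity.

Section RealInduction.
Variable R : realType.

(** The continuity method: the supremum of the times up to which P holds cannot lie below 1. At t =
    0 the premise of the first hypothesis is void and starts the induction. *)
Lemma real_induction (P : R -> Prop) :
 (forall t, 0 <= t <= 1 -> (forall s, 0 <= s < t -> P s) -> P t) ->
 (forall t, 0 <= t <= 1 -> (forall s, 0 <= s <= t -> P s) ->
   \forall s \near t, P s) ->
 forall t, 0 <= t <= 1 -> P t.
Proof.
move=> h1 h2;pose S:= [set t : R | 0 <= t <= 1 /\ forall s, 0 <= s <= t -> P s].
have S0 : S 0.
 split;first by rewrite lexx ler01.
 move=> s /andP[s0 s1];have -> : s = 0 by apply/eqP;rewrite eq_le s0 s1.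
 by apply:h1=> [|u /andP[u0 u1]];[rewrite lexx ler01 | have:= le_lt_trans u0 u1;rewrite ltxx].
have bS : has_sup S by split;[exists 0 | exists 1=> t [/andP[]]].
pose T:= sup S.
have T01 : 0 <= T <= 1.
 apply/andP;split;first by apply:ub_le_sup=> //;case:bS.
 by apply:ge_sup;[exists 0 | move=> t [/andP[]]].
have lT s : 0 <= s < T -> P s.
 move=> /andP[s0 sT];have [|t [_ ht] st] := @sup_gt R S s _ sT;first by exists 0.
 by apply:ht;rewrite s0 ltW.
have lT' s : 0 <= s <= T -> P s.
 move=> /andP[s0];rewrite le_eqVlt=> /orP[/eqP -> | sT];last by apply:lT;rewrite s0.
 by apply:h1=> // u /lT.
have [T1|T1] := leP 1 T.
 by move=> t /andP[t0 t1];apply:lT';rewrite t0 (le_trans t1).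
have [rho rho0 hrho] := near_ball (h2 T T01 lT').
pose t:= Num.min 1 (T + rho / 2).
have r2 : 0 < rho / 2 by rewrite divr_gt0.
have tT : T < t by rewrite lt_min T1 ltrDl.
have : S t.
 case/andP: T01=> T0 _;split;first by rewrite ge_min lexx /= (le_trans T0) ?ltW.
 move=> s /andP[s0 st];have [sT|sT] := leP s T;first by apply:lT';rewrite s0.
 apply:hrho;rewrite gtr0_norm ?subr_gt0 //;move:st;rewrite le_min=> /andP[_];lra.
by move=> /(ub_le_sup (proj2 bS));rewrite leNgt tT.
Qed.

Lemma left_limit_le (f : R -> R) (t b : R) : {for t, continuous f} -> 0 < t ->
 (forall s, 0 <= s < t -> `|f s| <= b) -> `|f t| <= b.
Proof.
move=> cf t0 h;apply/ler_addgt0Pr=> eps e0.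
have [rho rho0 hrho] := near_ball (cts_dist cf e0).
pose s:= Num.max 0 (t - rho / 2).
have r2 : 0 < rho / 2 by rewrite divr_gt0.
have st : s < t by rewrite gt_max t0 ltrBlDr ltrDl.
have hs : `|s - t| < rho.
 rewrite distrC gtr0_norm ?subr_gt0 //.
 have : t - rho / 2 <= s by rewrite le_max lexx orbT.
 lra.
have:= h s;rewrite st le_max lexx=> /(_ isT) h1.
have h2:= hrho s hs;rewrite -[f t](subrK (f s));apply:le_trans (ler_normD _ _) _.
by rewrite distrC addrC;apply:lerD.
Qed.
End RealInduction.

Lemma parametrization_sub (R : realType) d k N (U U' : set 'rV[R]_N) (f : 'rV[R]_N -> 'M[R[i]]_(d * k, d)) :
 open U' -> U' `<=` U -> parametrization U f -> parametrization U' f.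
Proof.
move=> oU' sub [oU sm irr tan uniq];split;first exact:oU'.
- move=> a b;have [h1 h2] := sm a b.
 by split=> n;[exact:diff_class_sub sub (h1 n) | exact:diff_class_sub sub (h2 n)].
- by move=> x /sub;exact:irr.
- by move=> x /sub;exact:tan.
- by move=> x /sub;exact:uniq.
Qed.

Lemma is_derive_continuous (R : realType) (f : R -> R) (t df : R) : is_derive t (1 : R) f df ->
 {for t, continuous f}.
Proof. by move=> [d _];apply:differentiable_continuous;apply/derivable1_diffP. Qed.

(** * Second order expansion of geodesics *)

Section GeodesicEstimate.
Variables (R : realType) (d k N : nat).
Local Notation C := R[i].
Local Notation isom := 'M[C]_(d * k, d).
Variable nu : isom -> isom -> isom -> R.
Hypothesis rm : riemannian_metric nu.
Variables (V0 : isom) (r0 rho0 K : R) (phi : 'rV[R]_N -> isom) (theta : isom -> 'rV[R]_N).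
Hypotheses (r00 : 0 < r0) (rho00 : 0 < rho0) (K0 : 0 <= K) (par : parametrization (ball 0 r0) phi).
Local Notation tan v := (\sum_i (v 0 i)%:C *: derive_mx phi 0 (delta_mx 0 i)).
Hypothesis phi_near : forall x, `|x| < r0 ->
 mxn (phi x - V0 - tan x) <= K * `|x| ^+ 2 /\ mxn (phi x - V0) <= K * `|x|.
Hypothesis theta_phi : forall W, W^t* *m W = 1%:M -> mxn (W - V0) < rho0 ->
 `|theta W| < r0 /\ phi (theta W) = W.
Hypothesis theta0 : theta V0 = 0.
Hypothesis theta_class : forall (E : normedModType R) n (U : set E) (f : E -> isom) i, open U ->
 (forall y, U y -> mxn (f y - V0) < rho0) -> mx_class n U f ->
 diff_class n U (fun y => theta (f y) 0 i).
Hypothesis tan_onto : forall A, tangent V0 A ->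
 exists v : 'rV[R]_N, tan v = 'i%C *: A /\ `|v| <= K * mxn A.

Let H x := gram nu phi x.

Lemma geodesic_continuous g t : geodesic_at nu g t -> {for t, continuous (fun s => mxn (g s - V0))}.
Proof.
move=> [N' [U [f [J [x [par' [oJ Jt] sx gx _]]]]]].
have oU : open U by case:par'.
have hf : mx_class 0 U f by case:par'=> _ /smooth_mxP h _ _ _;exact:h.
have hc : mx_class 0 J (fun s=> f (x s)).
 move=> a b;apply:(@cx_class_comp R N' _ 0 U J (fun z=> f z a b) x oU oJ (fun s Js=> (gx s Js).1) (hf a b)).
 by move=> i;exact:sx.
apply/cvgrPdist_le=> eps e0;have /cvgrPdist_le/(_ eps e0) := mxn_continuous (A:= V0) hc Jt.
rewrite -[f (x t)](gx t Jt).2;apply:filterS2 (open_near oJ Jt)=> s Js.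
by rewrite -[f (x s)](gx s Js).2.
Qed.

(** [geodesic_at] may use other coordinates at each time; [momentum_change] moves the equation to
    the fixed chart, where different times can be compared. *)
Lemma geodesic_local g t : geodesic_at nu g t -> mxn (g t - V0) < rho0 ->
 let y s := theta (g s) in
 [/\ \forall s \near t, `|y s| < r0 /\ g s = phi (y s),
   forall a, is_derive t (1 : R) (fun s => y s 0 a) (derive1 (fun s => y s 0 a) t) &
   forall a, is_derive t (1 : R) (fun s => \sum_b H (y s) a b * derive1 (fun s => y s 0 b) s)
   (2^-1 * \sum_b \sum_c 'D_(delta_mx 0 a) (fun z => gram nu phi z b c) (y t)
    * derive1 (fun s => y s 0 b) t * derive1 (fun s => y s 0 c) t)].
Proof.
move=> [N' [U [f [J [x [par' [oJ Jt] sx gx geo]]]]]] gt y.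
have oU : open U by case:par'.
have hf n : mx_class n U f by case:par'=> _ /smooth_mxP h _ _ _;exact:h.
pose U1:= [set z | U z /\ mxn (f z - V0) < rho0].
have oU1 : open U1 by exact:open_mxn.
have par1 : parametrization U1 f by apply:parametrization_sub par'=> // z [].
have hc : mx_class 0 J (fun s=> f (x s)).
 move=> a b;apply:(@cx_class_comp R N' _ 0 U J (fun z=> f z a b) x oU oJ (fun s Js=> (gx s Js).1) (hf 0%N a b)).
 by move=> i;exact:sx.
pose J1:= [set s | J s /\ mxn (f (x s) - V0) < rho0].
have oJ1 : open J1 by exact:open_mxn.
have J1t : J1 t by split=> //;rewrite -(gx t Jt).2.
have xU1 s : J1 s -> U1 (x s) by move=> [Js h];split=> //;have [] := gx s Js.
have isoU z : U z -> (f z)^t* *m f z = 1%:M by case:par'=> _ _ irr _ _ /irr[].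
have sth n i : diff_class n U1 (fun z=> theta (f z) 0 i).
 apply:theta_class=> // [z [] //|];move=> a b;have [h1 h2] := hf n a b.
 by split;[apply:diff_class_sub h1 | apply:diff_class_sub h2] => z [].
have hth z : U1 z -> ball 0 r0 (theta (f z)) /\ f z = phi (theta (f z)).
 by move=> [Uz h];have [h1 h2] := theta_phi (isoU z Uz) h;split=> //;apply/ball0E.
have sx1 l : smooth_on J1 (fun s=> x s 0 l).
 by move=> n;apply:diff_class_sub (sx l n)=> s [].
have mom:= geodesic_momentum rm par1 oJ1 J1t xU1 sx1 (geo t Jt).
have [dy dq] := momentum_change rm par1 par oJ1 J1t xU1 sx1 sth hth mom.
have nE : \forall s \near t, theta (f (x s)) = y s.
 by apply:filterS (open_near oJ1 J1t)=> s [Js _];rewrite /y (gx s Js).2.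
have eT : theta (f (x t)) = y t by rewrite /y (gx t Jt).2.
have e1 a : derive1 (fun s=> theta (f (x s)) 0 a) t = derive1 (fun s=> y s 0 a) t.
 by rewrite !derive1E;apply:near_eq_derive;apply:filterS nE=> s ->.
have nE1 a : \forall s \near t, derive1 (fun s=> theta (f (x s)) 0 a) s = derive1 (fun s=> y s 0 a) s.
 apply:filterS (open_near oJ1 J1t)=> s J1s;rewrite !derive1E;apply:near_eq_derive.
 by apply:filterS (open_near oJ1 J1s)=> u [Ju _];rewrite /y (gx u Ju).2.
split.
- apply:filterS (open_near oJ1 J1t)=> s J1s;have [Js _] := J1s.
 have [/ball0E h1 h2] := hth _ (xU1 s J1s).
 by rewrite /y (gx s Js).2;split=> //;rewrite -h2.
- move=> a;rewrite -e1;apply:near_eq_is_derive (dy a).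
 by apply:filterS nE=> s ->.
- move=> a;apply:near_eq_is_derive (is_derive_eq (dq a) _).
  have /(@filter_forall _ _ (fun b : 'I_N=> [set s | derive1 (fun s=> theta (f (x s)) 0 b) s = derive1 (fun s=> y s 0 b) s]) (nbhs t)) h:= nE1.
  by apply:filterS2 nE h=> s -> h;apply:eq_bigr=> b _;rewrite h.
 by congr (_ * _);apply:eq_bigr=> b _;apply:eq_bigr=> c _;rewrite !e1 eT.
Qed.

Lemma smooth_lip_bound (I : finType) (f : I -> 'rV[R]_N -> R) : (forall i, diff_class 1 (ball 0 r0) (f i)) ->
 exists r B L : R, [/\ 0 < r, 0 <= B, 0 <= L, forall i x, `|x| <= r -> `|f i x| <= B &
  forall i x, `|x| <= r -> `|f i x - f i 0| <= L * `|x|].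
Proof.
move=> hf;have [r [L [r_0 L0 _ hL]]] := smooth_lip (ball_open 0 r0) (ballxx _ r00) hf.
have lip i x : `|x| <= r -> `|f i x - f i 0| <= L * `|x|.
 by move=> hx;have:= hL i x 0;rewrite !subr0;apply=> //;rewrite normr0 ltW.
exists r, (\sum_i `|f i 0| + L * r), L;split=> //.
 by rewrite addr_ge0 ?mulr_ge0 ?(ltW r_0) //;apply:sumr_ge0.
move=> i x hx;rewrite -[f i x](subrK (f i 0)) addrC;apply:le_trans (ler_normD _ _) _;apply:lerD.
 by rewrite (bigD1 i) //= lerDl;apply:sumr_ge0.
by apply:le_trans (lip i x hx) _;rewrite ler_wpM2l.
Qed.

Lemma sum_bound n (F : 'I_n -> R) c : (forall i, `|F i| <= c) -> `|\sum_i F i| <= n%:R * c.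
Proof.
move=> h;apply:le_trans (ler_norm_sum _ _ _) _;rewrite -[n in n%:R]card_ord.
by rewrite mulr_natl -sumr_const;apply:ler_sum=> i _.
Qed.

(** A geodesic might leave the chart before time 1, so bounds are propagated by [real_induction].
    The derivative of the momentum is quadratic in the velocity, hence O(e^2): momentum, velocity
    and finally coordinates stay within O(e^2) of the straight line t v. *)
Lemma geodesic_estimate : exists rho K' : R, [/\ 0 < rho, 0 <= K' & forall e A g, 0 < e <= rho ->
 tangent V0 A -> mxn A <= e -> (forall t, 0 <= t <= 1 -> geodesic_at nu g t) ->
 g 0 = V0 -> derive_mx g 0 1 = 'i%C *: A ->
 irreducible (g 1) /\ mxn (g 1 - V0 - 'i%C *: A) <= K' * e ^+ 2].
Proof.
have [ra [B1 [L1 [ra0 B10 L10 hB1 hL1]]]] := smooth_lip_bound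
 (fun ab : 'I_N * 'I_N=> gram_inv_class rm par 1 ab.1 ab.2).
have [rb [B2 [_ [rb0 B20 _ hB2 _]]]] := smooth_lip_bound
 (fun abc : 'I_N * 'I_N * 'I_N=> gram_derive_class rm par 1 (delta_mx 0 abc.1.1) abc.1.2 abc.2).
pose n : R:= N%:R;have n0 : 0 <= n by exact:ler0n.
pose B0 : R:= \sum_a \sum_b `|H 0 a b|.
have B00 : 0 <= B0 by apply:sumr_ge0=> ? _;apply:sumr_ge0.
(* Bounds in units of e: c for the initial momentum, c1 for the velocity while the momentum is at
   most 2 c e; and in units of e^2: c2 for the derivative of the momentum, c3 for the change of the
   velocity. *)
pose c:= B0 * K + 1;have c0 : 0 < c by rewrite ltr_wpDl // mulr_ge0.
pose c1:= n * (B1 * (2 * c));pose c2:= 2^-1 * (n * (n * (B2 * c1 * c1))).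
have c10 : 0 <= c1 by rewrite !mulr_ge0 // ltW.
have c20 : 0 <= c2.
 by repeat first [exact:c10 | exact:n0 | exact:B20 | by rewrite invr_ge0 | apply:mulr_ge0].
pose c3:= n * (L1 * c1 * (2 * c) + B1 * c2).
have c30 : 0 <= c3 by rewrite mulr_ge0 // addr_ge0 // !mulr_ge0 // ltW.
pose KL : R:= \sum_i mxn (derive_mx phi 0 (delta_mx 0 i : 'rV[R]_N)).
have KL0 : 0 <= KL by apply:sumr_ge0=> i _;exact:mxn_ge0.
pose r3:= Num.min (Num.min ra rb) (r0 / 2).
have r30 : 0 < r3 by rewrite !lt_min ra0 rb0 divr_gt0.
pose rho:= Num.min (r3 / (2 * (c1 + 1))) (Num.min (c / (2 * (c2 + 1))) (rho0 / (4 * (K * c1 + 1)))).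
have pp (x : R) : 0 <= x -> 0 < x + 1 by move=> x0;rewrite ltr_wpDl.
have rho_0 : 0 < rho.
 by rewrite !lt_min;apply/and3P;split;apply:divr_gt0=> //;rewrite mulr_gt0 // pp // mulr_ge0.
exists rho, (K * c1 ^+ 2 + KL * c3);split=> //;first by rewrite addr_ge0 // mulr_ge0 // exprn_ge0.
move=> e A g /andP[e0 hrho] tA hA geo g0 dg.
have e_0:= ltW e0.
have s1 : c1 * e <= r3 / 2.
 have : e <= r3 / (2 * (c1 + 1)) by apply:le_trans hrho _;rewrite ge_min lexx.
 rewrite ler_pdivlMr;last by rewrite mulr_gt0 // pp.
 by rewrite mulrCA mulrDr mulr1 mulrC;lra.
have s2 : c2 * e <= c / 2.
 have : e <= c / (2 * (c2 + 1)) by apply:le_trans hrho _;rewrite !ge_min lexx orbT.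
 rewrite ler_pdivlMr;last by rewrite mulr_gt0 // pp.
 by rewrite mulrCA mulrDr mulr1 mulrC;lra.
have s3 : K * c1 * e < rho0 / 3.
 have : e <= rho0 / (4 * (K * c1 + 1)) by apply:le_trans hrho _;rewrite !ge_min lexx !orbT.
 rewrite ler_pdivlMr;last by rewrite mulr_gt0 // pp // mulr_ge0.
 by rewrite mulrCA mulrDr mulr1 mulrC;have:= rho00;lra.
pose y s:= theta (g s);pose Y s a:= derive1 (fun s=> y s 0 a) s.
pose q s a:= \sum_b H (y s) a b * Y s b.
have I0 : (0 : R) <= (0 : R) <= (1 : R) by apply/andP;split;[exact:lexx | exact:ler01].
have gV0 : mxn (g 0 - V0) < rho0 by rewrite g0 subrr mxn0.
have y0 : y 0 = 0 by rewrite /y g0 theta0.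
have [v [hv nv]] := tan_onto tA.
(* Uniqueness of the coordinates of a tangent vector identifies the initial velocity in the chart
   with v. *)
have Y0 a : Y 0 a = v 0 a.
 have [nE dy _] := geodesic_local (geo 0 I0) gV0.
 have sm : mx_class 1 (ball 0 r0) phi by case:par=> _ /smooth_mxP h _ _ _;exact:h.
 have By0 : ball 0 r0 (y 0) by apply/ball0E;rewrite y0 normr0.
 have [dd ee] := @derive_mx_chain R N _ _ _ (ball 0 r0) phi y 0 1 (Y 0) (ball_open _ _) sm By0 dy.
 have nE' : \forall s \near (0 : R), phi (y s) = g s by apply:filterS nE=> s [_ ->].
 have [_ e2] := derive_mx_near nE' dd.
 have e3 : tan (\row_i Y 0 i) = tan v.
  by rewrite hv -dg e2 ee y0;apply:eq_bigr=> i _;rewrite mxE.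
 have [_ _ _ tang uniq] := par.
 have B00' : ball (0 : 'rV[R]_N) r0 0 by apply:ballxx.
 pose T:= - 'i%C *: tan v.
 have tE (w : 'rV[R]_N) : - 'i%C *: tan w = \sum_j (w 0 j)%:C *: coord_vector phi 0 j.
  by rewrite scaler_sumr;apply:eq_bigr=> j _;rewrite !scalerA mulrC.
 have tT : tangent (phi 0) T by rewrite /T tE;apply:tangent_sum=> j;exact:tang.
 have [w [_ uw]] := uniq 0 B00' T tT.
 have w1:= uw v (tE v);have w2:= uw (\row_i Y 0 i) (etrans (congr1 _ (esym e3)) (tE _)).
 by rewrite -w1 w2 mxE.
have q0 a : `|q 0 a| <= c * e.
 rewrite /q y0;apply:le_trans (ler_norm_sum _ _ _) _.
 apply:(@le_trans _ _ (B0 * (K * e)));last by rewrite mulrA /c mulrDl mul1r lerDl.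
 have hB : \sum_b `|H 0 a b| <= B0.
  by rewrite /B0 [X in _ <= X](bigD1 a) //= lerDl;apply:sumr_ge0=> ? _;apply:sumr_ge0.
 have Ke : 0 <= K * e by rewrite mulr_ge0.
 apply:le_trans (ler_wpM2r Ke hB);rewrite mulr_suml;apply:ler_sum=> b _;rewrite normrM ler_wpM2l // Y0.
 by apply:le_trans (rV_norm_coord _ _) _;apply:le_trans nv _;rewrite ler_wpM2l.
(* rho0 / 2 keeps g inside the domain of the chart, and the momentum is allowed twice its initial
   bound. *)
pose P s:= [/\ mxn (g s - V0) <= rho0 / 2, forall a, `|y s 0 a| <= r3 & forall a, `|q s a| <= 2 * c * e].
have rho2 : rho0 / 2 < rho0 by have:= rho00;lra.
have Pr s : P s -> [/\ `|y s| <= ra, `|y s| <= rb & `|y s| < r0].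
 move=> [_ hy _];have ny : `|y s| <= r3 by apply:rV_norm_le=> //;exact:ltW.
 split;apply:le_trans ny _ || apply:le_lt_trans ny _;rewrite /r3 ?ge_min ?lexx ?orbT //.
 by rewrite gt_min;apply/orP;right;have:= r00;lra.
have PY s : P s -> forall a, Y s a = \sum_b invmx (H (y s)) a b * q s b.
 move=> Ps a;have [_ _ hr] := Pr s Ps.
 have u : H (y s) \in unitmx by apply:(gram_unit rm par);apply/ball0E.
 have e1 : (\col_b q s b) = H (y s) *m (\col_b Y s b).
  by apply/colP=> b;rewrite [LHS]mxE [RHS]mxE;apply:eq_bigr=> l _;rewrite [X in _ = _ * X]mxE.
 have e2 : (\col_b Y s b) = invmx (H (y s)) *m (\col_b q s b) by rewrite e1 mulKmx.
 have:= congr1 (fun M : 'cV_N=> M a 0) e2;rewrite /= [LHS]mxE [RHS]mxE=> ->.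
 by apply:eq_bigr=> b _;rewrite [X in _ * X = _]mxE.
have Yb s : P s -> forall a, `|Y s a| <= c1 * e.
 move=> Ps a;have [h1 _ _] := Pr s Ps;have [_ _ hq] := Ps;rewrite (PY s Ps) /c1 -mulrA.
 apply:sum_bound=> b;rewrite normrM -mulrA;apply:ler_pM=> //;first exact:(hB1 (a, b)).
have dqb s : P s -> forall a, `|2^-1 * \sum_b \sum_c 'D_(delta_mx 0 a) (fun z=> gram nu phi z b c) (y s)
    * Y s b * Y s c| <= c2 * e ^+ 2.
 move=> Ps a;have [_ h2 _] := Pr s Ps.
 rewrite normrM (ger0_norm (_ : 0 <= 2^-1)) ?invr_ge0 // /c2 -mulrA ler_wpM2l ?invr_ge0 //.
 have -> : n * (n * (B2 * c1 * c1)) * e ^+ 2 = n * (n * (B2 * (c1 * e) * (c1 * e))) by ring.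
 apply:sum_bound=> b;apply:sum_bound=> b';rewrite !normrM;apply:ler_pM=> //;last exact:Yb.
 by apply:ler_pM=> //;[exact:(hB2 (a, b, b')) | exact:Yb].
have q_0 : 0 <= c * e by rewrite mulr_ge0 // ltW.
have close t : 0 <= t <= 1 -> (forall s, 0 <= s < t -> P s) -> P t.
 move=> t01 h;have /andP[t0 t1] := t01;move:(t0);rewrite le_eqVlt=> /orP[/eqP <-|tp].
  split=> [|a|a];first by rewrite g0 subrr mxn0 divr_ge0 // ltW.
   by rewrite y0 mxE normr0 ltW.
  by have:= q0 a;lra.
 have m1 : mxn (g t - V0) <= rho0 / 2.
  have:= left_limit_le (geodesic_continuous (geo t t01)) tp (b:= rho0 / 2).
  rewrite ger0_norm ?mxn_ge0 //;apply=> s hs;rewrite ger0_norm ?mxn_ge0 //.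
  by have [] := h s hs.
 have [_ dy dq] := geodesic_local (geo t t01) (le_lt_trans m1 rho2).
 split=> // a.
  by apply:left_limit_le (is_derive_continuous (dy a)) tp _=> s /h[_ hy _];exact:hy.
 by apply:left_limit_le (is_derive_continuous (dq a)) tp _=> s /h[_ _ hq];exact:hq.
(* The bounds of P up to time t imply strictly better ones at time t, which is what makes P open. *)
have strict t : 0 <= t <= 1 -> (forall s, 0 <= s <= t -> P s) ->
  [/\ mxn (g t - V0) <= rho0 / 3, forall a, `|y t 0 a| <= c1 * e & forall a, `|q t a - q 0 a| <= c2 * e ^+ 2].
 move=> /andP[t0 t1] h.
 have loc s : 0 <= s <= t -> geodesic_at nu g s /\ mxn (g s - V0) < rho0.
  move=> /andP[s0 st];split;first by apply:geo;rewrite s0 (le_trans st).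
  by have [h1 _ _] := h s (introT andP (conj s0 st));exact:le_lt_trans h1 rho2.
 have hy a : `|y t 0 a| <= c1 * e.
  have:= @mean_value_bound R (fun s=> y s 0 a) (fun s=> Y s a) t (c1 * e) t0.
  rewrite y0 [in X in `|_ - X|]mxE subr0=> hm;apply:le_trans (hm _ _) _.
  - by move=> s hs;have [l1 l2] := loc s hs;have [_ dy _] := geodesic_local l1 l2;exact:dy.
  - by move=> s hs;apply:Yb;exact:h.
  - by rewrite ler_piMr // mulr_ge0.
 split=> [|//|a].
  have tt : 0 <= t <= t by rewrite t0 lexx.
  have [l1 l2] := loc t tt;have [nE _ _] := geodesic_local l1 l2.
  have [yt ->] := nbhs_singleton nE;have [_ h2] := phi_near yt.
  apply:le_trans h2 _;apply:le_trans (ltW s3);rewrite -mulrA ler_wpM2l //.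
  by apply:rV_norm_le=> //;rewrite mulr_ge0.
 have:= @mean_value_bound R (fun s=> q s a) (fun s=> 2^-1 * \sum_b \sum_c 'D_(delta_mx 0 a) (fun z=> gram nu phi z b c) (y s)
    * Y s b * Y s c) t (c2 * e ^+ 2) t0.
 move=> hm;apply:le_trans (hm _ _) _.
 - by move=> s hs;have [l1 l2] := loc s hs;have [_ _ dq] := geodesic_local l1 l2;exact:dq.
 - by move=> s hs;apply:dqb;exact:h.
 - by rewrite ler_piMr // mulr_ge0 // exprn_ge0.
have openness (t : R) : 0 <= t <= 1 -> (forall s, 0 <= s <= t -> P s) -> \forall s \near t, P s.
 move=> t01 h;have [m1 hy hq] := strict t t01 h.
 have m2 : mxn (g t - V0) < rho0 by apply:le_lt_trans m1 _;have:= rho00;lra.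
 have [_ dy dq] := geodesic_local (geo t t01) m2.
 have e1 : 0 < rho0 / 6 by rewrite divr_gt0.
 have e2 : 0 < r3 / 2 by rewrite divr_gt0.
 have e3 : 0 < c * e / 2 by rewrite divr_gt0 // mulr_gt0.
 have F1:= cts_dist (geodesic_continuous (geo t t01)) e1.
 have F2 : \forall s \near t, forall a, `|y s 0 a - y t 0 a| <= r3 / 2.
  apply:(@filter_forall _ _ (fun a : 'I_N=> [set s | `|y s 0 a - y t 0 a| <= r3 / 2]) (nbhs t))=> a.
  exact:(cts_dist (is_derive_continuous (dy a)) e2).
 have F3 : \forall s \near t, forall a, `|q s a - q t a| <= c * e / 2.
  apply:(@filter_forall _ _ (fun a : 'I_N=> [set s | `|q s a - q t a| <= c * e / 2]) (nbhs t))=> a.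
  exact:(cts_dist (is_derive_continuous (dq a)) e3).
 have [d1 d10 G1] := near_ball F1;have [d2' d20 G2] := near_ball F2;have [d3 d30 G3] := near_ball F3.
 apply/nbhs_normP;exists (Num.min d1 (Num.min d2' d3));first by rewrite /= !lt_min d10 d20.
 move=> s /=;rewrite distrC !lt_min=> /and3P[/G1 h1 /G2 h2 /G3 h3];split.
 - by move:h1;rewrite ler_norml=> /andP[_];lra.
 - move=> a;have:= ler_normD (y s 0 a - y t 0 a) (y t 0 a);rewrite subrK.
  by have:= h2 a;have:= hy a;lra.
 - move=> a;have:= ler_normD (q s a - q t a) (q t a);rewrite subrK.
  have:= ler_normD (q t a - q 0 a) (q 0 a);rewrite subrK.
  have : c2 * e ^+ 2 <= c * e / 2 by rewrite expr2 mulrA (mulrAC c);exact:ler_wpM2r.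
  have:= h3 a;have:= hq a;have:= q0 a;rewrite -(mulrA 2);move:(c * e) (c2 * _)=> z z';lra.
have allP:= real_induction close openness.
have I1 : (0 : R) <= (1 : R) <= (1 : R) by apply/andP;split;[exact:ler01 | exact:lexx].
have [m1 hy hq] := strict 1 I1 (fun s hs=> allP s hs).
have loc s : 0 <= s <= 1 -> geodesic_at nu g s /\ mxn (g s - V0) < rho0.
 by move=> hs;split;[exact:geo | have [h1 _ _] := allP s hs;exact:le_lt_trans h1 rho2].
have yv a : `|y 1 0 a - v 0 a| <= c3 * e ^+ 2.
 have:= @mean_value_bound R (fun s=> y s 0 a - s * v 0 a) (fun s=> Y s a - v 0 a) 1 (c3 * e ^+ 2) ler01.
 rewrite y0 [in X in _ - (X - _)]mxE mul0r mul1r subrr subr0 mulr1;apply.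
  move=> s hs;have [l1 l2] := loc s hs;have [_ dy _] := geodesic_local l1 l2.
  have h : is_derive (s : R) (1 : R) (fun u : R=> u * v 0 a) (v 0 a).
   apply:is_derive_eq (is_deriveM (is_derive_id (s : R) (1 : R)) (is_derive_cst (v 0 a) (s : R) (1 : R))) _.
   by rewrite scaler0 add0r -[_ *: 1]/(_ * 1) mulr1.
  exact:(is_deriveB (dy a) h).
 move=> s hs;have Ps:= allP s hs;have P0:= allP 0 I0.
 have [ys1 hys hqs] := strict s hs (fun u hu=> allP u (let: conj a1 a2:= andP hu in
  introT andP (conj a1 (le_trans a2 (proj2 (andP hs)))))).
 rewrite -(Y0 a) (PY s Ps) (PY 0 P0) -sumrB /c3 -mulrA.
 apply:sum_bound=> b.
 have -> : invmx (H (y s)) a b * q s b - invmx (H (y 0)) a b * q 0 b =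
   (invmx (H (y s)) a b - invmx (H 0) a b) * q s b + invmx (H 0) a b * (q s b - q 0 b).
  by rewrite y0;ring.
 apply:le_trans (ler_normD _ _) _;rewrite [X in _ <= X]mulrDl;apply:lerD;rewrite normrM.
  have -> : L1 * c1 * (2 * c) * e ^+ 2 = (L1 * (c1 * e)) * (2 * c * e) by ring.
  have [h1 _ _] := Pr s Ps;have [_ _ hq'] := Ps.
  apply:ler_pM=> //;apply:le_trans (hL1 (a, b) _ h1) _;rewrite ler_wpM2l //.
  by apply:rV_norm_le=> //;rewrite mulr_ge0.
 rewrite -mulrA;apply:ler_pM=> //.
 by apply:(hB1 (a, b));rewrite normr0 ltW.
have [nE _ _] := let: conj l1 l2:= loc 1 I1 in geodesic_local l1 l2.
have [y1 g1] := nbhs_singleton nE;rewrite g1;split.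
 by case:par=> _ _ irr _ _;apply:irr;apply/ball0E.
have [h1 _] := phi_near y1.
have -> : phi (y 1) - V0 - 'i%C *: A = (phi (y 1) - V0 - tan (y 1)) + tan (y 1 - v).
 rewrite -hv;have -> : tan (y 1 - v) = tan (y 1) - tan v.
  rewrite -sumrB;apply:eq_bigr=> i _;rewrite -scalerBl -rmorphB;congr (_%:C *: _).
  by rewrite !mxE.
 by rewrite addrA subrK.
apply:le_trans (mxnD _ _) _;rewrite mulrDl;apply:lerD.
 apply:le_trans h1 _;rewrite -mulrA -exprMn ler_wpM2l // ler_sqr ?nnegrE //;last by rewrite mulr_ge0.
 by apply:rV_norm_le=> //;rewrite mulr_ge0.
apply:le_trans (mxn_sum _ _ _) _;rewrite /KL -mulrA mulr_suml;apply:ler_sum=> i _.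
rewrite mxn_real mulrC ler_wpM2l ?mxn_ge0 //;have:= yv i;rewrite !mxE //.
Qed.
End GeodesicEstimate.

(** Short geodesics exist, so [xget] does not fall back on its default, and the estimate applies to
    whichever endpoint it selects. The basis e provides the chart. *)
Lemma exp_map_near (R : realType) (d k D : nat) (nu : 'M[R[i]]_(d * k, d) -> 'M[R[i]]_(d * k, d) -> 'M[R[i]]_(d * k, d) -> R)
  (V0 : 'M[R[i]]_(d * k, d)) (e : 'I_D -> 'M[R[i]]_(d * k, d)) :
 riemannian_metric nu -> irreducible V0 -> basis_id V0 e ->
 exists rho K : R, [/\ 0 < rho, 0 <= K & forall eps A, 0 < eps <= rho ->
  tangent_id V0 A -> mxn A <= eps ->
  irreducible (exp_map nu V0 A) /\ mxn (exp_map nu V0 A - V0 - 'i%C *: A) <= K * eps ^+ 2].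
Proof.
move=> rm irr be.
have [r0 [rho0 [K [r00 rho00 K0 [par dch d0 chn] [thP th0 thc onto]]]]] := chart_facts irr be.
have oB : open (ball (0 : 'rV[R]_#|{: 'I_d * 'I_d + ('I_D + 'I_D)}|) r0) by exact:ball_open.
have sm : mx_class 1 (ball 0 r0) (chart V0 e) by case:par=> _ /smooth_mxP h _ _ _;exact:h.
have B0 : ball 0 r0 (0 : 'rV[R]_#|{: 'I_d * 'I_d + ('I_D + 'I_D)}|) by exact:ballxx.
have tE x : tan_of V0 e x = \sum_i (x 0 i)%:C *: derive_mx (chart V0 e) 0 (delta_mx 0 i).
 by rewrite -(derive_mx_dir x oB sm B0) d0.
have ch0 : chart V0 e 0 = V0.
 have [_ h] : _ /\ _:= chn 0 (eq_ind_r (fun t=> t < r0) r00 (normr0 _)).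
 apply/eqP;rewrite -subr_eq0;apply/eqP;apply:mxn_eq0.
 by apply:le_trans h _;rewrite normr0 mulr0.
have pn x : `|x| < r0 -> mxn (chart V0 e x - V0 - \sum_i (x 0 i)%:C *: derive_mx (chart V0 e) 0 (delta_mx 0 i)) <= K * `|x| ^+ 2 /\
  mxn (chart V0 e x - V0) <= K * `|x|.
 by rewrite -tE;exact:chn.
have on A : tangent V0 A -> exists v : 'rV[R]_#|{: 'I_d * 'I_d + ('I_D + 'I_D)}|,
  \sum_i (v 0 i)%:C *: derive_mx (chart V0 e) 0 (delta_mx 0 i) = 'i%C *: A /\ `|v| <= K * mxn A.
 by move=> /onto[v];rewrite tE=> h;exists v.
have [rho1 rho10 ex] := geodesic_exists rm r00 par.
have [rho2 [K' [rho20 K'0 est]]] := geodesic_estimate rm r00 rho00 K0 par pn thP th0 thc on.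
exists (Num.min rho2 (rho1 / (K + 1))), K';split=> //.
 by rewrite lt_min rho20 divr_gt0 // ltr_wpDl.
move=> eps A /andP[e0 he] tA hA.
have K1 : 0 < K + 1 by rewrite ltr_wpDl.
have tA' : tangent V0 A.
 rewrite /tangent (tangent_id0 irr tA) subr0.
 by rewrite -[_ *m V0]trmxCK trmxC_mul trmxCK (tangent_id0 irr tA) trmx0 map_mx0.
have [v [hv nv]] := on A tA'.
have [|g [g1 g2 g3]] := ex v.
 apply:le_trans nv _;apply:(@le_trans _ _ ((K + 1) * eps)).
  by apply:ler_pM=> //;[exact:mxn_ge0 | rewrite lerDl].
 by rewrite mulrC -ler_pdivlMr //;apply:le_trans he _;rewrite ge_min lexx orbT.
have : is_exp nu V0 A (g 1) by exists g;split=> //;[rewrite g2 | rewrite g3].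
rewrite /exp_map=> h;have:= @xgetPex _ V0 [set V1 | is_exp nu V0 A V1] (ex_intro _ _ h).
move=> [g' [h1 h2 h3 h4]];rewrite -h4;apply:(est eps A g')=> //.
by rewrite e0 (le_trans he) // ge_min lexx.
Qed.

(** * From Gram matrices to deficiencies *)

Section Transfer.
Variables (R : realType) (H1 H2 : hilbert R) (Theta : Type) (S : set Theta) (J W E F : finType) (M : nat).
Local Notation C := R[i].
Variables (x : Theta -> J -> H1) (y : Theta -> J -> W -> H2) (net : 'I_M -> Theta).
Variables (Q : Theta -> H1 -> H1) (G : Theta -> H2 -> H2) (u u' : Theta -> E -> H1) (v v' : Theta -> F -> H2) (eps t epsE epsF : R).
Hypothesis eps0 : 0 < eps.
Hypothesis gram_close : forall A B j j', S A -> S B ->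
 cabs (\sum_w hdot (y A j w) (y B j' w) - hdot (x A j) (x B j')) <= eps.
Hypothesis x_le1 : forall A j, S A -> hnorm (x A j) <= 1.
Hypothesis y_le1 : forall A j w, S A -> hnorm (y A j w) <= 1.
Hypothesis netS : forall i, S (net i).
Hypothesis net_close : forall A, S A -> exists i (c : C), cabs c = 1 /\ forall j,
 hsq (x A j - c *: x (net i) j) <= t /\ \sum_w hsq (y A j w - c *: y (net i) j w) <= t.
Hypothesis QE : forall A z, S A -> Q A z = rankop (x A) (x A) z + rankop (u' A) (u A) z.
Hypothesis uE : forall A, S A -> \sum_k hnorm (u A k) * hnorm (u' A k) <= epsE.
Hypothesis GE : forall A z, S A -> G A z = \sum_j \sum_w hdot (y A j w) z *: y A j w + rankop (v' A) (v A) z.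
Hypothesis vE : forall A, S A -> \sum_k hnorm (v A k) * hnorm (v' A k) <= epsF.
Variable e2 : H2.
Hypothesis ee : hdot e2 e2 = 1.

Lemma hnorm_sqrt (H : hilbert R) (z : H) (c : R) : hsq z <= c -> hnorm z <= Num.sqrt c.
Proof.
move=> h;have c0:= le_trans (hsq_ge0 z) h.
by rewrite hnorm_leP // sqr_sqrtr.
Qed.

(** The contraction is built from the grid vectors alone. At any other A both families are compared
    with a grid point up to a common factor of modulus one, which costs 2 sqrt t; the grid itself
    costs the square root of the regularization parameter. *)
Lemma deficiency_transfer (eta : R) : eta = 2 * Num.sqrt t + Num.sqrt (eps * (M * #|J|).+1%:R) ->
 (deficiency S Q G <= (2 * eta * #|W|%:R * #|J|%:R + #|J|%:R * (eps + 2 * eta * #|W|%:R)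
   + (1 + 2 * #|W|%:R) * epsE + epsF)%:E)%E.
Proof.
move=> etaE;pose n:= #|{: 'I_M * J}|.
pose ev (i : 'I_n) : 'I_M * J:= enum_val i.
(* [gram_contraction] asks for the Gram error times the number of vectors; the successor keeps eps'
   positive when there are none. *)
pose eps' := eps * (M * #|J|).+1%:R.
have e'0 : 0 < eps' by rewrite mulr_gt0 // ltr0n.
have nE : n = (M * #|J|)%N by rewrite /n card_prod card_ord.
have [|a [contr near]] := @gram_contraction R H1 H2 W n (fun i=> x (net (ev i).1) (ev i).2)
  (fun i w=> y (net (ev i).1) (ev i).2 w) eps' e'0.
 move=> i j;apply:ler_pM;rewrite ?cabs_ge0 //.
  exact:gram_close.
 by rewrite nE ler_nat.
have [|I [h [_ [hh _ _]]]] := @orthonormal_extend R H1 [::];first by [].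
pose b i:= x (net (ev i).1) (ev i).2.
have chT : channel (kraus_channel b a e2 h) by apply:kraus_channel_channel.
have hin : [set ereal_sup [set trace_norm (fun z=> T (Q th) z - G th z) | th in S] | T in [set T | channel T]]
  (ereal_sup [set trace_norm (fun z=> kraus_channel b a e2 h (Q th) z - G th z) | th in S]).
 by exists (kraus_channel b a e2 h).
apply:le_trans (ereal_inf_lbound hin) _.
apply:ge_ereal_sup=> _ [A SA <-].
have eta0 : 0 <= eta by rewrite etaE addr_ge0 // mulr_ge0.
have -> : (fun z=> kraus_channel b a e2 h (Q A) z - G A z) = (fun z=> kraus_channel b a e2 h
   (fun z=> rankop (x A) (x A) z + rankop (u' A) (u A) z) z
   - (\sum_j \sum_w hdot (y A j w) z *: y A j w + rankop (v' A) (v A) z)).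
 apply/funext=> z;rewrite (_ : Q A = (fun z=> rankop (x A) (x A) z + rankop (u' A) (u A) z)) ?GE //.
 by apply/funext=> z';exact:QE.
apply:kraus_estimate=> //.
- by move=> j;exact:x_le1.
- by move=> w j;exact:y_le1.
- move=> w j;have [i [c [c1 hc]]] := net_close SA;have [h1 h2] := hc j.
 pose k : 'I_n:= enum_rank (i, j);have kE : ev k = (i, j) by rewrite /ev enum_rankK.
 have hk:= near k;rewrite kE /= in hk.
 have Kle:= kraus_op_le contr.
 pose K:= rankop b (a w);rewrite -/K.
 have KB u0 v0 : K (u0 - c *: v0) = K u0 - c *: K v0.
  by rewrite addrC -scaleNr /K rankop_linear scaleNr addrC.
 have -> : K (x A j) - y A j w = K (x A j - c *: x (net i) j) +
   (c *: (K (x (net i) j) - y (net i) j w) + - (y A j w - c *: y (net i) j w)).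
  by rewrite KB scalerBr opprB [X in _ = _ + X]addrA subrK addrA subrK.
 apply:le_trans (hnormD _ _) _;rewrite etaE mulr_natl mulr2n -addrA;apply:lerD.
  by apply:le_trans (Kle w _) _;exact:hnorm_sqrt.
 apply:le_trans (hnormD _ _) _;rewrite addrC;apply:lerD.
  rewrite hnormZ c1 mul1r;apply:hnorm_sqrt;apply:le_trans hk;rewrite (bigD1 w) //= lerDl.
  by apply:sumr_ge0=> ? _;exact:hsq_ge0.
 rewrite hnormN;apply:hnorm_sqrt;apply:le_trans h2;rewrite (bigD1 w) //= lerDl.
 by apply:sumr_ge0=> ? _;exact:hsq_ge0.
- move=> j;have:= gram_close j j SA SA.
 rewrite hdotxx (eq_bigr _ (fun w _=> hdotxx (y A j w))) -rmorph_sum -rmorphB cabs_real distrC //.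
- exact:uE.
- exact:vE.
Qed.
End Transfer.

Section GramDistance.
Variables (R : realType) (H1 H2 : hilbert R) (W : finType).
Local Notation C := R[i].

(** Squared distances are combinations of Gram entries, so closeness to the grid in one family
    passes to the other. *)
Lemma gram_distance (x x0 : H1) (y y0 : W -> H2) (c : C) (eps : R) : cabs c = 1 ->
 cabs (\sum_w hdot (y w) (y w) - hdot x x) <= eps ->
 cabs (\sum_w hdot (y0 w) (y0 w) - hdot x0 x0) <= eps ->
 cabs (\sum_w hdot (y w) (y0 w) - hdot x x0) <= eps ->
 `|\sum_w hsq (y w - c *: y0 w) - hsq (x - c *: x0)| <= 4 * eps.
Proof.
move=> c1 h1 h2 h3.
have E (H : hilbert R) (v v0 : H) : hsq (v - c *: v0) = hsq v + hsq v0 - 2 * Re (c * hdot v v0).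
 rewrite hsqD hsqN hsqZ c1 expr1n mul1r hdotNr hdotZr ReN mulrN //.
have -> : \sum_w hsq (y w - c *: y0 w) = Re (\sum_w hdot (y w) (y w)) + Re (\sum_w hdot (y0 w) (y0 w))
  - 2 * Re (c * \sum_w hdot (y w) (y0 w)).
 rewrite (eq_bigr _ (fun w _=> E H2 (y w) (y0 w))) sumrB big_split /= !Re_sum mulr_sumr Re_sum mulr_sumr.
 by [].
rewrite E.
have k1:= le_trans (Re_le_cabs _) h1;have k2:= le_trans (Re_le_cabs _) h2.
have k3 : `|Re (c * (\sum_w hdot (y w) (y0 w) - hdot x x0))| <= eps.
 by apply:le_trans (Re_le_cabs _) _;rewrite cabsM c1 mul1r.
move:k1 k2 k3;rewrite mulrBr !ReB /hsq.
move:(Re _) (Re _) (Re _) (Re _) (Re _) (Re _)=> a1 a2 a3 a4 a5 a6.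
rewrite !ler_norml=> /andP[? ?] /andP[? ?] /andP[? ?];apply/andP;split;lra.
Qed.
End GramDistance.
Section CyclicSums.
Variables (T : zmodType) (p : nat).
Hypothesis p0 : (0 < p)%N.

Lemma double_residue_sum (F : nat -> nat -> T) (f : 'I_p -> T) :
 (forall (j m : 'I_p), F ((j + m) %% p)%N m = f j) ->
 \sum_(m < p) \sum_(m' < p) F m m' = (\sum_j f j) *+ p.
Proof.
move=> h;rewrite exchange_big /=.
have E (m' : 'I_p) : \sum_(m < p) F m m' = \sum_j f j.
 pose s (j : 'I_p) : 'I_p:= Ordinal (ltn_pmod (j + m') p0).
 have si : injective s.
  move=> i j /(congr1 val) /eqP;rewrite eqn_modDr !modn_small // => /eqP e;exact:val_inj.
 by rewrite (reindex s);[apply:eq_bigr=> j _;exact:h | exact:onW_bij (injF_bij si)].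
by rewrite (eq_bigr _ (fun m' _=> E m')) sumr_const card_ord.
Qed.
End CyclicSums.

(** * Gram matrix of the output vectors *)

Section LocalModel.
Variables (R : realType) (d k p : nat).
Local Notation C := R[i].
Local Notation isom := 'M[C]_(d * k, d).
Variables (V : isom) (P : 'I_p -> 'M[C]_d) (Z : 'M[C]_d).
Hypotheses (irr : irreducible V) (per : has_period V p) (cyc : cyclic_unitary V P Z).
Local Notation rho := (rho_ss V).
Local Notation g := (@Defs.root_of_unity R p).
Local Notation Zp := (Zp Z).
Variable S : 'M[C]_d.
Hypotheses (SS : S *m S = rho) (hS : S^t* = S).
Implicit Types (A B VA VB : isom).
Local Notation L := ('I_d * 'I_d)%type.
Local Notation ip := (inner_id V).

Definition word_vector (VA : isom) (M : 'M[C]_d) (n : nat) (lb : L) : out_space R k n :=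
 [ffun s : n.-tuple 'I_k => (word VA s *m M) lb.2 lb.1].

(** Compensates the phase that [zeta] adds to the n-th power of the eigenvalues. That phase is the
    same for all j, so one factor per vector removes it. *)
Definition out_phase (VA : isom) (n : nat) : C := cexp ((- (n%:R * phase V VA))%:C * 'i%C).

Definition out_vector VA n lb : out_space R k n := out_phase VA n *: word_vector VA S n lb.

Lemma hdot_word_vector VA VB M M' n (lb lb' : L) :
 hdot (word_vector VA M n lb) (word_vector VB M' n lb') =
 (M^t* *m iter n (chan2 VA VB) (delta_mx lb.2 lb'.2) *m M') lb.1 lb'.1.
Proof.
rewrite iter_chan2_word mulmx_sumr mulmx_suml summxE;apply:eq_bigr=> s _;rewrite !ffunE.
have -> : M^t* *m ((word VA s)^t* *m delta_mx lb.2 lb'.2 *m word VB s) *m M' =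
  (word VA s *m M)^t* *m delta_mx lb.2 lb'.2 *m (word VB s *m M') by rewrite trmxC_mul !mulmxA.
move:(word VA s *m M) (word VB s *m M')=> X Y;rewrite mxE (bigD1 lb'.2) //= big1 ?addr0.
 rewrite mxE (bigD1 lb.2) //= big1 ?addr0=> [|i ilb].
  by rewrite !mxE !eqxx mulr1.
 by rewrite [delta_mx _ _ _ _]mxE (negPf ilb) mulr0.
move=> i ilb;rewrite [X in X * _]mxE big1 ?mul0r // => j _.
by rewrite [delta_mx _ _ _ _]mxE (negPf ilb) andbF mulr0.
Qed.

(** The powers (g^j)^n do not converge; the limit Gram matrix keeps them, and the Fock vectors are
    weighted accordingly. *)
Definition gram_weight (n : nat) (lb lb' : L) (j : nat) : C :=
 (g ^+ j) ^+ n * (S *m Zp j *m S) lb.1 lb'.1 * (rho *m (Zp j)^t*) lb'.2 lb.2.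
Definition gram_limit (n : nat) A B (lb lb' : L) : C :=
 \sum_(j < p) cexp (brot p V Z j A B - ((Re (ip A A) + Re (ip B B)) / 2)%:C) * gram_weight n lb lb' j.

Lemma cabs_phase VA n : cabs (out_phase VA n) = 1.
Proof.
rewrite /out_phase cabs_cexp (_ : Re _ = 0) ?expR0 //.
by rewrite Defs.ReM /=;ring.
Qed.

Lemma brot_scale j (a : R) A B : brot p V Z j (a%:C *: A) (a%:C *: B) = (a ^+ 2)%:C * brot p V Z j A B.
Proof.
have cr : (a%:C)^* = a%:C :> C by apply:complexP=> //=;rewrite oppr0.
rewrite /brot !rotE [X in inner_id V X _](_ : _ = a%:C *: (g ^+ j *: ((Zp j)^t* *t 1%:M *m A *m Zp j))).
 by rewrite innerZl innerZr cr mulrA expr2 rmorphM.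
by rewrite -scalemxAr -scalemxAl !scalerA mulrC.
Qed.

Lemma fZ_delta j (i i' : 'I_d) : fZ V Z j (delta_mx i i') = (rho *m (Zp j)^t*) i' i.
Proof.
rewrite /fZ /mxtrace (bigD1 i') //= big1=> [|l li];rewrite mxE (bigD1 i) //= big1 ?addr0.
- by rewrite [delta_mx _ _ _ _]mxE !eqxx mulr1.
- by move=> l li;rewrite [delta_mx _ _ _ _]mxE (negPf li) mulr0.
- by rewrite [delta_mx _ _ _ _]mxE eqxx (negPf li) mulr0.
- by move=> m mi;rewrite [delta_mx _ _ _ _]mxE (negPf mi) mulr0.
Qed.

Lemma out_gram kap : 0 <= kap -> exists2 K : R, 0 <= K & forall e n A B VA VB lb lb',
 0 <= e -> e <= 1 -> (0 < n)%N ->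
 near V kap e ((Num.sqrt n%:R)^-1%:C *: A) VA -> near V kap e ((Num.sqrt n%:R)^-1%:C *: B) VB ->
 cabs (hdot (out_vector VA n lb) (out_vector VB n lb') - gram_limit n A B lb lb') <=
  K * (n%:R^-1 + e + n%:R * e ^+ 3).
Proof.
move=> kap0;have [K K0 hK] := iter_chan2_asymptotics irr per cyc kap0.
exists (mxn S * K * mxn S);first by rewrite !mulr_ge0 ?mxn_ge0.
move=> e n A B VA VB lb lb' e0 e1 n0 nA nB.
pose a : R:= (Num.sqrt n%:R)^-1.
have na : n%:R * a ^+ 2 = 1 :> R.
 by rewrite /a exprVn sqr_sqrtr // mulfV // pnatr_eq0 -lt0n.
(* ph cancels the n-th power of the phase factor of exp zeta. *)
pose ph : C:= (out_phase VA n)^* * out_phase VB n.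
have ph1 : cabs ph = 1 by rewrite cabsM cabs_conj !cabs_phase mulr1.
have phE : ph = cexp ((n%:R * (phase V VA - phase V VB))%:C * 'i%C).
 rewrite /ph /out_phase -cexp_conj -cexpD;congr cexp.
 by apply:complexP;rewrite ?Defs.ReM ?Defs.ImM /=;ring.
pose X : 'M[C]_d:= delta_mx lb.2 lb'.2.
pose Y:= \sum_(j < p) ((g ^+ j * cexp (zeta p V Z j (a%:C *: A) (a%:C *: B) VA VB)) ^+ n *
  fZ V Z j X) *: Zp j.
have hXY : mxn (iter n (chan2 VA VB) X - Y) <= K * (n%:R^-1 + e + n%:R * e ^+ 3).
 have:= hK e _ _ VA VB n X e0 e1 n0 nA nB;rewrite (_ : mxn X = 1) ?mulr1 //.
 rewrite /mxn /X (bigD1 lb.2) //= (bigD1 lb'.2) //= mxE !eqxx cabs1 big1=> [|j jl].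
  rewrite big1 ?addr0 // => i il;apply:big1=> j _;by rewrite mxE (negPf il) cabs0.
 by rewrite mxE (negPf jl) andbF cabs0.
have e1' : hdot (out_vector VA n lb) (out_vector VB n lb') =
  ph * (S *m iter n (chan2 VA VB) X *m S) lb.1 lb'.1.
 by rewrite /out_vector hdotZl hdotZr hdot_word_vector hS mulrA.
have e2' : gram_limit n A B lb lb' = ph * (S *m Y *m S) lb.1 lb'.1.
 rewrite /Y mulmx_sumr mulmx_suml summxE mulr_sumr;apply:eq_bigr=> j _.
 rewrite -scalemxAr -scalemxAl [X in _ = ph * X]mxE fZ_delta exprMn -cexpMn /gram_weight phE.
 have -> : cexp (n%:R * zeta p V Z j (a%:C *: A) (a%:C *: B) VA VB) =
   cexp (brot p V Z j A B - ((Re (ip A A) + Re (ip B B)) / 2)%:C)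
   * cexp ((n%:R * (phase V VB - phase V VA))%:C * 'i%C).
  rewrite -cexpD;congr cexp;rewrite /zeta brot_scale.
  have na' : n%:R * (a ^+ 2)%:C = 1 :> C by rewrite -[n%:R](rmorph_nat (real_complex R)) -rmorphM na.
  have iz (D : isom) : Re (ip (a%:C *: D) (a%:C *: D)) = a ^+ 2 * Re (ip D D).
   by rewrite -!(brot0 p V Z) brot_scale Defs.ReM mul0r subr0.
  have izz : ((Re (ip (a%:C *: A) (a%:C *: A)) + Re (ip (a%:C *: B) (a%:C *: B))) / 2)%:C =
    (a ^+ 2)%:C * ((Re (ip A A) + Re (ip B B)) / 2)%:C.
   by rewrite !iz -rmorphM;congr (_ %:C);rewrite -mulrDr mulrA.
  have hn : (n%:R * (phase V VB - phase V VA))%:C = n%:R * (phase V VB - phase V VA)%:C :> C.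
   by rewrite rmorphM rmorph_nat.
  rewrite hn izz -mulrBr mulrDr !(mulrA n%:R) na' mul1r //.
 have -> : cexp ((n%:R * (phase V VA - phase V VB))%:C * 'i%C) *
   ((g ^+ j) ^+ n * (cexp (brot p V Z j A B - ((Re (ip A A) + Re (ip B B)) / 2)%:C)
   * cexp ((n%:R * (phase V VB - phase V VA))%:C * 'i%C)) * (rho *m (Zp j)^t*) lb'.2 lb.2 * (S *m Zp j *m S) lb.1 lb'.1)
  = (cexp ((n%:R * (phase V VA - phase V VB))%:C * 'i%C) * cexp ((n%:R * (phase V VB - phase V VA))%:C * 'i%C))
   * (cexp (brot p V Z j A B - ((Re (ip A A) + Re (ip B B)) / 2)%:C) *
   ((g ^+ j) ^+ n * (S *m Zp j *m S) lb.1 lb'.1 * (rho *m (Zp j)^t*) lb'.2 lb.2)).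
  move:(cexp _) (cexp _) (cexp _) ((g ^+ j) ^+ n) ((rho *m _) _ _) ((S *m _ *m S) _ _)=> *;ring.
 have hz : (n%:R * (phase V VA - phase V VB))%:C * 'i%C + (n%:R * (phase V VB - phase V VA))%:C * 'i%C = 0 :> C.
  by rewrite -mulrDl -rmorphD -mulrDr addrA subrK subrr mulr0 mul0r.
 by rewrite -cexpD hz cexp0 mul1r.
rewrite e1' e2' -mulrBr cabsM ph1 mul1r.
have -> : (S *m iter n (chan2 VA VB) X *m S) lb.1 lb'.1 - (S *m Y *m S) lb.1 lb'.1 =
  (S *m (iter n (chan2 VA VB) X - Y) *m S) lb.1 lb'.1.
 by rewrite mulmxBr mulmxBl [RHS]mxE [X in _ = _ + X]mxE.
apply:le_trans (cabs_le_mxn _ _ _) _;apply:le_trans (mxnM _ _) _.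
rewrite [leRHS]mulrAC ler_wpM2r ?mxn_ge0 //;apply:le_trans (mxnM _ _) _.
by rewrite -mulrA ler_wpM2l ?mxn_ge0.
Qed.

Definition out_op VA (N : 'M[C]_d) n : out_space R k n -> out_space R k n := fun z =>
 [ffun s : n.-tuple 'I_k => \sum_(t : n.-tuple 'I_k) \tr (word VA s *m N *m (word VA t)^t*) * z t].

Lemma out_opD VA N N' n z : out_op VA (N + N') z = out_op VA N z + out_op VA N' z :> out_space R k n.
Proof.
apply/ffunP=> s;rewrite [RHS]ffunE !ffunE -big_split;apply:eq_bigr=> t _ /=.
by rewrite mulmxDr mulmxDl mxtraceD mulrDl.
Qed.

Lemma trace_word VA (N : 'M[C]_d) (s t : seq 'I_k) : \tr (word VA s *m N *m (word VA t)^t*) =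
 \sum_(lb : L) \sum_l' N lb.1 l' * (word VA s) lb.2 lb.1 * ((word VA t) lb.2 l')^*.
Proof.
rewrite /mxtrace -(pair_bigA _ (fun l b=> \sum_l' N l l' * word VA s b l * (word VA t b l')^*)) exchange_big /=.
apply:eq_bigr=> b _;rewrite [RHS]exchange_big mxE;apply:eq_bigr=> l' _ /=.
have -> : (word VA t)^t* l' b = ((word VA t) b l')^* by rewrite !mxE.
by rewrite mxE mulr_suml;apply:eq_bigr=> l _;rewrite (mulrC (N l l')).
Qed.

Lemma out_op_rankop VA N n (z : out_space R k n) : out_op VA N z =
 rankop (fun q : L * 'I_d => word_vector VA 1%:M n (q.2, q.1.2))
     (fun q => N q.1.1 q.2 *: word_vector VA 1%:M n q.1) z.
Proof.
apply/ffunP=> s;rewrite sum_ffunE ffunE.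
under eq_bigr=> t _ do rewrite trace_word mulr_suml.
rewrite exchange_big -(pair_bigA _ (fun lb l'=> (hdot (word_vector VA 1%:M n (l', lb.2)) z *:
  (N lb.1 l' *: word_vector VA 1%:M n lb)) s)) /=;apply:eq_bigr=> lb _.
under eq_bigr=> t _ do rewrite mulr_suml.
rewrite exchange_big;apply:eq_bigr=> l' _ /=.
rewrite [RHS]ffunE [X in _ = _ *: X]ffunE [X in _ = _ *: (_ *: X)]ffunE mulmx1 /GRing.scale /= [RHS]mulrC [RHS]mulr_sumr;apply:eq_bigr=> t _.
by rewrite ffunE mulmx1 !mulrA.
Qed.

Lemma out_sum VA n z : rankop (out_vector VA n) (out_vector VA n) z = out_op VA rho z.
Proof.
have -> : rankop (out_vector VA n) (out_vector VA n) z = rankop (word_vector VA S n) (word_vector VA S n) z.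
 apply:eq_bigr=> lb _;rewrite /out_vector hdotZl scalerA mulrAC conjMz_cabs cabs_phase expr1n mul1r //.
apply/ffunP=> s;rewrite sum_ffunE ffunE.
under eq_bigr=> lb _ do rewrite ffunE ffunE -[_ *: _]/(_ * _) mulr_suml.
rewrite exchange_big;apply:eq_bigr=> t _ /=.
have -> : word VA s *m rho *m (word VA t)^t* = (word VA s *m S) *m (word VA t *m S)^t*.
 by rewrite trmxC_mul hS -SS !mulmxA.
move:(z t)=> zt;rewrite /mxtrace mulr_suml.
rewrite (eq_bigr (fun lb=> (word_vector VA S n (lb.1, lb.2) t)^* * zt * word_vector VA S n (lb.1, lb.2) s));last first.
 by case=> l b _;rewrite [X in _ = _ * X]ffunE.
rewrite -(pair_bigA _ (fun l b=> (word_vector VA S n (l, b) t)^* * zt * word_vector VA S n (l, b) s)) exchange_big /=.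
apply:eq_bigr=> b _;rewrite mxE mulr_suml;apply:eq_bigr=> l _;rewrite !ffunE /=.
have -> : (word VA t *m S)^t* l b = ((word VA t *m S) b l)^* by rewrite !mxE.
by rewrite mulrC mulrA.
Qed.

Lemma iter_chan2_1 VA n : VA^t* *m VA = 1%:M -> iter n (chan2 VA VA) 1%:M = 1%:M.
Proof. by move=> iV;elim:n=> [//|n IH] /=;rewrite IH /chan2 tens11 mulmx1. Qed.

(** Summing over b inserts the identity, which the channel of an isometry preserves. *)
Lemma word_vector_sum VA M n l : VA^t* *m VA = 1%:M ->
 \sum_b hsq (word_vector VA M n (l, b)) = Re ((M^t* *m M) l l).
Proof.
move=> iV;rewrite /hsq -Re_sum;congr Re.
under eq_bigr=> b _ do rewrite hdot_word_vector iter_chan2_word /=.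
rewrite -summxE -mulmx_suml -mulmx_sumr exchange_big /=.
have -> : \sum_(s : n.-tuple 'I_k) \sum_i (word VA s)^t* *m delta_mx i i *m word VA s = 1%:M.
 rewrite -(iter_chan2_1 n iV) iter_chan2_word;apply:eq_bigr=> s _.
 by rewrite -mulmx_suml -mulmx_sumr -mx1_sum_delta.
by rewrite mulmx1.
Qed.

Lemma word_vector_le VA M n lb : VA^t* *m VA = 1%:M ->
 hsq (word_vector VA M n lb) <= Re ((M^t* *m M) lb.1 lb.1).
Proof.
case:lb=> l b iV;rewrite -(word_vector_sum M n l iV) (bigD1 b) //= lerDl.
by apply:sumr_ge0=> ? _;exact:hsq_ge0.
Qed.

Lemma word_vector_le1 VA n lb : VA^t* *m VA = 1%:M -> hnorm (word_vector VA 1%:M n lb) <= 1.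
Proof.
move=> iV;rewrite hnorm_leP // expr1n;apply:le_trans (word_vector_le _ _ _ iV) _.
by rewrite mulmx1 adj1 mxE eqxx.
Qed.

Lemma out_vector_le1 VA n lb : VA^t* *m VA = 1%:M -> hnorm (out_vector VA n lb) <= 1.
Proof.
move=> iV;rewrite /out_vector hnormZ cabs_phase mul1r hnorm_leP // expr1n.
apply:le_trans (word_vector_le _ _ _ iV) _;rewrite hS SS.
have [_ [_ tr _] _ _] := irreducible_rho irr.
have -> : 1 = \sum_l Re (rho l l) by rewrite -Re_sum -/(mxtrace _) tr.
rewrite (bigD1 lb.1) //= lerDl;apply:sumr_ge0=> l _.
rewrite -SS -{1}hS -(word_vector_sum S n l iV).
by apply:sumr_ge0=> ? _;exact:hsq_ge0.
Qed.

(** The vectors use the square root S of the stationary state of V for every A; the difference of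
    the stationary states is kept as a perturbation. *)
Lemma rho_out_split VA n z : rho_out VA n z = rankop (out_vector VA n) (out_vector VA n) z +
 rankop (fun q : L * 'I_d => word_vector VA 1%:M n (q.2, q.1.2))
     (fun q => (rho_ss VA - rho) q.1.1 q.2 *: word_vector VA 1%:M n q.1) z.
Proof. by rewrite out_sum -out_op_rankop -out_opD addrC subrK. Qed.

Lemma out_diff_small VA n : VA^t* *m VA = 1%:M ->
 \sum_(q : L * 'I_d) hnorm ((rho_ss VA - rho) q.1.1 q.2 *: word_vector VA 1%:M n q.1)
  * hnorm (word_vector VA 1%:M n (q.2, q.1.2)) <= d%:R * mxn (rho_ss VA - rho).
Proof.
move=> iV;apply:(@le_trans _ _ (\sum_(q : L * 'I_d) cabs ((rho_ss VA - rho) q.1.1 q.2))).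
 apply:ler_sum=> q _;rewrite hnormZ -mulrA ler_piMr ?cabs_ge0 //.
 by rewrite mulr_ile1 ?hnorm_ge0 ?word_vector_le1.
rewrite -(pair_bigA _ (fun (lb : L) l'=> cabs ((rho_ss VA - rho) lb.1 l'))) /=.
rewrite -(pair_bigA _ (fun l (b : 'I_d)=> \sum_l' cabs ((rho_ss VA - rho) l l'))) exchange_big /=.
by rewrite sumr_const card_ord mulr_natl.
Qed.
End LocalModel.

(** * Gram matrix of the Gaussian mixture *)

Section FockModel.
Variables (R : realType) (d k p : nat).
Local Notation C := R[i].
Local Notation isom := 'M[C]_(d * k, d).
Variables (V : isom) (P : 'I_p -> 'M[C]_d) (Z : 'M[C]_d).
Hypotheses (irr : irreducible V) (per : has_period V p) (cyc : cyclic_unitary V P Z).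
Local Notation rho := (rho_ss V).
Local Notation g := (@Defs.root_of_unity R p).
Local Notation Zp := (Zp Z).
Variable S : 'M[C]_d.
Hypotheses (SS : S *m S = rho) (hS : S^t* = S).
Variables (D : nat) (e : 'I_D -> isom).
Hypothesis be : basis_id V e.
Implicit Types (A B : isom).
Local Notation L := ('I_d * 'I_d)%type.
Local Notation ip := (inner_id V).
Local Notation rot m A := (iter m (rotation p Z) A).

Definition coherent A : fock_hilbert R D := coh (coords_id V e A).

Lemma hdot_coords A B : tangent_id V B -> hdot (coords_id V e A) (coords_id V e B) = ip A B.
Proof.
case:be=> _ _ eB tB;rewrite -[LHS]/(\sum_i _) [in RHS](eB B tB) /inner_id mulmx_sumr raddf_sum.
apply:eq_bigr=> i _;rewrite !ffunE -/(ip _ _) -(innerC irr A) -/(ip A _).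
by rewrite mulrC -[LHS]innerZr.
Qed.

Lemma hdot_coherent A B : tangent_id V A -> tangent_id V B ->
 hdot (coherent A) (coherent B) = cexp (ip A B - ((Re (ip A A) + Re (ip B B)) / 2)%:C).
Proof. by move=> tA tB;rewrite hdot_coh /hsq !hdot_coords. Qed.

Lemma hsq_coherent A : tangent_id V A -> hsq (coherent A) = 1.
Proof.
move=> tA;rewrite /hsq hdot_coherent // (_ : ip A A - _ = 0) ?cexp0 //.
apply/eqP;rewrite subr_eq0;apply/eqP/complexP=> /=;first by field.
by have:= inner_ge0 irr A;rewrite ge0E=> /andP[/eqP].
Qed.

(** The phase makes the inner product real and equal to exp (- |A - B|^2 / 2), and exp (- x) >= 1 -
    x. One phase serves all m because the rotation is unitary. *)
Lemma coherent_close A B : tangent_id V A -> tangent_id V B ->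
 exists2 c : C, cabs c = 1 & forall m,
  hsq (coherent (rot m A) - c *: coherent (rot m B)) <= Re (ip (A - B) (A - B)).
Proof.
move=> tA tB;exists (cexp ((- Im (ip A B))%:C * 'i%C)).
 by rewrite cabs_cexp (_ : Re _ = 0) ?expR0 // Defs.ReM /=;ring.
move=> m;have tm:= fun X=> tangent_id_rot irr cyc m (A:= X).
set c:= cexp _;have c1 : cabs c = 1.
 by rewrite cabs_cexp (_ : Re _ = 0) ?expR0 // Defs.ReM /=;ring.
rewrite hsqD hsqN hsqZ c1 expr1n mul1r !hsq_coherent.
rewrite [hdot _ _]hdotNr hdotZr hdot_coherent.
rewrite !(inner_rot irr cyc) /c -cexpD.
have -> : (- Im (ip A B))%:C * 'i%C + (ip A B - ((Re (ip A A) + Re (ip B B)) / 2)%:C) =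
  (- (Re (ip (A - B) (A - B)) / 2))%:C.
 rewrite innerDl !innerDr !innerNl !innerNr (innerC irr B A).
 move:(ip A A) (ip A B) (ip B B)=> [a1 a2] [b1 b2] [c1' c2].
 by apply:complexP=> /=;field.
have -> (a : R) : cexp (- (a / 2))%:C = (expR (- (a / 2)))%:C.
 by rewrite /cexp cos0 sin0;apply:complexP=> /=;ring.
rewrite ReN /=.
have:= expR_ge1Dx (- (Re (ip (A - B) (A - B)) / 2));move:(Re _)=> a;move:(expR _)=> b;lra.
all: exact:tm.
Qed.

(** Weights of a decomposition of the mixture into rank one operators: lb matches the index of the
    output vectors and w is an environment index. Summed over w they produce the limit Gram matrix,
    summed over both they leave the mixture itself. *)
Definition fock_weight n m (lb w : L) : C :=
 ((g ^+ m) ^+ n)^* * (((Zp m)^t* *m S) w.1 lb.1 * (Zp m *m S) lb.2 w.2).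

Definition fock_vector A n (lb w : L) : fock_hilbert R D :=
 (Num.sqrt p%:R)^-1%:C *: \sum_(m < p) fock_weight n m lb w *: coherent (rot m A).

Lemma fock_weight_sum n m m' lb lb' :
 \sum_w (fock_weight n m lb w)^* * fock_weight n m' lb' w =
 (g ^+ m) ^+ n * ((g ^+ m') ^+ n)^* *
  ((S *m Zp m *m (Zp m')^t* *m S) lb.1 lb'.1 * (Zp m' *m rho *m (Zp m)^t*) lb'.2 lb.2).
Proof.
have cK (z : C) : z^*^* = z by apply:complexP;rewrite ?Reconj ?Imconj ?opprK.
have cE a b (X : 'M[C]_(a, b)) i j : X^t* i j = (X j i)^* by rewrite !mxE.
have -> : S *m Zp m *m (Zp m')^t* *m S = ((Zp m)^t* *m S)^t* *m ((Zp m')^t* *m S).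
 by rewrite trmxC_mul trmxCK hS !mulmxA.
have -> : Zp m' *m rho *m (Zp m)^t* = (Zp m' *m S) *m (Zp m *m S)^t*.
 by rewrite trmxC_mul hS -SS !mulmxA.
rewrite [X in _ * (X * _)]mxE [X in _ * (_ * X)]mxE mulr_suml mulr_sumr.
rewrite -(pair_bigA _ (fun w1 w2=> (fock_weight n m lb (w1, w2))^* * fock_weight n m' lb' (w1, w2))) /=.
apply:eq_bigr=> w1 _;rewrite !mulr_sumr;apply:eq_bigr=> w2 _.
rewrite /fock_weight /= !rmorphM /= !cE cK.
move:((g ^+ m) ^+ n) (((g ^+ m') ^+ n)^*)=> a b.
move:((_ w1 lb.1)^*) ((_ lb.2 w2)^*) (_ w1 lb'.1) (_ lb'.2 w2)=> *;ring.
Qed.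

Lemma conj_invsqrt : ((Num.sqrt p%:R)^-1%:C)^* * (Num.sqrt p%:R)^-1%:C = p%:R^-1 :> C.
Proof.
have -> : ((Num.sqrt p%:R)^-1%:C)^* = (Num.sqrt (p%:R : R))^-1%:C :> C by apply:complexP=> //=;rewrite oppr0.
by rewrite -rmorphM -invfM -expr2 sqr_sqrtr // fmorphV rmorph_nat.
Qed.

Lemma hdot_fock_vector A B n lb w lb' w' : hdot (fock_vector A n lb w) (fock_vector B n lb' w') =
 p%:R^-1 * \sum_(m < p) \sum_(m' < p) ((fock_weight n m lb w)^* * fock_weight n m' lb' w')
  * hdot (coherent (rot m A)) (coherent (rot m' B)).
Proof.
rewrite /fock_vector hdotZl hdotZr mulrA.
rewrite conj_invsqrt;congr (_ * _);rewrite hdot_suml;apply:eq_bigr=> m _;rewrite hdot_sumr;apply:eq_bigr=> m' _.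
by rewrite hdotZl hdotZr mulrA.
Qed.

(** As Z^p = 1, Z commutes with rho and the rotation preserves inner products, the summand depends
    on m and m' only through m - m' modulo p; the double sum is p times the sum over j. *)
Lemma fock_gram A B n lb lb' : tangent_id V A -> tangent_id V B ->
 \sum_w hdot (fock_vector A n lb w) (fock_vector B n lb' w) = gram_limit p V Z S n A B lb lb'.
Proof.
move=> tA tB;have p0 : (0 < p)%N by case:per.
under eq_bigr=> w _ do rewrite hdot_fock_vector.
rewrite -mulr_sumr exchange_big /=;under eq_bigr=> m _ do rewrite exchange_big /=.
under eq_bigr=> m _ do under eq_bigr=> m' _ do rewrite -mulr_suml fock_weight_sum.
rewrite (double_residue_sum p0 (F:= fun m m'=> (g ^+ m) ^+ n * ((g ^+ m') ^+ n)^* *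
  ((S *m Zp m *m (Zp m')^t* *m S) lb.1 lb'.1 * (Zp m' *m rho *m (Zp m)^t*) lb'.2 lb.2)
  * hdot (coherent (rot m A)) (coherent (rot m' B)))
  (f:= fun j=> cexp (brot p V Z j A B - ((Re (ip A A) + Re (ip B B)) / 2)%:C) * gram_weight p V Z S n lb lb' j)).
  rewrite -[X in _ * X](mulr_natl _ p) mulrA mulVf ?mul1r //.
 by rewrite pnatr_eq0 -lt0n.
move=> j m;have [u1 u2] := Zp_unitary cyc m.
have modp a : [/\ Zp (a %% p) = Zp a, g ^+ (a %% p) = g ^+ a & forall X : isom, rot (a %% p) X = rot a X].
 have gE : g ^+ (a %% p) = g ^+ a.
  by rewrite {2}(divn_eq a p) exprD mulnC exprM root_expr ?expr1n ?mul1r.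
 have ZE : Zp (a %% p) = Zp a.
  rewrite {2}(divn_eq a p) ZpD;elim:(a %/ p)%N=> [|q IH];first by rewrite /Zp mul1mx.
  by rewrite mulSn ZpD (Zp_period per cyc) mul1mx.
 by split=> // X;rewrite !rotE ZE gE.
have [-> -> rotE'] := modp (j + m)%N;rewrite rotE' addnC iterD hdot_coherent.
rewrite !(inner_rot irr cyc) -/(brot p V Z j A B) /gram_weight mulrC;congr (_ * _).
rewrite (addnC m j) ZpD trmxC_mul exprD exprMn.
have -> : (g ^+ j) ^+ n * (g ^+ m) ^+ n * ((g ^+ m) ^+ n)^* = (g ^+ j) ^+ n.
 rewrite -mulrA [X in _ * X]mulrC -[(g ^+ m) ^+ n]exprM rootX_conj mulr1 //.
rewrite -mulrA;congr (_ * (_ * _)).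
 by rewrite -!mulmxA [Zp m *m (_ *m S)]mulmxA u2 mul1mx.
by rewrite !mulmxA -(rho_Zp irr cyc) -[_ *m Zp m *m _]mulmxA u2 mulmx1.
all: by do ?[exact:tA | exact:tB | apply:(tangent_id_rot irr cyc)].
Qed.

(** Traces of rho against nontrivial powers of Z vanish, so cross terms between different components
    disappear from the sum of rank one operators. *)
Lemma fock_weight_delta n (m m' : 'I_p) :
 \sum_lb \sum_w (fock_weight n m lb w)^* * fock_weight n m' lb w = (m == m')%:R.
Proof.
under eq_bigr=> lb _ do rewrite fock_weight_sum.
rewrite -mulr_sumr -(pair_bigA _ (fun l b=> (S *m Zp m *m (Zp m')^t* *m S) l l * (Zp m' *m rho *m (Zp m)^t*) b b)) /=.
under eq_bigr=> l _ do rewrite -mulr_sumr.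
rewrite -mulr_suml -!/(mxtrace _).
have -> : \tr (S *m Zp m *m (Zp m')^t* *m S) = (m == m')%:R.
 rewrite mxtrace_mulC !mulmxA SS (rho_Zp irr cyc) -mulmxA mxtrace_mulC.
 by rewrite eq_sym -(fZ_Zp irr cyc).
have [->|_] := eqVneq m m';last by rewrite mul0r mulr0.
rewrite mul1r -mulmxA mxtrace_mulC -mulmxA (proj1 (Zp_unitary cyc _)) mulmx1.
have [_ [_ -> _] _ _] := irreducible_rho irr.
by rewrite mulr1 mulrC -[(g ^+ m') ^+ n]exprM rootX_conj.
Qed.

Lemma fock_sum A n z : \sum_lb \sum_w hdot (fock_vector A n lb w) z *: fock_vector A n lb w = rho_gm V p Z e A z.
Proof.
have E lb w : hdot (fock_vector A n lb w) z *: fock_vector A n lb w = p%:R^-1 *: (\sum_(m < p) \sum_(m' < p)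
  ((fock_weight n m lb w)^* * fock_weight n m' lb w) *: (hdot (coherent (rot m A)) z *: coherent (rot m' A))).
 rewrite /fock_vector hdotZl scalerA mulrAC conj_invsqrt -scalerA;congr (_ *: _).
 rewrite hdot_suml scaler_suml;apply:eq_bigr=> m _;rewrite scaler_sumr;apply:eq_bigr=> m' _.
 by rewrite hdotZl !scalerA mulrAC.
under eq_bigr=> lb _ do under eq_bigr=> w _ do rewrite E.
under eq_bigr=> lb _ do rewrite -scaler_sumr exchange_big /=.
rewrite -scaler_sumr exchange_big /= /rho_gm;congr (_ *: _);apply:eq_bigr=> m _.
under eq_bigr=> lb _ do rewrite exchange_big /=.
rewrite exchange_big /=;under eq_bigr=> m' _.
 under eq_bigr=> lb _ do rewrite -scaler_suml.
 rewrite -scaler_suml fock_weight_delta;over.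
by rewrite (bigD1 m) //= eqxx scale1r big1 ?addr0 // => m' mm;rewrite eq_sym (negPf mm) scale0r.
Qed.

Lemma fock_vector_le1 A n lb w : tangent_id V A -> hnorm (fock_vector A n lb w) <= 1.
Proof.
move=> tA;have p0 : (0 < p)%N by case:per.
rewrite hnorm_leP // expr1n.
have : \sum_lb \sum_w hsq (fock_vector A n lb w) = 1.
 have -> : \sum_lb \sum_w hsq (fock_vector A n lb w) =
   Re (\sum_lb \sum_w hdot (fock_vector A n lb w) (fock_vector A n lb w)).
  by rewrite Re_sum;apply:eq_bigr=> lb' _;rewrite Re_sum.
 under eq_bigr=> lb' _ do under eq_bigr=> w' _ do rewrite hdot_fock_vector.
 under eq_bigr=> lb' _ do rewrite -mulr_sumr exchange_big /=.
 rewrite -mulr_sumr exchange_big /=.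
 have -> : \sum_(m < p) \sum_lb' \sum_w' \sum_(m' < p) (fock_weight n m lb' w')^* * fock_weight n m' lb' w'
   * hdot (coherent (rot m A)) (coherent (rot m' A)) = \sum_(m < p) 1.
  apply:eq_bigr=> m _;under eq_bigr=> lb' _ do rewrite exchange_big /=.
  rewrite exchange_big /=;under eq_bigr=> m' _.
   under eq_bigr=> lb' _ do rewrite -mulr_suml.
   rewrite -mulr_suml fock_weight_delta;over.
  rewrite (bigD1 m) //= eqxx mul1r big1 ?addr0=> [|m' mm];last by rewrite eq_sym (negPf mm) mul0r.
  have:= hsq_coherent (tangent_id_rot irr cyc m tA);move/(congr1 (real_complex R));rewrite -hdotxx;apply.
 by rewrite sumr_const card_ord mulVf // pnatr_eq0 -lt0n.
rewrite (bigD1 lb) //= (bigD1 w) //= => <-;rewrite -addrA lerDl addr_ge0 //.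
 by apply:sumr_ge0=> ? _;exact:hsq_ge0.
by apply:sumr_ge0=> ? _;apply:sumr_ge0=> ? _;exact:hsq_ge0.
Qed.

Lemma fock_weight_bound : exists2 K : R, 0 <= K & forall n (m : 'I_p) lb w, cabs (fock_weight n m lb w) <= K.
Proof.
pose K0:= \sum_(m < p) mxn ((Zp m)^t* *m S) * mxn (Zp m *m S).
have K00 : 0 <= K0 by apply:sumr_ge0=> m _;rewrite mulr_ge0 ?mxn_ge0.
exists K0=> // n m lb w;rewrite /fock_weight !cabsM cabs_conj cabsX cabs_rootX expr1n mul1r.
apply:(@le_trans _ _ (mxn ((Zp m)^t* *m S) * mxn (Zp m *m S))).
 by apply:ler_pM;rewrite ?cabs_ge0 ?cabs_le_mxn.
by rewrite /K0 (bigD1 m) //= lerDl;apply:sumr_ge0=> ? _;rewrite mulr_ge0 ?mxn_ge0.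
Qed.

Lemma fock_vector_close : exists2 K : R, 0 <= K & forall A B n (c : C) s lb, 0 <= s ->
 (forall m, hsq (coherent (rot m A) - c *: coherent (rot m B)) <= s) ->
 \sum_w hsq (fock_vector A n lb w - c *: fock_vector B n lb w) <= K * s.
Proof.
have p0 : (0 < p)%N by case:per.
have [K K0 hK] := fock_weight_bound.
exists (#|{: L}|%:R * (p%:R * K) ^+ 2)=> [|A B n c s lb s0 hs];first by rewrite mulr_ge0 ?sqr_ge0.
rewrite -mulrA mulr_natl -sumr_const;apply:ler_sum=> w _.
rewrite -(sqr_sqrtr s0) -exprMn -hnorm_leP;last by rewrite !mulr_ge0.
have -> : fock_vector A n lb w - c *: fock_vector B n lb w = (Num.sqrt p%:R)^-1%:C *:
  \sum_(m < p) fock_weight n m lb w *: (coherent (rot m A) - c *: coherent (rot m B)).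
 rewrite /fock_vector scalerA mulrC -scalerA -scalerBr;congr (_ *: _).
 rewrite scaler_sumr -sumrB;apply:eq_bigr=> m _.
 by rewrite scalerBr !scalerA (mulrC c).
rewrite hnormZ cabs_real.
apply:(@le_trans _ _ (1 * (\sum_(m < p) K * Num.sqrt s)));last first.
 by rewrite mul1r sumr_const card_ord -mulrA mulr_natl.
apply:ler_pM;rewrite ?hnorm_ge0 //.
 rewrite ger0_norm // invf_le1 ?sqrtr_gt0 ?ltr0n //.
 by rewrite -[leLHS]sqrtr1 ler_sqrt // ler1n.
apply:le_trans (hnorm_sum _ _ _) _;apply:ler_sum=> m _;rewrite hnormZ.
by apply:ler_pM;rewrite ?cabs_ge0 ?hnorm_ge0 // hnorm_sqrt.
Qed.

(** Summed over lb, the weight of j contains Tr (rho Z^j), which vanishes for 0 < j < p; only the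
    unrotated inner product survives. *)
Lemma gram_limit_trace n A B : tangent_id V A -> tangent_id V B ->
 \sum_lb gram_limit p V Z S n A B lb lb = hdot (coherent A) (coherent B).
Proof.
move=> tA tB;have p0 : (0 < p)%N by case:per.
rewrite exchange_big (bigD1 (Ordinal p0)) //= [X in _ + X]big1 ?addr0=> [|j j0].
 rewrite -mulr_sumr brot0 -hdot_coherent // (_ : \sum_i _ = 1) ?mulr1 //.
 rewrite /gram_weight expr0 expr1n /Zp mulmx1 adj1 mulmx1 SS.
 rewrite -(pair_bigA _ (fun l b=> 1 * rho l l * rho b b)) /=.
 under eq_bigr=> l _ do rewrite -mulr_sumr mul1r.
 rewrite -mulr_suml -/(mxtrace _).
 by have [_ [_ -> _] _ _] := irreducible_rho irr;rewrite mulr1.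
rewrite -mulr_sumr /gram_weight.
rewrite -(pair_bigA _ (fun l b=> (g ^+ j) ^+ n * (S *m Zp j *m S) l l * (rho *m (Zp j)^t*) b b)) /=.
under eq_bigr=> l _ do rewrite -mulr_sumr.
rewrite -mulr_suml -mulr_sumr -/(mxtrace _).
rewrite mxtrace_mulC mulmxA SS (tr_rho_Zp irr per cyc) ?mulr0 ?mul0r ?mulr0 //.
by rewrite ltn_ord andbT lt0n;apply:contra j0=> /eqP h;apply/eqP/val_inj.
Qed.
End FockModel.

(** * Gauge rotations of isometries *)

Section WordGauge.
Variables (R : realType) (d k : nat).
Local Notation C := R[i].
Local Notation isom := 'M[C]_(d * k, d).

Lemma word_gauge (c : C) (U : 'M[C]_d) (V : isom) (s : seq 'I_k) : U^t* *m U = 1%:M -> U *m U^t* = 1%:M ->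
 word (c *: ((U^t* *t (1%:M : 'M[C]_k)) *m V *m U)) s = c ^+ size s *: (U^t* *m word V s *m U).
Proof.
move=> u1 u2;elim/last_ind: s=> [|s i IH];first by rewrite /word mulmx1 u1 scale1r.
rewrite /word !foldl_rcons -!/(word _ _) IH size_rcons exprS krausZ kraus_mul kraus_tens.
rewrite -scalemxAl -scalemxAr scalerA;congr (_ *: _).
by rewrite !mulmxA -[_ *m U *m _]mulmxA u2 mulmx1.
Qed.
End WordGauge.

Section Rotations.
Variables (R : realType) (d k p : nat).
Local Notation C := R[i].
Local Notation isom := 'M[C]_(d * k, d).
Variables (V : isom) (P : 'I_p -> 'M[C]_d) (Z : 'M[C]_d).
Hypotheses (irr : irreducible V) (per : has_period V p) (cyc : cyclic_unitary V P Z).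
Local Notation rho := (rho_ss V).
Local Notation g := (@Defs.root_of_unity R p).
Local Notation Zp := (Zp Z).
Local Notation ip := (inner_id V).
Local Notation rot m A := (iter m (rotation p Z) A).
Implicit Types (A B : isom).

(** The rotation is a gauge transformation by Z^m with a phase; the phase cancels and Z commutes
    with the initial state rho. *)
Lemma out_op_rot m VA n z : out_op (rot m VA) rho z = out_op VA rho z :> out_space R k n.
Proof.
have [u1 u2] := Zp_unitary cyc m;apply/ffunP=> s;rewrite [LHS]ffunE [RHS]ffunE.
apply:eq_bigr=> t _;apply:(congr1 (fun x=> x * z t)).
rewrite rotE !word_gauge // !size_tuple adjZ -!scalemxAl -scalemxAr scalerA !mxtraceZ.
rewrite -[(g ^+ m) ^+ n]exprM (mulrC (g ^+ _)) rootX_conj mul1r !trmxC_mul trmxCK.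
rewrite !mulmxA -[_ *m Zp m *m rho]mulmxA -(rho_Zp irr cyc) !mulmxA -[_ *m Zp m *m (Zp m)^t*]mulmxA u2 mulmx1.
by rewrite mxtrace_mulC !mulmxA u2 mul1mx.
Qed.

Lemma rot_V m : rot m V = V.
Proof.
have [u1 u2] := Zp_unitary cyc m.
rewrite rotE -mulmxA -[in RHS](mul1mx V) -(tens11 R d k) -u1 tens1M -mulmxA (Zp_intertwine irr cyc).
by rewrite -scalemxAr.
Qed.

Lemma rot_lin m (a : C) A B : rot m (a *: A + B) = a *: rot m A + rot m B.
Proof. by rewrite !rotE mulmxDr mulmxDl scalerDr -!scalemxAr -!scalemxAl !scalerA mulrC. Qed.

Lemma rot_isometry m (VA : isom) : VA^t* *m VA = 1%:M -> (rot m VA)^t* *m rot m VA = 1%:M.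
Proof.
move=> iVA;have [u1 u2] := Zp_unitary cyc m.
rewrite rotE adjZ -scalemxAr -scalemxAl scalerA mulrC rootX_conj scale1r.
rewrite !trmxC_mul tens1_adj trmxCK !mulmxA -[_ *m (Zp m *t _) *m _]mulmxA -tens1M u2 tens11 mulmx1.
by rewrite -[_ *m VA^t* *m VA]mulmxA iVA mulmx1.
Qed.

(** The rotation is linear and fixes V, so it acts on the expansion of VA term by term. *)
Lemma near_rot : exists2 c : R, 1 <= c & forall kap e (m : 'I_p) A VA, 0 <= kap -> 0 <= e ->
 near V kap e A VA -> near V kap (c * e) (rot m A) (rot m VA).
Proof.
pose b m:= mxn ((Zp m)^t* *t (1%:M : 'M[C]_k)) * mxn (Zp m).
have b0 m : 0 <= b m by rewrite mulr_ge0 ?mxn_ge0.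
pose c : R:= 1 + \sum_(m < p) b m;have s0 : 0 <= \sum_(m < p) b m by apply:sumr_ge0.
have c1 : 1 <= c by rewrite lerDl.
have rotn (m : 'I_p) A : mxn (rot m A) <= c * mxn A.
 rewrite rotE mxnZ cabs_rootX mul1r;apply:le_trans (mxnM _ _) _.
 apply:(@le_trans _ _ (b m * mxn A)).
  by rewrite /b mulrAC ler_wpM2r ?mxn_ge0 // mxnM.
 rewrite ler_wpM2r ?mxn_ge0 // /c (bigD1 m) //= addrCA lerDl addr_ge0 //.
 by apply:sumr_ge0.
exists c=> // kap e m A VA kap0 e0 [iVA tA lA dA];split.
- exact:rot_isometry.
- exact:(tangent_id_rot irr cyc).
- by apply:le_trans (rotn _ _) _;rewrite ler_wpM2l // (le_trans _ c1).
- have -> : rot m VA - V - 'i%C *: rot m A = rot m (VA - V - 'i%C *: A).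
  have -> : VA - V - 'i%C *: A = (- 'i%C) *: A + ((-1) *: V + VA).
   by rewrite scaleNr scaleN1r addrC [- V + VA]addrC.
  by rewrite !rot_lin rot_V scaleNr scaleN1r addrC [- V + _]addrC.
 apply:le_trans (rotn _ _) _;apply:(@le_trans _ _ (c * (kap * e ^+ 2))).
  by rewrite ler_wpM2l // (le_trans _ c1).
 rewrite exprMn mulrCA ler_wpM2l // ler_wpM2r ?sqr_ge0 // expr2 ler_peMl // (le_trans _ c1) //.
Qed.

(** Since rho is positive definite, the norm of the model controls every entry of A. *)
Lemma norm_lower : exists2 c : R, 0 < c & forall A, mxn A <= c * Num.sqrt (Re (ip A A)).
Proof.
have [_ [prho _ _] drho _] := irreducible_rho irr.
have [c c0 hc] := posdef_lower prho drho.
exists ((d * k * d)%:R * Num.sqrt c^-1 + 1)=> [|A].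
 by [].
have entry s j : cabs (A s j) <= Num.sqrt c^-1 * Num.sqrt (Re (ip A A)).
 rewrite -sqrtrM ?invr_ge0 ?(ltW c0) // -(ger0_norm (cabs_ge0 (A s j))) -sqrtr_sqr.
 rewrite ler_wsqrtr // mulrC ler_pdivlMr //.
 apply:(@le_trans _ _ (c * colsq ((row s A)^t*))).
  rewrite mulrC ler_wpM2l ?(ltW c0) // /colsq (bigD1 j) //= !mxE cabs_conj lerDl.
  by apply:sumr_ge0=> ? _;rewrite sqr_ge0.
 apply:le_trans (hc _) _;rewrite inner_rows Re_sum (bigD1 s) //= lerDl.
 by apply:sumr_ge0=> i _;have:= prho ((row i A)^t*);rewrite ge0E=> /andP[].
apply:(@le_trans _ _ ((d * k * d)%:R * (Num.sqrt c^-1 * Num.sqrt (Re (ip A A))))).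
 apply:(@le_trans _ _ (\sum_(s < d * k) \sum_(j < d) (Num.sqrt c^-1 * Num.sqrt (Re (ip A A))))).
  by apply:ler_sum=> s _;apply:ler_sum.
 by rewrite !sumr_const !card_ord -mulrnA mulr_natl mulnC.
by rewrite mulrDl mulrA lerDl mul1r sqrtr_ge0.
Qed.
End Rotations.

(** * Grid in the parameter ball and the number of coordinates *)

Section Net.
Variables (R : realType) (d k : nat).
Local Notation C := R[i].
Local Notation isom := 'M[C]_(d * k, d).
Variables (V : isom).
Hypothesis irr : irreducible V.
Variables (D : nat) (e : 'I_D -> isom).
Hypothesis be : basis_id V e.
Local Notation ip := (inner_id V).
Implicit Types (A B : isom).

Lemma tangent_idB A B : tangent_id V A -> tangent_id V B -> tangent_id V (A - B).
Proof. by rewrite /tangent_id mulmxBr=> -> ->;rewrite subrr. Qed.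

Lemma inner_coords A : tangent_id V A -> Re (ip A A) = \sum_i (Re (ip (e i) A) ^+ 2 + Im (ip (e i) A) ^+ 2).
Proof.
move=> tA;rewrite -(hdot_coords irr be A tA) -[LHS]/(Re (\sum_i _)) Re_sum;apply:eq_bigr=> i _.
by rewrite !ffunE Defs.ReM Reconj Imconj;ring.
Qed.

(** The real and imaginary coordinates, shifted by r, lie in [0, 2 r] and are cut into cells of side
    h; points of one cell differ by at most h in each of the 2 D coordinates. *)
Lemma ball_net (r h : R) : 0 < r -> 0 < h ->
 exists net : 'I_((Num.truncn (2 * r / h)).+1 ^ (2 * D)) -> isom, (forall i, ball_id V r (net i)) /\
  forall A, ball_id V r A -> exists i, Re (ip (A - net i) (A - net i)) <= (2 * D)%:R * h ^+ 2.
Proof.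
move=> r0 h0;set q:= Num.truncn _.
pose comp (A : isom) (x : 'I_D * bool) : R:= if x.2 then Re (ip (e x.1) A) else Im (ip (e x.1) A).
pose cell A : {ffun 'I_D * bool -> 'I_q.+1} := [ffun x=> inord (Num.truncn ((comp A x + r) / h))].
have cM : #|{ffun 'I_D * bool -> 'I_q.+1}| = (q.+1 ^ (2 * D))%N.
 by rewrite card_ffun card_prod !card_ord card_bool mulnC.
(* Representatives of nonempty cells are taken in the ball and the default 0 lies in it too, so the
   grid stays inside the model. *)
pose pt f:= xget 0 [set A | ball_id V r A /\ cell A = f].
have b0 : ball_id V r 0.
 by split;rewrite /tangent_id ?mulmx0 //= /inner_id mulmx0 mxtrace0 sqrtr0.
have ptb f : ball_id V r (pt f).
 rewrite /pt;case:(pselect (exists A, ball_id V r A /\ cell A = f))=> [[A hA]|nA].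
  by have [] := xgetPex 0 (ex_intro _ A hA : exists A, [set A | ball_id V r A /\ cell A = f] A).
 by rewrite xgetPN // => A hA;apply:nA;exists A.
exists (fun i=> pt (enum_val (cast_ord (esym cM) i)));split=> // A bA.
exists (cast_ord cM (enum_rank (cell A)));rewrite cast_ordK enum_rankK.
have bB:= ptb (cell A);set B:= pt (cell A) in bB *.
have cB : cell B = cell A.
 have hA : [set A' | ball_id V r A' /\ cell A' = cell A] A by [].
 by have [] := xgetPex 0 (ex_intro _ A hA : exists A', [set A' | ball_id V r A' /\ cell A' = cell A] A').
have compb X x : ball_id V r X -> `|comp X x| < r.
 case=> tX;apply:le_lt_trans;rewrite -sqrtr_sqr ler_wsqrtr // inner_coords // (bigD1 x.1) //= /comp.
 have h' : 0 <= \sum_(i < D | i != x.1) (Re (ip (e i) X) ^+ 2 + Im (ip (e i) X) ^+ 2).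
  by apply:sumr_ge0=> ? _;rewrite addr_ge0 ?sqr_ge0.
 by case:x.2;rewrite -?addrA ?lerDl ?(addrCA (Re _ ^+ 2)) ?lerDl ?addr_ge0 ?sqr_ge0.
have ind X x : ball_id V r X -> (cell X x : nat) = Num.truncn ((comp X x + r) / h) /\ 0 <= (comp X x + r) / h.
 move=> bX;have:= compb X x bX;rewrite ltr_norml=> /andP[l1 l2].
 have p0 : 0 <= (comp X x + r) / h by rewrite divr_ge0 //;lra.
 split=> //;rewrite ffunE inordK // ltnS truncn_ge_nat;last first.
  by rewrite divr_ge0 ?(ltW h0) // mulr_ge0 // ltW.
 apply:(@le_trans _ _ ((comp X x + r) / h));first by rewrite truncn_le.
 by rewrite ler_pM2r ?invr_gt0;lra.
have close x : comp (A - B) x ^+ 2 <= h ^+ 2.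
 have -> : comp (A - B) x = comp A x - comp B x.
  by rewrite /comp innerDr innerNr;case:x.2;rewrite ?ReB ?ImB.
 have [iA pA] := ind A x bA;have [iB pB] := ind B x bB.
 have:= truncn_itv pA;have:= truncn_itv pB;rewrite -iA -iB cB.
 move:(cell A x : nat)=> m;rewrite -!natr1=> /andP[u1 u2] /andP[v1 v2].
 move:u1 u2 v1 v2;rewrite !ler_pdivlMr // !ltr_pdivrMr //.
 move:(comp A x) (comp B x) (m%:R : R)=> a b c u1 u2 v1 v2.
 rewrite -[leLHS]real_normK ?num_real // lerXn2r ?nnegrE ?(ltW h0) // ler_norml;apply/andP;split;lra.
rewrite inner_coords;last by apply:tangent_idB;[case:bA | case:bB].
apply:(@le_trans _ _ (\sum_(i < D) (h ^+ 2 + h ^+ 2))).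
 by apply:ler_sum=> i _;apply:lerD;[exact:(close (i, true)) | exact:(close (i, false))].
by rewrite sumr_const card_ord -mulr2n -mulrnA mulr_natl.
Qed.

(* the e i are linearly independent and orthogonal to the d^2-dimensional range of X |-> V X *)
Lemma basis_dim : (D <= d ^ 2 * (k - 1))%N.
Proof.
have [iV _ _ _] := irreducible_rho irr;have [te oe _] := be.
pose E : 'M[C]_(D, (d * k) * d) := \matrix_i mxvec (e i).
pose f : 'M[C]_((d * k) * d, d * d) := lin_mx (mulmx (V^t*)).
have Ef : E *m f = 0.
 apply/row_matrixP=> i;rewrite row_mul rowK row0 /f mul_vec_lin /= (tangent_id0 irr) //.
 by rewrite linear0.
have rf : \rank f = (d * d)%N.
 apply/eqP/row_fullP;exists (lin_mx (mulmx V));apply/row_matrixP=> i.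
 rewrite row_mul rowE -(vec_mxK (delta_mx 0 i)) mul_vec_lin mul_vec_lin /= mulmxA iV mul1mx.
 by rewrite rowE mulmx1 vec_mxK.
have rE : \rank E = D.
 apply/eqP/row_freeP.
 exists (\matrix_(s, j) ip (e j) (vec_mx (delta_mx 0 s)));apply/matrixP=> i j.
 rewrite mxE [RHS]mxE eq_sym -oe.
 have -> : e i = \sum_s E i s *: vec_mx (delta_mx 0 s).
  have -> : \sum_s E i s *: vec_mx (delta_mx 0 s) = vec_mx (row i E).
   rewrite [X in vec_mx X]row_sum_delta linear_sum;apply:eq_bigr=> s _.
   by rewrite linearZ;congr (_ *: _);rewrite [RHS]mxE.
  by rewrite rowK mxvecK.
 rewrite /inner_id mulmx_sumr raddf_sum;apply:eq_bigr=> s _.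
 by rewrite -/(ip (e j) _) [X in _ * X]mxE -innerZr.
have:= mulmx0_rank_max Ef;rewrite rf rE.
by case:k=> [|k'];nia.
Qed.
End Net.

(** * Rates *)

Section Bounds.
Variable R : realType.

(** The threshold tau is chosen before the grid size M, so that the mesh can be fixed from it and n
    taken large afterwards. *)
Lemma transfer_small (w j : nat) (eps : R) : 0 < eps -> exists2 tau : R, 0 < tau &
 forall ep t epsE epsF M, 0 < ep -> 0 <= t -> t <= tau -> ep * (M * j).+1%:R <= tau -> epsE <= tau -> epsF <= tau ->
 2 * (2 * Num.sqrt t + Num.sqrt (ep * (M * j).+1%:R)) * w%:R * j%:R
  + j%:R * (ep + 2 * (2 * Num.sqrt t + Num.sqrt (ep * (M * j).+1%:R)) * w%:R)
  + (1 + 2 * w%:R) * epsE + epsF <= eps.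
Proof.
(* c is the bound per unit s once both square roots and all error terms are at most s; s <= 1 makes
   tau = s^2 at most s. *)
move=> eps0;pose c : R:= 6 * w%:R * j%:R + j%:R * (1 + 6 * w%:R) + (1 + 2 * w%:R) + 1.
have w0 : 0 <= w%:R :> R by [];have j0 : 0 <= j%:R :> R by [].
have c0 : 0 < c by rewrite /c ltr_wpDl // !addr_ge0.
pose s:= Num.min 1 (eps / c).
have s0 : 0 < s by rewrite lt_min ltr01 divr_gt0.
have s1 : s <= 1 by rewrite ge_min lexx.
have sc : s * c <= eps by rewrite -ler_pdivlMr // ge_min lexx orbT.
exists (s ^+ 2)=> [|ep t epsE epsF M ep0 t0 ts es h1 h2];first by rewrite exprn_gt0.
have ss : s ^+ 2 <= s by rewrite expr2 ler_piMr // ltW.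
have q1 : Num.sqrt t <= s by rewrite -(ger0_norm (ltW s0)) -sqrtr_sqr ler_wsqrtr.
have q2 : Num.sqrt (ep * (M * j).+1%:R) <= s by rewrite -(ger0_norm (ltW s0)) -sqrtr_sqr ler_wsqrtr.
have q3 : ep <= s.
 by apply:le_trans ss;apply:le_trans es;rewrite ler_peMr ?(ltW ep0) // ler1n.
have q4 : 2 * Num.sqrt t + Num.sqrt (ep * (M * j).+1%:R) <= 3 * s by move:q1 q2;lra.
have:= sqrtr_ge0 t;have:= sqrtr_ge0 (ep * (M * j).+1%:R)=> q5 q6.
have q7 : 0 <= 2 * Num.sqrt t + Num.sqrt (ep * (M * j).+1%:R) by [].
apply:le_trans sc.
move:(2 * Num.sqrt t + _) q4 q7=> eta q4 q7.
have -> : s * c = 2 * (3 * s) * w%:R * j%:R + j%:R * (s + 2 * (3 * s) * w%:R) + (1 + 2 * w%:R) * s + s.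
 by rewrite /c;ring.
have h1' := le_trans h1 ss;have h2' := le_trans h2 ss.
apply:lerD=> //;apply:lerD;last by rewrite ler_wpM2l // addr_ge0.
apply:lerD;first by rewrite !ler_wpM2r // ler_wpM2l.
by rewrite ler_wpM2l // lerD // ler_wpM2r // ler_wpM2l.
Qed.

Lemma powR_small (kappa eps : R) : 0 < kappa -> 0 < eps ->
 exists N, forall n, (N <= n)%N -> n%:R `^ (- kappa) <= eps.
Proof.
move=> k0 e0;exists (Num.truncn ((eps^-1) `^ kappa^-1)).+1=> n hn.
have h : (eps^-1) `^ kappa^-1 <= n%:R.
 by apply:le_trans (ltW (truncnS_gt _)) _;rewrite ler_nat.
have n0 : 0 < n%:R :> R by rewrite ltr0n (leq_trans _ hn).
rewrite powRN -(invrK eps) lef_pV2 ?posrE ?invr_gt0 ?powR_gt0 //.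
have:= ge0_ler_powR (ltW k0) _ _ h;rewrite !nnegrE powR_ge0 ler0n=> /(_ isT isT).
by rewrite -powRrM mulVf ?lt0r_neq0 // powRr1 // invr_ge0 ltW.
Qed.

(* (2 C n^delta / h)^D' grid points against the Gram error n^(3 delta - 1/2) *)
Lemma rate_small (delta : R) (D' : nat) (eps : R) : 0 < delta -> delta * (D' + 3)%:R < 2^-1 -> 0 < eps ->
 exists N, forall n, (N <= n)%N -> (n%:R `^ delta) ^+ (D' + 3) * (Num.sqrt n%:R)^-1 <= eps.
Proof.
move=> d0 dD e0;have k0 : 0 < 2^-1 - delta * (D' + 3)%:R by rewrite subr_gt0.
have [N hN] := powR_small k0 e0;exists (N + 1)%N=> n nN.
have n0 : 0 < n%:R :> R by rewrite ltr0n;lia.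
apply:le_trans (hN n _);last by lia.
rewrite -powR_mulrn // -powRrM -powR12_sqrt // -powRN -powRD ?opprB //.
by rewrite (lt0r_neq0 n0) implybT.
Qed.
End Bounds.

Section TraceNorm.
Variable R : realType.

Lemma trace_norm_ge0 (H : hilbert R) (X : H -> H) : (0 <= trace_norm X)%E.
Proof.
rewrite /trace_norm;case:xgetP=> [_ _ [t [Q [[[_ Q0] _] tr]] <-]|//].
have:= has_trace_ge Q0 tr (s:= [::]);rewrite big_nil lee_fin ge0E /= => h.
by have /andP[] : (0 == 0 :> R) && (0 <= t) by apply:h;split.
Qed.

Lemma deficiency_ge0 (H1 H2 : hilbert R) (Theta : Type) (S : set Theta) (Q : Theta -> H1 -> H1) (G : Theta -> H2 -> H2) :
 S !=set0 -> (0 <= deficiency S Q G)%E.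
Proof.
case=> th Sth;apply:le_ereal_inf_tmp=> _ [T _ <-].
by apply:le_trans (trace_norm_ge0 (fun x=> T (Q th) x - G th x)) (ereal_sup_ubound _);exists th.
Qed.
End TraceNorm.
Lemma ler_shift (R : realType) (a b c x : R) : - x <= a - b -> a <= c -> b <= c + x.
Proof. lra. Qed.

(** * Both deficiencies at a fixed n *)

Section Deficiencies.
Variables (R : realType) (d k p : nat).
Local Notation C := R[i].
Local Notation isom := 'M[C]_(d * k, d).
Variables (V : isom) (P : 'I_p -> 'M[C]_d) (Z : 'M[C]_d).
Hypotheses (irr : irreducible V) (per : has_period V p) (cyc : cyclic_unitary V P Z).
Local Notation rho := (rho_ss V).
Local Notation g := (@Defs.root_of_unity R p).
Local Notation Zp := (Zp Z).
Variable S : 'M[C]_d.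
Hypotheses (SS : S *m S = rho) (hS : S^t* = S).
Variables (D : nat) (e : 'I_D -> isom).
Hypothesis be : basis_id V e.
Local Notation L := ('I_d * 'I_d)%type.
Local Notation ip := (inner_id V).
Local Notation rot m A := (iter m (rotation p Z) A).
Implicit Types (A B : isom).

Variables (r : R) (n : nat) (W : isom -> isom) (ep st s Kf : R).
Variables (M : nat) (net : 'I_M -> isom).
Hypothesis r0 : 0 < r.
Hypothesis iW : forall A, ball_id V r A -> (W A)^t* *m W A = 1%:M.
Hypothesis stW : forall A, ball_id V r A -> mxn (rho_ss (W A) - rho) <= st.
Hypothesis netB : forall i, ball_id V r (net i).
Hypothesis netC : forall A, ball_id V r A -> exists i, Re (ip (A - net i) (A - net i)) <= s.
Hypothesis ep0 : 0 < ep.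
Hypothesis gramW : forall A B (m m' : 'I_p) lb lb', ball_id V r A -> ball_id V r B ->
 cabs (hdot (out_vector V S (rot m (W A)) n lb) (out_vector V S (rot m' (W B)) n lb')
    - gram_limit p V Z S n (rot m A) (rot m' B) lb lb') <= ep.
Hypotheses (Kf0 : 0 <= Kf) (hKf : forall A B n (c : C) s lb, 0 <= s ->
 (forall m, hsq (coherent V e (rot m A) - c *: coherent V e (rot m B)) <= s) ->
 \sum_w hsq (fock_vector p V Z S e A n lb w - c *: fock_vector p V Z S e B n lb w) <= Kf * s).

Lemma period_pos : (0 < p)%N. Proof. by case: per. Qed.

Lemma dim_pos : (0 < d * k)%N.
Proof.
have [iV [_ tr _] _ _] := irreducible_rho irr;rewrite lt0n;apply/negP=> /eqP h0.
have : \tr (rho *m (V^t* *m V)) = 0.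
 rewrite (_ : V^t* *m V = 0) ?mulmx0 ?mxtrace0 //;apply/matrixP=> i j;rewrite !mxE.
 apply:big1=> l _;exfalso;have hl : (nat_of_ord l < d * k)%N:= ltn_ord l.
 by move:(nat_of_ord l) hl=> x;rewrite h0.
by rewrite iV mulmx1 tr=> /eqP;rewrite oner_eq0.
Qed.

Lemma ball0 : ball_id V r 0.
Proof. by split;rewrite /tangent_id ?mulmx0 //= /inner_id mulmx0 mxtrace0 sqrtr0. Qed.

Lemma unit_out : exists f : out_space R k n, hdot f f = 1.
Proof.
have k0 : (0 < k)%N by have:= dim_pos;rewrite muln_gt0=> /andP[].
pose i0 : 'I_k:= Ordinal k0;pose s0:= [tuple of nseq n i0].
exists [ffun t : n.-tuple 'I_k=> (t == s0)%:R : C^o].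
rewrite -[LHS]/(\sum_t _) (bigD1 s0) //= big1=> [|t ts];first by rewrite !ffunE eqxx conjC1 mulr1 addr0.
by rewrite !ffunE (negPf ts) mulr0.
Qed.

Lemma unit_fock : hdot (coherent V e 0) (coherent V e 0) = 1.
Proof. by rewrite hdotxx (hsq_coherent irr be);case:ball0. Qed.

(** The source vectors are the output vectors, their images the Fock vectors with environment index
    w. Closeness to the grid is known on the Fock side; [gram_distance] carries it to the output
    side at the cost 4 ep. *)
Lemma out_deficiency : (deficiency (ball_id V r) (fun A => rho_out (W A) n) (fun A => rho_gm V p Z e A) <=
 (2 * (2 * Num.sqrt (Kf * s + 4 * ep) + Num.sqrt (ep * (M * #|{: L}|).+1%:R)) * #|{: L}|%:R * #|{: L}|%:R
  + #|{: L}|%:R * (ep + 2 * (2 * Num.sqrt (Kf * s + 4 * ep) + Num.sqrt (ep * (M * #|{: L}|).+1%:R)) * #|{: L}|%:R)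
  + (1 + 2 * #|{: L}|%:R) * (d%:R * st) + 0)%:E)%E.
Proof.
have tB A : ball_id V r A -> tangent_id V A by case.
pose z0 : 'I_p:= Ordinal period_pos.
have gr A B lb lb' : ball_id V r A -> ball_id V r B ->
  cabs (\sum_w hdot (fock_vector p V Z S e A n lb w) (fock_vector p V Z S e B n lb' w)
   - hdot (out_vector V S (W A) n lb) (out_vector V S (W B) n lb')) <= ep.
 move=> bA bB;rewrite (fock_gram irr per cyc SS hS be n lb lb' (tB _ bA) (tB _ bB)) cabsB.
 exact:(gramW z0 z0 lb lb' bA bB).
apply:(@deficiency_transfer R _ _ isom (ball_id V r) _ _ (L * 'I_d)%type 'I_0 M
 (fun A lb=> out_vector V S (W A) n lb) (fun A lb w=> fock_vector p V Z S e A n lb w) net _ _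
 (fun A q=> (rho_ss (W A) - rho) q.1.1 q.2 *: word_vector (W A) 1%:M n q.1)
 (fun A q=> word_vector (W A) 1%:M n (q.2, q.1.2)) (fun _ _=> 0) (fun _ _=> 0) ep)=> //.
- by move=> A lb bA;apply:(out_vector_le1 irr SS hS);exact:iW.
- by move=> A lb w bA;apply:(fock_vector_le1 irr per cyc SS hS be);exact:tB.
- move=> A bA;have [i hi] := netC bA;exists i.
 have [c c1 hc] := coherent_close irr cyc be (tB _ bA) (tB _ (netB i)).
 have s0 : 0 <= s by apply:le_trans hi;have:= inner_ge0 irr (A - net i);rewrite ge0E=> /andP[].
 exists c;split=> // lb.
 have hf:= @hKf A (net i) n c s lb s0 (fun m=> le_trans (hc m) hi).
 have g1:= gr _ _ lb lb bA bA;have g2:= gr _ _ lb lb (netB i) (netB i);have g3:= gr _ _ lb lb bA (netB i).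
 have:= gram_distance c1 g1 g2 g3;rewrite ler_norml=> /andP[h1 h2].
 split;last by apply:le_trans hf _;rewrite lerDl mulr_ge0 // ltW.
 exact:ler_shift h1 hf.
- by move=> A z bA;rewrite (rho_out_split SS hS).
- move=> A bA;apply:le_trans (out_diff_small V n (iW bA)) _.
 by rewrite ler_wpM2l ?stW.
- by move=> A z bA;rewrite (fock_sum irr cyc SS hS) /rankop big_ord0 addr0.
- by move=> A bA;rewrite big_ord0.
- exact:unit_fock.
Qed.

(** The p coherent components are the source vectors, and component m goes to the output vectors of
    the m-th rotated isometry, with lb as environment index. [gram_limit_trace] matches the Gram
    matrices for all pairs of components; by [out_op_rot] the images average to the output of the
    original isometry. Gram entries are now sums over lb, whence the factor #|L| in front of ep. *)
Lemma gm_deficiency : (deficiency (ball_id V r) (fun A => rho_gm V p Z e A) (fun A => rho_out (W A) n) <=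
 (2 * (2 * Num.sqrt (s + 4 * (#|{: L}|%:R * ep)) + Num.sqrt (#|{: L}|%:R * ep * (M * #|'I_p|).+1%:R)) * #|{: L}|%:R * #|'I_p|%:R
  + #|'I_p|%:R * (#|{: L}|%:R * ep + 2 * (2 * Num.sqrt (s + 4 * (#|{: L}|%:R * ep))
    + Num.sqrt (#|{: L}|%:R * ep * (M * #|'I_p|).+1%:R)) * #|{: L}|%:R)
  + (1 + 2 * #|{: L}|%:R) * 0 + d%:R * st)%:E)%E.
Proof.
have tB A : ball_id V r A -> tangent_id V A by case.
have p0:= period_pos;pose c0 : C:= (Num.sqrt p%:R)^-1%:C.
have l0 : (0 < #|{: L}|)%N.
 by rewrite card_prod card_ord;have:= dim_pos;rewrite !muln_gt0=> /andP[->].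
have c0le : cabs c0 <= 1.
 rewrite cabs_real ger0_norm // invf_le1 ?sqrtr_gt0 ?ltr0n //.
 by rewrite -[leLHS]sqrtr1 ler_sqrt // ler1n.
have rot_iso A (m : 'I_p) : ball_id V r A -> (rot m (W A))^t* *m rot m (W A) = 1%:M.
 by move=> /iW;exact:(rot_isometry cyc).
have tR A m : ball_id V r A -> tangent_id V (rot m A) by move=> /tB;exact:(tangent_id_rot irr cyc).
have gr A B (m m' : 'I_p) : ball_id V r A -> ball_id V r B ->
  cabs (\sum_lb hdot (c0 *: out_vector V S (rot m (W A)) n lb) (c0 *: out_vector V S (rot m' (W B)) n lb)
   - hdot (c0 *: coherent V e (rot m A)) (c0 *: coherent V e (rot m' B))) <= #|{: L}|%:R * ep.
 move=> bA bB;rewrite [X in _ - X]hdotZl hdotZr -(gram_limit_trace irr per cyc SS be n (tR _ m bA) (tR _ m' bB)).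
 under eq_bigr=> lb _ do rewrite hdotZl hdotZr.
 rewrite !mulr_sumr -sumrB;apply:le_trans (cabs_sum _ _ _) _.
 rewrite mulr_natl -sumr_const;apply:ler_sum=> lb _.
 rewrite !mulrA -mulrBr !cabsM cabs_conj;apply:le_trans (gramW m m' lb lb bA bB).
 by rewrite ler_piMl ?cabs_ge0 // mulr_ile1 ?cabs_ge0.
have [f ff] := unit_out.
apply:(@deficiency_transfer R _ _ isom (ball_id V r) 'I_p _ 'I_0 (L * 'I_d)%type M
 (fun A m=> c0 *: coherent V e (rot m A)) (fun A m lb=> c0 *: out_vector V S (rot m (W A)) n lb) net _ _
 (fun _ _=> 0) (fun _ _=> 0)
 (fun A q=> (rho_ss (W A) - rho) q.1.1 q.2 *: word_vector (W A) 1%:M n q.1)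
 (fun A q=> word_vector (W A) 1%:M n (q.2, q.1.2)) (#|{: L}|%:R * ep) (s + 4 * (#|{: L}|%:R * ep)))=> //.
- by rewrite mulr_gt0 // ltr0n.
- move=> A m bA;rewrite hnormZ mulr_ile1 ?cabs_ge0 ?hnorm_ge0 //.
 by rewrite hnorm_leP // expr1n (hsq_coherent irr be (tR _ m bA)).
- move=> A m lb bA;rewrite hnormZ mulr_ile1 ?cabs_ge0 ?hnorm_ge0 //.
 by apply:(out_vector_le1 irr SS hS);exact:rot_iso.
- move=> A bA;have [i hi] := netC bA;exists i.
 have [c c1 hc] := coherent_close irr cyc be (tB _ bA) (tB _ (netB i)).
 exists c;split=> // m.
 have hf : hsq (c0 *: coherent V e (rot m A) - c *: (c0 *: coherent V e (rot m (net i)))) <= s.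
  have -> : c0 *: coherent V e (rot m A) - c *: (c0 *: coherent V e (rot m (net i))) =
    c0 *: (coherent V e (rot m A) - c *: coherent V e (rot m (net i))).
   by rewrite scalerBr !scalerA (mulrC c).
  rewrite hsqZ;apply:le_trans (hi);apply:le_trans (hc m).
  by rewrite ler_piMl ?hsq_ge0 // exprn_ile1 ?cabs_ge0.
 have g1:= gr _ _ m m bA bA;have g2:= gr _ _ m m (netB i) (netB i);have g3:= gr _ _ m m bA (netB i).
 have:= gram_distance c1 g1 g2 g3;rewrite ler_norml=> /andP[h1 h2].
 split;last by move:h2;rewrite lerBlDr addrC=> h2;apply:le_trans h2 _;rewrite lerD2r.
 by apply:le_trans hf _;rewrite lerDl !mulr_ge0 // ltW.
- move=> A z bA;rewrite [X in _ + X]/rankop big_ord0 addr0 /rankop /rho_gm scaler_sumr.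
 apply:eq_bigr=> m _;rewrite hdotZl scalerA mulrAC conj_invsqrt -scalerA //.
- by move=> A bA;rewrite big_ord0.
- move=> A z bA;rewrite (rho_out_split SS hS);congr (_ + _).
 rewrite (eq_bigr (fun m : 'I_p=> p%:R^-1 *: rankop (out_vector V S (W A) n) (out_vector V S (W A) n) z)).
  by rewrite sumr_const card_ord -scaler_nat scalerA divff ?scale1r // pnatr_eq0 -lt0n.
 move=> m _;rewrite (out_sum SS hS) -(out_op_rot irr cyc m) -(out_sum SS hS) /rankop scaler_sumr.
 apply:eq_bigr=> lb _;rewrite hdotZl scalerA mulrAC conj_invsqrt -scalerA //.
- move=> A bA;apply:le_trans (out_diff_small V n (iW bA)) _.
 by rewrite ler_wpM2l ?stW.
- exact:ff.
Qed.
End Deficiencies.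
(** The regularization parameter is the Gram error, of order n^(3 delta - 1/2), times the number of
    grid vectors, of order n^(delta D'); [rate_small] makes the product small. *)
Lemma rate_bounds (R : realType) (delta C h c k3 tau : R) (D' j : nat) :
 0 < delta -> delta * (D' + 3)%:R < 2^-1 -> 0 < C -> 0 < h -> 0 <= c -> 0 <= k3 -> 0 < tau ->
 exists N, forall n, (N <= n)%N -> let a := n%:R `^ delta in let b := (Num.sqrt n%:R)^-1 in
  [/\ (0 < n)%N, 1 <= a, [/\ 0 < b, b <= 1 & n%:R * b ^+ 2 = 1], c * (a * b) <= tau &
   k3 * (a ^+ 3 * b) * ((Num.truncn (2 * (C * a) / h)).+1 ^ D' * j).+1%:R <= tau].
Proof.
move=> d0 dD C0 h0 c0 k0 tau0.
(* As a >= 1, f a bounds the number of cells per coordinate. *)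
pose f:= 2 * C / h + 1;have f1 : 1 <= f by rewrite lerDr divr_ge0 ?mulr_ge0 // ltW.
pose Kc:= c + k3 * (f ^+ D' * j.+1%:R);have fj : 0 <= f ^+ D' * j.+1%:R by rewrite mulr_ge0 ?exprn_ge0 // (le_trans _ f1).
have Kc0 : 0 <= Kc by rewrite addr_ge0 // mulr_ge0.
have [|N hN] := @rate_small R delta D' (tau / (Kc + 1)) d0 dD;first by rewrite divr_gt0 // ltr_wpDl.
exists N.+1=> n nN;have n0 : (0 < n)%N by apply:leq_trans nN.
have nR : 1 <= n%:R :> R by rewrite ler1n.
have hv:= hN n (ltnW nN).
have a1 : 1 <= n%:R `^ delta.
 apply:(@le_trans _ _ (1 `^ delta));first by rewrite powR1.
 by rewrite ge0_ler_powR ?nnegrE ?(ltW d0).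
have b0 : 0 < (Num.sqrt (n%:R : R))^-1 by rewrite invr_gt0 sqrtr_gt0 ltr0n.
have b1 : (Num.sqrt (n%:R : R))^-1 <= 1 by rewrite invf_le1 ?sqrtr_gt0 ?ltr0n // -[leLHS]sqrtr1 ler_wsqrtr.
have nb : n%:R * (Num.sqrt (n%:R : R))^-1 ^+ 2 = 1.
 by rewrite exprVn sqr_sqrtr // mulfV // pnatr_eq0 -lt0n.
move:(n%:R `^ delta) (Num.sqrt n%:R)^-1 hv a1 b0 b1 nb=> a b hv a1 b0 b1 nb /=.
have a0 : 0 <= a by apply:le_trans a1.
pose v:= a ^+ (D' + 3) * b;have v0 : 0 <= v by rewrite mulr_ge0 ?exprn_ge0 // ltW.
have Kv : Kc * v <= tau.
 apply:(@le_trans _ _ ((Kc + 1) * v));first by rewrite ler_wpM2r // lerDl.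
 by rewrite mulrC -ler_pdivlMr // ltr_wpDl.
split=> //;apply:le_trans Kv.
 apply:(@le_trans _ _ (c * v));last by rewrite ler_wpM2r // lerDl mulr_ge0.
 rewrite ler_wpM2l // ler_wpM2r ?(ltW b0) // -[leLHS]expr1 ler_weXn2l // addn3 //.
apply:(@le_trans _ _ (k3 * (f ^+ D' * j.+1%:R) * v));last by rewrite ler_wpM2r // lerDr.
rewrite -(mulrA k3) -(mulrA k3) ler_wpM2l // /v exprD.
have tr : (Num.truncn (2 * (C * a) / h)).+1%:R <= f * a.
 have:= truncn_le (2 * (C * a) / h);rewrite divr_ge0 ?mulr_ge0 ?(ltW C0) ?(ltW h0) // => t.
 have -> : f * a = 2 * (C * a) / h + a by rewrite /f;ring.
 have -> : (Num.truncn (2 * (C * a) / h)).+1%:R = (Num.truncn (2 * (C * a) / h))%:R + 1 :> R by rewrite natr1.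
 exact:lerD t a1.
have fa : 1 <= f * a by rewrite mulr_ege1.
have Mj : ((Num.truncn (2 * (C * a) / h)).+1 ^ D' * j).+1%:R <= (f * a) ^+ D' * j.+1%:R.
 rewrite -natr1 natrM natrX -[j.+1%:R]natr1 mulrDr mulr1 lerD ?exprn_ege1 //.
 by rewrite ler_wpM2r // lerXn2r ?nnegrE // (le_trans _ fa).
apply:(@le_trans _ _ (a ^+ 3 * b * ((f * a) ^+ D' * j.+1%:R))).
 by rewrite ler_wpM2l // mulr_ge0 ?exprn_ge0 // ltW.
rewrite exprMn le_eqVlt;apply/orP;left;apply/eqP;ring.
Qed.

(** With a = n^delta and b = n^(-1/2) the scale e is c2 a b, and n b^2 = 1 turns the dominant term n
    e^3 into a multiple of a^3 b. *)
Lemma gram_error (R : realType) (Kg c2 a b nn : R) : 0 <= Kg -> 0 <= c2 -> 1 <= a -> 0 < b -> b <= 1 -> nn * b ^+ 2 = 1 ->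
 Kg * (nn^-1 + c2 * (a * b) + nn * (c2 * (a * b)) ^+ 3) <= (Kg * (1 + c2 + c2 ^+ 3) + 1) * (a ^+ 3 * b).
Proof.
move=> Kg0 c20 a1 b0 b1 nb.
have a0 : 0 <= a by apply:le_trans a1.
have a3 : 1 <= a ^+ 3 by rewrite exprn_ege1.
have nE : nn^-1 = b ^+ 2.
 by rewrite -[LHS]mul1r -nb mulrAC mulfV ?mul1r //;apply:contra_eq_neq nb=> ->;rewrite mul0r eq_sym oner_neq0.
have h1 : nn^-1 <= a ^+ 3 * b.
 rewrite nE expr2 ler_wpM2r ?(ltW b0) //;exact:le_trans b1 a3.
have h2 : c2 * (a * b) <= c2 * (a ^+ 3 * b).
 by rewrite ler_wpM2l // ler_wpM2r ?(ltW b0) // -[leLHS]expr1 ler_weXn2l.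
have h3 : nn * (c2 * (a * b)) ^+ 3 = c2 ^+ 3 * (a ^+ 3 * b).
 have -> : nn * (c2 * (a * b)) ^+ 3 = (nn * b ^+ 2) * (c2 ^+ 3 * (a ^+ 3 * b)) by ring.
 by rewrite nb mul1r.
rewrite mulrDl mul1r;apply:(@le_trans _ _ (Kg * (1 + c2 + c2 ^+ 3) * (a ^+ 3 * b)));last first.
 by rewrite lerDl mulr_ge0 ?exprn_ge0 // ltW.
rewrite -mulrA ler_wpM2l // !mulrDl mul1r h3 lerD // lerD //.
Qed.

(** * The limit *)

Section Limit.
Variables (R : realType) (d k p : nat).
Local Notation C := R[i].
Local Notation isom := 'M[C]_(d * k, d).
Variables (nu : isom -> isom -> isom -> R) (V : isom) (P : 'I_p -> 'M[C]_d) (Z : 'M[C]_d).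
Variables (D : nat) (e : 'I_D -> isom).
Hypotheses (rm : riemannian_metric nu) (irr : irreducible V) (per : has_period V p) (cyc : cyclic_unitary V P Z).
Hypothesis be : basis_id V e.
Local Notation L := ('I_d * 'I_d)%type.
Local Notation ip := (inner_id V).
Local Notation rot m A := (iter m (rotation p Z) A).
Variables (C0 delta : R).
Hypotheses (C00 : 0 < C0) (delta0 : 0 < delta) (deltaD : delta * (2 * D + 3)%:R < 2^-1).

(** The choices are nested as eps, the threshold tau, the mesh h, and only then n: with h
    independent of n the grid grows polynomially in n. *)
Lemma le_cam_small (eps : R) : 0 < eps -> exists N, forall n, (N <= n)%N ->
 (le_cam (ball_id V (C0 * n%:R `^ delta))
   (fun A => rho_out (exp_map nu V ((Num.sqrt n%:R)^-1%:C *: A)) n)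
   (fun A => rho_gm V p Z e A) <= eps%:E)%E.
Proof.
move=> eps0.
have [iV [prho trho _] drho _] := irreducible_rho irr;have hrho:= psd_hermitian prho.
have [S [SS hS _]] := psd_sqrt hrho prho.
have [c1 c10 hc1] := norm_lower irr.
have [r0 [K [r00 K0 hexp]]] := exp_map_near rm irr be.
have [rst [Kst [rst0 Kst0 hst]]] := stationary_near irr.
have [cr cr1 hrot] := near_rot irr cyc.
have [Kg Kg0 hgram] := out_gram irr per cyc hS K0.
have [Kf Kf0 hKf] := @fock_vector_close R d k p V Z per S D e.
have [tau1 tau10 h1] := transfer_small #|{: L}| #|{: L}| eps0.
have [tau2 tau20 h2] := transfer_small #|{: L}| #|'I_p| eps0.
pose tau:= Num.min tau1 tau2.
have tau0 : 0 < tau by rewrite lt_min tau10.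
have taul : tau <= tau1 /\ tau <= tau2 by split;rewrite /tau ge_min lexx ?orbT.
clearbody tau.
(* Half of tau is reserved for the mesh, directly or multiplied by Kf; the other half is for the
   error from [gram_distance]. *)
pose s:= tau / (2 * (Kf + 1)).
have s0 : 0 < s by rewrite divr_gt0 // mulr_gt0 // ltr_wpDl.
have Ks : Kf * s <= tau / 2 /\ s <= tau / 2.
 have E : (Kf + 1) * s = tau / 2.
  by rewrite /s;field;rewrite lt0r_neq0 // ltr_wpDl.
 by move:E;rewrite mulrDl mul1r=> <-;rewrite lerDl lerDr (ltW s0) mulr_ge0 // ltW.
clearbody s;pose h:= Num.sqrt (s / (2 * D).+1%:R).
have h0 : 0 < h by rewrite sqrtr_gt0 divr_gt0.
have hs : (2 * D)%:R * h ^+ 2 <= s.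
 rewrite sqr_sqrtr;last by rewrite divr_ge0 // ltW.
 by rewrite mulrA [X in X / _]mulrC -mulrA ler_piMr ?(ltW s0) // ler_pdivrMr // mul1r ler_nat.
clearbody h;pose l:= (#|{: L}|%:R : R);have l0 : 0 <= l by [].
pose c2:= cr * (c1 * C0).
have c1C : 0 < c1 * C0 by rewrite mulr_gt0.
have c1c2 : c1 * C0 <= c2 by rewrite ler_peMl // ltW.
have c20 : 0 <= c2 by apply:le_trans c1c2;exact:ltW.
(* c collects the three quantities of order a b: the size of the rotated vectors, the distance of
   the deformed isometry from V, and the change of the stationary state. *)
pose c:= c2 + (1 + K) * c2 + d%:R * (Kst * ((1 + K) * c2)).
(* The factor 8 (l + 1) serves both directions, which need 4 ep and 4 l ep below tau / 2. *)
pose k3:= 8 * (l + 1) * (Kg * (1 + c2 + c2 ^+ 3) + 1).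
pose t' := Num.min (Num.min 1 r0) (Num.min (rst / 2) tau).
have t'0 : 0 < t' by rewrite !lt_min ltr01 r00 tau0 divr_gt0.
have k30 : 0 <= k3 by rewrite !mulr_ge0 ?addr_ge0 ?mulr_ge0 ?addr_ge0 ?exprn_ge0.
have c3_0 : 0 <= (1 + K) * c2 by rewrite mulr_ge0 ?addr_ge0.
have c4_0 : 0 <= d%:R * (Kst * ((1 + K) * c2)) by rewrite mulr_ge0 // mulr_ge0.
have cc0 : 0 <= c by rewrite /c !addr_ge0.
have [N hN] := @rate_bounds R delta C0 h c k3 t' (2 * D) (#|{: L}| + #|'I_p|) delta0 deltaD C00 h0 cc0 k30 t'0.
exists N=> n /hN [n0 a1 [b0 b1 nb] q1 q2].
set a:= n%:R `^ delta in a1 q1 q2 *;set b:= (Num.sqrt n%:R)^-1 in b0 b1 nb q1 q2 *.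
have a0 : 0 < a by apply:lt_le_trans a1.
have ab0 : 0 < a * b by rewrite mulr_gt0.
have [u1 u2 u3 u4] : [/\ c2 * (a * b) <= 1, c1 * C0 * (a * b) <= r0, (1 + K) * c2 * (a * b) < rst &
  d%:R * (Kst * ((1 + K) * c2 * (a * b))) <= tau].
 move:q1;rewrite /t' !le_min=> /andP[/andP[w1 w2] /andP[w3 w4]].
 have w5 : c2 * (a * b) <= c * (a * b) by rewrite ler_wpM2r ?(ltW ab0) // /c -addrA lerDl addr_ge0.
 have w6 : (1 + K) * c2 * (a * b) <= c * (a * b) by rewrite ler_wpM2r ?(ltW ab0) // /c addrAC lerDr addr_ge0.
 have w7 : d%:R * (Kst * ((1 + K) * c2)) * (a * b) <= c * (a * b) by rewrite ler_wpM2r ?(ltW ab0) // /c lerDr addr_ge0.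
 split;first exact:le_trans w1.
 - by apply:le_trans (w2);apply:le_trans w5;rewrite ler_wpM2r // ltW.
 - apply:le_lt_trans w6 _;apply:le_lt_trans w3 _;rewrite ltr_pdivrMr // ltr_pMr // ltr1n //.
 - by apply:le_trans w4;apply:le_trans w7;rewrite !mulrA.
have rZ m (x : C) (A : isom) : rot m (x *: A) = x *: rot m A.
 by rewrite !rotE -scalemxAr -scalemxAl !scalerA mulrC.
pose W (A : isom) := exp_map nu V (b%:C *: A).
have ec : 0 < c1 * C0 * (a * b) by rewrite mulr_gt0.
have nearW A : ball_id V (C0 * a) A -> near V K (c1 * C0 * (a * b)) (b%:C *: A) (W A).
 move=> [tA lA];have tA' : tangent_id V (b%:C *: A) by rewrite /tangent_id -scalemxAr tA scaler0.
 have mA : mxn (b%:C *: A) <= c1 * C0 * (a * b).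
  rewrite mxnZ cabs_real ger0_norm ?(ltW b0) // [leRHS]mulrA [leRHS]mulrC ler_wpM2l ?(ltW b0) //.
  by apply:le_trans (hc1 A) _;rewrite -mulrA ler_wpM2l // ltW.
 have hr : 0 < c1 * C0 * (a * b) <= r0 by rewrite ec.
 have [iW dW] := hexp _ _ hr tA' mA.
 by split=> //;case:iW.
have c2E : cr * (c1 * C0 * (a * b)) = c2 * (a * b) by rewrite mulrA.
have nearR A (m : 'I_p) : ball_id V (C0 * a) A -> near V K (c2 * (a * b)) (b%:C *: rot m A) (rot m (W A)).
 by move=> /nearW /(hrot _ _ m _ _ K0 (ltW ec));rewrite c2E rZ.
have iW A : ball_id V (C0 * a) A -> (W A)^t* *m W A = 1%:M by move=> /nearW[].
pose ep:= (Kg * (1 + c2 + c2 ^+ 3) + 1) * (a ^+ 3 * b).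
have ep0 : 0 < ep.
 by rewrite mulr_gt0 ?mulr_gt0 // ltr_wpDl // mulr_ge0 ?addr_ge0 ?exprn_ge0.
have gramW A B (m m' : 'I_p) lb lb' : ball_id V (C0 * a) A -> ball_id V (C0 * a) B ->
 cabs (hdot (out_vector V S (rot m (W A)) n lb) (out_vector V S (rot m' (W B)) n lb')
    - gram_limit p V Z S n (rot m A) (rot m' B) lb lb') <= ep.
 move=> /nearR nA /nearR nB.
 have c2ab : 0 <= c2 * (a * b) by rewrite mulr_ge0 // ltW.
 apply:le_trans (hgram _ n _ _ _ _ lb lb' c2ab u1 n0 (nA m) (nB m')) _;exact:gram_error.
have stW A : ball_id V (C0 * a) A -> mxn (rho_ss (W A) - rho_ss V) <= Kst * ((1 + K) * c2 * (a * b)).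
 move=> bA;have [iWA _ lA dA] := nearW A bA.
 have hd : mxn (W A - V) <= (1 + K) * c2 * (a * b).
  have -> : W A - V = (W A - V - 'i%C *: (b%:C *: A)) + 'i%C *: (b%:C *: A) by rewrite subrK.
  apply:le_trans (mxnD _ _) _;rewrite mxnZ (_ : cabs 'i%C = 1) ?mul1r;last first.
   by rewrite cabs_sqrt /sqn expr0n expr1n add0r sqrtr1.
  have e1 : c1 * C0 * (a * b) <= c2 * (a * b) by rewrite ler_wpM2r // ltW.
  rewrite -[leRHS]mulrA mulrDl mul1r addrC lerD //;first exact:le_trans e1.
  apply:le_trans dA _;rewrite ler_wpM2l // expr2.
  by apply:(le_trans _ (e1));rewrite ler_piMl ?(ltW ec) //;exact:le_trans e1 u1.
 have [_ hs'] := hst _ iWA (le_lt_trans hd u3).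
 by apply:le_trans hs' _;rewrite ler_wpM2l.
have [net [netB netC]] := ball_net irr be (mulr_gt0 C00 a0) h0.
have netC' A : ball_id V (C0 * a) A -> exists i, Re (ip (A - net i) (A - net i)) <= s.
 by move=> /netC[i hi];exists i;exact:le_trans hs.
pose M:= ((Num.truncn (2 * (C0 * a) / h)).+1 ^ (2 * D))%N.
have q3 : 8 * (l + 1) * ep * (M * (#|{: L}| + #|'I_p|)).+1%:R <= tau.
 apply:(@le_trans _ _ t');last by rewrite /t' !ge_min lexx !orbT.
 by apply:le_trans q2;rewrite /k3 /ep /M !mulrA.
clearbody ep.
have bnd (x : R) (j : nat) : 0 <= x -> x <= 8 * (l + 1) -> (j <= M * (#|{: L}| + #|'I_p|))%N ->
  x * ep * j.+1%:R <= tau.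
 move=> x0 xl jl;apply:le_trans q3;apply:ler_pM;rewrite ?mulr_ge0 ?(ltW ep0) //.
  by rewrite ler_wpM2r // ltW.
 by rewrite ler_nat ltnS.
have z4 : 4 * (l * ep) <= tau / 2.
 have:= bnd (8 * l) 0%N;rewrite mulr1 ler_pdivlMr // => hh.
 have -> : 4 * (l * ep) * 2 = 8 * l * ep by ring.
 by apply:hh;rewrite ?mulr_ge0 // ler_wpM2l // lerDl.
have z3 : 4 * ep <= tau / 2.
 have:= bnd 8 0%N;rewrite mulr1 ler_pdivlMr // => hh.
 have -> : 4 * ep * 2 = 8 * ep by ring.
 by apply:hh;rewrite ?ler_peMr // lerDr.
have [Ks1 Ks2] := Ks;have [tl1 tl2] := taul;have ee : tau / 2 + tau / 2 = tau by field.
rewrite /le_cam ge_max;apply/andP;split.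
 have r_gt0:= mulr_gt0 C00 a0.
 apply:le_trans (out_deficiency irr per cyc SS hS be r_gt0 iW stW netB netC' ep0 gramW hKf) _.
 rewrite lee_fin;apply:h1=> //.
 - by rewrite addr_ge0 ?mulr_ge0 ?(ltW ep0) ?(ltW s0).
 - by apply:le_trans tl1;rewrite -ee lerD.
 - apply:le_trans tl1;rewrite -[ep]mul1r;apply:bnd=> //;last by rewrite leq_mul2l leq_addr orbT.
  by rewrite mulrDr mulr1 ler_wpDl ?mulr_ge0 // ler1n.
 - exact:le_trans tl1.
 - exact:ltW.
apply:le_trans (gm_deficiency irr per cyc SS hS be iW stW netB netC' ep0 gramW) _.
rewrite lee_fin;apply:h2.
- by rewrite mulr_gt0 // ltr0n card_prod card_ord;have:= dim_pos irr;rewrite !muln_gt0=> /andP[->].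
- by rewrite addr_ge0 ?(ltW s0) // !mulr_ge0 // ltW.
- by apply:le_trans tl2;rewrite -ee lerD.
- apply:le_trans tl2;apply:bnd=> //;last by rewrite leq_mul2l leq_addl orbT.
 by rewrite mulrDr mulr1 ler_wpDr // ler_peMl // ler1n.
- exact:ltW.
- exact:le_trans tl2.
Qed.
End Limit.
Theorem theorem12 (R : realType) (d k p : nat) (V0 : 'M[R[i]]_(d * k, d))
  (nu : 'M[R[i]]_(d * k, d) -> 'M[R[i]]_(d * k, d) -> 'M[R[i]]_(d * k, d) -> R)
  (P : 'I_p -> 'M[R[i]]_d) (Z : 'M[R[i]]_d)
  (D : nat) (e : 'I_D -> 'M[R[i]]_(d * k, d)) (C delta : R) :
  admissible_metric nu ->
  irreducible V0 -> has_period V0 p -> cyclic_unitary V0 P Z ->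
  basis_id V0 e ->
  0 < C -> 0 < delta ->
  delta < (2 * ((2 * d ^ 2 * (k - 1))%N%:R + 3))^-1 ->
  le_cam (ball_id V0 (C * n%:R `^ delta))
         (fun A => rho_out (exp_map nu V0 ((Num.sqrt n%:R)^-1%:C%C *: A)) n)
         (fun A => rho_gm V0 p Z e A)
    @[n --> \oo] --> 0%E.
Proof.
move=> am irr per cyc be C0 d0 dlt.
(* By [basis_dim] the grid has at most 2 d^2 (k - 1) real coordinates. *)
have dD : delta * (2 * D + 3)%:R < 2^-1.
 apply:(@le_lt_trans _ _ (delta * ((2 * d ^ 2 * (k - 1))%N%:R + 3))).
  by rewrite ler_wpM2l ?(ltW d0) // natrD lerD2r ler_nat -mulnA leq_mul2l (basis_dim irr be) orbT.
 by rewrite -ltr_pdivlMr // -invfM.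
have small eps:= @le_cam_small R d k p nu V0 P Z D e (admissible_riemannian am) irr per cyc be C delta C0 d0 dD eps.
set f:= fun n=> le_cam _ _ _.
(* For n = 0 the radius is 0 and the ball is empty, so nonnegativity is claimed for positive n. *)
have f0 n : (0 < n)%N -> (0 <= f n)%E.
 move=> n0;rewrite /f /le_cam le_max deficiency_ge0 //.
 by exists 0;apply:ball0;rewrite mulr_gt0 // powR_gt0 // ltr0n.
have fin eps : 0 < eps -> exists N, forall n, (N <= n)%N -> f n \is a fin_num /\ 0 <= fine (f n) <= eps.
 move=> /small[N hN];exists (N + 1)%N=> n nN.
 have h1 : (0 <= f n)%E by apply:f0;lia.
 have h2 : (f n <= eps%:E)%E by apply:hN;lia.
 have ff : f n \is a fin_num by rewrite ge0_fin_numE // (le_lt_trans h2) // ltry.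
 by split=> //;rewrite fine_ge0 // -lee_fin fineK.
apply/fine_cvgP;split.
 by have [N hN] := fin 1 ltr01;exists N=> // n /hN[].
apply/cvgrPdist_le=> /= eps /fin[N hN];exists N=> // n /hN[_ /andP[h1 h2]].
by rewrite sub0r normrN ger0_norm.
Qed.
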